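(* Let $N\ge1$ be an integer, $1<p<m$ and $\sigma>0$. Then there exist a unique $\xi_0\in(0,\infty)$ and a unique self-similar profile $f_*$ presenting a dead-core at $\xi=\xi_0$, in the sense that $$f_*(\xi)=0 \ \text{ for } 0\le\xi\le\xi_0,\qquad f_*(\xi)>0\ \text{ for } \xi_0<\xi<\infty,\qquad (f_*^m)'(\xi_0)=0,$$ and satisfying $$\lim_{\xi\to\infty}\xi^{\sigma/(p-1)}f_*(\xi)=\left(\frac{1}{p-1}\right)^{1/(p-1)}.$$ Moreover, $f_*$ has a single point of maximum on $(\xi_0,\infty)$.
   Context: Consider the equation $\partial_t u=\Delta u^m-|x|^{\sigma}u^p$ for $(x,t)\in\mathbb{R}^N\times(0,\infty)$, with $N\ge1$, $1<p<m$, $\sigma>0$, and its nonnegative self-similar solutions $u(x,t)=t^{-\alpha}f(|x|t^{\beta})$, where $$\alpha=\frac{\sigma+2}{\sigma(m-1)+2(p-1)},\qquad \beta=\frac{m-p}{\sigma(m-1)+2(p-1)}.$$ The profile $f=f(\xi)$, $\xi=|x|t^{\beta}\ge0$, solves $$(f^m)''(\xi)+\frac{N-1}{\xi}(f^m)'(\xi)+\alpha f(\xi)-\beta\xi f'(\xi)-\xi^{\sigma}f^p(\xi)=0. \qquad ( * )$$ A self-similar profile is a continuous function $f:[0,\infty)\to[0,\infty)$ such that $f^m\in C^1([0,\infty))$, $(f^m)'(0)=0$, $(f^m)'(\xi)=0$ at every zero $\xi$ of $f$, and $f$ satisfies $( * )$ classically on $\{\xi>0: f(\xi)>0\}$. 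*)

(* Defs.v *)
From Stdlib Require Import Reals.
From Coquelicot Require Import Coquelicot.
Open Scope R_scope.

(* Stdlib's [Rpower 0 y] is [1]; the real powers of [f] must vanish where [f] does. *)
Definition rpow (x y : R) : R := if Rlt_dec 0 x then Rpower x y else 0.

(* A function on [0,oo) is a total function [R -> R] whose values at negative
   arguments are junk: at [0], limits and derivatives are one-sided. *)
Definition halfline_at (x : R) : (R -> Prop) -> Prop :=
  within (fun y => 0 <= y) (locally x).

Definition continuous_halfline (f : R -> R) : Prop :=
  forall x, 0 <= x -> filterlim f (halfline_at x) (locally (f x)).

(* Coquelicot's [is_derive], with [locally x] replaced by [halfline_at x]. *)
Definition is_derive_halfline (F : R -> R) (x l : R) : Prop :=
  filterdiff F (halfline_at x) (fun h => scal h l).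

Definition C1_halfline (F : R -> R) : Prop :=
  exists G : R -> R,
    (forall x, 0 <= x -> is_derive_halfline F x (G x)) /\ continuous_halfline G.

Definition alpha (m p sigma : R) : R :=
  (sigma + 2) / (sigma * (m - 1) + 2 * (p - 1)).

Definition beta (m p sigma : R) : R :=
  (m - p) / (sigma * (m - 1) + 2 * (p - 1)).

(* The profile equation at a point [xi > 0] with [f xi > 0], including the
   differentiability that it needs. *)
Definition profile_equation_at (N : nat) (m p sigma : R) (f : R -> R) (xi : R) : Prop :=
  let F := fun x => rpow (f x) m in
  ex_derive f xi /\ ex_derive_n F 1 xi /\ ex_derive_n F 2 xi /\
  Derive_n F 2 xi + (INR N - 1) / xi * Derive F xi + alpha m p sigma * f xi
    - beta m p sigma * xi * Derive f xi - rpow xi sigma * rpow (f xi) p = 0.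

Definition self_similar_profile (N : nat) (m p sigma : R) (f : R -> R) : Prop :=
  let F := fun x => rpow (f x) m in
  (forall xi, 0 <= xi -> 0 <= f xi) /\
  continuous_halfline f /\
  C1_halfline F /\
  is_derive_halfline F 0 0 /\
  (forall xi, 0 <= xi -> f xi = 0 -> is_derive_halfline F xi 0) /\
  (forall xi, 0 < xi -> 0 < f xi -> profile_equation_at N m p sigma f xi).

Definition dead_core_at (m : R) (f : R -> R) (xi0 : R) : Prop :=
  (forall xi, 0 <= xi <= xi0 -> f xi = 0) /\
  (forall xi, xi0 < xi -> 0 < f xi) /\
  is_derive (fun x => rpow (f x) m) xi0 0.

Definition has_decay (p sigma : R) (f : R -> R) : Prop :=
  is_lim (fun xi => rpow xi (sigma / (p - 1)) * f xi) p_infty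
    (rpow (1 / (p - 1)) (1 / (p - 1))).

Definition dead_core_profile (N : nat) (m p sigma xi0 : R) (f : R -> R) : Prop :=
  0 < xi0 /\ self_similar_profile N m p sigma f /\ dead_core_at m f xi0 /\
  has_decay p sigma f.

(* Besides being the unique global maximum point, [xm] is the only local one. *)
Definition single_maximum_point (f : R -> R) (xi0 : R) : Prop :=
  exists xm, xi0 < xm /\
    (forall xi, xi0 < xi -> f xi <= f xm) /\
    (forall y, xi0 < y -> locally y (fun z => f z <= f y) -> y = xm).

(* Main.v *)
(* Write f(xi)^m = xi^L W(ln xi) with L = m(sigma+2)/(m-p), a = 1/m and q = p/m. The profile equation becomes
   W'' + A W' + B W = k W^q + E(s) (W^a)' with k = 1 and E(s) = beta e^{-s/beta}, so that time enters through E
   only. At the edge of a dead core W' is asymptotic to E W^a, and the required decay is the convergence of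
   e^{chi s} W to a positive constant.

   Existence. Dilations of W and translations of s allow one to fix the edge at s = 0 and to shoot with k. The k
   whose orbit dies in finite time form an open set containing 0 but not all large k; orbits that turn upwards
   again after a descent, or whose energy is caught in the potential well, stay away from 0, and these are open
   conditions too. At the end of the interval of dying orbits the orbit is therefore global, decreases to 0
   eventually, and has the required decay rate.

   Uniqueness. In the phase plane the pair (W', E), as a function of W, solves a cooperative system, so an earlier
   edge, which has the larger E, gives the higher speed on the ascent, the higher top, and the faster descent. If
   two profiles cross, the times at which they descend through the same level thus differ by more than a fixed
   amount, which contradicts the common limit of e^{chi s} W. If they do not, the one with the later edge can be
   slid to the left, as a strict subsolution, until the edges coincide, and the comparison from the edge is
   contradicted.

   Single maximum. At a critical point of f the second derivative has the sign of xi^sigma f^{p-1} - alpha, and so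
   no minimum can precede a higher maximum. *)
Require Import Defs.
From Stdlib Require Import Reals Lra Lia Psatz Classical ClassicalEpsilon.
From Coquelicot Require Import Coquelicot.
Open Scope R_scope.

(** * Calculus *)

(** The coefficient [W^(a-1)] is singular at the edge, so the Cauchy problem there is not standard:
    an orbit issuing from the edge is constructed by a fixed point in the pressure [W^(1-a)], and
    its uniqueness is a consequence of comparison, through small dilations that make weak
    inequalities strict. Away from zero the singular product [W^(a-1) P] is avoided by passing to
    the flux [P - E W^a], whose equation contains only [W], [W^q] and [W^a] beside the flux itself.
    The equation is not autonomous and its energy is not monotone while [E] is large. The ordering
    of the pairs (speed, [E]) at equal heights takes the place of a Lyapunov function: it compares
    two orbits, but also two successive turns of one orbit, the earlier having the larger [E].
    Sliding is a translation followed by the one dilation that restores the coefficient of [E]; the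
    price is a larger [k], and this gives the strictness. The decay constant is the balance
    [k C^(q-a) = e chi a] of absorption and drag along [C e^(-chi s)], the other terms being smaller
    by the factor [e^(-chi (1-q) s)]. *)

Lemma Rpower_pos (x y : R) : 0 < Rpower x y.
Proof. apply exp_pos. Qed.

Lemma is_derive_Rpower (y w : R) :
  0 < w -> is_derive (fun x => Rpower x y) w (y * Rpower w (y - 1)).
Proof.
  intros hw. unfold Rpower. auto_derive; [lra|].
  replace ((y - 1) * ln w) with (y * ln w + - ln w) by ring.
  rewrite exp_plus, exp_Ropp, exp_ln by lra. field. lra.
Qed.

Lemma is_derive_Rpower_comp (y : R) (f : R -> R) (x df : R) :
  0 < f x -> is_derive f x df ->
  is_derive (fun t => Rpower (f t) y) x (y * Rpower (f x) (y - 1) * df).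
Proof.
  intros h hd.
  replace (y * Rpower (f x) (y - 1) * df) with (df * (y * Rpower (f x) (y - 1))) by ring.
  exact (is_derive_comp (fun w => Rpower w y) f x _ _ (is_derive_Rpower y (f x) h) hd).
Qed.

Lemma Rpower_mult_base (x y z : R) : 0 < x -> 0 < y -> Rpower (x * y) z = Rpower x z * Rpower y z.
Proof. intros; symmetry; now apply Rpower_mult_distr. Qed.

Lemma Rpower_succ (w y : R) : 0 < w -> Rpower w (y - 1) * w = Rpower w y.
Proof.
  intros h. rewrite <- (Rpower_1 w) at 2 by exact h. rewrite <- Rpower_plus. f_equal; ring.
Qed.

Lemma Rpower_incr (x y z : R) : 0 < z -> 0 < x -> x < y -> Rpower x z < Rpower y z.
Proof. intros. apply exp_increasing. apply Rmult_lt_compat_l; [lra|]. now apply ln_increasing. Qed.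

Lemma Rpower_decr (x y z : R) : z < 0 -> 0 < x -> x < y -> Rpower y z < Rpower x z.
Proof. intros. apply exp_increasing. assert (ln x < ln y) by now apply ln_increasing. nra. Qed.

Lemma Rpower_le (x y z : R) : 0 <= z -> 0 < x -> x <= y -> Rpower x z <= Rpower y z.
Proof. intros. apply Rle_Rpower_l; lra. Qed.

Lemma Rpower_le_neg (x y z : R) : z <= 0 -> 0 < x -> x <= y -> Rpower y z <= Rpower x z.
Proof.
  intros. destruct (Req_dec x y) as [->|]; [lra|]. destruct (Req_dec z 0) as [->|].
  - rewrite !Rpower_O; lra.
  - apply Rlt_le, Rpower_decr; lra.
Qed.

Lemma Rpower_inv_base (x z : R) : 0 < x -> z <> 0 -> Rpower (Rpower x (/ z)) z = x.
Proof. intros. rewrite Rpower_mult. replace (/ z * z) with 1 by (field; auto). now apply Rpower_1. Qed.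

Lemma Rpower_gt_1 (l z : R) : 1 < l -> 0 < z -> 1 < Rpower l z.
Proof. intros hl hz. rewrite <- (Rpower_O l) at 1 by lra. now apply Rpower_lt. Qed.

Lemma Rpower_small (z eps : R) : 0 < z -> 0 < eps ->
  exists d, 0 < d /\ forall x, 0 < x -> x < d -> Rpower x z < eps.
Proof.
  intros hz he. exists (Rpower eps (/ z)). split; [apply Rpower_pos|]. intros x hx hd.
  rewrite <- (Rpower_inv_base eps z) by lra. apply Rpower_incr; auto.
Qed.

Lemma Rpower_large (z M : R) : z < 0 -> 
  exists d, 0 < d /\ forall x, 0 < x -> x < d -> M < Rpower x z.
Proof.
  intros hz. set (M' := Rmax M 1). assert (0 < M') by (unfold M'; pose proof (Rmax_r M 1); lra).
  exists (Rpower M' (/ z)). split; [apply Rpower_pos|]. intros x hx hd.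
  apply Rle_lt_trans with M'; [apply Rmax_l|].
  rewrite <- (Rpower_inv_base M' z) by lra. apply Rpower_decr; auto.
Qed.

Lemma derive_continuous (f : R -> R) (x l : R) : is_derive f x l -> continuous f x.
Proof. intros h. apply (@ex_derive_continuous R_AbsRing R_NormedModule). now exists l. Qed.

Lemma continuous_eps (f : R -> R) (x : R) : continuous f x ->
  forall eps, 0 < eps -> exists d, 0 < d /\ forall y, Rabs (y - x) < d -> Rabs (f y - f x) < eps.
Proof.
  intros h eps he.
  destruct (proj1 (filterlim_locally f (f x)) h (mkposreal eps he)) as [d hd].
  exists d. split; [apply cond_pos|]. intros y hy. exact (hd y hy).
Qed.

Lemma eps_continuous (f : R -> R) (x : R) :
  (forall eps, 0 < eps -> exists d, 0 < d /\ forall y, Rabs (y - x) < d -> Rabs (f y - f x) < eps) ->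
  continuous f x.
Proof.
  intros h. apply filterlim_locally. intros [eps he]. destruct (h eps he) as [d [hd hy]].
  exists (mkposreal d hd). intros y hb. exact (hy y hb).
Qed.

Lemma continuous_continuity_pt (f : R -> R) (x : R) : continuous f x -> continuity_pt f x.
Proof. intros h. now apply continuity_pt_filterlim. Qed.

Lemma MVT_interval (f df : R -> R) (a b : R) : a < b ->
  (forall x, a <= x <= b -> is_derive f x (df x)) ->
  exists c, a <= c <= b /\ f b - f a = df c * (b - a).
Proof.
  intros hab h. destruct (MVT_gen f a b df) as [c [hc e]].
  - intros x hx. rewrite Rmin_left, Rmax_right in hx by lra. apply h; lra.
  - intros x hx. rewrite Rmin_left, Rmax_right in hx by lra.
    apply continuous_continuity_pt, derive_continuous with (df x), h; lra.
  - rewrite Rmin_left, Rmax_right in hc by lra. now exists c.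
Qed.

Lemma incr_of_derive (f df : R -> R) (a b : R) : a <= b ->
  (forall x, a <= x <= b -> is_derive f x (df x)) ->
  (forall x, a <= x <= b -> 0 <= df x) -> f a <= f b.
Proof.
  intros hab h hp. destruct (Req_dec a b) as [->|]; [lra|].
  destruct (MVT_interval f df a b) as [c [hc e]]; auto; [lra|]. specialize (hp c hc). nra.
Qed.

Lemma strict_incr_of_derive (f df : R -> R) (a b : R) : a < b ->
  (forall x, a <= x <= b -> is_derive f x (df x)) ->
  (forall x, a <= x <= b -> 0 < df x) -> f a < f b.
Proof.
  intros hab h hp. 
  destruct (MVT_interval f df a b) as [c [hc e]]; auto. specialize (hp c hc). nra.
Qed.

Lemma decr_of_derive (f df : R -> R) (a b : R) : a <= b ->
  (forall x, a <= x <= b -> is_derive f x (df x)) ->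
  (forall x, a <= x <= b -> df x <= 0) -> f b <= f a.
Proof.
  intros hab h hp. destruct (Req_dec a b) as [->|]; [lra|].
  destruct (MVT_interval f df a b) as [c [hc e]]; auto; [lra|]. specialize (hp c hc). nra.
Qed.

Lemma strict_decr_of_derive (f df : R -> R) (a b : R) : a < b ->
  (forall x, a <= x <= b -> is_derive f x (df x)) ->
  (forall x, a <= x <= b -> df x < 0) -> f b < f a.
Proof.
  intros hab h hp.
  destruct (MVT_interval f df a b) as [c [hc e]]; auto. specialize (hp c hc). nra.
Qed.

Lemma first_zero (f : R -> R) (a b : R) : a < b ->
  (forall x, a <= x <= b -> continuous f x) -> 0 < f a -> f b <= 0 ->
  exists c, a < c <= b /\ f c = 0 /\ forall x, a <= x < c -> 0 < f x.
Proof.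
  intros hab hc ha hb.
  set (S := fun x => a <= x <= b /\ forall y, a <= y <= x -> 0 < f y).
  destruct (completeness S) as [c [hub hlub]].
  - exists b. intros x [hx _]. lra.
  - exists a. split; [lra|]. intros y hy. replace y with a by lra. exact ha.
  - assert (hac : a <= c).
    { apply hub. split; [lra|]. intros y hy. replace y with a by lra. exact ha. }
    assert (hcb : c <= b) by (apply hlub; intros x [hx _]; lra).
    assert (hpos : forall x, a <= x < c -> 0 < f x).
    { intros x hx. destruct (classic (exists y, S y /\ x < y)) as [[y [[_ hy] hxy]]|hn].
      - apply hy; lra.
      - exfalso. assert (c <= x); [|lra]. apply hlub. intros y hy.
        destruct (Rle_lt_dec y x); auto. exfalso. apply hn. now exists y. }
    assert (hc0 : f c = 0).
    { destruct (Rtotal_order (f c) 0) as [hlt|[h|hgt]]; auto; exfalso.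
      - destruct (continuous_eps f c (hc c ltac:(lra)) (- f c) ltac:(lra)) as [d [hd hy]].
        destruct (Req_dec a c) as [e|ne]; [subst c; lra|].
        set (x := Rmax a (c - d / 2)).
        assert (a <= x /\ x < c /\ c - x < d).
        { unfold x, Rmax. destruct (Rle_dec a (c - d/2)); lra. }
        assert (h1 := hy x). assert (h2 := hpos x ltac:(lra)).
        assert (Rabs (x - c) < d) by (apply Rabs_def1; lra).
        apply h1 in H0. apply Rabs_def2 in H0. lra.
      - destruct (continuous_eps f c (hc c ltac:(lra)) (f c) ltac:(lra)) as [d [hd hy]].
        assert (c < b) by (destruct (Req_dec c b) as [->|]; lra).
        set (x := Rmin b (c + d / 2)).
        assert (x <= b /\ c < x /\ x - c < d).
        { unfold x, Rmin. destruct (Rle_dec b (c + d/2)); lra. }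
        assert (x <= c); [|lra]. apply hub. split; [lra|]. intros y hyx.
        destruct (Rlt_le_dec y c); [apply hpos; lra|].
        assert (Rabs (y - c) < d) by (apply Rabs_def1; lra).
        apply hy in H1. apply Rabs_def2 in H1. lra. }
    exists c. repeat split; auto.
    destruct (Req_dec a c) as [e|]; [subst c; lra|lra].
Qed.

Lemma continuous_Ropp_comp (f : R -> R) (x : R) : continuous f (- x) -> continuous (fun y => f (- y)) x.
Proof.
  intros h. apply (continuous_comp Ropp f); auto.
  apply derive_continuous with (-1). auto_derive; auto.
Qed.

Lemma last_zero (f : R -> R) (a b : R) : a < b ->
  (forall x, a <= x <= b -> continuous f x) -> f a <= 0 -> 0 < f b ->
  exists c, a <= c < b /\ f c = 0 /\ forall x, c < x <= b -> 0 < f x.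
Proof.
  intros hab hc ha hb.
  destruct (first_zero (fun y => f (- y)) (- b) (- a)) as [c [h1 [h2 h3]]].
  - lra.
  - intros x hx. apply continuous_Ropp_comp, hc. lra.
  - now rewrite Ropp_involutive.
  - now rewrite Ropp_involutive.
  - exists (- c). repeat split; auto; try lra.
    intros x hx. replace x with (- - x) by ring. apply h3. lra.
Qed.

Lemma continuous_opp_fun (f : R -> R) (x : R) : continuous f x -> continuous (fun y => - f y) x.
Proof. intros h. apply (continuous_opp f x h). Qed.

Lemma IVT_interval (f : R -> R) (a b y : R) : a < b ->
  (forall x, a <= x <= b -> continuous f x) -> f a < y -> y < f b ->
  exists c, a < c < b /\ f c = y.
Proof.
  intros hab hc ha hb.
  destruct (first_zero (fun x => y - f x) a b) as [c [h1 [h2 h3]]]; auto; try lra.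
  - intros x hx. apply (continuous_minus (fun _ => y) f); [apply continuous_const | now apply hc].
  - exists c. split; [|lra]. destruct (Req_dec c b) as [->|]; lra.
Qed.

Lemma IVT_interval_decr (f : R -> R) (a b y : R) : a < b ->
  (forall x, a <= x <= b -> continuous f x) -> y < f a -> f b < y ->
  exists c, a < c < b /\ f c = y.
Proof.
  intros hab hc ha hb.
  destruct (IVT_interval (fun x => - f x) a b (- y)) as [c [h1 h2]]; auto; try lra.
  - intros x hx. apply continuous_opp_fun; auto.
  - exists c. split; lra.
Qed.

Lemma derive_eps (f : R -> R) (x l : R) : is_derive f x l ->
  forall eps, 0 < eps -> exists d, 0 < d /\
    forall y, Rabs (y - x) < d -> Rabs (f y - f x - l * (y - x)) <= eps * Rabs (y - x).
Proof.
  intros h eps he. apply is_derive_Reals in h.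
  destruct (h eps he) as [[d hd] hy]. exists d. split; auto. intros y hyx.
  destruct (Req_dec y x) as [->|hne].
  - replace (f x - f x - l * (x - x)) with 0 by ring.
    rewrite Rminus_diag, !Rabs_R0. lra.
  - specialize (hy (y - x) ltac:(lra) hyx). simpl in hy.
    replace (x + (y - x)) with y in hy by ring.
    replace (f y - f x - l * (y - x)) with (((f y - f x) / (y - x) - l) * (y - x)) by (field; lra).
    rewrite Rabs_mult. apply Rmult_le_compat_r; [apply Rabs_pos|lra].
Qed.

Lemma derive_pos_right (f : R -> R) (x l : R) : is_derive f x l -> 0 < l ->
  exists d, 0 < d /\ (forall y, x < y < x + d -> f x < f y) /\ (forall y, x - d < y < x -> f y < f x).
Proof.
  intros h hl. destruct (derive_eps f x l h (l / 2) ltac:(lra)) as [d [hd hy]].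
  exists d. split; auto. split.
  - intros y hyx. specialize (hy y). rewrite (Rabs_pos_eq (y - x)) in hy by lra.
    specialize (hy ltac:(lra)). apply Rabs_le_between in hy. nra.
  - intros y hyx. specialize (hy y). rewrite (Rabs_left (y - x)) in hy by lra.
    specialize (hy ltac:(lra)). apply Rabs_le_between in hy. nra.
Qed.

Lemma derive_neg_right (f : R -> R) (x l : R) : is_derive f x l -> l < 0 ->
  exists d, 0 < d /\ (forall y, x < y < x + d -> f y < f x) /\ (forall y, x - d < y < x -> f x < f y).
Proof.
  intros h hl. destruct (derive_pos_right (fun y => - f y) x (- l)) as [d [hd [h1 h2]]].
  - apply (is_derive_opp f x l h).
  - lra.
  - exists d. split; auto. split; intros y hy; [specialize (h1 y hy)|specialize (h2 y hy)]; lra.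
Qed.

Lemma derive_le_of_left (f : R -> R) (a x l : R) : a < x -> is_derive f x l ->
  (forall y, a <= y < x -> f x <= f y) -> l <= 0.
Proof.
  intros hax h hy. destruct (Rle_lt_dec l 0); auto. exfalso.
  destruct (derive_pos_right f x l h r) as [d [hd [_ h2]]].
  set (y := Rmax a (x - d / 2)).
  assert (a <= y /\ y < x /\ x - d < y).
  { unfold y, Rmax. destruct (Rle_dec a (x - d/2)); lra. }
  specialize (hy y ltac:(lra)). specialize (h2 y ltac:(lra)). lra.
Qed.

Lemma derive_ge_of_right (f : R -> R) (b x l : R) : x < b -> is_derive f x l ->
  (forall y, x < y <= b -> f x <= f y) -> 0 <= l.
Proof.
  intros hax h hy. destruct (Rle_lt_dec 0 l); auto. exfalso.
  destruct (derive_neg_right f x l h r) as [d [hd [h2 _]]].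
  set (y := Rmin b (x + d / 2)).
  assert (y <= b /\ x < y /\ y < x + d).
  { unfold y, Rmin. destruct (Rle_dec b (x + d/2)); lra. }
  specialize (hy y ltac:(lra)). specialize (h2 y ltac:(lra)). lra.
Qed.

(** Adding the constant [D / C] turns the affine inequality into a homogeneous one; [D] carries the
    change of the parameter [k] in [truncated_dependence]. *)
Lemma Gronwall (G dG : R -> R) (a b C D : R) : a <= b -> 0 < C ->
  (forall x, a <= x <= b -> is_derive G x (dG x)) ->
  (forall x, a <= x <= b -> dG x <= C * G x + D) ->
  G b + D / C <= (G a + D / C) * exp (C * (b - a)).
Proof.
  intros hab hC hd hi.
  assert (h : exp (- C * b) * (G b + D / C) <= exp (- C * a) * (G a + D / C)).
  { apply (decr_of_derive (fun x => exp (- C * x) * (G x + D / C))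
      (fun x => exp (- C * x) * (dG x - (C * G x + D)))); auto.
    - intros x hx. specialize (hd x hx). auto_derive.
      + now exists (dG x).
      + replace (Derive (fun y => G y) x) with (dG x) by (symmetry; now apply is_derive_unique). field. lra.
    - intros x hx. specialize (hi x hx). pose proof (exp_pos (- C * x)). nra. }
  replace (C * (b - a)) with (C * b + - C * a) by ring. rewrite exp_plus.
  assert (e : exp (C * b) * exp (- C * b) = 1).
  { rewrite <- exp_plus. replace (C * b + - C * b) with 0 by ring. apply exp_0. }
  pose proof (exp_pos (C * b)).
  replace (G b + D / C) with (exp (C * b) * (exp (- C * b) * (G b + D / C))).
  - replace ((G a + D / C) * (exp (C * b) * exp (- C * a)))
      with (exp (C * b) * (exp (- C * a) * (G a + D / C))) by ring.
    apply Rmult_le_compat_l; lra.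
  - rewrite <- Rmult_assoc, e. ring.
Qed.

Lemma continuous_bounded_max (f : R -> R) (a b : R) : a <= b ->
  (forall x, a <= x <= b -> continuous f x) ->
  exists x, a <= x <= b /\ forall y, a <= y <= b -> f y <= f x.
Proof.
  intros hab hc. destruct (continuity_ab_maj f a b hab) as [x [h1 h2]].
  - intros c hcc. apply continuous_continuity_pt, hc; auto.
  - exists x. split; auto.
Qed.

Lemma continuous_bounded_min (f : R -> R) (a b : R) : a <= b ->
  (forall x, a <= x <= b -> continuous f x) ->
  exists x, a <= x <= b /\ forall y, a <= y <= b -> f x <= f y.
Proof.
  intros hab hc. destruct (continuity_ab_min f a b hab) as [x [h1 h2]].
  - intros c hcc. apply continuous_continuity_pt, hc; auto.
  - exists x. split; auto.
Qed.

Ltac use_derives :=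
  repeat match goal with
  | |- context [Derive ?g ?x] =>
    match goal with
    | H : is_derive ?f x ?l |- _ =>
      replace (Derive g x) with l by (symmetry; apply is_derive_unique; exact H)
    end
  end.

Ltac dsolve :=
  auto_derive;
  [ repeat split; try (eexists; eassumption); try exact I; auto; try lra
  | use_derives; try ring; try (field; lra) ].

Lemma is_derive_eq (f : R -> R) (x l l' : R) : is_derive f x l -> l = l' -> is_derive f x l'.
Proof. now intros h <-. Qed.

Lemma is_derive_square (f : R -> R) (x l : R) : is_derive f x l -> is_derive (fun t => f t * f t) x (2 * f x * l).
Proof. intros h. dsolve. Qed.

Lemma eps_derive (f : R -> R) (x l : R) :
  (forall eps, 0 < eps -> exists d, 0 < d /\
    forall y, Rabs (y - x) < d -> Rabs (f y - f x - l * (y - x)) <= eps * Rabs (y - x)) ->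
  is_derive f x l.
Proof.
  intros h. apply is_derive_Reals. intros eps he.
  destruct (h (eps / 2) ltac:(lra)) as [d [hd hy]]. exists (mkposreal d hd). simpl. intros k hk hkd.
  specialize (hy (x + k)). replace (x + k - x) with k in hy by ring. specialize (hy hkd).
  replace ((f (x + k) - f x) / k - l) with ((f (x + k) - f x - l * k) * / k) by (field; auto).
  rewrite Rabs_mult, Rabs_inv. assert (0 < Rabs k) by now apply Rabs_pos_lt.
  apply Rmult_lt_reg_r with (Rabs k); auto. rewrite Rmult_assoc, Rinv_l by lra. nra.
Qed.

Lemma is_derive_near (f g : R -> R) (x l d : R) : 0 < d ->
  (forall y, Rabs (y - x) < d -> f y = g y) -> is_derive g x l -> is_derive f x l.
Proof.
  intros hd h hg. apply (is_derive_ext_loc g f); auto.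
  exists (mkposreal d hd). intros y hy. symmetry. apply h. exact hy.
Qed.

Lemma is_derive_on (f g : R -> R) (a b x l : R) : a < x < b ->
  (forall y, a < y < b -> f y = g y) -> is_derive g x l -> is_derive f x l.
Proof.
  intros hx h hg. apply (is_derive_near f g x l (Rmin (x - a) (b - x))); auto.
  - apply Rmin_pos; lra.
  - intros y hy. apply h. assert (h1 := Rmin_l (x - a) (b - x)). assert (h2 := Rmin_r (x - a) (b - x)).
    apply Rabs_def2 in hy. lra.
Qed.

Lemma strict_incr_on (g G : R -> R) (a b : R) :
  (forall s, a < s < b -> is_derive g s (G s) /\ 0 < G s) ->
  forall s t, a < s -> t < b -> s < t -> g s < g t.
Proof.
  intros h s t hs ht hst. apply (strict_incr_of_derive g G); auto; intros x hx; apply h; lra.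
Qed.

Lemma inverse_function (g G : R -> R) (a b : R) :
  (forall s, a < s < b -> is_derive g s (G s) /\ 0 < G s) ->
  exists S : R -> R, forall s, a < s < b -> S (g s) = s /\ is_derive S (g s) (/ G s).
Proof.
  intros h. pose proof (strict_incr_on g G a b h) as hinc.
  assert (hinj : forall s t, a < s < b -> a < t < b -> g s = g t -> s = t).
  { intros s t hs ht e. destruct (Rtotal_order s t) as [hl|[he|hl]]; auto; exfalso.
    - specialize (hinc s t ltac:(lra) ltac:(lra) hl). lra.
    - specialize (hinc t s ltac:(lra) ltac:(lra) hl). lra. }
  set (S := fun w => epsilon (inhabits 0) (fun s => a < s < b /\ g s = w)).
  assert (hS : forall s, a < s < b -> S (g s) = s).
  { intros s hs. unfold S. 
    destruct (epsilon_spec (inhabits 0) (fun t => a < t < b /\ g t = g s)) as [h1 h2].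
    - now exists s.
    - apply hinj; auto. }
  exists S. intros s hs. split; [now apply hS|]. destruct (h s hs) as [hd hG].
  apply eps_derive. intros eps he.
  (* The first bound gives [|g t - g s| >= (G s / 2) |t - s|], which converts errors in [t - s] into
     errors in the values; the second then makes the final error at most [eps] times the increment
     of [g]. *)
  set (eta := Rmin (G s / 2) (eps * G s * G s / 2)).
  assert (heta : 0 < eta) by (unfold eta; apply Rmin_pos; [lra|]; assert (0 < eps * G s * G s) by (repeat apply Rmult_lt_0_compat; auto); lra).
  assert (heta1 : eta <= G s / 2) by apply Rmin_l.
  assert (heta2 : eta <= eps * G s * G s / 2) by apply Rmin_r.
  destruct (derive_eps g s (G s) hd eta heta) as [d [hd0 hy]].
  set (d' := Rmin (d / 2) (Rmin ((s - a) / 2) ((b - s) / 2))).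
  assert (hd' : 0 < d' /\ d' <= d / 2 /\ d' <= (s - a) / 2 /\ d' <= (b - s) / 2).
  { unfold d'. split; [repeat apply Rmin_pos; lra|]. split; [apply Rmin_l|].
    split; (eapply Rle_trans; [apply Rmin_r|]); [apply Rmin_l|apply Rmin_r]. }
  assert (hup := hinc s (s + d') ltac:(lra) ltac:(lra) ltac:(lra)).
  assert (hlo := hinc (s - d') s ltac:(lra) ltac:(lra) ltac:(lra)).
  exists (Rmin (g (s + d') - g s) (g s - g (s - d'))). split; [apply Rmin_pos; lra|].
  intros w hw. assert (hw1 := Rmin_l (g (s + d') - g s) (g s - g (s - d'))).
  assert (hw2 := Rmin_r (g (s + d') - g s) (g s - g (s - d'))).
  apply Rabs_def2 in hw.
  destruct (IVT_interval g (s - d') (s + d') w) as [t [ht et]]; try lra.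
  { intros x hx. apply derive_continuous with (G x), h; lra. }
  subst w. rewrite !hS by lra.
  specialize (hy t ltac:(apply Rabs_def1; lra)).
  assert (hlow : G s / 2 * Rabs (t - s) <= Rabs (g t - g s)).
  { assert (Rabs (G s * (t - s)) <= Rabs (g t - g s) + Rabs (g t - g s - G s * (t - s))).
    { pose proof (Rabs_triang (g t - g s) (- (g t - g s - G s * (t - s)))) as ht'.
      rewrite Rabs_Ropp in ht'.
      replace (g t - g s + - (g t - g s - G s * (t - s))) with (G s * (t - s)) in ht' by ring. exact ht'. }
    rewrite Rabs_mult, (Rabs_pos_eq (G s)) in H by lra.
    assert (eta * Rabs (t - s) <= G s / 2 * Rabs (t - s))
      by (apply Rmult_le_compat_r; [apply Rabs_pos|lra]). lra. }
  replace (t - s - / G s * (g t - g s)) with (- (/ G s) * (g t - g s - G s * (t - s))) by (field; lra).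
  rewrite Rabs_mult, Rabs_Ropp, (Rabs_pos_eq (/ G s)) by (left; now apply Rinv_0_lt_compat).
  apply Rle_trans with (/ G s * (eps * G s * G s / 2 * Rabs (t - s))).
  - apply Rmult_le_compat_l; [left; now apply Rinv_0_lt_compat|].
    eapply Rle_trans; [exact hy|]. apply Rmult_le_compat_r; [apply Rabs_pos|lra].
  - replace (/ G s * (eps * G s * G s / 2 * Rabs (t - s))) with (eps * (G s / 2 * Rabs (t - s))) by (field; lra).
    apply Rmult_le_compat_l; lra.
Qed.

(* Along an orbit whose first coordinate [g] increases, every quantity is a function of [g]. *)
Lemma reparametrize (g G X X' S : R -> R) (a b : R) :
  (forall s, a < s < b -> S (g s) = s /\ is_derive S (g s) (/ G s)) ->
  (forall s, a < s < b -> is_derive X s (X' s)) ->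
  forall s, a < s < b -> X (S (g s)) = X s /\ is_derive (fun w => X (S w)) (g s) (X' s / G s).
Proof.
  intros hS hX s hs. destruct (hS s hs) as [e hd]. split; [now rewrite e|].
  replace (X' s / G s) with (/ G s * X' s) by (unfold Rdiv; ring).
  apply (is_derive_comp X S (g s)); auto. rewrite e. auto.
Qed.

(** * Comparison of monotone orbits in the phase plane *)

(* The two scalar equations, with [x] as independent variable, form a cooperative system: the
   growth of [p] increases with [e], and that of [ln e] increases with [p]. *)
Lemma phase_comparison (p1 p2 e1 e2 H1 H2 Phi : R -> R) (A om om2 x0 x1 r : R) :
  0 < om -> om <= om2 -> x0 < x1 -> 1 <= r ->
  (forall x, x0 <= x <= x1 -> 0 < p1 x /\ 0 < e1 x /\ 0 < Phi x /\
    is_derive p1 x (H1 x / p1 x + e1 x * Phi x - A) /\ is_derive e1 x (- om * e1 x / p1 x)) ->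
  (forall x, x0 <= x <= x1 -> 0 < p2 x /\ 0 < e2 x /\
    is_derive p2 x (H2 x / p2 x + e2 x * Phi x - A) /\ is_derive e2 x (- om2 * e2 x / p2 x)) ->
  (forall x, x0 <= x <= x1 -> H2 x <= H1 x) ->
  p2 x0 < p1 x0 -> r * e2 x0 <= e1 x0 ->
  p2 x1 < p1 x1 /\ r * e2 x1 < e1 x1.
Proof.
  intros hom hom2 hx hr h1 h2 hH hp he.
  assert (hratio : forall y, x0 < y <= x1 -> (forall x, x0 <= x <= y -> p2 x <= p1 x) ->
    (forall x, x0 <= x < y -> p2 x < p1 x) -> r * e2 y < e1 y).
  { intros y hy hle hpy.
    (* The logarithm of [e1 / e2] has derivative [om2 / p2 - om / p1], nonnegative as long as
       [p2 <= p1]: the ratio cannot shrink. *)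
    set (q := fun x => ln (e1 x) - ln (e2 x)).
    assert (hq : forall x, x0 <= x <= y -> is_derive q x (om2 / p2 x - om / p1 x)).
    { intros x hxy. destruct (h1 x ltac:(lra)) as [a1 [a2 [a3 [a4 a5]]]].
      destruct (h2 x ltac:(lra)) as [b1 [b2 [b3 b4]]]. unfold q. dsolve. }
    assert (hqy : q x0 < q y).
    (* At [y] itself only [p2 <= p1] is known, so strict growth is obtained on the first half of the
       interval. *)
    { set (m := (x0 + y) / 2). assert (hm : x0 < m < y) by (unfold m; lra).
      assert (q x0 < q m).
      { apply (strict_incr_of_derive q (fun x => om2 / p2 x - om / p1 x)); [lra|intros; apply hq; lra|].
        intros x hxx. destruct (h1 x ltac:(lra)) as [a1 _]. destruct (h2 x ltac:(lra)) as [b1 _].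
        specialize (hpy x ltac:(lra)).
        assert (/ p1 x < / p2 x) by (apply Rinv_lt_contravar; [now apply Rmult_lt_0_compat|auto]).
        assert (0 < / p2 x) by now apply Rinv_0_lt_compat.
        assert (om * / p1 x < om * / p2 x) by now apply Rmult_lt_compat_l.
        assert (om * / p2 x <= om2 * / p2 x) by (apply Rmult_le_compat_r; lra).
        unfold Rdiv. lra. }
      assert (q m <= q y); [|lra].
      apply (incr_of_derive q (fun x => om2 / p2 x - om / p1 x)); [lra|intros; apply hq; lra|].
      intros x hxx. destruct (h1 x ltac:(lra)) as [a1 _]. destruct (h2 x ltac:(lra)) as [b1 _].
      specialize (hle x ltac:(lra)).
      assert (/ p1 x <= / p2 x) by (apply Rinv_le_contravar; auto).
      assert (0 < / p2 x) by now apply Rinv_0_lt_compat.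
      assert (om * / p1 x <= om * / p2 x) by (apply Rmult_le_compat_l; lra).
      assert (om * / p2 x <= om2 * / p2 x) by (apply Rmult_le_compat_r; lra).
      unfold Rdiv. lra. }
    unfold q in hqy. destruct (h1 x0 ltac:(lra)) as [_ [a2 _]]. destruct (h2 x0 ltac:(lra)) as [_ [b2 _]].
    destruct (h1 y ltac:(lra)) as [_ [c2 _]]. destruct (h2 y ltac:(lra)) as [_ [d2 _]].
    assert (ln r + ln (e2 x0) <= ln (e1 x0)).
    { rewrite <- ln_mult by lra. destruct he as [he|he]; [left; apply ln_increasing; auto; nra|].
      rewrite he. lra. }
    apply ln_lt_inv; auto; [nra|]. rewrite ln_mult by lra. lra. }
  assert (hall : forall x, x0 <= x <= x1 -> p2 x < p1 x).
  { intros x hxx. destruct (Rlt_le_dec (p2 x) (p1 x)); auto. exfalso.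
    destruct (first_zero (fun x => p1 x - p2 x) x0 x) as [c [hc [ec hpos]]]; try lra.
    { destruct (Req_dec x0 x) as [e|]; [subst x|]; lra. }
    { intros t ht. apply (continuous_minus p1 p2).
      - destruct (h1 t ltac:(lra)) as [_ [_ [_ [h _]]]]. exact (derive_continuous _ _ _ h).
      - destruct (h2 t ltac:(lra)) as [_ [_ [h _]]]. exact (derive_continuous _ _ _ h). }
    destruct (h1 c ltac:(lra)) as [a1 [a2 [a3 [a4 a5]]]].
    destruct (h2 c ltac:(lra)) as [b1 [b2 [b3 b4]]].
    specialize (hH c ltac:(lra)).
    (* At the first contact [c] the speeds agree, so with [H2 <= H1] the derivatives of [p1] and
       [p2] differ by at least [(e1 - e2) Phi > 0], while a first contact makes this difference
       nonpositive. *)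
    assert (hec : r * e2 c < e1 c).
    { apply hratio; [lra| |].
      - intros y hyc. destruct (Rlt_le_dec y c); [specialize (hpos y ltac:(lra)); lra|].
        replace y with c by lra. lra.
      - intros y hxc. specialize (hpos y ltac:(lra)). lra. }
    assert (e2 c < e1 c) by nra.
    assert (hle : (H1 c / p1 c + e1 c * Phi c - A) - (H2 c / p2 c + e2 c * Phi c - A) <= 0).
    { apply (derive_le_of_left (fun x => p1 x - p2 x) x0 c); [lra| |].
      - apply (is_derive_minus p1 p2 c _ _ a4 b3).
      - intros y hy. specialize (hpos y ltac:(lra)). lra. }
    replace (p2 c) with (p1 c) in hle by lra.
    assert (H2 c / p1 c <= H1 c / p1 c).
    { apply Rmult_le_compat_r; auto. left. now apply Rinv_0_lt_compat. }
    nra. }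
  split; [apply hall; lra|]. apply hratio; [lra| |]; intros; [left|]; apply hall; lra.
Qed.

(** Height serves as a common clock: each orbit is inverted on its monotone stretch, so that speed
    and [E] become functions of the height, to which [phase_comparison] applies. The forces [H1] and
    [H2] are left free in order to cover ascents with different [k] and, after reflection,
    descents. *)
Lemma orbit_comparison (g1 G1 E1 H1 g2 G2 E2 H2 Phi : R -> R) (A om a1 b1 a2 b2 r x1 y1 x2 y2 : R) :
  0 < om -> 1 <= r ->
  (forall s, a1 < s < b1 -> is_derive g1 s (G1 s) /\ 0 < G1 s /\
    is_derive G1 s (H1 (g1 s) + E1 s * Phi (g1 s) * G1 s - A * G1 s) /\
    0 < E1 s /\ is_derive E1 s (- om * E1 s) /\ 0 < Phi (g1 s)) ->
  (forall s, a2 < s < b2 -> is_derive g2 s (G2 s) /\ 0 < G2 s /\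
    is_derive G2 s (H2 (g2 s) + E2 s * Phi (g2 s) * G2 s - A * G2 s) /\
    0 < E2 s /\ is_derive E2 s (- om * E2 s)) ->
  (forall w, H2 w <= H1 w) ->
  a1 < x1 -> x1 < y1 -> y1 < b1 -> a2 < x2 < b2 -> a2 < y2 < b2 ->
  g1 x1 = g2 x2 -> g1 y1 = g2 y2 ->
  G2 x2 < G1 x1 -> r * E2 x2 <= E1 x1 ->
  G2 y2 < G1 y1 /\ r * E2 y2 < E1 y1.
Proof.
  intros hom hr h1 h2 hH hx1 hxy hy1 hx2 hy2 ex ey hG hE.
  assert (i1 : forall s, a1 < s < b1 -> is_derive g1 s (G1 s) /\ 0 < G1 s) by (intros s hs; destruct (h1 s hs); tauto).
  assert (i2 : forall s, a2 < s < b2 -> is_derive g2 s (G2 s) /\ 0 < G2 s) by (intros s hs; destruct (h2 s hs); tauto).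
  destruct (inverse_function g1 G1 a1 b1 i1) as [S1 hS1].
  destruct (inverse_function g2 G2 a2 b2 i2) as [S2 hS2].
  assert (inc1 := strict_incr_on g1 G1 a1 b1 i1). assert (inc2 := strict_incr_on g2 G2 a2 b2 i2).
  assert (hx2y2 : x2 < y2).
  { destruct (Rlt_le_dec x2 y2); auto. exfalso. specialize (inc1 x1 y1 hx1 hy1 hxy).
    destruct (Req_dec x2 y2) as [e|ne]; [subst; lra|].
    specialize (inc2 y2 x2 ltac:(lra) ltac:(lra) ltac:(lra)). lra. }
  assert (r1 : forall w, g1 x1 <= w <= g1 y1 -> exists s, x1 <= s <= y1 /\ g1 s = w).
  { intros w hw. destruct (Req_dec w (g1 x1)) as [->|]; [exists x1; lra|].
    destruct (Req_dec w (g1 y1)) as [->|]; [exists y1; lra|].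
    destruct (IVT_interval g1 x1 y1 w) as [s [hs es]]; try lra.
    - intros x hx. destruct (h1 x ltac:(lra)) as [h _]. exact (derive_continuous _ _ _ h).
    - exists s; lra. }
  assert (r2 : forall w, g1 x1 <= w <= g1 y1 -> exists s, x2 <= s <= y2 /\ g2 s = w).
  { intros w hw. destruct (Req_dec w (g1 x1)) as [->|]; [exists x2; lra|].
    destruct (Req_dec w (g1 y1)) as [->|]; [exists y2; lra|].
    destruct (IVT_interval g2 x2 y2 w) as [s [hs es]]; try lra.
    - intros x hx. destruct (h2 x ltac:(lra)) as [h _]. exact (derive_continuous _ _ _ h).
    - exists s; lra. }
  assert (inc := inc1 x1 y1 hx1 hy1 hxy).
  destruct (phase_comparison (fun w => G1 (S1 w)) (fun w => G2 (S2 w)) (fun w => E1 (S1 w))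
     (fun w => E2 (S2 w)) H1 H2 Phi A om om (g1 x1) (g1 y1) r) as [c1 c2]; auto.
  - lra.
  - intros w hw. destruct (r1 w hw) as [s [hs es]]. subst w.
    assert (hs' : a1 < s < b1) by lra.
    destruct (h1 s hs') as [d1 [d2 [d3 [d4 [d5 d6]]]]].
    destruct (hS1 s hs') as [hS _]. rewrite hS.
    refine (conj d2 (conj d4 (conj d6 (conj _ _)))).
    + replace (H1 (g1 s) / G1 s + E1 s * Phi (g1 s) - A) with
        ((H1 (g1 s) + E1 s * Phi (g1 s) * G1 s - A * G1 s) / G1 s) by (field; lra).
      refine (proj2 (reparametrize g1 G1 G1 (fun s => H1 (g1 s) + E1 s * Phi (g1 s) * G1 s - A * G1 s) S1 a1 b1 hS1 _ s hs')).
      intros t ht. now apply h1.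
    + refine (proj2 (reparametrize g1 G1 E1 (fun s => - om * E1 s) S1 a1 b1 hS1 _ s hs')).
      intros t ht. now apply h1.
  - intros w hw. destruct (r2 w hw) as [s [hs es]]. subst w.
    assert (hs' : a2 < s < b2) by lra.
    destruct (h2 s hs') as [d1 [d2 [d3 [d4 d5]]]].
    destruct (hS2 s hs') as [hS _]. rewrite hS.
    refine (conj d2 (conj d4 (conj _ _))).
    + replace (H2 (g2 s) / G2 s + E2 s * Phi (g2 s) - A) with
        ((H2 (g2 s) + E2 s * Phi (g2 s) * G2 s - A * G2 s) / G2 s) by (field; lra).
      refine (proj2 (reparametrize g2 G2 G2 (fun s => H2 (g2 s) + E2 s * Phi (g2 s) * G2 s - A * G2 s) S2 a2 b2 hS2 _ s hs')).
      intros t ht. now apply h2.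
    + refine (proj2 (reparametrize g2 G2 E2 (fun s => - om * E2 s) S2 a2 b2 hS2 _ s hs')).
      intros t ht. now apply h2.
  - destruct (hS1 x1 ltac:(lra)) as [e1 _]. destruct (hS2 x2 ltac:(lra)) as [e2 _].
    rewrite e1, ex, e2. auto.
  - destruct (hS1 x1 ltac:(lra)) as [e1 _]. destruct (hS2 x2 ltac:(lra)) as [e2 _].
    rewrite e1, ex, e2. auto.
  - destruct (hS1 y1 ltac:(lra)) as [e1 _]. destruct (hS2 y2 ltac:(lra)) as [e2 _].
    rewrite e1, ey, e2 in c1. rewrite e1, ey, e2 in c2. auto.
Qed.

(** In the application [a = 1/m], [q = p/m], [n] is the dimension, and [L (1 - q) = sigma + 2], so
    that [L_large] is the positivity of [sigma]. *)
Class coeffs := {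
  a : R; q : R; L : R; n : R;
  a_pos : 0 < a; a_lt_q : a < q; q_lt_1 : q < 1; L_large : 2 < L * (1 - q); n_ge_1 : 1 <= n }.

(** * The orbit equation and its symmetries *)

Section Orbits.
Context {c : coeffs}.

(** [x^2 + A x + B] has the roots [-L] and [-(L + n - 2)]: the linear part is the radial Laplacian
    in logarithmic time, its solutions [1] and [r^(2-n)] being multiplied by [e^(-L s)]. *)
Definition A := 2 * L + n - 2.
Definition B := L * (L + n - 2).
Definition om := (1 - a) * L - 2.

Lemma L_gt_2 : 2 < L.
Proof. pose proof a_pos; pose proof a_lt_q; pose proof q_lt_1; pose proof L_large. nra. Qed.

Lemma A_pos : 0 < A.
Proof. unfold A. pose proof L_gt_2; pose proof n_ge_1. lra. Qed.

Lemma B_pos : 0 < B.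
Proof. unfold B. pose proof L_gt_2; pose proof n_ge_1. nra. Qed.

Lemma om_pos : 0 < om.
Proof. unfold om. pose proof L_gt_2; pose proof L_large; pose proof a_lt_q. nra. Qed.

Definition E (e s : R) := e * exp (- om * s).

Lemma E_pos (e s : R) : 0 < e -> 0 < E e s.
Proof. intros. apply Rmult_lt_0_compat; [auto|apply exp_pos]. Qed.

Lemma E_derive (e s : R) : is_derive (E e) s (- om * E e s).
Proof. unfold E. auto_derive; [auto|ring]. Qed.

Lemma E_decr (e s t : R) : 0 < e -> s < t -> E e t < E e s.
Proof.
  intros he h. unfold E. apply Rmult_lt_compat_l; auto. apply exp_increasing.
  pose proof om_pos. nra.
Qed.

Lemma E_shift (e s l : R) : E e (s + l) = E (e * exp (- om * l)) s.
Proof. unfold E. rewrite Rmult_plus_distr_l, exp_plus. ring. Qed.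

Definition accel (k e s w p : R) :=
  - A * p - B * w + k * Rpower w q + E e s * (a * Rpower w (a - 1)) * p.

(** The interval is open because [accel] is singular where [W] vanishes; [P] is part of the data, so
    that the system is of first order. *)
Definition orbit (k e : R) (W P : R -> R) (s0 s1 : R) :=
  forall s, s0 < s < s1 -> 0 < W s /\ is_derive W s (P s) /\ is_derive P s (accel k e s (W s) (P s)).

Lemma orbit_sub k e W P s0 s1 t0 t1 : orbit k e W P s0 s1 -> s0 <= t0 -> t1 <= s1 -> orbit k e W P t0 t1.
Proof. intros h h0 h1 s hs. apply h; lra. Qed.

Lemma orbit_contW k e W P s0 s1 s : orbit k e W P s0 s1 -> s0 < s < s1 -> continuous W s.
Proof. intros h hs. destruct (h s hs) as [_ [h1 h2]]. exact (derive_continuous _ _ _ h1). Qed.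

Lemma orbit_contP k e W P s0 s1 s : orbit k e W P s0 s1 -> s0 < s < s1 -> continuous P s.
Proof. intros h hs. destruct (h s hs) as [_ [h1 h2]]. exact (derive_continuous _ _ _ h2). Qed.

Definition up (W P : R -> R) (s0 s1 : R) := forall s, s0 < s < s1 -> 0 < P s.
Definition down (W P : R -> R) (s0 s1 : R) := forall s, s0 < s < s1 -> P s < 0.

Lemma up_comparison k1 e1 W1 P1 a1 b1 k2 e2 W2 P2 a2 b2 r x1 y1 x2 y2 :
  0 < e1 -> 0 < e2 -> k2 <= k1 -> 1 <= r ->
  orbit k1 e1 W1 P1 a1 b1 -> up W1 P1 a1 b1 ->
  orbit k2 e2 W2 P2 a2 b2 -> up W2 P2 a2 b2 ->
  a1 < x1 -> x1 < y1 -> y1 < b1 -> a2 < x2 < b2 -> a2 < y2 < b2 ->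
  W1 x1 = W2 x2 -> W1 y1 = W2 y2 ->
  P2 x2 < P1 x1 -> r * E e2 x2 <= E e1 x1 ->
  P2 y2 < P1 y1 /\ r * E e2 y2 < E e1 y1.
Proof.
  intros he1 he2 hk hr o1 u1 o2 u2 h1 h2 h3 h4 h5 ex ey hP hE.
  apply (orbit_comparison W1 P1 (E e1) (fun w => k1 * Rpower w q - B * w)
     W2 P2 (E e2) (fun w => k2 * Rpower w q - B * w) (fun w => a * Rpower w (a - 1)) A om
     a1 b1 a2 b2 r x1 y1 x2 y2); auto.
  - apply om_pos.
  - intros s hs. destruct (o1 s hs) as [w1 [w2 w3]]. split; auto. split; [now apply u1|].
    split; [|split; [now apply E_pos|split; [apply E_derive|]]].
    + unfold accel in w3. apply (is_derive_eq _ _ _ _ w3). ring.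
    + apply Rmult_lt_0_compat; [apply a_pos|apply Rpower_pos].
  - intros s hs. destruct (o2 s hs) as [w1 [w2 w3]]. split; auto. split; [now apply u2|].
    split; [|split; [now apply E_pos|apply E_derive]].
    unfold accel in w3. apply (is_derive_eq _ _ _ _ w3). ring.
  - intros w. pose proof (Rpower_pos w q). nra.
Qed.

(** Replacing [W] by [-W] makes the descent an ascent. The force changes sign, so a larger [k] now
    slows the motion; hence one [k] for both orbits, unlike in [up_comparison]. *)
Lemma down_comparison k e1 W1 P1 a1 b1 e2 W2 P2 a2 b2 r x1 y1 x2 y2 :
  0 < e1 -> 0 < e2 -> 1 <= r ->
  orbit k e1 W1 P1 a1 b1 -> down W1 P1 a1 b1 ->
  orbit k e2 W2 P2 a2 b2 -> down W2 P2 a2 b2 ->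
  a1 < x1 -> x1 < y1 -> y1 < b1 -> a2 < x2 < b2 -> a2 < y2 < b2 ->
  W1 x1 = W2 x2 -> W1 y1 = W2 y2 ->
  P1 x1 < P2 x2 -> r * E e2 x2 <= E e1 x1 ->
  P1 y1 < P2 y2 /\ r * E e2 y2 < E e1 y1.
Proof.
  intros he1 he2 hr o1 u1 o2 u2 h1 h2 h3 h4 h5 ex ey hP hE.
  destruct (orbit_comparison (fun s => - W1 s) (fun s => - P1 s) (E e1) (fun w => B * (- w) - k * Rpower (- w) q)
     (fun s => - W2 s) (fun s => - P2 s) (E e2) (fun w => B * (- w) - k * Rpower (- w) q)
     (fun w => a * Rpower (- w) (a - 1)) A om
     a1 b1 a2 b2 r x1 y1 x2 y2) as [c1 c2]; auto; try lra.
  - apply om_pos.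
  - intros s hs. destruct (o1 s hs) as [w1 [w2 w3]]. specialize (u1 s hs).
    split; [apply (is_derive_opp W1 s _ w2)|]. split; [lra|].
    split; [|split; [now apply E_pos|split; [apply E_derive|]]].
    + apply (is_derive_opp P1) in w3. unfold accel in w3. apply (is_derive_eq _ _ _ _ w3).
      unfold opp; simpl. rewrite Ropp_involutive. ring.
    + apply Rmult_lt_0_compat; [apply a_pos|apply Rpower_pos].
  - intros s hs. destruct (o2 s hs) as [w1 [w2 w3]]. specialize (u2 s hs).
    split; [apply (is_derive_opp W2 s _ w2)|]. split; [lra|].
    split; [|split; [now apply E_pos|apply E_derive]].
    apply (is_derive_opp P2) in w3. unfold accel in w3. apply (is_derive_eq _ _ _ _ w3).
    unfold opp; simpl. rewrite Ropp_involutive. ring.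
  - intros w. lra.
Qed.

(** The source [W^q] and the drag [W^(a-1) W'] are homogeneous of degrees [q] and [a], so
    multiplying [W] by [l] costs [l^(1-q)] in [k] and [l^(1-a)] in [e]. *)
Lemma orbit_scale k e W P s0 s1 l : 0 < l -> orbit k e W P s0 s1 ->
  orbit (k * Rpower l (1 - q)) (e * Rpower l (1 - a)) (fun s => l * W s) (fun s => l * P s) s0 s1.
Proof.
  intros hl o s hs. destruct (o s hs) as [w1 [w2 w3]]. split; [nra|].
  split; [apply (is_derive_scal W s l _ w2)|].
  apply (is_derive_scal P s l) in w3. apply (is_derive_eq _ _ _ _ w3). unfold accel, E.
  rewrite !Rpower_mult_base by auto.
  assert (e1 : Rpower l (1 - q) * Rpower l q = l).
  { rewrite <- Rpower_plus. replace (1 - q + q) with 1 by ring. now apply Rpower_1. }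
  assert (e2 : Rpower l (1 - a) * Rpower l (a - 1) = 1).
  { rewrite <- Rpower_plus. replace (1 - a + (a - 1)) with 0 by ring. now apply Rpower_O. }
  transitivity (- A * (l * P s) - B * (l * W s) + k * (Rpower l (1 - q) * Rpower l q) * Rpower (W s) q
     + e * exp (- om * s) * (a * Rpower (W s) (a - 1)) * (Rpower l (1 - a) * Rpower l (a - 1)) * (l * P s)).
  - rewrite e1, e2. simpl. ring.
  - ring.
Qed.

Lemma is_derive_shift (f : R -> R) (s l d : R) : is_derive f (s + l) d -> is_derive (fun t => f (t + l)) s d.
Proof. intros h. dsolve. Qed.

Lemma orbit_shift k e W P s0 s1 l : orbit k e W P s0 s1 ->
  orbit k (e * exp (- om * l)) (fun s => W (s + l)) (fun s => P (s + l)) (s0 - l) (s1 - l).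
Proof.
  intros o s hs. destruct (o (s + l) ltac:(lra)) as [w1 [w2 w3]]. split; auto.
  split; [now apply is_derive_shift|]. apply (is_derive_shift P). 
  unfold accel in *. rewrite <- E_shift. exact w3.
Qed.

Lemma orbit_ext k e W P W' P' s0 s1 : 
  (forall s, s0 < s < s1 -> W' s = W s /\ P' s = P s) ->
  orbit k e W P s0 s1 -> orbit k e W' P' s0 s1.
Proof.
  intros h o s hs. destruct (h s hs) as [eW eP]. destruct (o s hs) as [w1 [w2 w3]].
  rewrite eW, eP. split; auto. split.
  - apply (is_derive_on W' W s0 s1); auto. intros y hy. now apply h.
  - apply (is_derive_on P' P s0 s1); auto. intros y hy. now apply h.
Qed.

End Orbits.

(** * The ascent from the interface *)

Lemma Gronwall_zero (U V u v : R -> R) (x y C : R) : 0 < C -> x <= y ->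
  (forall s, x <= s <= y -> is_derive U s (u s) /\ is_derive V s (v s) /\
     Rabs (u s) <= C * (Rabs (U s) + Rabs (V s)) /\ Rabs (v s) <= C * (Rabs (U s) + Rabs (V s))) ->
  U x = 0 -> V x = 0 -> U y = 0 /\ V y = 0.
Proof.
  intros hC hxy h hU hV.
  pose proof (Gronwall (fun s => U s * U s + V s * V s) (fun s => 2 * (U s * u s + V s * v s)) x y (4 * C) 0 hxy ltac:(lra)) as G.
  simpl in G. rewrite hU, hV in G.
  assert (G0 : U y * U y + V y * V y <= 0).
  { unfold Rdiv in G. rewrite !Rmult_0_l, !Rplus_0_r, Rmult_0_l in G. apply G.
    - intros s hs. destruct (h s hs) as [h1 [h2 _]]. dsolve.
    - intros s hs. destruct (h s hs) as [_ [_ [h3 h4]]].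
      assert (U s * u s <= Rabs (U s) * (C * (Rabs (U s) + Rabs (V s)))).
      { eapply Rle_trans; [apply Rle_abs|]. rewrite Rabs_mult. apply Rmult_le_compat_l; [apply Rabs_pos|auto]. }
      assert (V s * v s <= Rabs (V s) * (C * (Rabs (U s) + Rabs (V s)))).
      { eapply Rle_trans; [apply Rle_abs|]. rewrite Rabs_mult. apply Rmult_le_compat_l; [apply Rabs_pos|auto]. }
      assert (e1 : U s * U s = Rabs (U s) * Rabs (U s)) by (rewrite <- Rabs_mult; symmetry; apply Rabs_pos_eq, Rle_0_sqr).
      assert (e2 : V s * V s = Rabs (V s) * Rabs (V s)) by (rewrite <- Rabs_mult; symmetry; apply Rabs_pos_eq, Rle_0_sqr).
      rewrite e1, e2. assert (0 <= (Rabs (U s) - Rabs (V s)) * (Rabs (U s) - Rabs (V s))) by apply Rle_0_sqr.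
      set (x1 := Rabs (U s)) in *. set (x2 := Rabs (V s)) in *. nra. }
  split; nra.
Qed.

Lemma Gronwall_zero_both (U V u v : R -> R) (x y t C : R) : 0 < C -> x <= t <= y ->
  (forall s, x <= s <= y -> is_derive U s (u s) /\ is_derive V s (v s) /\
     Rabs (u s) <= C * (Rabs (U s) + Rabs (V s)) /\ Rabs (v s) <= C * (Rabs (U s) + Rabs (V s))) ->
  U t = 0 -> V t = 0 -> forall s, x <= s <= y -> U s = 0 /\ V s = 0.
Proof.
  intros hC ht h hU hV s hs. destruct (Rle_lt_dec t s) as [l|l].
  - apply (Gronwall_zero U V u v t s C); auto. intros r hr. apply h; lra.
  - destruct (Gronwall_zero (fun r => U (- r)) (fun r => V (- r)) (fun r => - u (- r)) (fun r => - v (- r)) (- t) (- s) C) as [h1 h2];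
    auto; try lra; rewrite ?Ropp_involutive; auto.
    + intros r hr. destruct (h (- r) ltac:(lra)) as [h1 [h2 [h3 h4]]]. rewrite !Rabs_Ropp.
      split; [dsolve|]. split; [dsolve|]. auto.
    + rewrite Ropp_involutive in h1, h2. auto.
Qed.

Lemma Rpower_lipschitz (m M z : R) : 0 < m -> m <= M -> exists C, 0 <= C /\
  forall x y, m <= x <= M -> m <= y <= M -> Rabs (Rpower x z - Rpower y z) <= C * Rabs (x - y).
Proof.
  intros hm hM. exists (Rabs z * (Rpower m (z - 1) + Rpower M (z - 1))).
  split. { apply Rmult_le_pos; [apply Rabs_pos|]. pose proof (Rpower_pos m (z-1)). pose proof (Rpower_pos M (z-1)). lra. }
  assert (h : forall x y, m <= x -> x < y -> y <= M ->
    Rabs (Rpower x z - Rpower y z) <= Rabs z * (Rpower m (z - 1) + Rpower M (z - 1)) * Rabs (x - y)).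
  { intros x y hx hxy hy.
    destruct (MVT_interval (fun w => Rpower w z) (fun w => z * Rpower w (z - 1)) x y) as [t [ht e]]; auto.
    - intros w hw. apply is_derive_Rpower. lra.
    - rewrite Rabs_minus_sym, e, !Rabs_mult, (Rabs_minus_sym x y).
      apply Rmult_le_compat_r; [apply Rabs_pos|]. apply Rmult_le_compat_l; [apply Rabs_pos|].
      rewrite Rabs_pos_eq by (left; apply Rpower_pos).
      pose proof (Rpower_pos m (z-1)). pose proof (Rpower_pos M (z-1)).
      destruct (Rle_lt_dec 0 (z - 1)).
      + assert (Rpower t (z - 1) <= Rpower M (z - 1)) by (apply Rpower_le; lra). lra.
      + assert (Rpower t (z - 1) <= Rpower m (z - 1)) by (apply Rpower_le_neg; lra). lra. }
  intros x y hx hy. destruct (Rtotal_order x y) as [l|[->|l]].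
  - apply h; lra.
  - rewrite !Rminus_diag, Rabs_R0. lra.
  - rewrite Rabs_minus_sym, (Rabs_minus_sym x y). apply h; lra.
Qed.

Lemma continuous_Rabs_bound (f : R -> R) (x y : R) : x <= y ->
  (forall s, x <= s <= y -> continuous f s) -> exists M, 0 < M /\ forall s, x <= s <= y -> Rabs (f s) <= M.
Proof.
  intros h hc. destruct (continuous_bounded_max f x y h hc) as [u [_ hu]].
  destruct (continuous_bounded_min f x y h hc) as [v [_ hv]].
  exists (Rabs (f u) + Rabs (f v) + 1). pose proof (Rabs_pos (f u)). pose proof (Rabs_pos (f v)).
  split; [lra|]. intros s hs. specialize (hu s hs). specialize (hv s hs).
  pose proof (Rle_abs (f u)). pose proof (Rle_abs (- f v)). rewrite Rabs_Ropp in H2.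
  apply Rabs_le. lra.
Qed.

Section Head.
Context {c : coeffs}.

(** Between [s] and [t] both orbits stay in a compact set of positive heights, on which the powers
    are Lipschitz, and Gronwall applies. *)
Lemma orbit_unique k e W1 P1 W2 P2 s0 s1 t : 
  orbit k e W1 P1 s0 s1 -> orbit k e W2 P2 s0 s1 -> s0 < t < s1 -> W1 t = W2 t -> P1 t = P2 t ->
  forall s, s0 < s < s1 -> W1 s = W2 s /\ P1 s = P2 s.
Proof.
  intros o1 o2 ht eW eP s hs.
  set (x := Rmin s t). set (y := Rmax s t).
  assert (hx : s0 < x) by (unfold x; apply Rmin_glb_lt; lra).
  assert (hy : y < s1) by (unfold y; apply Rmax_lub_lt; lra).
  assert (hxs : x <= s <= y) by (unfold x, y; split; [apply Rmin_l|apply Rmax_l]).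
  assert (hxt : x <= t <= y) by (unfold x, y; split; [apply Rmin_r|apply Rmax_r]).
  assert (hpos : forall W P, orbit k e W P s0 s1 -> exists m M, 0 < m /\ forall r, x <= r <= y -> m <= W r <= M).
  { intros W P o. destruct (continuous_bounded_max W x y ltac:(lra)) as [u [hu1 hu]].
    { intros r hr. eapply orbit_contW; eauto; lra. }
    destruct (continuous_bounded_min W x y ltac:(lra)) as [v [hv1 hv]].
    { intros r hr. eapply orbit_contW; eauto; lra. }
    exists (W v), (W u). split; [apply o; lra|]. intros r hr. split; auto. }
  destruct (hpos _ _ o1) as [m1 [M1 [hm1 hb1]]]. destruct (hpos _ _ o2) as [m2 [M2 [hm2 hb2]]].
  set (m := Rmin m1 m2). set (M := Rmax M1 M2).
  assert (hm : 0 < m) by (unfold m; apply Rmin_pos; auto).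
  assert (hb1' : forall r, x <= r <= y -> m <= W1 r <= M).
  { intros r hr. specialize (hb1 r hr). pose proof (Rmin_l m1 m2). pose proof (Rmax_l M1 M2). unfold m, M. lra. }
  assert (hb2' : forall r, x <= r <= y -> m <= W2 r <= M).
  { intros r hr. specialize (hb2 r hr). pose proof (Rmin_r m1 m2). pose proof (Rmax_r M1 M2). unfold m, M. lra. }
  assert (hmM : m <= M) by (specialize (hb1' t hxt); lra).
  destruct (Rpower_lipschitz m M q hm hmM) as [Cq [hCq hlq]].
  destruct (Rpower_lipschitz m M (a - 1) hm hmM) as [Ca [hCa hla]].
  destruct (continuous_Rabs_bound P1 x y ltac:(lra)) as [MP [hMP hP]].
  { intros r hr. eapply orbit_contP; eauto; lra. }
  destruct (continuous_Rabs_bound (E e) x y ltac:(lra)) as [ME [hME hE]].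
  { intros r hr. eapply derive_continuous, E_derive. }
  destruct (continuous_Rabs_bound (fun r => Rpower (W2 r) (a - 1)) x y ltac:(lra)) as [MW [hMW hW]].
  { intros r hr. destruct (o2 r ltac:(lra)) as [w1 [w2 _]].
    eapply derive_continuous, is_derive_Rpower_comp; eauto. }
  set (C := 1 + A + B + Rabs k * Cq + ME * a * (Ca * MP + MW)).
  pose proof A_pos; pose proof B_pos; pose proof a_pos.
  pose proof (Rabs_pos k).
  assert (0 <= Rabs k * Cq) by (apply Rmult_le_pos; auto).
  assert (0 <= ME * a) by (apply Rmult_le_pos; lra).
  assert (0 <= Ca * MP) by (apply Rmult_le_pos; lra).
  assert (0 <= ME * a * (Ca * MP + MW)) by (apply Rmult_le_pos; lra).
  destruct (Gronwall_zero_both (fun r => W1 r - W2 r) (fun r => P1 r - P2 r) (fun r => P1 r - P2 r)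
    (fun r => accel k e r (W1 r) (P1 r) - accel k e r (W2 r) (P2 r)) x y t C) with (s := s) as [g1 g2]; auto; try lra.
  - unfold C. lra.
  - intros r hr. destruct (o1 r ltac:(lra)) as [w1 [w2 w3]]. destruct (o2 r ltac:(lra)) as [v1 [v2 v3]].
    split; [apply (is_derive_minus W1 W2 r _ _ w2 v2)|].
    split; [apply (is_derive_minus P1 P2 r _ _ w3 v3)|].
    set (dW := Rabs (W1 r - W2 r)). set (dP := Rabs (P1 r - P2 r)).
    assert (0 <= dW) by apply Rabs_pos. assert (0 <= dP) by apply Rabs_pos.
    split.
    + assert (0 <= C - 1) by (unfold C; lra). nra.
    + specialize (hlq (W1 r) (W2 r) (hb1' r hr) (hb2' r hr)). specialize (hla (W1 r) (W2 r) (hb1' r hr) (hb2' r hr)).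
      specialize (hP r hr). specialize (hE r hr). specialize (hW r hr). fold dW in hlq, hla.
      replace (accel k e r (W1 r) (P1 r) - accel k e r (W2 r) (P2 r)) with
        (- A * (P1 r - P2 r) + (- B * (W1 r - W2 r)) + k * (Rpower (W1 r) q - Rpower (W2 r) q)
          + E e r * a * ((Rpower (W1 r) (a - 1) - Rpower (W2 r) (a - 1)) * P1 r + Rpower (W2 r) (a - 1) * (P1 r - P2 r)))
        by (unfold accel; ring).
      eapply Rle_trans; [apply Rabs_triang|]. eapply Rle_trans; [apply Rplus_le_compat_r, Rabs_triang|].
      eapply Rle_trans; [apply Rplus_le_compat_r, Rplus_le_compat_r, Rabs_triang|].
      rewrite !Rabs_mult, !Rabs_Ropp, (Rabs_pos_eq A), (Rabs_pos_eq B), (Rabs_pos_eq a) by lra.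
      fold dW dP.
      assert (t1 : Rabs k * Rabs (Rpower (W1 r) q - Rpower (W2 r) q) <= Rabs k * Cq * dW).
      { rewrite Rmult_assoc. apply Rmult_le_compat_l; auto. }
      assert (t2 : Rabs ((Rpower (W1 r) (a - 1) - Rpower (W2 r) (a - 1)) * P1 r + Rpower (W2 r) (a - 1) * (P1 r - P2 r))
         <= (Ca * MP + MW) * (dW + dP)).
      { eapply Rle_trans; [apply Rabs_triang|]. rewrite !Rabs_mult. fold dP.
        assert (Rabs (Rpower (W1 r) (a - 1) - Rpower (W2 r) (a - 1)) * Rabs (P1 r) <= Ca * dW * MP).
        { apply Rmult_le_compat; auto; apply Rabs_pos. }
        assert (Rabs (Rpower (W2 r) (a - 1)) * dP <= MW * dP) by (apply Rmult_le_compat_r; auto).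
        assert (0 <= Ca * MP * dP) by (apply Rmult_le_pos; auto).
        assert (0 <= MW * dW) by (apply Rmult_le_pos; lra). nra. }
      assert (t3 : Rabs (E e r) * a * Rabs ((Rpower (W1 r) (a - 1) - Rpower (W2 r) (a - 1)) * P1 r + Rpower (W2 r) (a - 1) * (P1 r - P2 r))
         <= ME * a * ((Ca * MP + MW) * (dW + dP))).
      { apply Rmult_le_compat; auto; [apply Rmult_le_pos; [apply Rabs_pos|lra]|apply Rabs_pos|].
        apply Rmult_le_compat_r; lra. }
      assert (0 <= Rabs k * Cq * dP) by (apply Rmult_le_pos; auto).
      unfold C. nra.
Qed.

(** Takes the place of Cauchy data, which make no sense where the equation is singular: the pressure
    [W^(1-a)] leaves 0 with slope [(1 - a) E e s0]. *)
Definition interface (e : R) (W P : R -> R) (s0 : R) :=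
  forall eps, 0 < eps -> exists d, 0 < d /\ forall s, s0 < s < s0 + d ->
    W s < eps /\ Rabs (P s / Rpower (W s) a - E e s0) < eps.

Lemma interface_up k e W P s0 s1 : 0 < e -> s0 < s1 -> orbit k e W P s0 s1 -> interface e W P s0 ->
  exists t, s0 < t < s1 /\ up W P s0 t.
Proof.
  intros he hs o hi. pose proof (E_pos e s0 he) as hE.
  destruct (hi (E e s0) hE) as [d [hd h]].
  exists (s0 + Rmin (d / 2) ((s1 - s0) / 2)).
  assert (h1 := Rmin_l (d / 2) ((s1 - s0) / 2)). assert (h2 := Rmin_r (d / 2) ((s1 - s0) / 2)).
  assert (h3 : 0 < Rmin (d / 2) ((s1 - s0) / 2)) by (apply Rmin_pos; lra).
  split; [lra|]. intros s hss. destruct (h s ltac:(lra)) as [_ hr]. apply Rabs_def2 in hr.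
  destruct (o s ltac:(lra)) as [w1 _]. pose proof (Rpower_pos (W s) a).
  assert (0 < P s / Rpower (W s) a) by lra.
  replace (P s) with (P s / Rpower (W s) a * Rpower (W s) a) by (field; lra). now apply Rmult_lt_0_compat.
Qed.

Lemma interface_reaches k e W P s0 s1 t w : s0 < t < s1 -> orbit k e W P s0 s1 -> interface e W P s0 ->
  0 < w -> w < W t -> exists s, s0 < s < t /\ W s = w.
Proof.
  intros ht o hi hw hwt. destruct (hi w hw) as [d [hd h]].
  set (x := s0 + Rmin (d / 2) ((t - s0) / 2)).
  assert (h1 := Rmin_l (d / 2) ((t - s0) / 2)). assert (h2 := Rmin_r (d / 2) ((t - s0) / 2)).
  assert (h3 : 0 < Rmin (d / 2) ((t - s0) / 2)) by (apply Rmin_pos; lra).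
  destruct (h x ltac:(unfold x; lra)) as [hx _].
  destruct (IVT_interval W x t w) as [s [hs es]]; auto.
  - unfold x; lra.
  - intros r hr. eapply orbit_contW; eauto. unfold x in hr; lra.
  - exists s. split; [unfold x in hs; lra|auto].
Qed.

(** Near the edge the speed at height [w] is about [E w^a], so the edge with the larger [E] gives
    the larger speed at every small common height; [up_comparison] carries this upwards. *)
Lemma head_comparison k1 e1 W1 P1 s1 t1 k2 e2 W2 P2 s2 t2 y1 y2 :
  0 < e1 -> 0 < e2 -> k2 <= k1 ->
  orbit k1 e1 W1 P1 s1 t1 -> up W1 P1 s1 t1 -> interface e1 W1 P1 s1 ->
  orbit k2 e2 W2 P2 s2 t2 -> up W2 P2 s2 t2 -> interface e2 W2 P2 s2 ->
  E e2 s2 < E e1 s1 -> s1 < y1 < t1 -> s2 < y2 < t2 -> W1 y1 = W2 y2 ->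
  P2 y2 < P1 y1 /\ E e2 y2 < E e1 y1.
Proof.
  intros he1 he2 hk o1 u1 i1 o2 u2 i2 hE hy1 hy2 ey.
  (* A quarter of the gap leaves room for the errors of both ratios and for the drop of [E e1] after
     [s1]. *)
  set (eps := (E e1 s1 - E e2 s2) / 4).
  assert (heps : 0 < eps) by (unfold eps; lra).
  destruct (i1 eps heps) as [d1 [hd1 h1]]. destruct (i2 eps heps) as [d2 [hd2 h2]].
  destruct (continuous_eps (E e1) s1 (derive_continuous _ _ _ (E_derive e1 s1)) eps heps) as [d3 [hd3 h3]].
  set (z2 := s2 + Rmin (d2 / 2) ((y2 - s2) / 2)).
  assert (hz2 : s2 < z2 < y2 /\ z2 < s2 + d2).
  { unfold z2. assert (g1 := Rmin_l (d2 / 2) ((y2 - s2) / 2)). assert (g2 := Rmin_r (d2 / 2) ((y2 - s2) / 2)).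
    assert (g3 : 0 < Rmin (d2 / 2) ((y2 - s2) / 2)) by (apply Rmin_pos; lra). lra. }
  set (dd := Rmin (d1 / 2) (Rmin (d3 / 2) ((y1 - s1) / 2))).
  assert (hdd : 0 < dd /\ dd <= d1 / 2 /\ dd <= d3 / 2 /\ dd <= (y1 - s1) / 2).
  { unfold dd. split; [repeat apply Rmin_pos; lra|]. split; [apply Rmin_l|].
    split; (eapply Rle_trans; [apply Rmin_r|]); [apply Rmin_l|apply Rmin_r]. }
  set (w := Rmin (W1 (s1 + dd)) (W2 z2) / 2).
  assert (hw1 := Rmin_l (W1 (s1 + dd)) (W2 z2)). assert (hw2 := Rmin_r (W1 (s1 + dd)) (W2 z2)).
  assert (hw : 0 < Rmin (W1 (s1 + dd)) (W2 z2)).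
  { apply Rmin_pos; [apply o1; lra|apply o2; lra]. }
  destruct (interface_reaches k1 e1 W1 P1 s1 t1 (s1 + dd) w) as [x1 [hx1 ex1]]; auto; try (unfold w; lra).
  destruct (interface_reaches k2 e2 W2 P2 s2 t2 z2 w) as [x2 [hx2 ex2]]; auto; try (unfold w; lra).
  destruct (h1 x1 ltac:(lra)) as [_ g1]. destruct (h2 x2 ltac:(lra)) as [_ g2].
  specialize (h3 x1 ltac:(apply Rabs_def1; lra)).
  apply Rabs_def2 in g1. apply Rabs_def2 in g2. apply Rabs_def2 in h3.
  rewrite ex1 in g1. rewrite ex2 in g2.
  assert (hlt : P2 x2 / Rpower w a < P1 x1 / Rpower w a) by (unfold eps in *; lra).
  assert (hPx : P2 x2 < P1 x1).
  { apply Rmult_lt_reg_r with (/ Rpower w a); [apply Rinv_0_lt_compat, Rpower_pos|exact hlt]. }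
  assert (hEx : E e2 x2 < E e2 s2) by (apply E_decr; auto; lra).
  destruct (up_comparison k1 e1 W1 P1 s1 t1 k2 e2 W2 P2 s2 t2 1 x1 y1 x2 y2) as [r1 r2]; auto; try lra.
  unfold eps in *; lra.
Qed.

Lemma interface_scale k e W P s0 s1 l : s0 < s1 -> 0 < l -> orbit k e W P s0 s1 -> interface e W P s0 ->
  interface (e * Rpower l (1 - a)) (fun s => l * W s) (fun s => l * P s) s0.
Proof.
  intros hs hl o hi eps he. set (l' := Rpower l (1 - a)). assert (hl' : 0 < l') by apply Rpower_pos.
  set (eps' := Rmin (eps / l) (eps / l')).
  assert (he1 : eps' <= eps / l) by apply Rmin_l. assert (he2 : eps' <= eps / l') by apply Rmin_r.
  assert (he0 : 0 < eps').
  { apply Rmin_pos; apply Rmult_lt_0_compat; auto; now apply Rinv_0_lt_compat. }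
  destruct (hi eps' he0) as [d [hd h]]. exists (Rmin d (s1 - s0)).
  split; [apply Rmin_pos; lra|]. intros s hss.
  pose proof (Rmin_l d (s1 - s0)). pose proof (Rmin_r d (s1 - s0)).
  destruct (h s ltac:(lra)) as [h1 h2]. destruct (o s ltac:(lra)) as [w1 _]. split.
  - apply Rmult_lt_reg_r with (/ l); [now apply Rinv_0_lt_compat|].
    replace (l * W s * / l) with (W s) by (field; lra). unfold Rdiv in he1. lra.
  - rewrite Rpower_mult_base by auto.
    assert (el : l = l' * Rpower l a).
    { unfold l'. rewrite <- Rpower_plus. replace (1 - a + a) with 1 by ring. now rewrite Rpower_1. }
    replace (l * P s / (Rpower l a * Rpower (W s) a)) with (l' * (P s / Rpower (W s) a)).
    + replace (E (e * l') s0) with (l' * E e s0) by (unfold E; ring).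
      replace (l' * (P s / Rpower (W s) a) - l' * E e s0) with (l' * (P s / Rpower (W s) a - E e s0)) by ring.
      rewrite Rabs_mult, (Rabs_pos_eq l') by lra.
      apply Rmult_lt_reg_l with (/ l'); [now apply Rinv_0_lt_compat|].
      rewrite <- Rmult_assoc, Rinv_l by lra. unfold Rdiv in he2. lra.
    + pose proof (Rpower_pos l a). pose proof (Rpower_pos (W s) a).
      transitivity (l' * Rpower l a * P s / (Rpower l a * Rpower (W s) a)); [field; lra|now rewrite <- el].
Qed.

(** Equality of [E] at the edges gives no strict start. Dilating the first orbit by [l > 1]
    multiplies its [E] by [l^(1-a) > 1] and does not lower its [k], so the strict comparison
    applies; then [l] tends to 1. *)
Lemma head_comparison_le k1 e1 W1 P1 s1 t1 k2 e2 W2 P2 s2 t2 y1 y2 :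
  0 < e1 -> 0 < e2 -> 0 <= k1 -> k2 <= k1 ->
  orbit k1 e1 W1 P1 s1 t1 -> up W1 P1 s1 t1 -> interface e1 W1 P1 s1 ->
  orbit k2 e2 W2 P2 s2 t2 -> up W2 P2 s2 t2 -> interface e2 W2 P2 s2 ->
  E e2 s2 <= E e1 s1 -> s1 < y1 < t1 -> s2 < y2 < t2 -> W1 y1 = W2 y2 ->
  P2 y2 <= P1 y1 /\ E e2 y2 <= E e1 y1.
Proof.
  intros he1 he2 hk1 hk o1 u1 i1 o2 u2 i2 hE hy1 hy2 ey.
  assert (key : forall y, s1 < y < y1 -> P2 y2 < W2 y2 / W1 y * P1 y /\
     E e2 y2 < Rpower (W2 y2 / W1 y) (1 - a) * E e1 y).
  (* This [l] lifts the first orbit to the height [W2 y2] at the time [y]; as [y] increases to [y1],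
     [l] decreases to 1. *)
  { intros y hy. set (l := W2 y2 / W1 y).
    assert (hinc : W1 y < W1 y1).
    { apply (strict_incr_of_derive W1 P1); [lra|intros x hx; apply o1; lra|intros x hx; apply u1; lra]. }
    assert (hWy : 0 < W1 y) by (apply o1; lra).
    assert (hl : 1 < l).
    { unfold l. apply Rmult_lt_reg_r with (W1 y); auto. unfold Rdiv. rewrite Rmult_assoc, Rinv_l by lra. lra. }
    assert (hl' : 1 < Rpower l (1 - a)).
    { apply Rpower_gt_1; auto. pose proof q_lt_1; pose proof a_lt_q; lra. }
    assert (hlq : 1 < Rpower l (1 - q)).
    { apply Rpower_gt_1; auto. pose proof q_lt_1; lra. }
    destruct (head_comparison (k1 * Rpower l (1 - q)) (e1 * Rpower l (1 - a)) (fun s => l * W1 s) (fun s => l * P1 s) s1 t1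
       k2 e2 W2 P2 s2 t2 y y2) as [h1 h2]; auto; try lra.
    - apply Rmult_lt_0_compat; lra.
    - nra.
    - apply orbit_scale; auto. lra.
    - intros s hs. apply Rmult_lt_0_compat; [lra|now apply u1].
    - eapply interface_scale; eauto; lra.
    - pose proof (E_pos e1 s1 he1). replace (E (e1 * Rpower l (1 - a)) s1) with (Rpower l (1 - a) * E e1 s1) by (unfold E; ring). nra.
    - unfold l. field. lra.
    - replace (E (e1 * Rpower l (1 - a)) y) with (Rpower l (1 - a) * E e1 y) in h2 by (unfold E; ring). auto. }
  assert (lim : forall f x, continuous f y1 -> (forall y, s1 < y < y1 -> x < f y) -> x <= f y1).
  { intros f x hc h. destruct (Rle_lt_dec x (f y1)); auto. exfalso.
    destruct (continuous_eps f y1 hc (x - f y1) ltac:(lra)) as [d [hd hh]].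
    set (y := y1 - Rmin (d / 2) ((y1 - s1) / 2)).
    assert (g1 := Rmin_l (d / 2) ((y1 - s1) / 2)). assert (g2 := Rmin_r (d / 2) ((y1 - s1) / 2)).
    assert (g3 : 0 < Rmin (d / 2) ((y1 - s1) / 2)) by (apply Rmin_pos; lra).
    specialize (hh y ltac:(unfold y; apply Rabs_def1; lra)). specialize (h y ltac:(unfold y; lra)).
    apply Rabs_def2 in hh. lra. }
  destruct (o1 y1 hy1) as [w1 [w2 w3]].
  assert (hl : W2 y2 / W1 y1 = 1) by (rewrite <- ey; field; lra).
  assert (hd : is_derive (fun y => W2 y2 / W1 y) y1 (- W2 y2 * P1 y1 / (W1 y1 * W1 y1))).
  { dsolve. }
  split.
  - replace (P1 y1) with (W2 y2 / W1 y1 * P1 y1) by (rewrite hl; ring).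
    apply (lim (fun y => W2 y2 / W1 y * P1 y)).
    + apply (continuous_mult (fun y => W2 y2 / W1 y) P1); [eapply derive_continuous; eauto|eapply derive_continuous; eauto].
    + intros y hy. now apply key.
  - replace (E e1 y1) with (Rpower (W2 y2 / W1 y1) (1 - a) * E e1 y1).
    2:{ rewrite hl. unfold Rpower at 1. rewrite ln_1, Rmult_0_r, exp_0. ring. }
    apply (lim (fun y => Rpower (W2 y2 / W1 y) (1 - a) * E e1 y)).
    + apply (continuous_mult (fun y => Rpower (W2 y2 / W1 y) (1 - a)) (E e1)).
      * eapply derive_continuous. apply (is_derive_Rpower_comp (1 - a) (fun y => W2 y2 / W1 y)); [|exact hd].
        rewrite hl; lra.
      * eapply derive_continuous, E_derive.
    + intros y hy. now apply key.
Qed.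

Lemma E_inj e s t : 0 < e -> E e s = E e t -> s = t.
Proof.
  intros he h. destruct (Rtotal_order s t) as [l|[->|l]]; auto; apply (E_decr e) in l; auto; lra.
Qed.

(** Comparison in both directions gives equal [E], hence equal times, and equal speeds at a common
    small height; from there on the equation is regular. The singularity at the edge excludes a
    direct Lipschitz argument. *)
Lemma interface_unique k e W1 P1 W2 P2 s0 t1 t2 : 0 < e -> 0 <= k -> s0 < t1 -> s0 < t2 ->
  orbit k e W1 P1 s0 t1 -> interface e W1 P1 s0 -> orbit k e W2 P2 s0 t2 -> interface e W2 P2 s0 ->
  forall s, s0 < s -> s < t1 -> s < t2 -> W1 s = W2 s /\ P1 s = P2 s.
Proof.
  intros he hk ht1 ht2 o1 i1 o2 i2.
  destruct (interface_up _ _ _ _ _ _ he ht1 o1 i1) as [x1 [hx1 u1]].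
  destruct (interface_up _ _ _ _ _ _ he ht2 o2 i2) as [x2 [hx2 u2]].
  assert (p1 : orbit k e W1 P1 s0 x1) by (eapply orbit_sub; eauto; lra).
  assert (p2 : orbit k e W2 P2 s0 x2) by (eapply orbit_sub; eauto; lra).
  set (z1 := (s0 + x1) / 2). set (z2 := (s0 + x2) / 2).
  assert (hz1 : s0 < z1 < x1) by (unfold z1; lra). assert (hz2 : s0 < z2 < x2) by (unfold z2; lra).
  set (w := Rmin (W1 z1) (W2 z2) / 2).
  assert (hw1 := Rmin_l (W1 z1) (W2 z2)). assert (hw2 := Rmin_r (W1 z1) (W2 z2)).
  assert (hw : 0 < Rmin (W1 z1) (W2 z2)).
  { apply Rmin_pos; [apply p1; lra|apply p2; lra]. }
  destruct (interface_reaches k e W1 P1 s0 x1 z1 w) as [y1 [hy1 ey1]]; auto; try (unfold w; lra).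
  destruct (interface_reaches k e W2 P2 s0 x2 z2 w) as [y2 [hy2 ey2]]; auto; try (unfold w; lra).
  destruct (head_comparison_le k e W1 P1 s0 x1 k e W2 P2 s0 x2 y1 y2) as [a1 a2]; auto; try lra.
  destruct (head_comparison_le k e W2 P2 s0 x2 k e W1 P1 s0 x1 y2 y1) as [b1 b2]; auto; try lra.
  assert (y1 = y2) by (apply (E_inj e); auto; lra). subst y2.
  intros s h0 h1 h2.
  assert (hM : exists T, T <= t1 /\ T <= t2 /\ s < T /\ y1 < T).
  { exists (Rmin t1 t2). split; [apply Rmin_l|]. split; [apply Rmin_r|]. split; apply Rmin_glb_lt; lra. }
  destruct hM as [T [hT1 [hT2 [hT3 hT4]]]].
  apply (orbit_unique k e W1 P1 W2 P2 s0 T y1); try lra.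
  - apply (orbit_sub k e W1 P1 s0 t1); auto; lra.
  - apply (orbit_sub k e W2 P2 s0 t2); auto; lra.
Qed.

End Head.

(** * Turning points and trapped orbits *)

Definition rising (g G : R -> R) (x y : R) :=
  forall s, x <= s <= y -> is_derive g s (G s) /\ continuous G s.

(** Supplies the starting pair of a comparison when the second orbit leaves rest at a height that
    the first passes in motion: just above this height the second is still slow, while the speed of
    the first is bounded below. *)
Lemma launch (g1 G1 g2 G2 : R -> R) (y1 b1 a2 b2 : R) : y1 < b1 -> a2 < b2 ->
  rising g1 G1 y1 b1 -> rising g2 G2 a2 b2 ->
  (forall s, y1 <= s < b1 -> 0 < G1 s) -> (forall s, a2 < s < b2 -> 0 < G2 s) ->
  G2 a2 = 0 -> g1 y1 = g2 a2 ->
  exists x1 x2, y1 < x1 < b1 /\ a2 < x2 < b2 /\ g1 x1 = g2 x2 /\ G2 x2 < G1 x1.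
Proof.
  (* [z] stops short of [b1], where the speed of the first orbit may vanish. *)
  intros h1 h2 r1 r2 p1 p2 e0 ey. set (z := (y1 + b1) / 2).
  destruct (continuous_bounded_min G1 y1 z ltac:(unfold z; lra)) as [u [hu hmin]].
  { intros s hs. apply r1. unfold z in hs; lra. }
  assert (hGu : 0 < G1 u) by (apply p1; unfold z in hu; lra).
  assert (hz : g1 y1 < g1 z).
  { apply (strict_incr_of_derive g1 G1); unfold z; [lra|intros s hs; apply r1; lra|intros s hs; apply p1; lra]. }
  destruct (r2 a2 ltac:(lra)) as [d2 c2].
  destruct (continuous_eps G2 a2 c2 (G1 u) hGu) as [da [hda ha]].
  destruct (continuous_eps g2 a2 (derive_continuous _ _ _ d2) (g1 z - g1 y1) ltac:(lra)) as [db [hdb hb]].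
  set (dd := Rmin (da / 2) (Rmin (db / 2) ((b2 - a2) / 2))).
  assert (hdd : 0 < dd /\ dd <= da / 2 /\ dd <= db / 2 /\ dd <= (b2 - a2) / 2).
  { unfold dd. split; [repeat apply Rmin_pos; lra|]. split; [apply Rmin_l|].
    split; (eapply Rle_trans; [apply Rmin_r|]); [apply Rmin_l|apply Rmin_r]. }
  set (x2 := a2 + dd). specialize (ha x2 ltac:(unfold x2; apply Rabs_def1; lra)).
  specialize (hb x2 ltac:(unfold x2; apply Rabs_def1; lra)). apply Rabs_def2 in ha. apply Rabs_def2 in hb.
  assert (hx2 : g2 a2 < g2 x2).
  { destruct (MVT_interval g2 G2 a2 x2) as [t [ht et]]; [unfold x2; lra|intros s hs; apply r2; unfold x2 in hs; lra|].
    assert (g2 a2 <= g2 ((a2 + x2) / 2)).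
    { apply (incr_of_derive g2 G2); [unfold x2; lra|intros s hs; apply r2; unfold x2 in hs; lra|].
      intros s hs. destruct (Req_dec s a2) as [->|]; [lra|]. left. apply p2. unfold x2 in hs; lra. }
    assert (g2 ((a2 + x2) / 2) < g2 x2).
    { apply (strict_incr_of_derive g2 G2); [unfold x2; lra|intros s hs; apply r2; unfold x2 in hs; lra|].
      intros s hs. apply p2. unfold x2 in hs; lra. }
    lra. }
  destruct (IVT_interval g1 y1 z (g2 x2)) as [x1 [hx1 ex1]]; try lra.
  { unfold z; lra. }
  { intros s hs. eapply derive_continuous, r1. unfold z in hs; lra. }
  exists x1, x2. split; [unfold z in hx1; lra|]. split; [unfold x2; lra|]. split; auto.
  specialize (hmin x1 ltac:(lra)). lra.
Qed.

(** The first orbit, being the faster at equal heights, inherits the positive lower bound of the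
    speed of the second, so it cannot come to rest within the range of heights of the second. *)
Lemma stall (g1 G1 g2 G2 : R -> R) (x1 b1 x2 y2 : R) : x1 < b1 -> x2 < y2 ->
  rising g1 G1 x1 b1 -> rising g2 G2 x2 y2 ->
  (forall s, x1 <= s < b1 -> 0 < G1 s) -> (forall s, x2 <= s <= y2 -> 0 < G2 s) ->
  g1 x1 = g2 x2 -> g1 b1 <= g2 y2 -> G1 b1 = 0 ->
  (forall y z, x1 < y < b1 -> x2 < z < y2 -> g1 y = g2 z -> G2 z < G1 y) -> False.
Proof.
  intros h1 h2 r1 r2 p1 p2 ex hb e0 hcmp.
  destruct (continuous_bounded_min G2 x2 y2 ltac:(lra)) as [u [hu hmin]].
  { intros s hs. apply r2. lra. }
  assert (hGu := p2 u hu). destruct (r1 b1 ltac:(lra)) as [_ cb].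
  destruct (continuous_eps G1 b1 cb (G2 u) hGu) as [da [hda ha]].
  set (y := b1 - Rmin (da / 2) ((b1 - x1) / 2)).
  assert (g1' := Rmin_l (da / 2) ((b1 - x1) / 2)). assert (g2' := Rmin_r (da / 2) ((b1 - x1) / 2)).
  assert (g3 : 0 < Rmin (da / 2) ((b1 - x1) / 2)) by (apply Rmin_pos; lra).
  specialize (ha y ltac:(unfold y; apply Rabs_def1; lra)). apply Rabs_def2 in ha.
  assert (i1 : g1 x1 < g1 y).
  { apply (strict_incr_of_derive g1 G1); unfold y; [lra|intros s hs; apply r1; lra|intros s hs; apply p1; lra]. }
  assert (i2 : g1 y < g1 b1).
  { assert (g1 y < g1 ((y + b1) / 2)).
    { apply (strict_incr_of_derive g1 G1); unfold y; [lra|intros s hs; apply r1; lra|intros s hs; apply p1; lra]. }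
    assert (g1 ((y + b1) / 2) <= g1 b1); [|lra].
    apply (incr_of_derive g1 G1); [unfold y; lra|intros s hs; apply r1; unfold y in hs; lra|].
    intros s hs. destruct (Req_dec s b1) as [->|]; [lra|left; apply p1; unfold y in hs; lra]. }
  destruct (IVT_interval g2 x2 y2 (g1 y)) as [z [hz ez]]; try lra.
  { intros s hs. eapply derive_continuous, r2; lra. }
  specialize (hcmp y z ltac:(unfold y; lra) hz ltac:(lra)). specialize (hmin z ltac:(lra)). lra.
Qed.

Lemma rising_opp (g G : R -> R) (x y : R) : rising g G x y -> rising (fun s => - g s) (fun s => - G s) x y.
Proof.
  intros h s hs. destruct (h s hs) as [h1 h2]. split; [apply (is_derive_opp g s _ h1)|].
  now apply continuous_opp_fun.
Qed.

Section Trap.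
Context {c : coeffs}.

Lemma orbit_rising k e W P s0 s1 x y : orbit k e W P s0 s1 -> s0 < x -> y < s1 -> rising W P x y.
Proof.
  intros o hx hy s hs. split; [apply o; lra|]. eapply orbit_contP; eauto; lra.
Qed.

Definition restoring (k w : R) := B * w - k * Rpower w q.

Lemma accel_turn k e s w : accel k e s w 0 = - restoring k w.
Proof. unfold accel, restoring. ring. Qed.

(** The second factor is increasing in [w], so [restoring] changes sign at most once, from negative
    to positive. This separates the heights of minima from those of maxima. *)
Lemma restoring_eq k w : 0 < w -> restoring k w = Rpower w q * (B * Rpower w (1 - q) - k).
Proof.
  intros hw. unfold restoring.
  assert (e : w = Rpower w q * Rpower w (1 - q)).
  { rewrite <- Rpower_plus. replace (q + (1 - q)) with 1 by ring. now rewrite Rpower_1. }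
  rewrite e at 1. ring.
Qed.

Lemma restoring_sign_lt k v w : 0 < v -> 0 < w -> restoring k v <= 0 -> 0 < restoring k w -> v < w.
Proof.
  intros hv hw h1 h2. rewrite restoring_eq in h1, h2 by auto.
  pose proof (Rpower_pos v q). pose proof (Rpower_pos w q). pose proof B_pos.
  destruct (Rlt_le_dec v w); auto. exfalso.
  assert (Rpower w (1 - q) <= Rpower v (1 - q)).
  { apply Rpower_le; auto. pose proof q_lt_1; lra. }
  assert (B * Rpower v (1 - q) - k <= 0).
  { destruct (Rle_lt_dec (B * Rpower v (1 - q) - k) 0); auto. exfalso. nra. }
  assert (0 < B * Rpower w (1 - q) - k).
  { destruct (Rlt_le_dec 0 (B * Rpower w (1 - q) - k)); auto. exfalso. nra. }
  assert (B * Rpower w (1 - q) <= B * Rpower v (1 - q)) by (apply Rmult_le_compat_l; lra). lra.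
Qed.

Lemma restoring_continuous k w : 0 < w -> continuous (restoring k) w.
Proof.
  intros hw. apply derive_continuous with (B - k * (q * Rpower w (q - 1))).
  pose proof (is_derive_Rpower q w hw) as h. unfold restoring.
  apply (is_derive_minus (fun w => B * w) (fun w => k * Rpower w q)).
  - auto_derive; auto; ring.
  - apply (is_derive_scal (fun w => Rpower w q)). exact h.
Qed.

(** At rest the drag vanishes, so a height with zero force is a constant orbit although the equation
    depends on time; uniqueness does the rest. *)
Lemma nondegenerate_turn k e W P s0 s1 t x : orbit k e W P s0 s1 -> s0 < t < s1 -> s0 < x < s1 ->
  P t = 0 -> P x <> 0 -> restoring k (W t) <> 0.
Proof.
  intros o ht hx e0 hne hr. apply hne.
  assert (o' : orbit k e (fun _ => W t) (fun _ => 0) s0 s1).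
  { intros s hs. split; [apply o; auto|]. split; [apply (is_derive_const (W t))|].
    rewrite accel_turn, hr, Ropp_0. apply (is_derive_const 0). }
  apply (orbit_unique k e W P (fun _ => W t) (fun _ => 0) s0 s1 t); auto.
Qed.

Lemma top_restoring k e W P s0 s1 x t : orbit k e W P s0 s1 -> s0 <= x -> x < t < s1 ->
  up W P x t -> P t = 0 -> 0 < restoring k (W t).
Proof.
  intros o hx ht u e0.
  assert (hd := proj2 (proj2 (o t ltac:(lra)))). rewrite e0, accel_turn in hd.
  assert (- restoring k (W t) <= 0).
  { apply (derive_le_of_left P ((x + t) / 2) t); auto; [lra|].
    intros y hy. rewrite e0. left. apply u. lra. }
  assert (restoring k (W t) <> 0); [|lra].
  apply (nondegenerate_turn k e W P s0 s1 t ((x + t) / 2)); auto; try lra.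
  assert (0 < P ((x + t) / 2)) by (apply u; lra). lra.
Qed.

Lemma orbit_phase k e W P s0 s1 S : orbit k e W P s0 s1 -> up W P s0 s1 ->
  (forall s, s0 < s < s1 -> S (W s) = s /\ is_derive S (W s) (/ P s)) ->
  forall s, s0 < s < s1 ->
    is_derive (fun w => P (S w)) (W s) (- restoring k (W s) / P s + E e s * (a * Rpower (W s) (a - 1)) - A) /\
    is_derive (fun w => E e (S w)) (W s) (- om * E e s / P s).
Proof.
  intros o u hS s hs. assert (hP := u s hs). split.
  - replace (- restoring k (W s) / P s + E e s * (a * Rpower (W s) (a - 1)) - A) with (accel k e s (W s) (P s) / P s)
      by (unfold accel, restoring; field; lra).
    refine (proj2 (reparametrize W P P (fun s => accel k e s (W s) (P s)) S s0 s1 hS _ s hs)).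
    intros r hr. now apply o.
  - refine (proj2 (reparametrize W P (E e) (fun s => - om * E e s) S s0 s1 hS _ s hs)).
    intros r hr. apply E_derive.
Qed.

Lemma level_time k e W P s0 s1 x y w : orbit k e W P s0 s1 -> s0 < x -> x <= y -> y < s1 -> W x <= w <= W y ->
  exists s, x <= s <= y /\ W s = w.
Proof.
  intros o hx hxy hy hw. destruct (Req_dec w (W x)) as [->|]; [exists x; lra|].
  destruct (Req_dec w (W y)) as [->|]; [exists y; lra|].
  destruct (Req_dec x y) as [->|]; [lra|].
  destruct (IVT_interval W x y w) as [s [hs es]]; try lra.
  - intros r hr. eapply orbit_contW; eauto; lra.
  - exists s; lra.
Qed.

(** A lower top of the first orbit is excluded by [stall]; the difficulty is a common top [M], where
    both speeds vanish. There each squared speed is asymptotic to [2 restoring k M (M - w)], so the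
    ratio of the speeds would tend to 1, whereas comparison with a rescaled second orbit keeps
    [P1 / P2] above some [rho > 1]. *)
Lemma top_comparison k e W1 P1 a1 b1 t1 x1 W2 P2 a2 b2 t2 x2 :
  0 < e -> orbit k e W1 P1 a1 b1 -> up W1 P1 a1 t1 -> t1 < b1 -> P1 t1 = 0 ->
  orbit k e W2 P2 a2 b2 -> up W2 P2 a2 t2 -> t2 < b2 -> P2 t2 = 0 ->
  a1 < x1 < t1 -> a2 < x2 < t2 -> W1 x1 = W2 x2 -> P2 x2 < P1 x1 -> E e x2 < E e x1 ->
  W2 t2 < W1 t1.
Proof.
  intros he o1 u1 ht1 z1 o2 u2 ht2 z2 hx1 hx2 ex hP hE.
  assert (o1' : orbit k e W1 P1 a1 t1) by (apply (orbit_sub _ _ _ _ a1 b1); auto; lra).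
  assert (o2' : orbit k e W2 P2 a2 t2) by (apply (orbit_sub _ _ _ _ a2 b2); auto; lra).
  assert (r1 : rising W1 P1 x1 t1) by (apply (orbit_rising k e _ _ a1 b1); auto; lra).
  assert (r2 : rising W2 P2 x2 t2) by (apply (orbit_rising k e _ _ a2 b2); auto; lra).
  assert (cmp : forall y z, x1 < y < t1 -> x2 < z < t2 -> W1 y = W2 z -> P2 z < P1 y /\ E e z < E e y).
  { intros y z hy hz eyz.
    destruct (up_comparison k e W1 P1 a1 t1 k e W2 P2 a2 t2 1 x1 y x2 z); auto; try lra. }
  destruct (Rlt_le_dec (W2 t2) (W1 t1)) as [|hle]; auto. exfalso.
  assert (inc1 : forall r s, a1 < r -> r < s -> s < t1 -> W1 r < W1 s).
  { intros r s hr hrs hs. apply (strict_incr_on W1 P1 a1 t1); auto. intros y hy. split; [apply o1; lra|apply u1; auto]. }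
  assert (inc2 : forall r s, a2 < r -> r < s -> s < t2 -> W2 r < W2 s).
  { intros r s hr hrs hs. apply (strict_incr_on W2 P2 a2 t2); auto. intros y hy. split; [apply o2; lra|apply u2; auto]. }
  assert (lim1 : forall s, a1 < s < t1 -> W1 s < W1 t1).
  { intros s hs. assert (W1 s < W1 ((s + t1) / 2)) by (apply inc1; lra).
    assert (W1 ((s + t1) / 2) <= W1 t1); [|lra]. apply (incr_of_derive W1 P1); [lra|intros r hr; apply o1; lra|].
    intros r hr. destruct (Req_dec r t1) as [->|]; [lra|left; apply u1; lra]. }
  assert (lim2 : forall s, a2 < s < t2 -> W2 s < W2 t2).
  { intros s hs. assert (W2 s < W2 ((s + t2) / 2)) by (apply inc2; lra).
    assert (W2 ((s + t2) / 2) <= W2 t2); [|lra]. apply (incr_of_derive W2 P2); [lra|intros r hr; apply o2; lra|].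
    intros r hr. destruct (Req_dec r t2) as [->|]; [lra|left; apply u2; lra]. }
  destruct (Req_dec (W1 t1) (W2 t2)) as [eM|nM].
  2:{ assert (hl1 := lim1 x1 ltac:(lra)).
    destruct (level_time k e W2 P2 a2 b2 x2 t2 (W1 t1)) as [y2 [hy2 ey2]]; auto; try lra.
    assert (y2 <> t2) by (intros ->; lra). assert (y2 <> x2) by (intros ->; lra).
    apply (stall W1 P1 W2 P2 x1 t1 x2 y2); auto; try lra.
    - intros s hs; apply r2; lra.
    - intros s hs; apply u1; lra.
    - intros s hs; apply u2; lra.
    - intros y z hy hz eyz. apply cmp; auto; lra. }
  set (M := W1 t1) in *.
  assert (hN : 0 < restoring k M) by (apply (top_restoring k e W1 P1 a1 b1 a1); auto; lra).
  assert (hM : 0 < M) by (apply o1; lra).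
  (* Close to the common level both speeds are small and the restoring force is positive. *)
  pose proof (Rpower_pos (M / 2) (a - 1)) as hPhi0. set (Phi0 := a * Rpower (M / 2) (a - 1)).
  assert (hPhi : 0 < Phi0) by (apply Rmult_lt_0_compat; [apply a_pos|auto]).
  destruct (continuous_eps (restoring k) M (restoring_continuous k M hM) (restoring k M / 2) ltac:(lra)) as [dN [hdN hNc]].
  set (wN := Rmax (M - dN / 2) (M / 2)).
  assert (hwN : wN < M) by (unfold wN; apply Rmax_lub_lt; lra).
  assert (hN' : forall w, wN <= w < M -> restoring k M / 2 < restoring k w /\ M / 2 <= w).
  { intros w hw. assert (h1 := Rmax_l (M - dN / 2) (M / 2)). assert (h2 := Rmax_r (M - dN / 2) (M / 2)). fold wN in h1, h2.
    specialize (hNc w ltac:(apply Rabs_def1; lra)). apply Rabs_def2 in hNc. lra. }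
  set (w0 := (Rmax (W1 x1) wN + M) / 2).
  assert (hw0 : W1 x1 < w0 /\ wN < w0 /\ w0 < M).
  { assert (h1 := Rmax_l (W1 x1) wN). assert (h2 := Rmax_r (W1 x1) wN).
    assert (Rmax (W1 x1) wN < M) by (apply Rmax_lub_lt; auto; apply lim1; lra). unfold w0. lra. }
  assert (lev1 : forall w, w0 <= w < M -> exists s, x1 < s < t1 /\ W1 s = w).
  { intros w hw. destruct (level_time k e W1 P1 a1 b1 x1 t1 w) as [s [hs es]]; auto; try (fold M; lra).
    exists s. split; auto. assert (s <> t1) by (intros ->; unfold M in *; lra). assert (s <> x1) by (intros ->; lra). lra. }
  assert (lev2 : forall w, w0 <= w < M -> exists s, x2 < s < t2 /\ W2 s = w).
  { intros w hw. destruct (level_time k e W2 P2 a2 b2 x2 t2 w) as [s [hs es]]; auto; try lra.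
    exists s. split; auto. assert (s <> t2) by (intros ->; lra). assert (s <> x2) by (intros ->; lra). lra. }
  destruct (inverse_function W1 P1 a1 t1) as [S1 hS1]. { intros s hs; split; [apply o1'|apply u1]; auto. }
  destruct (inverse_function W2 P2 a2 t2) as [S2 hS2]. { intros s hs; split; [apply o2'|apply u2]; auto. }
  assert (ph1 := orbit_phase k e W1 P1 a1 t1 S1 o1' u1 hS1).
  assert (ph2 := orbit_phase k e W2 P2 a2 t2 S2 o2' u2 hS2).
  destruct (lev1 w0 ltac:(lra)) as [y1 [hy1 ey1]]. destruct (lev2 w0 ltac:(lra)) as [y2 [hy2 ey2]].
  destruct (cmp y1 y2 hy1 hy2 ltac:(lra)) as [hPy hEy].
  assert (hP2y : 0 < P2 y2) by (apply u2; lra). assert (hE2y := E_pos e y2 he).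
  (* A factor above 1 that exceeds neither the ratio of the speeds nor the ratio of the values of
     [E] at the height [w0]. *)
  set (rho := Rmin ((1 + P1 y1 / P2 y2) / 2) (E e y1 / E e y2)).
  assert (q1 : 1 < P1 y1 / P2 y2).
  { apply Rmult_lt_reg_r with (P2 y2); auto. unfold Rdiv. rewrite Rmult_assoc, Rinv_l by lra. lra. }
  assert (q2 : 1 < E e y1 / E e y2).
  { apply Rmult_lt_reg_r with (E e y2); auto. unfold Rdiv. rewrite Rmult_assoc, Rinv_l by lra. lra. }
  assert (hrho : 1 < rho) by (apply Rmin_glb_lt; lra).
  assert (hrho1 : rho * P2 y2 < P1 y1).
  { assert (rho <= (1 + P1 y1 / P2 y2) / 2) by apply Rmin_l.
    apply Rmult_lt_reg_r with (/ P2 y2); [now apply Rinv_0_lt_compat|]. rewrite Rmult_assoc, Rinv_r by lra. unfold Rdiv in *. lra. }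
  assert (hrho2 : rho * E e y2 <= E e y1).
  { assert (rho <= E e y1 / E e y2) by apply Rmin_r.
    apply Rmult_le_reg_r with (/ E e y2); [now apply Rinv_0_lt_compat|]. rewrite Rmult_assoc, Rinv_r by lra. unfold Rdiv in *. lra. }
  assert (ratio : forall w y z, w0 < w < M -> x1 < y < t1 -> x2 < z < t2 -> W1 y = w -> W2 z = w -> rho * P2 z < P1 y).
  { intros w y z hw hy hz ey ez.
    assert (e1 : forall s, x1 < s < t1 -> S1 (W1 s) = s) by (intros s hs; apply hS1; lra).
    assert (e2 : forall s, x2 < s < t2 -> S2 (W2 s) = s) by (intros s hs; apply hS2; lra).
    (* The second orbit with speed and [E] multiplied by [rho] solves a system of the same kind,
       with decay rate [rho om]; the surplus terms have a favourable sign because [restoring] is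
       positive near [M]. *)
    destruct (phase_comparison (fun w => P1 (S1 w)) (fun w => rho * P2 (S2 w)) (fun w => E e (S1 w)) (fun w => rho * E e (S2 w))
      (fun w => - restoring k w) (fun w => - (rho * rho) * restoring k w - (rho - 1) * A * (rho * P2 (S2 w)))
      (fun w => a * Rpower w (a - 1)) A om (om * rho) w0 w 1) as [res _]; try lra.
    - apply om_pos.
    - pose proof om_pos. nra.
    - intros v hv. destruct (lev1 v ltac:(lra)) as [s [hs es]]. subst v. rewrite (e1 s hs).
      destruct (ph1 s ltac:(lra)) as [d1 d2]. split; [apply u1; lra|]. split; [now apply E_pos|].
      split; [|split; auto]. apply Rmult_lt_0_compat; [apply a_pos|apply Rpower_pos].
    - intros v hv. destruct (lev2 v ltac:(lra)) as [s [hs es]]. subst v. rewrite (e2 s hs).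
      destruct (ph2 s ltac:(lra)) as [d1 d2]. assert (0 < P2 s) by (apply u2; lra). assert (hEs := E_pos e s he).
      split; [nra|]. split; [nra|]. split.
      + apply (is_derive_scal (fun w => P2 (S2 w)) _ rho) in d1. apply (is_derive_eq _ _ _ _ d1). field. lra.
      + apply (is_derive_scal (fun w => E e (S2 w)) _ rho) in d2. apply (is_derive_eq _ _ _ _ d2). field. lra.
    - intros v hv. destruct (hN' v ltac:(lra)) as [g1 _]. destruct (lev2 v ltac:(lra)) as [s [hs es]]. subst v.
      rewrite (e2 s hs). assert (0 < P2 s) by (apply u2; lra). pose proof A_pos.
      assert (0 <= (rho - 1) * A * (rho * P2 s)) by (repeat apply Rmult_le_pos; lra).
      assert (1 <= rho * rho) by nra. nra.
    - cbv beta. rewrite <- ey1 at 2. rewrite <- ey2, (e1 y1 hy1), (e2 y2 hy2). exact hrho1.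
    - cbv beta. rewrite <- ey1 at 2. rewrite <- ey2 at 1. rewrite (e1 y1 hy1), (e2 y2 hy2). lra.
    - cbv beta in res. rewrite <- ey in res at 2. rewrite <- ez in res at 1. rewrite (e1 y hy), (e2 z hz) in res. exact res. }
  set (K := E e x1 * Phi0 + A).
  assert (hK : 0 < K) by (pose proof (E_pos e x1 he); pose proof A_pos; unfold K; nra).
  (* With speeds below [eta] the two drag terms in the derivative of [D] add up to at most half of
     [(rho^2 - 1) restoring k M], a quantity that the force term exceeds. *)
  set (eta := (rho * rho - 1) * restoring k M / 4 / (2 * rho * rho * K)).
  assert (hrr : 0 < rho * rho - 1) by nra.
  assert (heta : 0 < eta).
  { unfold eta. apply Rdiv_lt_0_compat; [apply Rdiv_lt_0_compat; [nra|lra]|]. nra. }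
  destruct (r1 t1 ltac:(lra)) as [_ c1]. destruct (r2 t2 ltac:(lra)) as [_ c2].
  destruct (continuous_eps P1 t1 c1 eta heta) as [da [hda ha]].
  destruct (continuous_eps P2 t2 c2 eta heta) as [db [hdb hb]].
  set (u1' := t1 - Rmin (da / 2) ((t1 - x1) / 2)). set (u2' := t2 - Rmin (db / 2) ((t2 - x2) / 2)).
  assert (hu1 : x1 < u1' < t1 /\ t1 - da < u1').
  { assert (g1 := Rmin_l (da / 2) ((t1 - x1) / 2)). assert (g2 := Rmin_r (da / 2) ((t1 - x1) / 2)).
    assert (g3 : 0 < Rmin (da / 2) ((t1 - x1) / 2)) by (apply Rmin_pos; lra). unfold u1'; lra. }
  assert (hu2 : x2 < u2' < t2 /\ t2 - db < u2').
  { assert (g1 := Rmin_l (db / 2) ((t2 - x2) / 2)). assert (g2 := Rmin_r (db / 2) ((t2 - x2) / 2)).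
    assert (g3 : 0 < Rmin (db / 2) ((t2 - x2) / 2)) by (apply Rmin_pos; lra). unfold u2'; lra. }
  set (w1 := (Rmax (Rmax (W1 u1') (W2 u2')) w0 + M) / 2).
  assert (hw1 : W1 u1' < w1 /\ W2 u2' < w1 /\ w0 < w1 /\ w1 < M).
  { assert (g1 := Rmax_l (W1 u1') (W2 u2')). assert (g2 := Rmax_r (W1 u1') (W2 u2')).
    assert (g3 := Rmax_l (Rmax (W1 u1') (W2 u2')) w0). assert (g4 := Rmax_r (Rmax (W1 u1') (W2 u2')) w0).
    assert (Rmax (Rmax (W1 u1') (W2 u2')) w0 < M).
    { apply Rmax_lub_lt; [apply Rmax_lub_lt|lra]; [apply lim1; lra|]. rewrite eM. apply lim2; lra. }
    unfold w1; lra. }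
  (* [D] is nonnegative and increasing near [M], yet bounded by [P1^2], which tends to 0 there. *)
  set (D := fun w => P1 (S1 w) * P1 (S1 w) - rho * rho * (P2 (S2 w) * P2 (S2 w))).
  assert (late : forall w, w1 <= w < M -> exists y z, u1' < y < t1 /\ u2' < z < t2 /\ W1 y = w /\ W2 z = w /\ S1 w = y /\ S2 w = z).
  { intros w hw. destruct (lev1 w ltac:(lra)) as [y [hy ey]]. destruct (lev2 w ltac:(lra)) as [z [hz ez]].
    exists y, z. split. { destruct (Rlt_le_dec u1' y); [lra|]. exfalso. destruct (Req_dec y u1') as [->|]; [lra|].
      assert (W1 y < W1 u1') by (apply inc1; lra). lra. }
    split. { destruct (Rlt_le_dec u2' z); [lra|]. exfalso. destruct (Req_dec z u2') as [->|]; [lra|].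
      assert (W2 z < W2 u2') by (apply inc2; lra). lra. }
    split; auto. split; auto. rewrite <- ey at 1. rewrite <- ez at 1. split; [apply hS1|apply hS2]; lra. }
  assert (Dpos : forall w, w1 <= w < M -> 0 <= D w).
  { intros w hw. destruct (late w hw) as [y [z [hy [hz [ey [ez [e1 e2]]]]]]].
    unfold D. rewrite e1, e2. assert (rho * P2 z < P1 y) by (apply (ratio w); auto; lra).
    assert (0 < P2 z) by (apply u2; lra). assert (0 < rho * P2 z) by nra. nra. }
  assert (Dinc : forall v w, w1 <= v -> v < w -> w < M -> D v < D w).
  { intros v w hv hvw hw.
    set (dD := fun r => 2 * P1 (S1 r) * (- restoring k r / P1 (S1 r) + E e (S1 r) * (a * Rpower r (a - 1)) - A)
        - rho * rho * (2 * P2 (S2 r) * (- restoring k r / P2 (S2 r) + E e (S2 r) * (a * Rpower r (a - 1)) - A))).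
    apply (strict_incr_of_derive D dD); auto.
    - intros r hr. destruct (late r ltac:(lra)) as [y [z [hy [hz [ey [ez [e1 e2]]]]]]].
      destruct (ph1 y ltac:(lra)) as [d1 _]. destruct (ph2 z ltac:(lra)) as [d2 _].
      rewrite ey in d1. rewrite ez in d2. unfold dD. rewrite e1, e2. unfold D.
      set (p1 := fun w => P1 (S1 w)) in *. set (p2 := fun w => P2 (S2 w)) in *.
      replace (P1 y) with (p1 r) in * by (unfold p1; now rewrite e1).
      replace (P2 z) with (p2 r) in * by (unfold p2; now rewrite e2).
      apply is_derive_square in d1. apply is_derive_square, (is_derive_scal _ _ (rho * rho)) in d2.
      exact (is_derive_minus _ _ _ _ _ d1 d2).
    - intros r hr. destruct (late r ltac:(lra)) as [y [z [hy [hz [ey [ez [e1 e2]]]]]]].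
      destruct (hN' r ltac:(lra)) as [n1 n2]. unfold dD. rewrite e1, e2.
      assert (p1 : 0 < P1 y) by (apply u1; lra). assert (p2 : 0 < P2 z) by (apply u2; lra).
      specialize (ha y ltac:(apply Rabs_def1; lra)). apply Rabs_def2 in ha.
      specialize (hb z ltac:(apply Rabs_def1; lra)). apply Rabs_def2 in hb.
      assert (hEy1 : E e y < E e x1) by (apply E_decr; auto; lra).
      assert (hEz1 : E e z < E e x1).
      { apply Rlt_trans with (E e x2); auto. apply E_decr; auto; lra. }
      assert (hPr : 0 < a * Rpower r (a - 1) <= Phi0).
      { unfold Phi0. pose proof a_pos. pose proof (Rpower_pos r (a - 1)). split; [nra|].
        apply Rmult_le_compat_l; [lra|]. apply Rpower_le_neg; [pose proof a_lt_q; pose proof q_lt_1; lra|lra|lra]. }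
      set (Ph := a * Rpower r (a - 1)) in *. pose proof A_pos.
      assert (k1 : - K <= E e y * Ph - A).
      { unfold K. pose proof (E_pos e y he). pose proof (E_pos e x1 he). nra. }
      assert (k2 : E e z * Ph - A <= K).
      { unfold K. pose proof (E_pos e z he). pose proof (E_pos e x1 he). nra. }
      replace (2 * P1 y * (- restoring k r / P1 y + E e y * Ph - A) - rho * rho * (2 * P2 z * (- restoring k r / P2 z + E e z * Ph - A)))
        with (2 * (rho * rho - 1) * restoring k r + 2 * P1 y * (E e y * Ph - A) - 2 * (rho * rho) * P2 z * (E e z * Ph - A)) by (field; lra).
      assert (b1' : - (2 * eta * K) <= 2 * P1 y * (E e y * Ph - A)).
      { assert (P1 y * - K <= P1 y * (E e y * Ph - A)) by (apply Rmult_le_compat_l; lra).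
        assert (P1 y * K <= eta * K) by (apply Rmult_le_compat_r; lra). lra. }
      assert (b2' : 2 * (rho * rho) * P2 z * (E e z * Ph - A) <= 2 * (rho * rho) * eta * K).
      { assert (P2 z * (E e z * Ph - A) <= P2 z * K) by (apply Rmult_le_compat_l; lra).
        assert (P2 z * K <= eta * K) by (apply Rmult_le_compat_r; lra).
        assert (0 <= 2 * (rho * rho)) by lra.
        assert (2 * (rho * rho) * (P2 z * (E e z * Ph - A)) <= 2 * (rho * rho) * (eta * K)) by (apply Rmult_le_compat_l; lra). lra. }
      assert (b3 : 2 * (rho * rho) * eta * K = (rho * rho - 1) * restoring k M / 4) by (unfold eta; field; lra).
      assert (b4 : 2 * eta * K <= 2 * (rho * rho) * eta * K).
      { assert (hek : 0 < eta * K) by now apply Rmult_lt_0_compat. clear - hek hrr. nra. }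
      assert (b5 : (rho * rho - 1) * restoring k M < 2 * (rho * rho - 1) * restoring k r) by (clear - hrr n1; nra).
      assert (0 < (rho * rho - 1) * restoring k M) by (now apply Rmult_lt_0_compat). lra. }
  set (wm := (w1 + M) / 2).
  assert (hwm : w1 < wm < M) by (unfold wm; lra).
  assert (hd0 : 0 < D wm). { apply Rle_lt_trans with (D w1); [apply Dpos; lra|apply Dinc; lra]. }
  (* The bound 1 is there because [P1 < eps <= 1] yields [P1^2 < eps <= D wm]. *)
  set (eps := Rmin 1 (D wm)). assert (heps : 0 < eps) by (apply Rmin_pos; lra).
  destruct (continuous_eps P1 t1 c1 eps heps) as [dc [hdc hc]].
  set (v := t1 - Rmin (dc / 2) ((t1 - x1) / 2)).
  assert (hv : x1 < v < t1 /\ t1 - dc < v).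
  { assert (g1 := Rmin_l (dc / 2) ((t1 - x1) / 2)). assert (g2 := Rmin_r (dc / 2) ((t1 - x1) / 2)).
    assert (g3 : 0 < Rmin (dc / 2) ((t1 - x1) / 2)) by (apply Rmin_pos; lra). unfold v; lra. }
  set (w2 := (Rmax wm (W1 v) + M) / 2).
  assert (hw2 : wm < w2 /\ W1 v < w2 /\ w2 < M).
  { assert (g1 := Rmax_l wm (W1 v)). assert (g2 := Rmax_r wm (W1 v)).
    assert (Rmax wm (W1 v) < M) by (apply Rmax_lub_lt; [lra|apply lim1; lra]). unfold w2; lra. }
  assert (hD := Dinc wm w2 ltac:(lra) ltac:(lra) ltac:(lra)).
  destruct (late w2 ltac:(lra)) as [y [z [hy [hz [ey [ez [e1 e2]]]]]]].
  assert (v < y). { destruct (Rlt_le_dec v y); auto. exfalso. destruct (Req_dec y v) as [->|]; [lra|].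
    assert (W1 y < W1 v) by (apply inc1; lra). lra. }
  specialize (hc y ltac:(apply Rabs_def1; lra)). apply Rabs_def2 in hc. rewrite z1 in hc.
  assert (p1 : 0 < P1 y) by (apply u1; lra).
  assert (hDP : D w2 <= P1 y * P1 y).
  { unfold D. rewrite e1, e2. assert (0 <= rho * rho * (P2 z * P2 z)) by (apply Rmult_le_pos; apply Rle_0_sqr). lra. }
  assert (he1 : eps <= 1) by apply Rmin_l. assert (he2 : eps <= D wm) by apply Rmin_r.
  assert (hy1' : P1 y < eps) by lra. clear - he1 he2 hDP hD p1 hy1'. nra.
Qed.

End Trap.

(** * Inward spirals and the potential well *)

Section Trap2.
Context {c : coeffs}.

Lemma first_top k e W P s0 s1 t : 0 < e -> orbit k e W P s0 s1 -> interface e W P s0 -> s0 < t < s1 -> P t <= 0 ->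
  exists b, s0 < b <= t /\ P b = 0 /\ up W P s0 b /\ 0 < restoring k (W b).
Proof.
  intros he o hi ht hP.
  destruct (interface_up k e W P s0 s1 he ltac:(lra) o hi) as [x [hx u]].
  assert (hxt : x <= t). { destruct (Rle_lt_dec x t); auto. specialize (u t ltac:(lra)). lra. }
  set (y := (s0 + x) / 2).
  destruct (first_zero P y t) as [b [hb [eb pb]]]; auto.
  - unfold y; lra.
  - intros s hs. eapply orbit_contP; eauto. unfold y in hs; lra.
  - apply u. unfold y; lra.
  - assert (ub : up W P s0 b).
    { intros s hs. destruct (Rlt_le_dec s y) as [l|l]; [apply u; unfold y in *; lra|apply pb; lra]. }
    exists b. split; [unfold y in *; lra|]. split; auto. split; auto.
    apply (top_restoring k e W P s0 s1 s0); auto; unfold y in *; lra.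
Qed.

Lemma descent_to_bottom k e W P s0 s1 b t : orbit k e W P s0 s1 -> s0 < b -> b < t -> t < s1 -> 
  P b = 0 -> 0 < restoring k (W b) -> 0 <= P t ->
  exists d, b < d <= t /\ P d = 0 /\ down W P b d /\ restoring k (W d) < 0.
Proof.
  intros o hb hbt ht eb hr hP.
  assert (hd := proj2 (proj2 (o b ltac:(lra)))). rewrite eb, accel_turn in hd.
  destruct (derive_neg_right P b _ hd ltac:(lra)) as [dl [hdl [hlt _]]]. rewrite eb in hlt.
  set (y := b + Rmin (dl / 2) ((t - b) / 2)).
  assert (g1 := Rmin_l (dl / 2) ((t - b) / 2)). assert (g2 := Rmin_r (dl / 2) ((t - b) / 2)).
  assert (g3 : 0 < Rmin (dl / 2) ((t - b) / 2)) by (apply Rmin_pos; lra).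
  destruct (first_zero (fun s => - P s) y t) as [d [hd' [ed pd]]].
  - unfold y; lra.
  - intros s hs. apply continuous_opp_fun. eapply orbit_contP; eauto. unfold y in hs; lra.
  - assert (P y < 0) by (apply hlt; unfold y; lra). lra.
  - lra.
  - assert (dn : down W P b d).
    { intros s hs. destruct (Rlt_le_dec s y) as [l|l]; [apply hlt; unfold y in *; lra|].
      specialize (pd s ltac:(lra)). lra. }
    assert (e0 : P d = 0) by lra. exists d. split; [unfold y in *; lra|]. split; auto. split; auto.
    assert (hd2 := proj2 (proj2 (o d ltac:(unfold y in *; lra)))). rewrite e0, accel_turn in hd2.
    assert (- (- restoring k (W d)) <= 0).
    { apply (derive_le_of_left (fun s => - P s) y d); [lra| |].
      - exact (is_derive_opp P d _ hd2).
      - intros s hs. specialize (pd s ltac:(lra)). lra. }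
    assert (restoring k (W d) <> 0); [|lra].
    apply (nondegenerate_turn k e W P s0 s1 d ((b + d) / 2)); auto; try (unfold y in *; lra).
    assert (P ((b + d) / 2) < 0) by (apply dn; unfold y in *; lra). lra.
Qed.

(* The orbit spirals inwards in the [(W,P)] plane after its first minimum: the previous turn of the
   orbit, run through with larger [E], is a barrier. *)
Lemma turning_trap k e W P s0 s1 b d : 0 < e -> orbit k e W P s0 s1 -> interface e W P s0 ->
  s0 < b -> b < d -> d < s1 -> up W P s0 b -> P b = 0 -> 0 < restoring k (W b) ->
  down W P b d -> P d = 0 -> restoring k (W d) < 0 ->
  forall s, d <= s < s1 -> W d <= W s.
Proof.
  intros he o hi hb hbd hd u eb rb dn ed rd s3 hs3.
  destruct (Rle_lt_dec (W d) (W s3)) as [|hlt]; auto. exfalso.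
  assert (ddP := proj2 (proj2 (o d ltac:(lra)))). rewrite ed, accel_turn in ddP.
  destruct (derive_pos_right P d _ ddP ltac:(lra)) as [dl [hdl [hgt _]]]. rewrite ed in hgt.
  assert (hs3d : d < s3). { destruct (Req_dec d s3) as [e0|]; [rewrite <- e0 in hlt|]; lra. }
  set (d' := d + Rmin (dl / 2) ((s3 - d) / 2)).
  assert (hd' : d < d' /\ d' < s3 /\ d' < d + dl).
  { assert (g1 := Rmin_l (dl / 2) ((s3 - d) / 2)). assert (g2 := Rmin_r (dl / 2) ((s3 - d) / 2)).
    assert (g3 : 0 < Rmin (dl / 2) ((s3 - d) / 2)) by (apply Rmin_pos; lra). unfold d'; lra. }
  assert (hPd' : 0 < P d') by (apply hgt; lra).
  assert (hWd' : W d < W d').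
  { assert (W d <= W ((d + d') / 2)).
    { apply (incr_of_derive W P); [lra|intros r hr; apply o; lra|].
      intros r hr. destruct (Req_dec r d) as [->|]; [lra|left; apply hgt; lra]. }
    assert (W ((d + d') / 2) < W d').
    { apply (strict_incr_of_derive W P); [lra|intros r hr; apply o; lra|]. intros r hr; apply hgt; lra. }
    lra. }
  (* [s4] is the last crossing of the height [W d] before [s3], necessarily downwards. *)
  destruct (last_zero (fun s => W d - W s) d' s3) as [s4 [hs4 [es4 ps4]]]; try lra.
  { intros r hr. apply (continuous_minus (fun _ => W d) W); [apply continuous_const|eapply orbit_contW; eauto; lra]. }
  assert (hP4 : P s4 < 0).
  { assert (dW4 := proj1 (proj2 (o s4 ltac:(lra)))).
    assert (h0 : 0 <= - P s4).
    { apply (derive_ge_of_right (fun s => W d - W s) s3 s4); [lra| |].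
      - assert (h := is_derive_minus (fun _ => W d) W s4 0 _ (is_derive_const (W d) s4) dW4).
        apply (is_derive_eq _ _ _ _ h). unfold minus, plus, opp; simpl. ring.
      - intros y hy. specialize (ps4 y ltac:(lra)). lra. }
    destruct (Req_dec (P s4) 0) as [e0|]; [|lra]. exfalso.
    assert (dP4 := proj2 (proj2 (o s4 ltac:(lra)))). rewrite e0, accel_turn in dP4.
    replace (W s4) with (W d) in dP4 by lra.
    destruct (derive_pos_right P s4 _ dP4 ltac:(lra)) as [dm [hdm [hgt4 _]]]. rewrite e0 in hgt4.
    set (y := s4 + Rmin (dm / 2) ((s3 - s4) / 2)).
    assert (hy : s4 < y /\ y < s3 /\ y < s4 + dm).
    { assert (g1 := Rmin_l (dm / 2) ((s3 - s4) / 2)). assert (g2 := Rmin_r (dm / 2) ((s3 - s4) / 2)).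
      assert (g3 : 0 < Rmin (dm / 2) ((s3 - s4) / 2)) by (apply Rmin_pos; lra). unfold y; lra. }
    assert (W s4 <= W y).
    { apply (incr_of_derive W P); [lra|intros r hr; apply o; lra|].
      intros r hr. destruct (Req_dec r s4) as [->|]; [lra|left; apply hgt4; lra]. }
    specialize (ps4 y ltac:(lra)). lra. }
  assert (s4 <> d') by (intros ->; lra).
  (* [b2] is the top from which this descent starts; [a2], further down, is the rest point from
     which the ascent to [b2] started. *)
  destruct (last_zero (fun s => - P s) d' s4) as [b2 [hb2 [eb2 pb2]]]; try lra.
  { intros r hr. apply continuous_opp_fun. eapply orbit_contP; eauto; lra. }
  assert (e0 : P b2 = 0) by lra. assert (b2 <> d') by (intros ->; lra).
  assert (dn2 : forall s, b2 < s <= s4 -> P s < 0) by (intros s hs; specialize (pb2 s hs); lra).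
  assert (dPb2 := proj2 (proj2 (o b2 ltac:(lra)))). rewrite e0, accel_turn in dPb2.
  assert (rb2 : 0 < restoring k (W b2)).
  { assert (0 <= restoring k (W b2)).
    { assert (h := derive_ge_of_right (fun s => - P s) s4 b2 _ ltac:(lra) (is_derive_opp P b2 _ dPb2)).
      unfold opp in h; simpl in h. rewrite Ropp_involutive in h. apply h. intros y hy. specialize (pb2 y hy). lra. }
    assert (restoring k (W b2) <> 0); [|lra].
    apply (nondegenerate_turn k e W P s0 s1 b2 s4); auto; lra. }
  destruct (derive_neg_right P b2 _ dPb2 ltac:(lra)) as [dm [hdm [_ hgt2]]]. rewrite e0 in hgt2.
  set (y := b2 - Rmin (dm / 2) ((b2 - d') / 2)).
  assert (hy : d' < y /\ y < b2 /\ b2 - dm < y).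
  { assert (g1 := Rmin_l (dm / 2) ((b2 - d') / 2)). assert (g2 := Rmin_r (dm / 2) ((b2 - d') / 2)).
    assert (g3 : 0 < Rmin (dm / 2) ((b2 - d') / 2)) by (apply Rmin_pos; lra). unfold y; lra. }
  destruct (last_zero P d y) as [a2 [ha2 [ea2 pa2]]]; try lra.
  { intros r hr. eapply orbit_contP; eauto; lra. }
  { apply hgt2; lra. }
  assert (u2 : up W P a2 b2).
  { intros s hs. destruct (Rle_lt_dec s y); [apply pa2; lra|apply hgt2; lra]. }
  assert (ra2 : restoring k (W a2) <= 0).
  { assert (dPa2 := proj2 (proj2 (o a2 ltac:(lra)))). rewrite ea2, accel_turn in dPa2.
    assert (0 <= - restoring k (W a2)); [|lra].
    apply (derive_ge_of_right P y a2); auto; [lra|]. intros r hr. rewrite ea2. left. apply pa2; lra. }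
  (* The force is nonpositive at the height of [a2] and positive at that of [b]; the first ascent
     therefore passes the height of [a2], and does so in motion. *)
  assert (hWa2 : W a2 < W b) by (apply (restoring_sign_lt k); auto; apply o; lra).
  destruct (interface_reaches k e W P s0 s1 b (W a2)) as [y1 [hy1 ey1]]; auto; [lra|apply o; lra|].
  destruct (launch W P W P y1 b a2 b2) as [x1 [x2 [hx1 [hx2 [ex hPx]]]]]; auto; try lra.
  { apply (orbit_rising k e _ _ s0 s1); auto; lra. }
  { apply (orbit_rising k e _ _ s0 s1); auto; lra. }
  { intros s hs. apply u; lra. }
  assert (htop : W b2 < W b).
  { apply (top_comparison k e W P s0 s1 b x1 W P a2 s1 b2 x2); auto; try lra.
    - apply (orbit_sub k e W P s0 s1); auto; lra.
    - apply E_decr; auto; lra. }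
  assert (hWb2 : W d < W b2).
  { replace (W d) with (W s4) by lra. assert (W s4 < W ((b2 + s4) / 2)).
    { apply (strict_decr_of_derive W P); [lra|intros r hr; apply o; lra|intros r hr; apply dn2; lra]. }
    assert (W ((b2 + s4) / 2) <= W b2); [|lra].
    apply (decr_of_derive W P); [lra|intros r hr; apply o; lra|].
    intros r hr. destruct (Req_dec r b2) as [->|]; [lra|left; apply dn2; lra]. }
  (* Since [b2] is lower than [b], the first descent passes the height of [b2] in motion and with
     the larger [E]. Being the faster from there on, it could not come to rest at [W d], which the
     second descent passes in motion. *)
  destruct (IVT_interval_decr W b d (W b2)) as [z1 [hz1 ez1]]; auto.
  { intros r hr. eapply orbit_contW; eauto; lra. }
  assert (ro : forall x y, s0 < x -> y < s1 -> rising (fun s => - W s) (fun s => - P s) x y).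
  { intros x x' hx hx'. apply rising_opp. apply (orbit_rising k e _ _ s0 s1); auto. }
  destruct (launch (fun s => - W s) (fun s => - P s) (fun s => - W s) (fun s => - P s) z1 d b2 s4)
    as [v1 [v2 [hv1 [hv2 [ev hPv]]]]]; auto; try lra.
  { apply ro; lra. } { apply ro; lra. }
  { intros s hs. specialize (dn s ltac:(lra)). lra. }
  { intros s hs. specialize (dn2 s ltac:(lra)). lra. }
  apply (stall (fun s => - W s) (fun s => - P s) (fun s => - W s) (fun s => - P s) v1 d v2 s4); auto; try lra.
  { apply ro; lra. } { apply ro; lra. }
  { intros s hs. specialize (dn s ltac:(lra)). lra. }
  { intros s hs. specialize (dn2 s ltac:(lra)). lra. }
  intros w z hw hz ewz.
  destruct (down_comparison k e W P b d e W P b2 s4 1 v1 w v2 z) as [r1 r2]; auto; try lra.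
  - apply (orbit_sub k e W P s0 s1); auto; lra.
  - apply (orbit_sub k e W P s0 s1); auto; lra.
  - intros s hs. apply dn2; lra.
  - assert (E e v2 < E e v1) by (apply E_decr; auto; lra). lra.
Qed.

Lemma turning_bounded_below k e W P s0 s1 x y : 0 < e -> orbit k e W P s0 s1 -> interface e W P s0 ->
  s0 < x -> x < y -> y < s1 -> P x < 0 -> 0 < P y ->
  exists m, 0 < m /\ forall s, y <= s < s1 -> m <= W s.
Proof.
  intros he o hi hx hxy hy hPx hPy.
  destruct (first_top k e W P s0 s1 x he o hi ltac:(lra) ltac:(lra)) as [b [hb [eb [u rb]]]].
  destruct (descent_to_bottom k e W P s0 s1 b y o ltac:(lra) ltac:(lra) hy eb rb ltac:(lra)) as [d [hd [ed [dn rd]]]].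
  exists (W d). split; [apply o; lra|]. intros s hs.
  apply (turning_trap k e W P s0 s1 b d); auto; lra.
Qed.

Definition potential (k w : R) := B / 2 * (w * w) - k / (1 + q) * Rpower w (1 + q).
Definition energy (k w p : R) := p * p / 2 + potential k w.

Lemma potential_derive k w : 0 < w -> is_derive (potential k) w (restoring k w).
Proof.
  intros hw. unfold potential, restoring. pose proof (is_derive_Rpower (1 + q) w hw) as h.
  replace (1 + q - 1) with q in h by ring.
  assert (h' := is_derive_scal _ _ (k / (1 + q)) _ h).
  assert (h'' : is_derive (fun w => B / 2 * (w * w)) w (B * w)).
  { auto_derive; [auto|]. field. }
  apply (is_derive_eq _ _ _ _ (is_derive_minus _ _ _ _ _ h'' h')).
  unfold minus, plus, opp; simpl. field. pose proof a_pos; pose proof a_lt_q; lra.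
Qed.

Lemma energy_derive k e W P s0 s1 s : orbit k e W P s0 s1 -> s0 < s < s1 ->
  is_derive (fun t => energy k (W t) (P t)) s ((E e s * (a * Rpower (W s) (a - 1)) - A) * (P s * P s)).
Proof.
  intros o hs. destruct (o s hs) as [w1 [w2 w3]].
  assert (h1 := is_derive_comp (potential k) W s _ _ (potential_derive k (W s) w1) w2).
  assert (h2 := is_derive_square P s _ w3).
  apply (is_derive_ext (fun t => / 2 * (P t * P t) + potential k (W t))).
  { intros t. change (/ 2 * (P t * P t) + potential k (W t) = energy k (W t) (P t)). unfold energy. field. }
  apply (is_derive_eq _ _ _ _ (is_derive_plus _ _ _ _ _ (is_derive_scal _ _ (/ 2) _ h2) h1)).
  unfold plus, scal; simpl. unfold mult; simpl. unfold accel, restoring. field.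
Qed.

(** From the time [s] on and above [wl] the drag coefficient is at most [A], so the energy cannot
    increase, and the height [wl] is out of reach for lack of energy. *)
Definition trapped (k e s w p wl : R) :=
  0 < wl /\ wl < w /\ E e s * (a * Rpower wl (a - 1)) <= A /\ energy k w p < potential k wl.

Lemma energy_trap k e W P s0 s1 t wl : 0 < e -> orbit k e W P s0 s1 -> s0 < t ->
  trapped k e t (W t) (P t) wl -> forall s, t <= s < s1 -> wl < W s.
Proof.
  intros he o ht [h0 [h1 [h2 h3]]] s hs.
  destruct (Rlt_le_dec wl (W s)) as [|hle]; auto. exfalso.
  assert (hts : t < s). { destruct (Req_dec t s) as [<-|]; lra. }
  destruct (first_zero (fun r => W r - wl) t s) as [r [hr [er pr]]]; try lra.
  { intros r hr. apply (continuous_minus W (fun _ => wl)); [eapply orbit_contW; eauto; lra|apply continuous_const]. }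
  assert (hdec : energy k (W r) (P r) <= energy k (W t) (P t)).
  { apply (decr_of_derive (fun s => energy k (W s) (P s))
      (fun s => (E e s * (a * Rpower (W s) (a - 1)) - A) * (P s * P s))); [lra| |].
    - intros x hx. apply (energy_derive k e W P s0 s1); auto; lra.
    - intros x hx. assert (wl <= W x).
      { destruct (Req_dec x r) as [->|]; [lra|specialize (pr x ltac:(lra)); lra]. }
      assert (Rpower (W x) (a - 1) <= Rpower wl (a - 1)).
      { apply Rpower_le_neg; auto. pose proof a_lt_q; pose proof q_lt_1; lra. }
      assert (E e x <= E e t). { destruct (Req_dec t x) as [->|]; [lra|left; apply E_decr; auto; lra]. }
      pose proof a_pos. pose proof (Rpower_pos (W x) (a - 1)). pose proof (E_pos e x he).
      assert (E e x * (a * Rpower (W x) (a - 1)) <= E e t * (a * Rpower wl (a - 1))).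
      { apply Rmult_le_compat; try lra; [|apply Rmult_le_compat_l; lra]. apply Rmult_le_pos; lra. }
      pose proof (Rle_0_sqr (P x)). unfold Rsqr in *. nra. }
  replace (W r) with wl in hdec by lra. unfold energy in *. pose proof (Rle_0_sqr (P r)). unfold Rsqr in *. lra.
Qed.

End Trap2.

(** * Existence of orbits issuing from the interface *)

Definition cont (u : R -> R) := forall x, continuous u x.

Lemma pow_half_pos (k : nat) : 0 < (/ 2) ^ k.
Proof. apply pow_lt; lra. Qed.

Lemma pow_half_small (M eps : R) : 0 <= M -> 0 < eps -> exists k, M * (/ 2) ^ k < eps.
Proof.
  intros hM he. destruct (pow_lt_1_zero (/ 2) ltac:(rewrite Rabs_pos_eq; lra) (eps / (M + 1))) as [N hN].
  { apply Rdiv_lt_0_compat; lra. }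
  exists N. specialize (hN N (le_n N)). rewrite Rabs_pos_eq in hN by (left; apply pow_half_pos).
  pose proof (pow_half_pos N).
  apply Rlt_le_trans with ((M + 1) * (eps / (M + 1))).
  - apply Rle_lt_trans with ((M + 1) * (/ 2) ^ N); [nra|apply Rmult_lt_compat_l; lra].
  - right. field. lra.
Qed.

Lemma le_of_pow_half (x M d : R) : 0 <= M -> (forall k, x <= M * (/ 2) ^ k + d) -> x <= d.
Proof.
  intros hM h. destruct (Rle_lt_dec x d); auto. exfalso.
  destruct (pow_half_small M (x - d) hM ltac:(lra)) as [k hk]. specialize (h k). lra.
Qed.

(** Banach's theorem without a function space: only distances occur, so no function need be bounded
    apart from the first iterate, and the limit is formed pointwise by choice. *)
Lemma contraction_fixed_point (T : (R -> R) -> R -> R) (M0 : R) : 0 <= M0 ->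
  (forall u, cont u -> cont (T u)) ->
  (forall u v M, cont u -> cont v -> (forall x, Rabs (u x - v x) <= M) -> forall x, Rabs (T u x - T v x) <= M / 2) ->
  (forall x, Rabs (T (fun _ => 0) x) <= M0) ->
  exists u, cont u /\ forall x, T u x = u x.
Proof.
  intros hM0 hc hl h0.
  set (un := fix un k := match k with O => fun _ : R => 0 | S j => T (un j) end).
  assert (cun : forall k, cont (un k)).
  { induction k; simpl; [intros x; apply continuous_const|auto]. }
  assert (step : forall k x, Rabs (un (S k) x - un k x) <= M0 * (/ 2) ^ k).
  { induction k; intros x.
    - simpl. rewrite Rminus_0_r, Rmult_1_r. apply h0.
    - replace (M0 * (/ 2) ^ S k) with (M0 * (/ 2) ^ k / 2) by (simpl; field).
      apply (hl (un (S k)) (un k)); auto. }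
  assert (far : forall k j x, Rabs (un (k + j)%nat x - un k x) <= 2 * M0 * (/ 2) ^ k * (1 - (/ 2) ^ j)).
  { intros k j x. induction j.
    - rewrite Nat.add_0_r, Rminus_diag, Rabs_R0. simpl. lra.
    - rewrite Nat.add_succ_r.
      replace (un (S (k + j)) x - un k x) with ((un (S (k + j)) x - un (k + j)%nat x) + (un (k + j)%nat x - un k x)) by ring.
      eapply Rle_trans; [apply Rabs_triang|]. specialize (step (k + j)%nat x). rewrite pow_add in step. simpl pow. nra. }
  assert (far' : forall k j x, Rabs (un (k + j)%nat x - un k x) <= 2 * M0 * (/ 2) ^ k).
  { intros k j x. eapply Rle_trans; [apply far|]. pose proof (pow_half_pos k). pose proof (pow_half_pos j).
    assert (0 <= 2 * M0 * (/ 2) ^ k) by (apply Rmult_le_pos; lra). nra. }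
  assert (hcv : forall x, exists l, is_lim_seq (fun k => un k x) (Finite l)).
  { intros x. apply ex_lim_seq_cauchy_corr. intros [eps he]. simpl.
    destruct (pow_half_small (4 * M0) eps ltac:(lra) he) as [N hN]. exists N. intros i j hi hj.
    replace (un i x - un j x) with ((un i x - un N x) - (un j x - un N x)) by ring.
    eapply Rle_lt_trans; [apply Rabs_triang|]. rewrite Rabs_Ropp.
    pose proof (far' N (i - N)%nat x) as f1. pose proof (far' N (j - N)%nat x) as f2.
    replace (N + (i - N))%nat with i in f1 by lia. replace (N + (j - N))%nat with j in f2 by lia. lra. }
  destruct (choice _ hcv) as [u hu].
  assert (close : forall k x, Rabs (u x - un k x) <= 2 * M0 * (/ 2) ^ k).
  { intros k x. assert (hlim : is_lim_seq (fun j => Rabs (un (j + k)%nat x - un k x)) (Finite (Rabs (u x - un k x)))).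
    { apply (is_lim_seq_abs _ (Finite (u x - un k x))).
      apply (is_lim_seq_minus' (fun j => un (j + k)%nat x) (fun _ => un k x)); [|apply is_lim_seq_const].
      apply (is_lim_seq_incr_n (fun j => un j x)). apply hu. }
    apply (is_lim_seq_le _ (fun _ => 2 * M0 * (/ 2) ^ k) (Finite _) (Finite _)) with (2 := hlim); [|apply is_lim_seq_const].
    intros j. rewrite Nat.add_comm. apply far'. }
  assert (cu : cont u).
  { intros x. apply eps_continuous. intros eps he.
    destruct (pow_half_small (2 * M0) (eps / 3) ltac:(lra) ltac:(lra)) as [k hk].
    destruct (continuous_eps (un k) x (cun k x) (eps / 3) ltac:(lra)) as [d [hd hy]].
    exists d. split; auto. intros y hyx. specialize (hy y hyx).
    pose proof (close k x) as c1. pose proof (close k y) as c2.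
    apply Rabs_def2 in hy. apply Rabs_le_between in c1. apply Rabs_le_between in c2. apply Rabs_def1; lra. }
  exists u. split; auto. intros x. apply Rminus_diag_uniq.
  assert (hle : Rabs (T u x - u x) <= 0).
  { apply (le_of_pow_half _ (4 * M0)); [lra|]. intros k.
    pose proof (hl u (un k) _ cu (cun k) (close k) x) as c1. pose proof (close (S k) x) as c2.
    change (un (S k)) with (T (un k)) in c2. simpl pow in c2.
    replace (T u x - u x) with ((T u x - T (un k) x) - (u x - T (un k) x)) by ring.
    eapply Rle_trans; [apply Rabs_triang|]. rewrite Rabs_Ropp. pose proof (pow_half_pos k). nra. }
  pose proof (Rabs_pos (T u x - u x)). destruct (Req_dec (T u x - u x) 0); auto.
  apply Rabs_pos_lt in H0. lra.
Qed.

(** Applied with [v] a fixed point of a map at distance [d] from [T], this is dependence on a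
    parameter. *)
Lemma fixed_point_stable (T : (R -> R) -> R -> R) (u v : R -> R) (M0 d : R) : 0 <= M0 -> 0 <= d ->
  cont u -> cont v ->
  (forall u v M, cont u -> cont v -> (forall x, Rabs (u x - v x) <= M) -> forall x, Rabs (T u x - T v x) <= M / 2) ->
  (forall x, T u x = u x) -> (forall x, Rabs (T v x - v x) <= d) -> (forall x, Rabs (u x - v x) <= M0) ->
  forall x, Rabs (u x - v x) <= 2 * d.
Proof.
  intros hM0 hd cu cv hl hu hv h0.
  assert (h : forall k x, Rabs (u x - v x) <= M0 * (/ 2) ^ k + 2 * d).
  { induction k; intros x.
    - specialize (h0 x). simpl. lra.
    - pose proof (hl u v _ cu cv IHk x) as c1. rewrite hu in c1.
      replace (u x - v x) with ((u x - T v x) + (T v x - v x)) by ring.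
      eapply Rle_trans; [apply Rabs_triang|]. specialize (hv x). simpl pow. lra. }
  intros x. apply (le_of_pow_half _ M0); auto.
Qed.

Lemma rpow_pos (x y : R) : 0 < x -> rpow x y = Rpower x y.
Proof. intros h. unfold rpow. destruct (Rlt_dec 0 x); auto; lra. Qed.

Lemma rpow_0 (x y : R) : x <= 0 -> rpow x y = 0.
Proof. intros h. unfold rpow. destruct (Rlt_dec 0 x); auto; lra. Qed.

Lemma rpow_ge_0 (x y : R) : 0 <= rpow x y.
Proof. unfold rpow. destruct (Rlt_dec 0 x); [left; apply Rpower_pos|lra]. Qed.

Lemma rpow_continuous (y : R) : 0 < y -> cont (fun x => rpow x y).
Proof.
  intros hy x. destruct (Rlt_le_dec 0 x) as [l|l].
  - apply eps_continuous. intros eps he.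
    destruct (continuous_eps (fun w => Rpower w y) x (derive_continuous _ _ _ (is_derive_Rpower y x l)) eps he) as [d [hd h]].
    exists (Rmin d x). split; [apply Rmin_pos; lra|]. intros w hw.
    pose proof (Rmin_l d x). pose proof (Rmin_r d x).
    assert (Rabs (w - x) < d) by lra. apply Rabs_def2 in hw. rewrite !rpow_pos by lra. auto.
  - apply eps_continuous. intros eps he. rewrite (rpow_0 x) by auto.
    destruct (Rpower_small y eps hy he) as [d [hd h]]. exists d. split; auto. intros w hw.
    rewrite Rminus_0_r, Rabs_pos_eq by apply rpow_ge_0.
    destruct (Rlt_le_dec 0 w); [|rewrite rpow_0; auto]. rewrite rpow_pos by auto. apply h; auto.
    apply Rabs_def2 in hw. lra.
Qed.

Lemma cont_comp (f g : R -> R) : cont f -> cont g -> cont (fun x => f (g x)).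
Proof. intros hf hg x. apply (continuous_comp g f); auto. Qed.

Lemma cont_plus (f g : R -> R) : cont f -> cont g -> cont (fun x => f x + g x).
Proof. intros hf hg x. apply (continuous_plus f g); auto. Qed.

Lemma cont_minus (f g : R -> R) : cont f -> cont g -> cont (fun x => f x - g x).
Proof. intros hf hg x. apply (continuous_minus f g); auto. Qed.

Lemma cont_mult (f g : R -> R) : cont f -> cont g -> cont (fun x => f x * g x).
Proof. intros hf hg x. apply (continuous_mult f g); auto. Qed.

Lemma cont_const (r : R) : cont (fun _ => r).
Proof. intros x. apply continuous_const. Qed.

Lemma cont_exp (r : R) : cont (fun s => exp (r * s)).
Proof. intros x. apply derive_continuous with (r * exp (r * x)). auto_derive; [auto|ring]. Qed.

Lemma eps_lip_cont (f : R -> R) : (forall x y, Rabs (f x - f y) <= Rabs (x - y)) -> cont f.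
Proof.
  intros h x. apply eps_continuous. intros eps he. exists eps. split; auto.
  intros y hy. eapply Rle_lt_trans; [apply h|auto].
Qed.

Definition clip (l u x : R) := Rmax l (Rmin x u).

Lemma clip_bounds l u x : l <= u -> l <= clip l u x <= u.
Proof.
  intros h. unfold clip. split; [apply Rmax_l|]. apply Rmax_lub; [auto|apply Rmin_r].
Qed.

Lemma clip_id l u x : l <= x <= u -> clip l u x = x.
Proof. intros h. unfold clip. rewrite Rmin_left, Rmax_right by lra. auto. Qed.

Lemma clip_lip l u x y : Rabs (clip l u x - clip l u y) <= Rabs (x - y).
Proof.
  assert (hmin : Rabs (Rmin x u - Rmin y u) <= Rabs (x - y)).
  { unfold Rmin. destruct (Rle_dec x u); destruct (Rle_dec y u);
      unfold Rabs; repeat destruct Rcase_abs; lra. }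
  assert (hmax : forall v w, Rabs (Rmax l v - Rmax l w) <= Rabs (v - w)).
  { intros v w. unfold Rmax. destruct (Rle_dec l v); destruct (Rle_dec l w);
      unfold Rabs; repeat destruct Rcase_abs; lra. }
  unfold clip. eapply Rle_trans; [apply hmax|exact hmin].
Qed.

Lemma clip_cont l u : cont (clip l u).
Proof. apply eps_lip_cont. intros. apply clip_lip. Qed.

Lemma cont_ex_RInt (f : R -> R) (x y : R) : cont f -> ex_RInt f x y.
Proof. intros h. apply (@ex_RInt_continuous R_CompleteNormedModule). intros z _. apply h. Qed.

Lemma cont_RInt_derive (f : R -> R) (x0 x : R) : cont f -> is_derive (fun y => RInt f x0 y) x (f x).
Proof.
  intros h. apply (is_derive_RInt f (fun y => RInt f x0 y) x0 x); [|apply h].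
  exists (mkposreal 1 Rlt_0_1). intros y _. apply (@RInt_correct R_CompleteNormedModule). now apply cont_ex_RInt.
Qed.

Lemma RInt_Rabs_le (f : R -> R) (x y M : R) : x <= y -> cont f ->
  (forall r, x < r < y -> Rabs (f r) <= M) -> Rabs (RInt f x y) <= (y - x) * M.
Proof.
  intros hxy hf hM. apply Rabs_le.
  assert (hc : forall r, RInt (fun _ => r) x y = (y - x) * r) by (intros r; apply (RInt_const x y r)).
  split.
  - replace (- ((y - x) * M)) with ((y - x) * - M) by ring. rewrite <- hc.
    apply RInt_le; auto; try (apply cont_ex_RInt; auto using cont_const).
    intros r hr. specialize (hM r hr). apply Rabs_le_between in hM. lra.
  - rewrite <- hc. apply RInt_le; auto; try (apply cont_ex_RInt; auto using cont_const).
    intros r hr. specialize (hM r hr). apply Rabs_le_between in hM. lra.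
Qed.

Lemma RInt_diff_le (f g : R -> R) (x y M : R) : x <= y -> cont f -> cont g ->
  (forall r, x < r < y -> Rabs (f r - g r) <= M) -> Rabs (RInt f x y - RInt g x y) <= (y - x) * M.
Proof.
  intros hxy hf hg hM.
  replace (RInt f x y - RInt g x y) with (RInt (fun r => f r - g r) x y).
  - apply RInt_Rabs_le; auto. now apply cont_minus.
  - apply (RInt_minus f g x y); now apply cont_ex_RInt.
Qed.

Lemma exp_lip_neg (x y : R) : x <= 0 -> y <= 0 -> Rabs (exp x - exp y) <= Rabs (x - y).
Proof.
  assert (h : forall x y, x <= y -> y <= 0 -> Rabs (exp x - exp y) <= Rabs (x - y)).
  { intros u v huv hv. rewrite Rabs_minus_sym, (Rabs_minus_sym u v), !Rabs_pos_eq; try lra.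
    - assert (exp u = exp v * exp (u - v)) by (rewrite <- exp_plus; f_equal; ring).
      assert (exp v <= 1). { rewrite <- exp_0. destruct hv as [hv|hv]; [left; now apply exp_increasing|rewrite hv; lra]. }
      pose proof (exp_ineq1_le (u - v)). pose proof (exp_pos v). nra.
    - destruct huv as [huv| ->]; [|lra]. apply exp_increasing in huv. lra. }
  intros hx hy. destruct (Rle_lt_dec x y); [now apply h|].
  rewrite Rabs_minus_sym, (Rabs_minus_sym x y). apply h; lra.
Qed.

Lemma ln_lip (x y m : R) : 0 < m -> m <= x -> m <= y -> Rabs (ln x - ln y) <= Rabs (x - y) / m.
Proof.
  intros hm.
  assert (h : forall x y, m <= x -> x <= y -> Rabs (ln x - ln y) <= Rabs (x - y) / m).
  { intros u v hu huv. rewrite Rabs_minus_sym, (Rabs_minus_sym u v), !Rabs_pos_eq; try lra.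
    - destruct huv as [huv| ->]; [|rewrite !Rminus_diag; unfold Rdiv; lra].
      rewrite <- ln_div by lra. pose proof (exp_ineq1_le (ln (v / u))).
      rewrite exp_ln in H by (apply Rdiv_lt_0_compat; lra).
      apply Rle_trans with ((v - u) / u).
      + replace ((v - u) / u) with (v / u - 1) by (field; lra). lra.
      + unfold Rdiv. apply Rmult_le_compat_l; [lra|]. apply Rinv_le_contravar; lra.
    - destruct huv as [huv| ->]; [|lra]. apply ln_increasing in huv; lra. }
  intros hx hy. destruct (Rle_lt_dec x y); [now apply h|].
  rewrite Rabs_minus_sym, (Rabs_minus_sym x y). apply h; lra.
Qed.

(** * The fixed point problem at the edge *)

Section HeadExistence.
Context {c : coeffs}.
Variables (tau K : R).

(** With [v = W^(1-a)] one has [W^a = v^nu] and [W^(q-a) = v^gam]. *)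
Definition nu := a / (1 - a).
Definition gam := (q - a) / (1 - a).

Lemma one_minus_a : 0 < 1 - a < 1.
Proof. pose proof a_pos; pose proof a_lt_q; pose proof q_lt_1. lra. Qed.

Lemma nu_pos : 0 < nu.
Proof. unfold nu. apply Rdiv_lt_0_compat; [apply a_pos|apply one_minus_a]. Qed.

Lemma gam_pos : 0 < gam.
Proof. unfold gam. apply Rdiv_lt_0_compat; [pose proof a_lt_q; lra|apply one_minus_a]. Qed.

(* In the pressure variable v = W^(1-a) the equation W' = R + E W^a reads v' = (1-a)(E + rho),
   where rho = R / W^a.  The unknown of the fixed point problem is rho, clipped to [-1/4,1/4]. *)
Definition Et (r : R) := E 1 (clip 0 tau r).
Definition speed (rho : R -> R) (r : R) := Et r + clip (-/4) (/4) (rho r).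
Definition press (rho : R -> R) (x : R) := (1 - a) * RInt (speed rho) 0 x.
(** The flux [R = P - E W^a] satisfies [R' = - A R + W^a src], the term [om E W^a] coming from [E'].
    Hence [flux_integrand] is the derivative of [e^(A s) R], and [weight] recovers [rho = R / W^a]
    from its integral. *)
Definition src (k : R) (rho : R -> R) (r : R) :=
  (om - A) * Et r - B * press rho r + k * rpow (press rho r) gam.
Definition flux_integrand (k : R) (rho : R -> R) (r : R) :=
  exp (A * r) * src k rho r * rpow (press rho r) nu.
Definition weight (rho : R -> R) (x : R) := / (exp (A * x) * rpow (press rho x) nu).
Definition head_map (k : R) (rho : R -> R) (s : R) :=
  weight rho (clip 0 tau s) * RInt (flux_integrand k rho) 0 (clip 0 tau s).

(** [om tau <= 1/4] keeps [Et] in [3/4,1], so that the clipped speed lies in [1/2,5/4]; [tau <= 4/5]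
    then keeps the pressure at most 1 and its logarithm nonpositive. *)
Hypothesis htau : 0 < tau.
Hypothesis htau1 : om * tau <= / 4.
Hypothesis htau2 : tau <= 4 / 5.
Hypothesis hK : 0 <= K.

Lemma Et_cont : cont Et.
Proof.
  apply (cont_comp (E 1) (clip 0 tau)); [|apply clip_cont].
  intros x. eapply derive_continuous, E_derive.
Qed.

Lemma Et_bounds r : 3 / 4 <= Et r <= 1.
Proof.
  unfold Et. destruct (clip_bounds 0 tau r ltac:(lra)) as [h1 h2]. set (x := clip 0 tau r) in *.
  unfold E. rewrite Rmult_1_l. pose proof om_pos. split.
  - pose proof (exp_ineq1_le (- om * x)). nra.
  - rewrite <- exp_0. destruct h1 as [h1|h1]; [left; apply exp_increasing; nra|].
    right. f_equal. rewrite <- h1. ring.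
Qed.

Lemma speed_cont rho : cont rho -> cont (speed rho).
Proof.
  intros h. apply cont_plus; [apply Et_cont|]. apply (cont_comp (clip (-/4) (/4)) rho); auto. apply clip_cont.
Qed.

Lemma speed_bounds rho r : / 2 <= speed rho r <= 5 / 4.
Proof.
  unfold speed. pose proof (Et_bounds r). pose proof (clip_bounds (-/4) (/4) (rho r) ltac:(lra)). lra.
Qed.

Lemma press_derive rho x : cont rho -> is_derive (press rho) x ((1 - a) * speed rho x).
Proof.
  intros h. unfold press. apply (is_derive_scal (fun x => RInt (speed rho) 0 x)).
  apply cont_RInt_derive. now apply speed_cont.
Qed.

Lemma press_cont rho : cont rho -> cont (press rho).
Proof. intros h x. eapply derive_continuous, press_derive; auto. Qed.

Lemma press_bounds rho x : cont rho -> 0 <= x -> (1 - a) * x / 2 <= press rho x <= 5 / 4 * x.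
Proof.
  intros h hx. pose proof one_minus_a.
  assert (h1 : RInt (fun _ => / 2) 0 x <= RInt (speed rho) 0 x).
  { apply RInt_le; auto; try (apply cont_ex_RInt; auto using cont_const, speed_cont).
    intros r _. apply speed_bounds. }
  assert (h2 : RInt (speed rho) 0 x <= RInt (fun _ => 5 / 4) 0 x).
  { apply RInt_le; auto; try (apply cont_ex_RInt; auto using cont_const, speed_cont).
    intros r _. apply speed_bounds. }
  rewrite (RInt_const 0 x (/2)) in h1. rewrite (RInt_const 0 x (5/4)) in h2.
  unfold scal in h1, h2; simpl in h1, h2; unfold mult in h1, h2; simpl in h1, h2. unfold press. nra.
Qed.

Lemma press_incr rho x y : cont rho -> x <= y -> press rho x <= press rho y.
Proof.
  intros h hxy. apply (incr_of_derive _ (fun x => (1 - a) * speed rho x)); auto.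
  - intros z _. now apply press_derive.
  - intros z _. pose proof (speed_bounds rho z). pose proof one_minus_a. nra.
Qed.

Lemma press_pos rho x : cont rho -> 0 < x -> 0 < press rho x.
Proof. intros h hx. pose proof (press_bounds rho x h ltac:(lra)). pose proof one_minus_a. nra. Qed.

Lemma press_diff r1 r2 M x : cont r1 -> cont r2 -> (forall s, Rabs (r1 s - r2 s) <= M) -> 0 <= x ->
  Rabs (press r1 x - press r2 x) <= (1 - a) * (x * M).
Proof.
  intros h1 h2 hM hx. unfold press. rewrite <- Rmult_minus_distr_l, Rabs_mult.
  pose proof one_minus_a. rewrite (Rabs_pos_eq (1 - a)) by lra. apply Rmult_le_compat_l; [lra|].
  replace (x * M) with ((x - 0) * M) by ring. apply RInt_diff_le; auto using speed_cont.
  intros r _. unfold speed. eapply Rle_trans; [|apply (hM r)].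
  replace (Et r + clip (-/4) (/4) (r1 r) - (Et r + clip (-/4) (/4) (r2 r))) with (clip (-/4) (/4) (r1 r) - clip (-/4) (/4) (r2 r)) by ring.
  apply clip_lip.
Qed.

(** The pressure is of exact order [x], and two pressures differ by at most a multiple of [x M]; so
    the difference of their logarithms is bounded uniformly up to the edge. This is what makes the
    singular [weight] harmless. *)
Lemma ln_press_diff r1 r2 M x : cont r1 -> cont r2 -> (forall s, Rabs (r1 s - r2 s) <= M) -> 0 < x ->
  Rabs (ln (press r1 x) - ln (press r2 x)) <= 2 * M.
Proof.
  intros h1 h2 hM hx. pose proof one_minus_a.
  pose proof (press_bounds r1 x h1 ltac:(lra)). pose proof (press_bounds r2 x h2 ltac:(lra)).
  assert (hm : 0 < (1 - a) * x / 2) by nra.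
  eapply Rle_trans; [apply (ln_lip _ _ ((1 - a) * x / 2)); lra|].
  pose proof (press_diff r1 r2 M x h1 h2 hM ltac:(lra)).
  apply Rle_trans with ((1 - a) * (x * M) / ((1 - a) * x / 2)).
  - apply Rmult_le_compat_r; auto. left. now apply Rinv_0_lt_compat.
  - right. field. lra.
Qed.

Lemma ln_press_neg rho x : cont rho -> 0 < x <= tau -> ln (press rho x) <= 0.
Proof.
  intros h hx. pose proof (press_bounds rho x h ltac:(lra)). pose proof (press_pos rho x h ltac:(lra)).
  rewrite <- ln_1. destruct (Req_dec (press rho x) 1) as [->|]; [lra|]. left. apply ln_increasing; lra.
Qed.

Lemma src_cont k rho : cont rho -> cont (src k rho).
Proof.
  intros h. unfold src. apply cont_plus; [apply cont_minus|].
  - apply (cont_mult (fun _ => om - A)); [apply cont_const|apply Et_cont].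
  - apply (cont_mult (fun _ => B)); [apply cont_const|now apply press_cont].
  - apply (cont_mult (fun _ => k)); [apply cont_const|].
    apply (cont_comp (fun x => rpow x gam) (press rho)); [apply rpow_continuous, gam_pos|now apply press_cont].
Qed.

Lemma rpow_press_cont rho : cont rho -> cont (fun r => rpow (press rho r) nu).
Proof.
  intros h. apply (cont_comp (fun x => rpow x nu) (press rho)); [apply rpow_continuous, nu_pos|now apply press_cont].
Qed.

Lemma flux_integrand_cont k rho : cont rho -> cont (flux_integrand k rho).
Proof.
  intros h. unfold flux_integrand. apply cont_mult; [apply cont_mult|].
  - apply cont_exp.
  - now apply src_cont.
  - now apply rpow_press_cont.
Qed.

Definition G0 := Rabs (om - A) + B + K.

Lemma G0_pos : 0 < G0.
Proof. unfold G0. pose proof (Rabs_pos (om - A)). pose proof B_pos. lra. Qed.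

Lemma src_bound k rho r : 0 <= k <= K -> cont rho -> 0 < r <= tau -> Rabs (src k rho r) <= G0.
Proof.
  intros hk h hr. pose proof (press_bounds rho r h ltac:(lra)). pose proof (press_pos rho r h ltac:(lra)).
  pose proof (Et_bounds r). pose proof B_pos. unfold src, G0.
  assert (h0 : 0 < rpow (press rho r) gam <= 1).
  { rewrite rpow_pos by auto. split; [apply Rpower_pos|].
    assert (hl := ln_press_neg rho r h hr). pose proof gam_pos.
    unfold Rpower. rewrite <- exp_0. 
    destruct (Req_dec (gam * ln (press rho r)) 0) as [->|]; [lra|]. left. apply exp_increasing. nra. }
  eapply Rle_trans; [apply Rabs_triang|]. apply Rplus_le_compat.
  - eapply Rle_trans; [apply Rabs_triang|]. rewrite Rabs_Ropp, !Rabs_mult.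
    rewrite (Rabs_pos_eq (Et r)), (Rabs_pos_eq B), (Rabs_pos_eq (press rho r)) by lra.
    pose proof (Rabs_pos (om - A)). nra.
  - rewrite Rabs_mult, !Rabs_pos_eq by lra. nra.
Qed.

(** In this form the kernel has a nonpositive exponent, on which [exp] is 1-Lipschitz, and it
    depends on [rho] only through differences of logarithms. *)
Lemma kernel_exp rho x r : cont rho -> 0 < r <= x ->
  weight rho x * (exp (A * r) * rpow (press rho r) nu) = exp (A * (r - x) + nu * (ln (press rho r) - ln (press rho x))).
Proof.
  intros h hr. assert (hp1 := press_pos rho r h ltac:(lra)). assert (hp2 := press_pos rho x h ltac:(lra)).
  unfold weight. rewrite !rpow_pos by auto. unfold Rpower. rewrite <- !exp_plus, <- exp_Ropp, <- exp_plus. f_equal. ring.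
Qed.

Lemma kernel_exponent rho x r : cont rho -> 0 < r <= x ->
  A * (r - x) + nu * (ln (press rho r) - ln (press rho x)) <= 0.
Proof.
  intros h hr. pose proof A_pos. pose proof nu_pos.
  assert (ln (press rho r) <= ln (press rho x)).
  { destruct (press_incr rho r x h ltac:(lra)) as [l|e]; [left; apply ln_increasing; auto; apply press_pos; auto; lra|rewrite e; lra]. }
  nra.
Qed.

Lemma kernel_le_1 rho x r : cont rho -> 0 < r <= x ->
  0 < weight rho x * (exp (A * r) * rpow (press rho r) nu) <= 1.
Proof.
  intros h hr. rewrite kernel_exp by auto. split; [apply exp_pos|].
  rewrite <- exp_0. destruct (kernel_exponent rho x r h hr) as [l|e]; [left; now apply exp_increasing|rewrite e; lra].
Qed.

Lemma weighted_RInt k rho x : cont rho ->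
  weight rho x * RInt (flux_integrand k rho) 0 x = RInt (fun r => weight rho x * flux_integrand k rho r) 0 x.
Proof.
  intros h. symmetry. apply (RInt_scal (flux_integrand k rho) 0 x (weight rho x)).
  apply cont_ex_RInt. now apply flux_integrand_cont.
Qed.

Lemma weighted_cont k rho x : cont rho -> cont (fun r => weight rho x * flux_integrand k rho r).
Proof. intros h. apply cont_mult; [apply cont_const|now apply flux_integrand_cont]. Qed.

Lemma weighted_eq k rho x r : weight rho x * flux_integrand k rho r =
   src k rho r * (weight rho x * (exp (A * r) * rpow (press rho r) nu)).
Proof. unfold flux_integrand. ring. Qed.

Lemma head_bound k rho x : 0 <= k <= K -> cont rho -> 0 <= x <= tau ->
  Rabs (weight rho x * RInt (flux_integrand k rho) 0 x) <= x * G0.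
Proof.
  intros hk h hx. rewrite weighted_RInt by auto. replace (x * G0) with ((x - 0) * G0) by ring.
  apply RInt_Rabs_le; [lra|now apply weighted_cont|]. intros r hr. rewrite weighted_eq, Rabs_mult.
  destruct (kernel_le_1 rho x r h ltac:(lra)) as [k1 k2].
  pose proof (src_bound k rho r hk h ltac:(lra)). rewrite (Rabs_pos_eq (weight _ _ * _)) by lra.
  pose proof (Rabs_pos (src k rho r)). nra.
Qed.

Lemma head_map_bound k rho s : 0 <= k <= K -> cont rho -> Rabs (head_map k rho s) <= tau * G0.
Proof.
  intros hk h. destruct (clip_bounds 0 tau s ltac:(lra)) as [h1 h2]. unfold head_map.
  eapply Rle_trans; [apply head_bound; auto|]. pose proof G0_pos. nra.
Qed.

Lemma head_map_cont k rho : 0 <= k <= K -> cont rho -> cont (head_map k rho).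
Proof.
  intros hk h.
  change (cont (fun s => (fun x => weight rho x * RInt (flux_integrand k rho) 0 x) (clip 0 tau s))).
  intros s. destruct (clip_bounds 0 tau s ltac:(lra)) as [h1 h2].
  (* At 0 [weight] divides by zero; continuity there comes from [head_bound], elsewhere from the
     formula. *)
  destruct (Req_dec (clip 0 tau s) 0) as [e0|ne].
  - apply eps_continuous. intros eps he. pose proof G0_pos. exists (eps / G0). split; [now apply Rdiv_lt_0_compat|].
    intros y hy. cbv beta. rewrite e0, (RInt_point 0 (flux_integrand k rho)). unfold zero; simpl. rewrite Rmult_0_r, Rminus_0_r.
    destruct (clip_bounds 0 tau y ltac:(lra)) as [g1 g2].
    eapply Rle_lt_trans; [apply head_bound; auto|].
    assert (clip 0 tau y <= Rabs (y - s)).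
    { pose proof (clip_lip 0 tau y s) as hl. rewrite e0, Rminus_0_r, Rabs_pos_eq in hl by lra. exact hl. }
    apply Rle_lt_trans with (Rabs (y - s) * G0); [apply Rmult_le_compat_r; lra|].
    apply Rlt_le_trans with (eps / G0 * G0); [apply Rmult_lt_compat_r; lra|right; field; lra].
  - apply (continuous_comp (clip 0 tau) (fun x => weight rho x * RInt (flux_integrand k rho) 0 x)); [apply clip_cont|].
    set (x := clip 0 tau s) in *. assert (hx : 0 < x) by lra.
    apply (continuous_mult (weight rho) (fun x => RInt (flux_integrand k rho) 0 x)).
    + unfold weight. apply continuous_Rinv_comp.
      * apply (continuous_mult (fun x => exp (A * x)) (fun x => rpow (press rho x) nu)); [apply cont_exp|now apply rpow_press_cont].
      * rewrite rpow_pos by (now apply press_pos). pose proof (exp_pos (A * x)). pose proof (Rpower_pos (press rho x) nu).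
        assert (0 < exp (A * x) * Rpower (press rho x) nu) by (now apply Rmult_lt_0_compat). lra.
    + eapply derive_continuous, cont_RInt_derive. now apply flux_integrand_cont.
Qed.

(** Lipschitz constant of [head_map] per unit of [tau]: the first two terms bound the variation of
    [src], the last one that of the kernel, times the bound [G0] of [src]. *)
Definition C1 := B + 2 * K * gam + 4 * nu * G0.

Lemma C1_pos : 0 < C1.
Proof.
  unfold C1. pose proof B_pos; pose proof gam_pos; pose proof nu_pos; pose proof G0_pos.
  assert (0 <= K * gam) by (apply Rmult_le_pos; lra). assert (0 < nu * G0) by (now apply Rmult_lt_0_compat). lra.
Qed.

(** [v^gam] is not Lipschitz at 0, because [gam < 1]; but [ln v] is nonpositive and varies by at
    most [2 M], so [exp (gam ln v)] varies at most in proportion to [M]. *)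
Lemma src_diff k r1 r2 M r : 0 <= k <= K -> cont r1 -> cont r2 -> (forall s, Rabs (r1 s - r2 s) <= M) -> 0 < r <= tau ->
  Rabs (src k r1 r - src k r2 r) <= (B + 2 * K * gam) * M.
Proof.
  intros hk h1 h2 hM hr. assert (hM0 : 0 <= M) by (pose proof (hM 0); pose proof (Rabs_pos (r1 0 - r2 0)); lra).
  pose proof B_pos; pose proof gam_pos. pose proof one_minus_a.
  replace (src k r1 r - src k r2 r) with (- B * (press r1 r - press r2 r) + k * (rpow (press r1 r) gam - rpow (press r2 r) gam))
    by (unfold src; ring).
  eapply Rle_trans; [apply Rabs_triang|]. rewrite !Rabs_mult, Rabs_Ropp, (Rabs_pos_eq B), (Rabs_pos_eq k) by lra.
  assert (d1 := press_diff r1 r2 M r h1 h2 hM ltac:(lra)).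
  assert (d1' : (1 - a) * (r * M) <= M).
  { assert (r * M <= M) by nra. assert (0 <= r * M) by (apply Rmult_le_pos; lra). nra. }
  assert (d2 : Rabs (rpow (press r1 r) gam - rpow (press r2 r) gam) <= gam * (2 * M)).
  { rewrite !rpow_pos by (apply press_pos; auto; lra). unfold Rpower.
    assert (l1 := ln_press_neg r1 r h1 hr). assert (l2 := ln_press_neg r2 r h2 hr).
    eapply Rle_trans; [apply exp_lip_neg; nra|]. rewrite <- Rmult_minus_distr_l, Rabs_mult, (Rabs_pos_eq gam) by lra.
    apply Rmult_le_compat_l; [lra|]. apply ln_press_diff; auto; lra. }
  assert (B * Rabs (press r1 r - press r2 r) <= B * M) by (apply Rmult_le_compat_l; lra).
  assert (k * Rabs (rpow (press r1 r) gam - rpow (press r2 r) gam) <= K * (gam * (2 * M))).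
  { apply Rmult_le_compat; try lra. apply Rabs_pos. }
  lra.
Qed.

Lemma kernel_diff r1 r2 M x r : cont r1 -> cont r2 -> (forall s, Rabs (r1 s - r2 s) <= M) -> 0 < r <= x ->
  Rabs (weight r1 x * (exp (A * r) * rpow (press r1 r) nu) - weight r2 x * (exp (A * r) * rpow (press r2 r) nu)) <= 4 * nu * M.
Proof.
  intros h1 h2 hM hr. rewrite !kernel_exp by auto. pose proof nu_pos.
  eapply Rle_trans; [apply exp_lip_neg; now apply kernel_exponent|].
  replace (A * (r - x) + nu * (ln (press r1 r) - ln (press r1 x)) - (A * (r - x) + nu * (ln (press r2 r) - ln (press r2 x))))
    with (nu * ((ln (press r1 r) - ln (press r2 r)) - (ln (press r1 x) - ln (press r2 x)))) by ring.
  rewrite Rabs_mult, (Rabs_pos_eq nu) by lra.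
  assert (Rabs ((ln (press r1 r) - ln (press r2 r)) - (ln (press r1 x) - ln (press r2 x))) <= 4 * M).
  { eapply Rle_trans; [apply Rabs_triang|]. rewrite Rabs_Ropp.
    pose proof (ln_press_diff r1 r2 M r h1 h2 hM ltac:(lra)). pose proof (ln_press_diff r1 r2 M x h1 h2 hM ltac:(lra)). lra. }
  nra.
Qed.

Lemma head_map_diff k r1 r2 M s : 0 <= k <= K -> cont r1 -> cont r2 -> (forall s, Rabs (r1 s - r2 s) <= M) ->
  Rabs (head_map k r1 s - head_map k r2 s) <= tau * C1 * M.
Proof.
  intros hk h1 h2 hM. assert (hM0 : 0 <= M) by (pose proof (hM 0); pose proof (Rabs_pos (r1 0 - r2 0)); lra).
  destruct (clip_bounds 0 tau s ltac:(lra)) as [g1 g2]. unfold head_map. set (x := clip 0 tau s) in *.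
  rewrite !weighted_RInt by auto.
  apply Rle_trans with ((x - 0) * (C1 * M)).
  - apply RInt_diff_le; auto using weighted_cont. intros r hr. rewrite !weighted_eq.
    set (w1 := weight r1 x * (exp (A * r) * rpow (press r1 r) nu)). set (w2 := weight r2 x * (exp (A * r) * rpow (press r2 r) nu)).
    replace (src k r1 r * w1 - src k r2 r * w2) with ((src k r1 r - src k r2 r) * w1 + src k r2 r * (w1 - w2)) by ring.
    eapply Rle_trans; [apply Rabs_triang|]. rewrite !Rabs_mult.
    assert (e1 := src_diff k r1 r2 M r hk h1 h2 hM ltac:(lra)).
    assert (e2 := kernel_diff r1 r2 M x r h1 h2 hM ltac:(lra)). fold w1 w2 in e2.
    assert (e3 := kernel_le_1 r1 x r h1 ltac:(lra)). fold w1 in e3.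
    assert (e4 := src_bound k r2 r hk h2 ltac:(lra)). rewrite (Rabs_pos_eq w1) by lra.
    pose proof (Rabs_pos (src k r1 r - src k r2 r)). pose proof (Rabs_pos (w1 - w2)). pose proof (Rabs_pos (src k r2 r)).
    assert (Rabs (src k r1 r - src k r2 r) * w1 <= (B + 2 * K * gam) * M * 1) by (apply Rmult_le_compat; lra).
    assert (Rabs (src k r2 r) * Rabs (w1 - w2) <= G0 * (4 * nu * M)) by (apply Rmult_le_compat; lra).
    unfold C1. lra.
  - pose proof C1_pos. assert (0 <= C1 * M) by (apply Rmult_le_pos; lra). nra.
Qed.

Lemma head_map_diff_k k k' rho s : 0 <= k <= K -> 0 <= k' <= K -> cont rho ->
  Rabs (head_map k rho s - head_map k' rho s) <= tau * Rabs (k - k').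
Proof.
  intros hk hk' h. destruct (clip_bounds 0 tau s ltac:(lra)) as [g1 g2]. unfold head_map. set (x := clip 0 tau s) in *.
  rewrite !weighted_RInt by auto.
  apply Rle_trans with ((x - 0) * Rabs (k - k')).
  - apply RInt_diff_le; auto using weighted_cont. intros r hr. rewrite !weighted_eq.
    set (w1 := weight rho x * (exp (A * r) * rpow (press rho r) nu)).
    replace (src k rho r * w1 - src k' rho r * w1) with ((k - k') * (rpow (press rho r) gam * w1)) by (unfold src; ring).
    rewrite Rabs_mult. rewrite <- (Rmult_1_r (Rabs (k - k'))) at 2. apply Rmult_le_compat_l; [apply Rabs_pos|].
    assert (e3 := kernel_le_1 rho x r h ltac:(lra)). fold w1 in e3.
    assert (hl := ln_press_neg rho r h ltac:(lra)). pose proof gam_pos.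
    rewrite rpow_pos by (apply press_pos; auto; lra).
    assert (0 < Rpower (press rho r) gam <= 1).
    { split; [apply Rpower_pos|]. unfold Rpower. rewrite <- exp_0.
      destruct (Req_dec (gam * ln (press rho r)) 0) as [->|]; [lra|]. left. apply exp_increasing. nra. }
    rewrite Rabs_pos_eq; nra.
  - pose proof (Rabs_pos (k - k')). nra.
Qed.

(** The first makes [head_map] a contraction by 1/2; the second keeps [rho] within [-1/4,1/4], where
    the clipping in [speed] is inactive. *)
Hypothesis htau3 : tau * C1 <= / 2.
Hypothesis htau4 : tau * G0 <= / 4.

Lemma head_fixed_point k : 0 <= k <= K -> exists rho, cont rho /\ (forall x, head_map k rho x = rho x).
Proof.
  intros hk. pose proof G0_pos.
  apply (contraction_fixed_point (head_map k) (tau * G0)).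
  - apply Rmult_le_pos; lra.
  - intros u hu. now apply head_map_cont.
  - intros u v M hu hv hM x. pose proof (head_map_diff k u v M x hk hu hv hM).
    assert (0 <= M) by (pose proof (hM 0); pose proof (Rabs_pos (u 0 - v 0)); lra). nra.
  - intros x. apply head_map_bound; auto. apply cont_const.
Qed.

Lemma head_fixed_point_stable k k' r1 r2 : 0 <= k <= K -> 0 <= k' <= K -> cont r1 -> cont r2 ->
  (forall x, head_map k r1 x = r1 x) -> (forall x, head_map k' r2 x = r2 x) ->
  forall x, Rabs (r1 x - r2 x) <= 2 * (tau * Rabs (k - k')).
Proof.
  intros hk hk' h1 h2 f1 f2. pose proof G0_pos.
  apply (fixed_point_stable (head_map k) r1 r2 (2 * (tau * G0))); auto.
  - assert (0 < tau * G0) by (now apply Rmult_lt_0_compat). lra.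
  - apply Rmult_le_pos; [lra|apply Rabs_pos].
  - intros u v M hu hv hM x. pose proof (head_map_diff k u v M x hk hu hv hM).
    assert (0 <= M) by (pose proof (hM 0); pose proof (Rabs_pos (u 0 - v 0)); lra). nra.
  - intros x. rewrite <- f2. now apply head_map_diff_k.
  - intros x. rewrite <- f1, <- f2. 
    pose proof (head_map_bound k r1 x hk h1). pose proof (head_map_bound k' r2 x hk' h2).
    eapply Rle_trans; [apply Rabs_triang|]. rewrite Rabs_Ropp. lra.
Qed.

Definition headW (rho : R -> R) (s : R) := Rpower (press rho s) (/ (1 - a)).
Definition headP (rho : R -> R) (s : R) := Rpower (press rho s) nu * (E 1 s + rho s).

Lemma head_small k rho s : 0 <= k <= K -> cont rho -> (forall x, head_map k rho x = rho x) ->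
  0 <= s <= tau -> Rabs (rho s) <= s * G0.
Proof.
  intros hk h f hs. rewrite <- f. unfold head_map. rewrite clip_id by auto. now apply head_bound.
Qed.

Lemma head_orbit k rho : 0 <= k <= K -> cont rho -> (forall x, head_map k rho x = rho x) ->
  orbit k 1 (headW rho) (headP rho) 0 tau.
Proof.
  intros hk h f s hs.
  assert (hp : 0 < press rho s) by (apply press_pos; auto; lra).
  pose proof one_minus_a as ha. pose proof G0_pos as hG.
  assert (hspeed : forall r, 0 < r < tau -> speed rho r = E 1 r + rho r).
  { intros r hr. unfold speed, Et. rewrite !clip_id; auto; try lra.
    pose proof (head_small k rho r hk h f ltac:(lra)). apply Rabs_le_between. nra. }
  assert (dv : is_derive (press rho) s ((1 - a) * (E 1 s + rho s))) by (rewrite <- hspeed by auto; now apply press_derive).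
  assert (hWnu : forall x, 0 < x -> Rpower (Rpower x (/ (1 - a))) a = Rpower x nu).
  { intros x hx. rewrite Rpower_mult. f_equal. unfold nu. field. lra. }
  assert (hWq : forall x, 0 < x -> Rpower (Rpower x (/ (1 - a))) q = Rpower x gam * Rpower x nu).
  { intros x hx. rewrite Rpower_mult, <- Rpower_plus. f_equal. unfold nu, gam. field. lra. }
  assert (hW1 : forall x, 0 < x -> Rpower x (/ (1 - a)) = x * Rpower x nu).
  { intros x hx. rewrite <- (Rpower_1 x) at 2 by auto. rewrite <- Rpower_plus. f_equal. unfold nu. field. lra. }
  assert (hWa1 : forall x, 0 < x -> Rpower (Rpower x (/ (1 - a))) (a - 1) = / x).
  { intros x hx. rewrite Rpower_mult. replace (/ (1 - a) * (a - 1)) with (- (1)) by (field; lra).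
    rewrite Rpower_Ropp, Rpower_1; auto. }
  split; [apply Rpower_pos|]. split.
  - apply (is_derive_eq _ _ _ _ (is_derive_Rpower_comp (/ (1 - a)) (press rho) s _ hp dv)).
    unfold headP. replace (/ (1 - a) - 1) with nu by (unfold nu; field; lra). field. lra.
  (* Multiplying the fixed point equation by [v^nu] cancels [weight] up to an exponential and
     exhibits the flux as [e^(-A r)] times an integral, which can be differentiated. *)
  - assert (hR : forall r, 0 < r < tau -> Rpower (press rho r) nu * rho r = exp (- A * r) * RInt (flux_integrand k rho) 0 r).
    { intros r hr. rewrite <- f. unfold head_map. rewrite clip_id by lra. unfold weight.
      rewrite rpow_pos by (apply press_pos; auto; lra). 
      replace (- A * r) with (- (A * r)) by ring. rewrite exp_Ropp. field.
      split; apply Rgt_not_eq; apply exp_pos. }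
    assert (dR : is_derive (fun r => Rpower (press rho r) nu * rho r) s
        (- A * (Rpower (press rho s) nu * rho s) + src k rho s * Rpower (press rho s) nu)).
    { apply (is_derive_on _ (fun r => exp (- A * r) * RInt (flux_integrand k rho) 0 r) 0 tau); auto.
      assert (d1 : is_derive (fun r => exp (- A * r)) s (- A * exp (- A * s))) by (auto_derive; [auto|ring]).
      assert (d2 := cont_RInt_derive (flux_integrand k rho) 0 s (flux_integrand_cont k rho h)).
      apply (is_derive_eq _ _ _ _ (is_derive_mult _ _ _ _ _ d1 d2 Rmult_comm)).
      rewrite hR by auto. unfold plus, mult; simpl. unfold flux_integrand. rewrite rpow_pos by auto.
      replace (exp (- A * s) * (exp (A * s) * src k rho s * Rpower (press rho s) nu)) with (src k rho s * Rpower (press rho s) nu).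
      - ring.
      - replace (- A * s) with (- (A * s)) by ring. rewrite exp_Ropp. field. apply Rgt_not_eq, exp_pos. }
    assert (dE : is_derive (fun r => Rpower (press rho r) nu * E 1 r) s
      (nu * Rpower (press rho s) (nu - 1) * ((1 - a) * (E 1 s + rho s)) * E 1 s + Rpower (press rho s) nu * (- om * E 1 s))).
    { apply (is_derive_eq _ _ _ _ (is_derive_mult _ _ _ _ _ (is_derive_Rpower_comp nu (press rho) s _ hp dv) (E_derive 1 s) Rmult_comm)).
      unfold plus, mult; simpl. ring. }
    apply (is_derive_ext (fun r => Rpower (press rho r) nu * rho r + Rpower (press rho r) nu * E 1 r)).
    { intros r. change (Rpower (press rho r) nu * rho r + Rpower (press rho r) nu * E 1 r = headP rho r). unfold headP. ring. }
    apply (is_derive_eq _ _ _ _ (is_derive_plus _ _ _ _ _ dR dE)). unfold plus; simpl.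
    unfold accel, headW, headP, src. rewrite hWq, hWa1, hW1 by auto. rewrite rpow_pos by auto.
    unfold Et. rewrite clip_id by lra.
    assert (en : Rpower (press rho s) (nu - 1) = Rpower (press rho s) nu / press rho s).
    { rewrite <- (Rpower_succ (press rho s) nu hp). field. lra. }
    rewrite en. assert (en2 : nu = a / (1 - a)) by reflexivity.
    set (V := Rpower (press rho s) nu) in *. set (G := Rpower (press rho s) gam) in *. clearbody V G.
    rewrite en2. field. lra.
Qed.

Lemma head_interface k rho : 0 <= k <= K -> cont rho -> (forall x, head_map k rho x = rho x) ->
  interface 1 (headW rho) (headP rho) 0.
Proof.
  intros hk h f eps he. pose proof one_minus_a as ha. pose proof G0_pos as hG.
  destruct (Rpower_small (/ (1 - a)) eps ltac:(apply Rinv_0_lt_compat; lra) he) as [d1 [hd1 h1]].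
  destruct (continuous_eps (E 1) 0 (derive_continuous _ _ _ (E_derive 1 0)) (eps / 2) ltac:(lra)) as [d2 [hd2 h2]].
  set (d := Rmin (Rmin (d1 / 2) d2) (Rmin tau (eps / (2 * G0)))).
  assert (hd : 0 < d /\ d <= d1 / 2 /\ d <= d2 /\ d <= tau /\ d <= eps / (2 * G0)).
  { unfold d. split. { repeat apply Rmin_pos; try lra. apply Rdiv_lt_0_compat; lra. }
    assert (g1 := Rmin_l (Rmin (d1 / 2) d2) (Rmin tau (eps / (2 * G0)))).
    assert (g2 := Rmin_r (Rmin (d1 / 2) d2) (Rmin tau (eps / (2 * G0)))).
    assert (g3 := Rmin_l (d1 / 2) d2). assert (g4 := Rmin_r (d1 / 2) d2).
    assert (g5 := Rmin_l tau (eps / (2 * G0))). assert (g6 := Rmin_r tau (eps / (2 * G0))). lra. }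
  exists d. split; [lra|]. intros s hs.
  assert (hp := press_pos rho s h ltac:(lra)). assert (hb := press_bounds rho s h ltac:(lra)).
  split.
  - unfold headW. apply h1; lra.
  - unfold headW, headP. rewrite Rpower_mult. replace (/ (1 - a) * a) with nu by (unfold nu; field; lra).
    replace (Rpower (press rho s) nu * (E 1 s + rho s) / Rpower (press rho s) nu) with (E 1 s + rho s)
      by (field; apply Rgt_not_eq, Rpower_pos).
    specialize (h2 s ltac:(apply Rabs_def1; lra)). pose proof (head_small k rho s hk h f ltac:(lra)).
    replace (E 1 s + rho s - E 1 0) with ((E 1 s - E 1 0) + rho s) by ring.
    eapply Rle_lt_trans; [apply Rabs_triang|].
    assert (s * G0 < eps / 2).
    { apply Rlt_le_trans with (eps / (2 * G0) * G0); [apply Rmult_lt_compat_r; lra|right; field; lra]. }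
    lra.
Qed.

Lemma head_dependence k rho t eps : 0 <= k <= K -> cont rho -> (forall x, head_map k rho x = rho x) ->
  0 < t < tau -> 0 < eps ->
  exists d, 0 < d /\ forall k' rho', 0 <= k' <= K -> cont rho' -> (forall x, head_map k' rho' x = rho' x) ->
    Rabs (k' - k) < d -> Rabs (headW rho' t - headW rho t) < eps /\ Rabs (headP rho' t - headP rho t) < eps.
Proof.
  intros hk h f ht he. pose proof one_minus_a as ha.
  assert (hp := press_pos rho t h ltac:(lra)).
  destruct (continuous_eps (fun x => Rpower x (/ (1 - a))) (press rho t) (derive_continuous _ _ _ (is_derive_Rpower _ _ hp)) eps he) as [d1 [hd1 h1]].
  set (Q := Rabs (E 1 t + rho t) + 1 + Rpower (press rho t) nu).
  assert (hQ1 : 1 <= Q) by (unfold Q; pose proof (Rabs_pos (E 1 t + rho t)); pose proof (Rpower_pos (press rho t) nu); lra).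
  set (e2 := Rmin 1 (eps / (4 * Q))).
  assert (he2 : 0 < e2). { apply Rmin_pos; [lra|]. apply Rdiv_lt_0_compat; lra. }
  assert (he2' : e2 <= eps / (4 * Q)) by apply Rmin_r. assert (he21 : e2 <= 1) by apply Rmin_l.
  destruct (continuous_eps (fun x => Rpower x nu) (press rho t) (derive_continuous _ _ _ (is_derive_Rpower _ _ hp)) e2 he2) as [d2 [hd2 h2]].
  exists (Rmin (Rmin d1 d2) e2 / 2). 
  assert (g1 := Rmin_l (Rmin d1 d2) e2). assert (g2 := Rmin_r (Rmin d1 d2) e2).
  assert (g3 := Rmin_l d1 d2). assert (g4 := Rmin_r d1 d2).
  assert (g5 : 0 < Rmin (Rmin d1 d2) e2) by (apply Rmin_pos; [apply Rmin_pos; auto|exact he2]).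
  split; [lra|]. intros k' rho' hk' h' f' hkk.
  assert (hst := head_fixed_point_stable k' k rho' rho hk' hk h' h f' f).
  set (M := 2 * (tau * Rabs (k' - k))) in *. pose proof (Rabs_pos (k' - k)).
  assert (hM : 0 <= M < Rmin (Rmin d1 d2) e2) by (unfold M; nra).
  assert (hpd := press_diff rho' rho M t h' h hst ltac:(lra)).
  assert (hpd' : (1 - a) * (t * M) <= M).
  { assert (t * M <= M) by nra. assert (0 <= t * M) by (apply Rmult_le_pos; lra). nra. }
  split; [apply h1; lra|]. specialize (h2 (press rho' t) ltac:(lra)). cbv beta in h2.
  specialize (hst t). unfold headP. set (y := Rpower (press rho t) nu) in *. set (y' := Rpower (press rho' t) nu) in *.
  replace (y' * (E 1 t + rho' t) - y * (E 1 t + rho t)) with ((y' - y) * (E 1 t + rho t) + y' * (rho' t - rho t)) by ring.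
  eapply Rle_lt_trans; [apply Rabs_triang|]. rewrite !Rabs_mult.
  assert (hy' : Rabs y' <= Q).
  { replace y' with (y + (y' - y)) by ring. eapply Rle_trans; [apply Rabs_triang|].
    assert (0 < y) by apply Rpower_pos. rewrite (Rabs_pos_eq y) by lra. unfold Q. pose proof (Rabs_pos (E 1 t + rho t)). lra. }
  assert (hz : Rabs (E 1 t + rho t) <= Q) by (unfold Q; assert (0 < y) by apply Rpower_pos; lra).
  assert (Rabs (y' - y) * Rabs (E 1 t + rho t) <= e2 * Q) by (apply Rmult_le_compat; try apply Rabs_pos; lra).
  assert (Rabs y' * Rabs (rho' t - rho t) <= Q * e2) by (apply Rmult_le_compat; try apply Rabs_pos; lra).
  assert (e2 * Q <= eps / 4).
  { apply Rle_trans with (eps / (4 * Q) * Q); [apply Rmult_le_compat_r; lra|right; field; lra]. }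
  lra.
Qed.

End HeadExistence.

(** * Continuation away from zero *)

Lemma RInt_exp_bound (f : R -> R) (t0 s M lam : R) : 0 < lam -> t0 <= s -> 0 <= M -> cont f ->
  (forall r, t0 < r < s -> Rabs (f r) <= M * exp (lam * (r - t0))) ->
  Rabs (RInt f t0 s) <= M / lam * exp (lam * (s - t0)).
Proof.
  intros hl hs hM hf h.
  assert (ce : cont (fun r => M * exp (lam * (r - t0)))).
  { intros r. apply derive_continuous with (M * (lam * exp (lam * (r - t0)))). auto_derive; auto. unfold Rminus. ring. }
  assert (hI : RInt (fun r => M * exp (lam * (r - t0))) t0 s = M / lam * exp (lam * (s - t0)) - M / lam).
  { replace (M / lam * exp (lam * (s - t0)) - M / lam) with (M / lam * exp (lam * (s - t0)) - M / lam * exp (lam * (t0 - t0))).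
    - apply is_RInt_unique. apply (is_RInt_derive (fun r => M / lam * exp (lam * (r - t0))) (fun r => M * exp (lam * (r - t0)))).
      + intros r _. auto_derive; auto. unfold Rminus. field. lra.
      + intros r _. apply ce.
    - replace (lam * (t0 - t0)) with 0 by ring. rewrite exp_0. ring. }
  assert (0 <= M / lam). { apply Rmult_le_pos; auto. left. now apply Rinv_0_lt_compat. }
  assert (h2 : Rabs (RInt f t0 s) <= RInt (fun r => M * exp (lam * (r - t0))) t0 s).
  { apply Rabs_le. split.
    - assert (ho : RInt (fun r => - (M * exp (lam * (r - t0)))) t0 s = - RInt (fun r => M * exp (lam * (r - t0))) t0 s).
      { apply (RInt_opp (fun r => M * exp (lam * (r - t0))) t0 s). now apply cont_ex_RInt. }
      rewrite <- ho. apply RInt_le; auto.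
      + apply cont_ex_RInt. intros r. apply continuous_opp_fun, ce.
      + now apply cont_ex_RInt.
      + intros r hr. specialize (h r hr). apply Rabs_le_between in h. lra.
    - apply RInt_le; auto; try now apply cont_ex_RInt.
      intros r hr. specialize (h r hr). apply Rabs_le_between in h. lra. }
  lra.
Qed.

Lemma Rpower_lip_above (eta z x y : R) : 0 < eta -> 0 < z < 1 -> eta <= x -> eta <= y ->
  Rabs (Rpower x z - Rpower y z) <= z * Rpower eta (z - 1) * Rabs (x - y).
Proof.
  intros he hz.
  assert (h : forall x y, eta <= x -> x < y -> Rabs (Rpower x z - Rpower y z) <= z * Rpower eta (z - 1) * Rabs (x - y)).
  { intros u v hu huv.
    destruct (MVT_interval (fun w => Rpower w z) (fun w => z * Rpower w (z - 1)) u v) as [t [ht e]]; auto.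
    - intros w hw. apply is_derive_Rpower. lra.
    - rewrite Rabs_minus_sym, e, !Rabs_mult, (Rabs_minus_sym u v).
      apply Rmult_le_compat_r; [apply Rabs_pos|]. rewrite !Rabs_pos_eq; [|left; apply Rpower_pos|lra].
      apply Rmult_le_compat_l; [lra|]. apply Rpower_le_neg; lra. }
  intros hx hy. destruct (Rtotal_order x y) as [l|[->|l]].
  - now apply h.
  - rewrite !Rminus_diag, Rabs_R0. lra.
  - rewrite Rabs_minus_sym, (Rabs_minus_sym x y). now apply h.
Qed.

(** Powers frozen below [eta], hence globally Lipschitz; nothing changes for an orbit that stays
    above [eta]. *)
Definition trunc_pow (eta z w : R) := Rpower (Rmax w eta) z.

Lemma trunc_pow_lip eta z x y : 0 < eta -> 0 < z < 1 ->
  Rabs (trunc_pow eta z x - trunc_pow eta z y) <= z * Rpower eta (z - 1) * Rabs (x - y).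
Proof.
  intros he hz. unfold trunc_pow.
  eapply Rle_trans; [apply (Rpower_lip_above eta); auto; apply Rmax_r|].
  apply Rmult_le_compat_l; [apply Rmult_le_pos; [lra|left; apply Rpower_pos]|].
  unfold Rmax. destruct (Rle_dec x eta); destruct (Rle_dec y eta); unfold Rabs; repeat destruct Rcase_abs; lra.
Qed.

Lemma trunc_pow_cont eta z : 0 < eta -> cont (trunc_pow eta z).
Proof.
  intros he x. apply (continuous_comp (fun w => Rmax w eta) (fun w => Rpower w z)).
  - apply eps_lip_cont. intros u v. unfold Rmax. destruct (Rle_dec u eta); destruct (Rle_dec v eta); unfold Rabs; repeat destruct Rcase_abs; lra.
  - eapply derive_continuous, is_derive_Rpower. pose proof (Rmax_r x eta). lra.
Qed.

Section Picard.
Context {c : coeffs}.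
Variables (eta t0 T k W0 R0 : R).
Hypothesis heta : 0 < eta.
Hypothesis ht0 : 0 <= t0.
Hypothesis htT : t0 < T.
Hypothesis hk : 0 <= k.

(** The equation of the flux, not of [P]: the pair of [W] and the flux has a right-hand side without
    products of unknowns, which after truncation is globally Lipschitz. With [P] as unknown the term
    [W^(a-1) P] would not be. *)
Definition forcing (s w : R) := - B * w + k * trunc_pow eta q w + (om - A) * E 1 s * trunc_pow eta a w.

Definition La := a * Rpower eta (a - 1).
Definition Lg := B + k * (q * Rpower eta (q - 1)) + Rabs (om - A) * La.
(** Exponent of a weighted supremum norm: in terms of [e^(-lam (s - t0)) W] the Picard map contracts
    on an interval of any length, since integration against [e^(lam s)] gains [1 / lam]. *)
Definition lam := 2 * (La + Lg) + 1.

Lemma La_pos : 0 < La.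
Proof. apply Rmult_lt_0_compat; [apply a_pos|apply Rpower_pos]. Qed.

Lemma Lg_pos : 0 < Lg.
Proof.
  unfold Lg. pose proof B_pos. pose proof La_pos. pose proof (Rabs_pos (om - A)).
  assert (0 <= k * (q * Rpower eta (q - 1))).
  { apply Rmult_le_pos; auto. apply Rmult_le_pos; [pose proof a_pos; pose proof a_lt_q; lra|left; apply Rpower_pos]. }
  assert (0 <= Rabs (om - A) * La) by (apply Rmult_le_pos; lra). lra.
Qed.

Lemma E1_bounds s : 0 <= s -> 0 < E 1 s <= 1.
Proof.
  intros hs. split; [apply E_pos; lra|]. unfold E. rewrite Rmult_1_l, <- exp_0. pose proof om_pos.
  destruct hs as [hs|hs]; [left; apply exp_increasing; nra|rewrite <- hs; right; f_equal; ring].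
Qed.

Lemma a_range : 0 < a < 1.
Proof. pose proof a_pos; pose proof a_lt_q; pose proof q_lt_1; lra. Qed.

Lemma q_range : 0 < q < 1.
Proof. pose proof a_pos; pose proof a_lt_q; pose proof q_lt_1; lra. Qed.

Lemma forcing_lip s x y : 0 <= s -> Rabs (forcing s x - forcing s y) <= Lg * Rabs (x - y).
Proof.
  intros hs. destruct (E1_bounds s hs) as [e1 e2]. pose proof B_pos.
  replace (forcing s x - forcing s y) with (- B * (x - y) + k * (trunc_pow eta q x - trunc_pow eta q y)
    + (om - A) * E 1 s * (trunc_pow eta a x - trunc_pow eta a y)) by (unfold forcing; ring).
  eapply Rle_trans; [apply Rabs_triang|]. eapply Rle_trans; [apply Rplus_le_compat_r, Rabs_triang|].
  rewrite !Rabs_mult, Rabs_Ropp, (Rabs_pos_eq B), (Rabs_pos_eq k), (Rabs_pos_eq (E 1 s)) by lra.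
  pose proof (trunc_pow_lip eta q x y heta q_range). pose proof (trunc_pow_lip eta a x y heta a_range). fold La in H1.
  unfold Lg. pose proof (Rabs_pos (om - A)). pose proof (Rabs_pos (x - y)). pose proof La_pos.
  assert (k * Rabs (trunc_pow eta q x - trunc_pow eta q y) <= k * (q * Rpower eta (q - 1) * Rabs (x - y))) by (apply Rmult_le_compat_l; auto).
  assert (Rabs (om - A) * E 1 s * Rabs (trunc_pow eta a x - trunc_pow eta a y) <= Rabs (om - A) * 1 * (La * Rabs (x - y))).
  { apply Rmult_le_compat; auto; [apply Rmult_le_pos; lra|apply Rabs_pos|apply Rmult_le_compat_l; lra]. }
  lra.
Qed.

Definition lift (u : R -> R) (r : R) := exp (lam * (clip t0 T r - t0)) * u r.
(** Only [W] is iterated; the flux is a functional of it by variation of constants. *)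
Definition picR (u : R -> R) (s : R) := exp (- A * s) * (exp (A * t0) * R0 + RInt (fun r => exp (A * r) * forcing r (lift u r)) t0 s).
Definition picW (u : R -> R) (s : R) := W0 + RInt (fun r => picR u r + E 1 r * trunc_pow eta a (lift u r)) t0 s.
Definition pic_map (u : R -> R) (s : R) := exp (- lam * (clip t0 T s - t0)) * picW u (clip t0 T s).

Lemma lift_cont u : cont u -> cont (lift u).
Proof.
  intros h. apply cont_mult; auto. apply (cont_comp (fun x => exp (lam * (x - t0))) (clip t0 T)); [|apply clip_cont].
  intros x. apply derive_continuous with (lam * exp (lam * (x - t0))). auto_derive; auto. unfold Rminus; ring.
Qed.

Lemma E_cont e : cont (E e).
Proof. intros x. eapply derive_continuous, E_derive. Qed.

Lemma forcing_cont f : cont f -> cont (fun r => forcing r (f r)).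
Proof.
  intros h. unfold forcing. apply cont_plus; [apply cont_plus|].
  - apply (cont_mult (fun _ => - B)); [apply cont_const|auto].
  - apply (cont_mult (fun _ => k)); [apply cont_const|]. apply (cont_comp (trunc_pow eta q)); auto. now apply trunc_pow_cont.
  - apply (cont_mult (fun r => (om - A) * E 1 r)); [apply (cont_mult (fun _ => om - A)); [apply cont_const|apply E_cont]|].
    apply (cont_comp (trunc_pow eta a)); auto. now apply trunc_pow_cont.
Qed.

Lemma picR_derive u s : cont u -> is_derive (picR u) s (- A * picR u s + forcing s (lift u s)).
Proof.
  intros h. assert (hf := forcing_cont (lift u) (lift_cont u h)).
  assert (hc : cont (fun r => exp (A * r) * forcing r (lift u r))) by (apply cont_mult; [apply cont_exp|auto]).
  assert (d1 : is_derive (fun r => exp (- A * r)) s (- A * exp (- A * s))) by (auto_derive; [auto|ring]).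
  assert (d2 := cont_RInt_derive _ t0 s hc).
  assert (d3 := is_derive_plus (fun _ => exp (A * t0) * R0) _ s _ _ (is_derive_const (exp (A * t0) * R0) s) d2).
  apply (is_derive_eq _ _ _ _ (is_derive_mult _ _ _ _ _ d1 d3 Rmult_comm)).
  unfold plus, mult, zero; simpl. unfold picR.
  replace (exp (- A * s) * (0 + exp (A * s) * forcing s (lift u s))) with (forcing s (lift u s)).
  - ring.
  - replace (- A * s) with (- (A * s)) by ring. rewrite exp_Ropp. field. apply Rgt_not_eq, exp_pos.
Qed.

Lemma picR_cont u : cont u -> cont (picR u).
Proof. intros h x. eapply derive_continuous, picR_derive; auto. Qed.

Lemma picW_int_cont u : cont u -> cont (fun r => picR u r + E 1 r * trunc_pow eta a (lift u r)).
Proof.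
  intros h. apply cont_plus; [now apply picR_cont|]. apply cont_mult; [apply E_cont|].
  apply (cont_comp (trunc_pow eta a)); [now apply trunc_pow_cont|now apply lift_cont].
Qed.

Lemma picW_derive u s : cont u -> is_derive (picW u) s (picR u s + E 1 s * trunc_pow eta a (lift u s)).
Proof.
  intros h. assert (d := cont_RInt_derive _ t0 s (picW_int_cont u h)).
  apply (is_derive_eq _ _ _ _ (is_derive_plus (fun _ => W0) _ s _ _ (is_derive_const W0 s) d)).
  unfold plus, zero; simpl. ring.
Qed.

Lemma pic_map_cont u : cont u -> cont (pic_map u).
Proof.
  intros h. change (cont (fun s => (fun x => exp (- lam * (x - t0)) * picW u x) (clip t0 T s))).
  apply (cont_comp (fun x => exp (- lam * (x - t0)) * picW u x)); [|apply clip_cont].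
  apply cont_mult.
  - intros x. apply derive_continuous with (- lam * exp (- lam * (x - t0))). auto_derive; auto. unfold Rminus; ring.
  - intros x. eapply derive_continuous, picW_derive; auto.
Qed.

Lemma lift_diff u v M r : t0 <= r <= T -> (forall x, Rabs (u x - v x) <= M) ->
  Rabs (lift u r - lift v r) <= M * exp (lam * (r - t0)).
Proof.
  intros hr hM. unfold lift. rewrite clip_id by auto. rewrite <- Rmult_minus_distr_l, Rabs_mult.
  pose proof (exp_pos (lam * (r - t0))). rewrite Rabs_pos_eq by lra. specialize (hM r). nra.
Qed.

Lemma lam_pos : 0 < lam.
Proof. unfold lam. pose proof La_pos; pose proof Lg_pos. lra. Qed.

Lemma picR_diff u v M s : cont u -> cont v -> t0 <= s <= T -> (forall x, Rabs (u x - v x) <= M) ->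
  Rabs (picR u s - picR v s) <= Lg * M / lam * exp (lam * (s - t0)).
Proof.
  intros hu hv hs hM. assert (hM0 : 0 <= M) by (pose proof (hM 0); pose proof (Rabs_pos (u 0 - v 0)); lra).
  pose proof A_pos. pose proof Lg_pos. pose proof lam_pos.
  assert (cu : cont (fun r => exp (A * r) * forcing r (lift u r))) by (apply cont_mult; [apply cont_exp|apply forcing_cont, lift_cont; auto]).
  assert (cv : cont (fun r => exp (A * r) * forcing r (lift v r))) by (apply cont_mult; [apply cont_exp|apply forcing_cont, lift_cont; auto]).
  replace (picR u s - picR v s) with (RInt (fun r => exp (- A * s) * (exp (A * r) * forcing r (lift u r) - exp (A * r) * forcing r (lift v r))) t0 s).
  - apply RInt_exp_bound; auto; try lra.
    + apply Rmult_le_pos; lra.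
    + apply (cont_mult (fun _ => exp (- A * s))); [apply cont_const|now apply cont_minus].
    + intros r hr. rewrite <- Rmult_minus_distr_l, <- Rmult_assoc, <- exp_plus, Rabs_mult, Rabs_pos_eq by (left; apply exp_pos).
      assert (he : exp (- A * s + A * r) <= 1). { rewrite <- exp_0. left. apply exp_increasing. nra. }
      pose proof (exp_pos (- A * s + A * r)). pose proof (forcing_lip r (lift u r) (lift v r) ltac:(lra)).
      pose proof (lift_diff u v M r ltac:(lra) hM). pose proof (Rabs_pos (forcing r (lift u r) - forcing r (lift v r))).
      apply Rle_trans with (1 * (Lg * (M * exp (lam * (r - t0))))); [|lra].
      apply Rmult_le_compat; try lra. eapply Rle_trans; [eassumption|]. apply Rmult_le_compat_l; lra.
  - rewrite (RInt_scal (fun r => exp (A * r) * forcing r (lift u r) - exp (A * r) * forcing r (lift v r)) t0 s (exp (- A * s)))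
      by (apply cont_ex_RInt; now apply cont_minus).
    rewrite (RInt_minus (fun r => exp (A * r) * forcing r (lift u r)) (fun r => exp (A * r) * forcing r (lift v r)) t0 s)
      by (now apply cont_ex_RInt).
    unfold scal, minus, plus, opp; simpl. unfold mult; simpl. unfold picR. ring.
Qed.

Lemma pic_map_contract u v M : cont u -> cont v -> (forall x, Rabs (u x - v x) <= M) ->
  forall x, Rabs (pic_map u x - pic_map v x) <= M / 2.
Proof.
  intros hu hv hM x. assert (hM0 : 0 <= M) by (pose proof (hM 0); pose proof (Rabs_pos (u 0 - v 0)); lra).
  destruct (clip_bounds t0 T x ltac:(lra)) as [h1 h2]. unfold pic_map. set (s := clip t0 T x) in *.
  pose proof La_pos. pose proof Lg_pos. pose proof lam_pos.
  assert (hlg : 0 <= Lg * M / lam). { apply Rmult_le_pos; [apply Rmult_le_pos; lra|left; now apply Rinv_0_lt_compat]. }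
  assert (hW : Rabs (picW u s - picW v s) <= (Lg * M / lam + La * M) / lam * exp (lam * (s - t0))).
  { unfold picW.
    replace (W0 + RInt (fun r => picR u r + E 1 r * trunc_pow eta a (lift u r)) t0 s - (W0 + RInt (fun r => picR v r + E 1 r * trunc_pow eta a (lift v r)) t0 s))
      with (RInt (fun r => (picR u r + E 1 r * trunc_pow eta a (lift u r)) - (picR v r + E 1 r * trunc_pow eta a (lift v r))) t0 s).
    - apply RInt_exp_bound; auto; try lra.
      + assert (0 <= La * M) by (apply Rmult_le_pos; lra). lra.
      + apply cont_minus; now apply picW_int_cont.
      + intros r hr.
        replace (picR u r + E 1 r * trunc_pow eta a (lift u r) - (picR v r + E 1 r * trunc_pow eta a (lift v r)))
          with ((picR u r - picR v r) + E 1 r * (trunc_pow eta a (lift u r) - trunc_pow eta a (lift v r))) by ring.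
        eapply Rle_trans; [apply Rabs_triang|]. rewrite Rmult_plus_distr_r. apply Rplus_le_compat.
        * apply picR_diff; auto; lra.
        * destruct (E1_bounds r ltac:(lra)) as [e1 e2]. rewrite Rabs_mult, (Rabs_pos_eq (E 1 r)) by lra.
          pose proof (trunc_pow_lip eta a (lift u r) (lift v r) heta a_range) as ht. fold La in ht.
          pose proof (lift_diff u v M r ltac:(lra) hM).
          apply Rle_trans with (1 * (La * (M * exp (lam * (r - t0))))); [|lra].
          apply Rmult_le_compat; try lra; [apply Rabs_pos|]. eapply Rle_trans; [exact ht|]. apply Rmult_le_compat_l; lra.
    - rewrite (RInt_minus (fun r => picR u r + E 1 r * trunc_pow eta a (lift u r)) (fun r => picR v r + E 1 r * trunc_pow eta a (lift v r)) t0 s)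
        by (apply cont_ex_RInt; now apply picW_int_cont).
      unfold minus, plus, opp; simpl. ring. }
  rewrite <- Rmult_minus_distr_l, Rabs_mult, (Rabs_pos_eq (exp _)) by (left; apply exp_pos).
  assert (hee : exp (- lam * (s - t0)) * exp (lam * (s - t0)) = 1).
  { rewrite <- exp_plus, <- exp_0. f_equal. ring. }
  apply Rle_trans with (exp (- lam * (s - t0)) * ((Lg * M / lam + La * M) / lam * exp (lam * (s - t0)))).
  - apply Rmult_le_compat_l; [left; apply exp_pos|auto].
  - replace (exp (- lam * (s - t0)) * ((Lg * M / lam + La * M) / lam * exp (lam * (s - t0)))) with ((Lg * M / lam + La * M) / lam)
      by (rewrite <- (Rmult_1_r ((Lg * M / lam + La * M) / lam)) at 1; rewrite <- hee; ring).
    assert (hl1 : 1 <= lam) by (unfold lam; lra).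
    assert (i1 : Lg * M / lam <= Lg * M).
    { unfold Rdiv. rewrite <- (Rmult_1_r (Lg * M)) at 2. apply Rmult_le_compat_l; [apply Rmult_le_pos; lra|].
      rewrite <- Rinv_1. apply Rinv_le_contravar; lra. }
    apply Rmult_le_reg_r with lam; [lra|]. unfold Rdiv at 1. rewrite Rmult_assoc, Rinv_l by lra.
    unfold lam at 2. nra.
Qed.

Lemma truncated_solution : exists W Rf : R -> R, W t0 = W0 /\ Rf t0 = R0 /\
  forall s, t0 <= s <= T -> is_derive W s (Rf s + E 1 s * trunc_pow eta a (W s)) /\
    is_derive Rf s (- A * Rf s + forcing s (W s)).
Proof.
  assert (hb : exists M0, 0 < M0 /\ forall s, t0 <= s <= T -> Rabs (pic_map (fun _ => 0) s) <= M0).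
  { apply continuous_Rabs_bound; [lra|]. intros s _. apply pic_map_cont. apply cont_const. }
  destruct hb as [M0 [hM0 hb]].
  destruct (contraction_fixed_point pic_map M0) as [u [hu fu]].
  - lra.
  - apply pic_map_cont.
  - intros u v M hu hv hM x. now apply pic_map_contract.
  - intros x. destruct (clip_bounds t0 T x ltac:(lra)) as [h1 h2].
    replace (pic_map (fun _ => 0) x) with (pic_map (fun _ => 0) (clip t0 T x)); [now apply hb|].
    unfold pic_map. now rewrite (clip_id t0 T (clip t0 T x)).
  - exists (picW u), (picR u).
    assert (e0 : picW u t0 = W0).
    { unfold picW. rewrite (RInt_point t0 (fun r => picR u r + E 1 r * trunc_pow eta a (lift u r))). unfold zero; simpl. ring. }
    split; auto. split.
    { unfold picR. rewrite (RInt_point t0 (fun r => exp (A * r) * forcing r (lift u r))). unfold zero; simpl.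
      rewrite Rplus_0_r, <- Rmult_assoc, <- exp_plus. replace (- A * t0 + A * t0) with 0 by ring. rewrite exp_0. ring. }
    intros s hs. assert (es : lift u s = picW u s).
    { unfold lift. rewrite <- fu. unfold pic_map. rewrite clip_id by auto. rewrite <- Rmult_assoc, <- exp_plus.
      replace (lam * (s - t0) + - lam * (s - t0)) with 0 by ring. rewrite exp_0. ring. }
    rewrite <- es. split; [now apply picW_derive|now apply picR_derive].
Qed.

End Picard.

(** * Continuous dependence on [k] *)

Section Shooting.
Context {c : coeffs}.

(** [tau] is chosen before [k], so that the orbits with [k <= K] live on one interval and can be
    compared at one time; beyond it the equation is regular. *)
Lemma head_exists (K t1 : R) : 0 <= K -> 0 < t1 -> exists tau, 0 < tau < t1 /\
  exists W P : R -> R -> R, forall k, 0 <= k <= K ->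
    orbit k 1 (W k) (P k) 0 tau /\ interface 1 (W k) (P k) 0 /\
    forall t eps, 0 < t < tau -> 0 < eps -> exists d, 0 < d /\
      forall k', 0 <= k' <= K -> Rabs (k' - k) < d -> Rabs (W k' t - W k t) < eps /\ Rabs (P k' t - P k t) < eps.
Proof.
  intros hK ht1. pose proof om_pos as ho. pose proof (C1_pos K hK) as hC. pose proof (G0_pos K hK) as hG.
  set (tau := Rmin (Rmin (t1 / 2) (/ (4 * om))) (Rmin (4 / 5) (Rmin (/ (2 * C1 K)) (/ (4 * G0 K))))).
  assert (i1 := Rmin_l (Rmin (t1 / 2) (/ (4 * om))) (Rmin (4 / 5) (Rmin (/ (2 * C1 K)) (/ (4 * G0 K))))).
  assert (i2 := Rmin_r (Rmin (t1 / 2) (/ (4 * om))) (Rmin (4 / 5) (Rmin (/ (2 * C1 K)) (/ (4 * G0 K))))).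
  fold tau in i1, i2.
  assert (i3 := Rmin_l (t1 / 2) (/ (4 * om))). assert (i4 := Rmin_r (t1 / 2) (/ (4 * om))).
  assert (i5 := Rmin_l (4 / 5) (Rmin (/ (2 * C1 K)) (/ (4 * G0 K)))). assert (i6 := Rmin_r (4 / 5) (Rmin (/ (2 * C1 K)) (/ (4 * G0 K)))).
  assert (i7 := Rmin_l (/ (2 * C1 K)) (/ (4 * G0 K))). assert (i8 := Rmin_r (/ (2 * C1 K)) (/ (4 * G0 K))).
  assert (htau : 0 < tau).
  { unfold tau. repeat apply Rmin_pos; try lra; apply Rinv_0_lt_compat; lra. }
  assert (h1 : om * tau <= / 4).
  { apply Rle_trans with (om * / (4 * om)); [apply Rmult_le_compat_l; lra|right; field; lra]. }
  assert (h3 : tau * C1 K <= / 2).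
  { apply Rle_trans with (/ (2 * C1 K) * C1 K); [apply Rmult_le_compat_r; lra|right; field; lra]. }
  assert (h4 : tau * G0 K <= / 4).
  { apply Rle_trans with (/ (4 * G0 K) * G0 K); [apply Rmult_le_compat_r; lra|right; field; lra]. }
  exists tau. split; [lra|].
  assert (hf : forall k, exists rho, 0 <= k <= K -> cont rho /\ forall x, head_map tau k rho x = rho x).
  { intros k. destruct (classic (0 <= k <= K)) as [hk|hk].
    - destruct (head_fixed_point tau K htau h1 ltac:(lra) hK h3 k hk) as [rho hr]. now exists rho.
    - exists (fun _ => 0). intros h; contradiction. }
  destruct (choice _ hf) as [rho hrho].
  exists (fun k => headW tau (rho k)), (fun k => headP tau (rho k)). intros k hk. destruct (hrho k hk) as [cr fr].
  split; [apply (head_orbit tau K); auto; lra|]. split; [apply (head_interface tau K htau h1 ltac:(lra) hK k); auto|].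
  intros t eps ht he.
  destruct (head_dependence tau K htau h1 ltac:(lra) hK h3 k (rho k) t eps hk cr fr ht he) as [d [hd hh]].
  exists d. split; auto. intros k' hk' hkk. destruct (hrho k' hk') as [cr' fr']. apply (hh k'); auto.
Qed.

Definition truncated (eta k : R) (W Rf : R -> R) (t0 T : R) :=
  forall s, t0 <= s <= T -> is_derive W s (Rf s + E 1 s * trunc_pow eta a (W s)) /\
    is_derive Rf s (- A * Rf s + forcing eta k s (W s)).

Definition flux (W P : R -> R) (s : R) := P s - E 1 s * Rpower (W s) a.
Definition unflux (W Rf : R -> R) (s : R) := Rf s + E 1 s * Rpower (W s) a.

Lemma EWa_derive (W : R -> R) s p : 0 < W s -> is_derive W s p ->
  is_derive (fun r => E 1 r * Rpower (W r) a) s (- om * E 1 s * Rpower (W s) a + E 1 s * (a * Rpower (W s) (a - 1)) * p).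
Proof.
  intros hp hd. apply (is_derive_eq _ _ _ _ (is_derive_mult _ _ _ _ _ (E_derive 1 s) (is_derive_Rpower_comp a W s p hp hd) Rmult_comm)).
  unfold plus, mult; simpl. ring.
Qed.

Lemma orbit_truncated eta k W P s0 s1 t0 T : 0 < eta -> orbit k 1 W P s0 s1 -> s0 < t0 -> T < s1 ->
  (forall s, t0 <= s <= T -> eta <= W s) -> truncated eta k W (flux W P) t0 T.
Proof.
  intros he o h0 hT hW s hs. destruct (o s ltac:(lra)) as [w1 [w2 w3]]. specialize (hW s hs).
  unfold forcing, trunc_pow. rewrite Rmax_left by lra. split.
  - apply (is_derive_eq _ _ _ _ w2). unfold flux. ring.
  - apply (is_derive_eq _ _ _ _ (is_derive_minus _ _ _ _ _ w3 (EWa_derive W s _ w1 w2))).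
    unfold minus, plus, opp; simpl. unfold accel, flux. ring.
Qed.

Lemma truncated_orbit eta k W Rf t0 T : 0 < eta -> truncated eta k W Rf t0 T ->
  (forall s, t0 < s < T -> eta <= W s) -> orbit k 1 W (unflux W Rf) t0 T.
Proof.
  intros he h hW s hs. destruct (h s ltac:(lra)) as [w2 w3]. specialize (hW s hs).
  unfold forcing, trunc_pow in *. rewrite Rmax_left in * by lra. split; [lra|]. split; [exact w2|].
  apply (is_derive_eq _ _ _ _ (is_derive_plus _ _ _ _ _ w3 (EWa_derive W s _ ltac:(lra) w2))).
  unfold plus; simpl. unfold accel, unflux. ring.
Qed.

(** Gronwall for the sum of squares, the change of [k] entering as the inhomogeneity. [C] is fixed
    before [k'] and [W'], as continuous dependence requires. *)
Lemma truncated_dependence eta k W Rf t0 T K : 0 < eta -> 0 <= t0 -> t0 < T -> 0 <= k <= K -> truncated eta k W Rf t0 T ->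
  exists C, 0 < C /\ forall k' W' Rf', 0 <= k' <= K -> forall T', t0 <= T' <= T -> truncated eta k' W' Rf' t0 T' ->
    forall s, t0 <= s <= T' -> (W' s - W s) * (W' s - W s) + (Rf' s - Rf s) * (Rf' s - Rf s) <=
      C * ((W' t0 - W t0) * (W' t0 - W t0) + (Rf' t0 - Rf t0) * (Rf' t0 - Rf t0) + (k' - k) * (k' - k)).
Proof.
  intros he ht0 hT hk h.
  destruct (continuous_Rabs_bound (fun s => trunc_pow eta q (W s)) t0 T ltac:(lra)) as [Mq [hMq hq]].
  { intros s hs. apply (continuous_comp W (trunc_pow eta q)); [destruct (h s hs) as [h' _]; exact (derive_continuous _ _ _ h')|now apply trunc_pow_cont]. }
  pose proof (La_pos eta) as hLa. pose proof (Lg_pos eta K ltac:(lra)) as hLg. pose proof A_pos as hA.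
  set (lg := Lg eta K) in *. set (la := La eta) in *.
  set (C := 2 * (1 + la + A + lg) + 1). assert (hC : 1 <= C) by (unfold C; lra).
  exists ((1 + Mq * Mq) * exp (C * (T - t0))).
  assert (hpos : 0 < 1 + Mq * Mq) by nra.
  split; [apply Rmult_lt_0_compat; [auto|apply exp_pos]|].
  intros k' W' R' hk' T' hT' h' s hs.
  set (U := fun r => W' r - W r). set (V := fun r => R' r - Rf r).
  set (u := fun r => V r + E 1 r * (trunc_pow eta a (W' r) - trunc_pow eta a (W r))).
  set (v := fun r => - A * V r + (forcing eta k' r (W' r) - forcing eta k r (W r))).
  set (D := Mq * Mq * ((k' - k) * (k' - k))).
  assert (hD : 0 <= D) by (unfold D; apply Rmult_le_pos; [nra|apply Rle_0_sqr]).
  assert (G := Gronwall (fun r => U r * U r + V r * V r) (fun r => 2 * (U r * u r + V r * v r)) t0 s C D ltac:(lra) ltac:(lra)).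
  cbv beta in G. 
  assert (hG : U s * U s + V s * V s + D / C <= (U t0 * U t0 + V t0 * V t0 + D / C) * exp (C * (s - t0))).
  { apply G.
    - intros r hr. destruct (h r ltac:(lra)) as [w2 w3]. destruct (h' r ltac:(lra)) as [v2 v3].
      assert (dU : is_derive U r (u r)).
      { apply (is_derive_eq _ _ _ _ (is_derive_minus _ _ _ _ _ v2 w2)). unfold minus, plus, opp; simpl. unfold u, V. ring. }
      assert (dV : is_derive V r (v r)).
      { apply (is_derive_eq _ _ _ _ (is_derive_minus _ _ _ _ _ v3 w3)). unfold minus, plus, opp; simpl. unfold v, V. ring. }
      apply (is_derive_eq _ _ _ _ (is_derive_plus _ _ _ _ _ (is_derive_square _ _ _ dU) (is_derive_square _ _ _ dV))).
      unfold plus; simpl. ring.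
    - intros r hr. destruct (E1_bounds r ltac:(lra)) as [e1 e2].
      assert (hu : Rabs (u r) <= Rabs (V r) + la * Rabs (U r)).
      { unfold u. eapply Rle_trans; [apply Rabs_triang|]. apply Rplus_le_compat_l. rewrite Rabs_mult, (Rabs_pos_eq (E 1 r)) by lra.
        pose proof (trunc_pow_lip eta a (W' r) (W r) he a_range) as ht. fold la (U r) in ht. fold (La eta) in ht. fold la in ht.
        pose proof (Rabs_pos (trunc_pow eta a (W' r) - trunc_pow eta a (W r))). nra. }
      assert (hv : Rabs (v r) <= A * Rabs (V r) + lg * Rabs (U r) + Mq * Rabs (k' - k)).
      { unfold v. replace (- A * V r + (forcing eta k' r (W' r) - forcing eta k r (W r)))
          with (- A * V r + (forcing eta k' r (W' r) - forcing eta k' r (W r)) + trunc_pow eta q (W r) * (k' - k)) by (unfold forcing; ring).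
        eapply Rle_trans; [apply Rabs_triang|]. apply Rplus_le_compat.
        - eapply Rle_trans; [apply Rabs_triang|]. apply Rplus_le_compat.
          + rewrite Rabs_mult, Rabs_Ropp, (Rabs_pos_eq A) by lra. lra.
          + eapply Rle_trans; [apply (forcing_lip eta k' he); lra|]. fold (U r). apply Rmult_le_compat_r; [apply Rabs_pos|].
            unfold lg, Lg. apply Rplus_le_compat_r, Rplus_le_compat_l. apply Rmult_le_compat_r; [|lra].
            apply Rmult_le_pos; [pose proof q_range; lra|left; apply Rpower_pos].
        - rewrite Rabs_mult. apply Rmult_le_compat_r; [apply Rabs_pos|]. apply hq; lra. }
      assert (p1 : U r * u r <= Rabs (U r) * (Rabs (V r) + la * Rabs (U r))).
      { eapply Rle_trans; [apply Rle_abs|]. rewrite Rabs_mult. apply Rmult_le_compat_l; [apply Rabs_pos|auto]. }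
      assert (p2 : V r * v r <= Rabs (V r) * (A * Rabs (V r) + lg * Rabs (U r) + Mq * Rabs (k' - k))).
      { eapply Rle_trans; [apply Rle_abs|]. rewrite Rabs_mult. apply Rmult_le_compat_l; [apply Rabs_pos|auto]. }
      assert (e3 : U r * U r = Rabs (U r) * Rabs (U r)) by (rewrite <- Rabs_mult; symmetry; apply Rabs_pos_eq, Rle_0_sqr).
      assert (e4 : V r * V r = Rabs (V r) * Rabs (V r)) by (rewrite <- Rabs_mult; symmetry; apply Rabs_pos_eq, Rle_0_sqr).
      assert (e5 : D = (Mq * Rabs (k' - k)) * (Mq * Rabs (k' - k))).
      { unfold D. replace ((k' - k) * (k' - k)) with (Rabs (k' - k) * Rabs (k' - k)); [ring|].
        rewrite <- Rabs_mult; apply Rabs_pos_eq, Rle_0_sqr. }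
      rewrite e3, e4, e5. pose proof (Rabs_pos (U r)). pose proof (Rabs_pos (V r)). 
      set (x := Rabs (U r)) in *. set (y := Rabs (V r)) in *. set (z := Mq * Rabs (k' - k)) in *.
      assert (q1 : 2 * (x * y) <= x * x + y * y) by (pose proof (Rle_0_sqr (x - y)); unfold Rsqr in *; lra).
      assert (q2 : 2 * (y * z) <= y * y + z * z) by (pose proof (Rle_0_sqr (y - z)); unfold Rsqr in *; lra).
      assert (q3 : lg * (2 * (x * y)) <= lg * (x * x + y * y)) by (apply Rmult_le_compat_l; lra).
      assert (q4 : 0 <= la * (y * y)) by (apply Rmult_le_pos; nra).
      assert (q5 : 0 <= A * (x * x)) by (apply Rmult_le_pos; nra).
      assert (q6 : 0 <= lg * (x * x + y * y)) by (apply Rmult_le_pos; nra).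
      assert (q7 : 0 <= x * x) by nra. assert (q8 : 0 <= y * y) by nra.
      unfold C. lra. }
  fold (U s) (V s) (U t0) (V t0). set (I0 := U t0 * U t0 + V t0 * V t0) in *.
  assert (hI0 : 0 <= I0) by (unfold I0; pose proof (Rle_0_sqr (U t0)); pose proof (Rle_0_sqr (V t0)); unfold Rsqr in *; lra).
  assert (hDC : 0 <= D / C) by (apply Rmult_le_pos; [auto|left; apply Rinv_0_lt_compat; lra]).
  assert (hDC' : D / C <= D).
  { unfold Rdiv. rewrite <- (Rmult_1_r D) at 2. apply Rmult_le_compat_l; auto. rewrite <- Rinv_1. apply Rinv_le_contravar; lra. }
  assert (hexp : exp (C * (s - t0)) <= exp (C * (T - t0))).
  { destruct (Req_dec s T) as [->|]; [lra|]. left. apply exp_increasing. apply Rmult_lt_compat_l; lra. }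
  pose proof (exp_pos (C * (s - t0))).
  apply Rle_trans with ((I0 + D) * exp (C * (T - t0))).
  - apply Rle_trans with ((I0 + D / C) * exp (C * (s - t0))); [lra|]. apply Rmult_le_compat; lra.
  - rewrite (Rmult_comm (1 + Mq * Mq)), Rmult_assoc, (Rmult_comm (I0 + D)). apply Rmult_le_compat_l; [lra|].
    assert (0 <= (k' - k) * (k' - k)) by apply Rle_0_sqr. assert (0 <= Mq * Mq * I0) by (apply Rmult_le_pos; nra). unfold D. lra.
Qed.

Lemma truncated_unique eta k W Rf W' Rf' t0 T : 0 < eta -> 0 <= t0 -> t0 < T -> 0 <= k ->
  truncated eta k W Rf t0 T -> truncated eta k W' Rf' t0 T -> W t0 = W' t0 -> Rf t0 = Rf' t0 ->
  forall s, t0 <= s <= T -> W s = W' s /\ Rf s = Rf' s.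
Proof.
  intros he h0 hT hk h h' eW eR s hs.
  destruct (truncated_dependence eta k W Rf t0 T k he h0 hT ltac:(lra) h) as [C [hC hd]].
  specialize (hd k W' Rf' ltac:(lra) T ltac:(lra) h' s hs). rewrite eW, eR, !Rminus_diag in hd.
  rewrite !Rmult_0_l, !Rplus_0_r, Rmult_0_r in hd.
  pose proof (Rle_0_sqr (W' s - W s)). pose proof (Rle_0_sqr (Rf' s - Rf s)). unfold Rsqr in *. split; nra.
Qed.

Lemma glue k e W1 P1 W2 P2 s0 x0 x1 s1 : s0 <= x0 -> x0 < x1 -> x1 <= s1 ->
  orbit k e W1 P1 s0 x1 -> orbit k e W2 P2 x0 s1 ->
  (forall s, x0 < s < x1 -> W1 s = W2 s /\ P1 s = P2 s) ->
  exists W P, orbit k e W P s0 s1 /\ (forall s, s < x1 -> W s = W1 s /\ P s = P1 s) /\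
    (forall s, x0 < s -> W s = W2 s /\ P s = P2 s).
Proof.
  intros h0 hx h1 o1 o2 he. 
  set (W := fun s => if Rlt_dec s x1 then W1 s else W2 s). set (P := fun s => if Rlt_dec s x1 then P1 s else P2 s).
  assert (e1 : forall s, s < x1 -> W s = W1 s /\ P s = P1 s).
  { intros s hs. unfold W, P. destruct (Rlt_dec s x1); [auto|lra]. }
  assert (e2 : forall s, x0 < s -> W s = W2 s /\ P s = P2 s).
  { intros s hs. unfold W, P. destruct (Rlt_dec s x1); [apply he; lra|auto]. }
  exists W, P. split; auto. intros s hs. destruct (Rlt_le_dec s x1) as [l|l].
  - apply (orbit_ext k e W1 P1 W P s0 x1); auto. intros r hr. apply e1; lra. lra.
  - apply (orbit_ext k e W2 P2 W P x0 s1); auto. intros r hr. apply e2; lra. lra.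
Qed.

Definition shoot (k : R) (W P : R -> R) (T : R) := orbit k 1 W P 0 T /\ interface 1 W P 0.

Lemma interface_ext e W P W' P' s0 x : s0 < x -> (forall s, s0 < s < x -> W' s = W s /\ P' s = P s) ->
  interface e W P s0 -> interface e W' P' s0.
Proof.
  intros hx h hi eps he. destruct (hi eps he) as [d [hd hh]]. exists (Rmin d (x - s0)). split; [apply Rmin_pos; lra|].
  intros s hs. pose proof (Rmin_l d (x - s0)). pose proof (Rmin_r d (x - s0)).
  destruct (h s ltac:(lra)) as [-> ->]. apply hh; lra.
Qed.

(** On the overlap the given orbit stays above [eta], so it solves the truncated problem too;
    uniqueness for that problem lets the two pieces be glued. *)
Lemma continuation eta k W P T t0 x T' W' Rf' : 0 < eta -> 0 <= k -> 0 < t0 -> t0 < x -> x < T -> x < T' ->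
  shoot k W P T -> (forall s, t0 <= s <= x -> eta <= W s) ->
  truncated eta k W' Rf' t0 T' -> W' t0 = W t0 -> Rf' t0 = flux W P t0 -> (forall s, t0 < s < T' -> eta <= W' s) ->
  exists W2 P2, shoot k W2 P2 T' /\ (forall s, s < x -> W2 s = W s /\ P2 s = P s) /\
    (forall s, t0 < s -> W2 s = W' s /\ P2 s = unflux W' Rf' s).
Proof.
  intros he hk ht0 hx hxT hxT' [o i] hW h' eW eR hW'.
  assert (ht := orbit_truncated eta k W P 0 T t0 x he o ht0 hxT hW).
  assert (ht' : truncated eta k W' Rf' t0 x) by (intros s hs; apply h'; lra).
  assert (hu := truncated_unique eta k W (flux W P) W' Rf' t0 x he ltac:(lra) hx hk ht ht' ltac:(auto) ltac:(auto)).
  assert (o' := truncated_orbit eta k W' Rf' t0 T' he h' hW').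
  destruct (glue k 1 W P W' (unflux W' Rf') 0 t0 x T') as [W2 [P2 [g1 [g2 g3]]]]; auto; try lra.
  - apply (orbit_sub k 1 W P 0 T); auto; lra.
  - intros s hs. destruct (hu s ltac:(lra)) as [e1 e2]. split; auto. unfold unflux. rewrite <- e1, <- e2. unfold flux. ring.
  - exists W2, P2. split; [split; auto|auto]. apply (interface_ext 1 W P W2 P2 0 x); auto; [lra|]. intros s hs; apply g2; lra.
Qed.

Lemma positive_lower_bound k e W P s0 s1 x y : orbit k e W P s0 s1 -> s0 < x -> x <= y -> y < s1 ->
  exists m, 0 < m /\ forall s, x <= s <= y -> m <= W s.
Proof.
  intros o hx hxy hy. destruct (continuous_bounded_min W x y hxy) as [u [hu hm]].
  - intros s hs. eapply orbit_contW; eauto; lra.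
  - exists (W u). split; [apply o; lra|auto].
Qed.

(** Dependence on [k] is transferred from the fixed point near the edge to the truncated problem at
    [t0]. With [eta] half a lower bound of [W], a perturbation smaller than [eta] remains above
    [eta], so the truncated solution is a true orbit. *)
Lemma nearby_shoot k0 W P T t1 t2 eps : 0 <= k0 -> shoot k0 W P T -> 0 < t1 -> t1 <= t2 -> t2 < T -> 0 < eps ->
  exists d, 0 < d /\ forall k, 0 <= k -> Rabs (k - k0) < d ->
    exists W' P' T', t2 < T' /\ shoot k W' P' T' /\
      forall s, t1 <= s <= t2 -> Rabs (W' s - W s) < eps /\ Rabs (P' s - P s) < eps.
Proof.
  intros hk0 [o i] ht1 ht12 ht2 he. set (K := k0 + 1).
  destruct (head_exists K t1 ltac:(unfold K; lra) ht1) as [tau [htau [Wh [Ph hh]]]].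
  destruct (hh k0 ltac:(unfold K; lra)) as [oh [ih dh]].
  set (t0 := tau / 2). set (T' := (t2 + T) / 2).
  assert (hT' : t2 < T' < T) by (unfold T'; lra). assert (ht0 : 0 < t0 < tau) by (unfold t0; lra).
  assert (hun := interface_unique k0 1 (Wh k0) (Ph k0) W P 0 tau T ltac:(lra) hk0 ltac:(lra) ltac:(lra) oh ih o i t0 ltac:(lra) ltac:(lra) ltac:(lra)).
  destruct hun as [eW eP].
  destruct (positive_lower_bound k0 1 W P 0 T t0 T' o ltac:(lra) ltac:(lra) ltac:(lra)) as [m [hm hWm]].
  set (eta := m / 2). assert (heta : 0 < eta) by (unfold eta; lra).
  assert (htr : truncated eta k0 W (flux W P) t0 T').
  { apply (orbit_truncated eta k0 W P 0 T); auto; try lra. intros s hs. specialize (hWm s hs). unfold eta; lra. }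
  destruct (truncated_dependence eta k0 W (flux W P) t0 T' K heta ltac:(lra) ltac:(lra) ltac:(unfold K; lra) htr) as [C [hC hdep]].
  pose proof (La_pos eta) as hLa.
  set (e1 := Rmin eta (Rmin (eps / 2) (eps / (4 * (La eta + 1))))).
  assert (he1 : 0 < e1). { unfold e1. repeat apply Rmin_pos; try lra. apply Rdiv_lt_0_compat; lra. }
  assert (j1 : e1 <= eta) by apply Rmin_l.
  assert (j2 : e1 <= eps / 2) by (eapply Rle_trans; [apply Rmin_r|apply Rmin_l]).
  assert (j3 : e1 <= eps / (4 * (La eta + 1))) by (eapply Rle_trans; [apply Rmin_r|apply Rmin_r]).
  (* The three squares in [truncated_dependence] are at most [e2] each at [t0], and
     [3 C e2 < e1^2]. *)
  set (e2 := Rmin 1 (e1 * e1 / (4 * C))).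
  assert (he2 : 0 < e2). { unfold e2. apply Rmin_pos; [lra|]. apply Rdiv_lt_0_compat; [now apply Rmult_lt_0_compat|lra]. }
  assert (he21 : e2 <= 1) by apply Rmin_l. assert (he2C : e2 <= e1 * e1 / (4 * C)) by apply Rmin_r.
  assert (hW0 : 0 < W t0) by (apply o; lra).
  destruct (continuous_eps (fun w => Rpower w a) (W t0) (derive_continuous _ _ _ (is_derive_Rpower a (W t0) hW0)) (e2 / 2) ltac:(lra)) as [dw [hdw hpw]].
  destruct (dh t0 (Rmin (Rmin (e2 / 2) eta) dw) ht0) as [d [hd hclose]]. { repeat apply Rmin_pos; lra. }
  exists (Rmin d (Rmin 1 e2)). split; [repeat apply Rmin_pos; lra|]. intros k hk hkd.
  assert (l1 := Rmin_l d (Rmin 1 e2)). assert (l2 := Rmin_r d (Rmin 1 e2)). assert (l3 := Rmin_l 1 e2). assert (l4 := Rmin_r 1 e2).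
  assert (hkK : 0 <= k <= K). { apply Rabs_def2 in hkd. unfold K. lra. }
  destruct (hh k hkK) as [ok [ik _]]. destruct (hclose k hkK ltac:(lra)) as [cW cP].
  assert (l5 := Rmin_l (Rmin (e2 / 2) eta) dw). assert (l6 := Rmin_r (Rmin (e2 / 2) eta) dw).
  assert (l7 := Rmin_l (e2 / 2) eta). assert (l8 := Rmin_r (e2 / 2) eta).
  rewrite eW in cW. rewrite eP in cP.
  assert (hWk0 : eta < Wh k t0). { apply Rabs_def2 in cW. specialize (hWm t0 ltac:(lra)). unfold eta in *. lra. }
  destruct (truncated_solution eta t0 T' k (Wh k t0) (flux (Wh k) (Ph k) t0) heta ltac:(lra) ltac:(lra) hk) as [W1 [R1 [i1 [i2 h1]]]].
  assert (hR0 : Rabs (R1 t0 - flux W P t0) < e2).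
  { rewrite i2. unfold flux. replace (Ph k t0 - E 1 t0 * Rpower (Wh k t0) a - (P t0 - E 1 t0 * Rpower (W t0) a))
      with ((Ph k t0 - P t0) + E 1 t0 * (Rpower (W t0) a - Rpower (Wh k t0) a)) by ring.
    eapply Rle_lt_trans; [apply Rabs_triang|]. specialize (hpw (Wh k t0) ltac:(lra)). cbv beta in hpw.
    rewrite Rabs_mult, (Rabs_minus_sym (Rpower (W t0) a)). destruct (E1_bounds t0 ltac:(lra)) as [g1 g2].
    rewrite (Rabs_pos_eq (E 1 t0)) by lra. pose proof (Rabs_pos (Rpower (Wh k t0) a - Rpower (W t0) a)). nra. }
  assert (hall : forall s, t0 <= s <= T' -> Rabs (W1 s - W s) < e1 /\ Rabs (R1 s - flux W P s) < e1).
  { intros s hs. specialize (hdep k W1 R1 hkK T' ltac:(lra) h1 s hs).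
    assert (hx : (W1 t0 - W t0) * (W1 t0 - W t0) <= e2).
    { rewrite i1. replace ((Wh k t0 - W t0) * (Wh k t0 - W t0)) with (Rabs (Wh k t0 - W t0) * Rabs (Wh k t0 - W t0))
        by (rewrite <- Rabs_mult; apply Rabs_pos_eq, Rle_0_sqr).
      pose proof (Rabs_pos (Wh k t0 - W t0)). nra. }
    assert (hy : (R1 t0 - flux W P t0) * (R1 t0 - flux W P t0) <= e2).
    { replace ((R1 t0 - flux W P t0) * (R1 t0 - flux W P t0)) with (Rabs (R1 t0 - flux W P t0) * Rabs (R1 t0 - flux W P t0))
        by (rewrite <- Rabs_mult; apply Rabs_pos_eq, Rle_0_sqr).
      pose proof (Rabs_pos (R1 t0 - flux W P t0)). nra. }
    assert (hz : (k - k0) * (k - k0) <= e2).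
    { replace ((k - k0) * (k - k0)) with (Rabs (k - k0) * Rabs (k - k0)) by (rewrite <- Rabs_mult; apply Rabs_pos_eq, Rle_0_sqr).
      pose proof (Rabs_pos (k - k0)). nra. }
    assert (hb : C * ((W1 t0 - W t0) * (W1 t0 - W t0) + (R1 t0 - flux W P t0) * (R1 t0 - flux W P t0) + (k - k0) * (k - k0)) <= C * (3 * e2)).
    { apply Rmult_le_compat_l; lra. }
    assert (hc : C * (3 * e2) < e1 * e1).
    { apply Rle_lt_trans with (C * (3 * (e1 * e1 / (4 * C)))); [apply Rmult_le_compat_l; lra|].
      replace (C * (3 * (e1 * e1 / (4 * C)))) with (3 / 4 * (e1 * e1)) by (field; lra).
      assert (0 < e1 * e1) by (now apply Rmult_lt_0_compat). lra. }
    assert (sq : forall x, x * x < e1 * e1 -> Rabs x < e1).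
    { intros x hx'. apply Rsqr_lt_abs_0 in hx'. rewrite (Rabs_pos_eq e1) in hx' by lra. auto. }
    pose proof (Rle_0_sqr (W1 s - W s)). pose proof (Rle_0_sqr (R1 s - flux W P s)). unfold Rsqr in *.
    split; apply sq; lra. }
  assert (hW1 : forall s, t0 <= s <= T' -> eta <= W1 s).
  { intros s hs. destruct (hall s hs) as [hs1 _]. apply Rabs_def2 in hs1. specialize (hWm s hs). unfold eta in *. lra. }
  assert (hx : exists x, t0 < x < tau /\ forall s, t0 <= s <= x -> eta <= Wh k s).
  { destruct (continuous_eps (Wh k) t0 (orbit_contW k 1 (Wh k) (Ph k) 0 tau t0 ok ltac:(lra)) (Wh k t0 - eta) ltac:(lra)) as [dx [hdx hcx]].
    exists (t0 + Rmin (dx / 2) ((tau - t0) / 2)).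
    assert (g1 := Rmin_l (dx / 2) ((tau - t0) / 2)). assert (g2 := Rmin_r (dx / 2) ((tau - t0) / 2)).
    assert (g3 : 0 < Rmin (dx / 2) ((tau - t0) / 2)) by (apply Rmin_pos; lra).
    split; [lra|]. intros s hs. specialize (hcx s ltac:(apply Rabs_def1; lra)). apply Rabs_def2 in hcx. lra. }
  destruct hx as [x [hx hWx]].
  destruct (continuation eta k (Wh k) (Ph k) tau t0 x T' W1 R1) as [W2 [P2 [s1 [s2 s3]]]]; auto; try lra.
  - split; auto.
  - intros s hs. apply hW1; lra.
  - exists W2, P2, T'. split; [lra|]. split; auto. intros s hs. destruct (s3 s ltac:(lra)) as [-> ->].
    destruct (hall s ltac:(lra)) as [a1 a2]. split; [lra|]. unfold unflux.
    replace (R1 s + E 1 s * Rpower (W1 s) a - P s) with ((R1 s - flux W P s) + E 1 s * (Rpower (W1 s) a - Rpower (W s) a)) by (unfold flux; ring).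
    eapply Rle_lt_trans; [apply Rabs_triang|]. destruct (E1_bounds s ltac:(lra)) as [g1 g2].
    rewrite Rabs_mult, (Rabs_pos_eq (E 1 s)) by lra.
    assert (hlip : Rabs (Rpower (W1 s) a - Rpower (W s) a) <= La eta * Rabs (W1 s - W s)).
    { apply (Rpower_lip_above eta); auto; [apply a_range|apply hW1; lra|]. specialize (hWm s ltac:(lra)). unfold eta; lra. }
    assert (La eta * Rabs (W1 s - W s) <= La eta * (eps / (4 * (La eta + 1)))) by (apply Rmult_le_compat_l; lra).
    assert (La eta * (eps / (4 * (La eta + 1))) < eps / 2).
    { apply Rmult_lt_reg_r with (4 * (La eta + 1)); [lra|].
      replace (La eta * (eps / (4 * (La eta + 1))) * (4 * (La eta + 1))) with (La eta * eps) by (field; lra). nra. }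
    pose proof (Rabs_pos (Rpower (W1 s) a - Rpower (W s) a)). nra.
Qed.

End Shooting.

(** * The shooting dichotomy *)

Section Dichotomy.
Context {c : coeffs}.

Definition global (k : R) := exists W P, forall T, 0 < T -> shoot k W P T.
Definition dying (k : R) := exists W P T, 0 < T /\ shoot k W P T /\
  forall eps, 0 < eps -> exists d, 0 < d /\ forall s, 0 < s -> T - d < s < T -> W s < eps.

Lemma Rpower_sublinear w z : 0 < w -> 0 < z < 1 -> Rpower w z <= 1 + w.
Proof.
  intros hw hz. destruct (Rle_lt_dec w 1).
  - apply Rle_trans with (Rpower 1 z); [apply Rpower_le; lra|]. unfold Rpower. rewrite ln_1, Rmult_0_r, exp_0. lra.
  - apply Rle_trans with (Rpower w 1); [apply Rle_Rpower; lra|]. rewrite Rpower_1; lra.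
Qed.

(** In terms of [W] and the flux the equation has linear growth, since [W^q] and [W^a] are at most
    [1 + W]; so nothing blows up in finite time. The bound passes to [P], even if [W] tends to 0 and
    the coefficient [W^(a-1)] is unbounded. *)
Lemma shoot_speed_bounded k W P T t0 : 0 <= k -> 0 < t0 < T -> shoot k W P T ->
  exists M, 0 < M /\ forall s, t0 <= s < T -> Rabs (P s) <= M.
Proof.
  intros hk ht [o _]. pose proof A_pos as hA. pose proof B_pos as hB.
  set (m := Rabs (om - A)). assert (hm : 0 <= m) by apply Rabs_pos.
  set (C := 4 * (1 + A + B + k + m) + 1).
  set (Rf := flux W P).
  set (Gf := fun s => 1 + W s * W s + Rf s * Rf s).
  assert (hb : forall s, t0 <= s < T -> Gf s <= Gf t0 * exp (C * (T - t0))).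
  { intros s hs.
    assert (G := Gronwall Gf (fun r => 2 * W r * P r + 2 * Rf r * (- A * Rf r - B * W r + k * Rpower (W r) q + (om - A) * E 1 r * Rpower (W r) a))
       t0 s C 0 ltac:(lra) ltac:(unfold C; lra)).
    unfold Rdiv in G. rewrite !Rmult_0_l, !Rplus_0_r in G.
    assert (G1 : Gf s <= Gf t0 * exp (C * (s - t0))).
    { apply G.
      - intros r hr. destruct (o r ltac:(lra)) as [w1 [w2 w3]].
        assert (dR : is_derive Rf r (- A * Rf r - B * W r + k * Rpower (W r) q + (om - A) * E 1 r * Rpower (W r) a)).
        { apply (is_derive_eq _ _ _ _ (is_derive_minus _ _ _ _ _ w3 (EWa_derive W r _ w1 w2))).
          unfold minus, plus, opp; simpl. unfold accel, Rf, flux. ring. }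
        assert (d1 := is_derive_plus (fun _ => 1) _ r _ _ (is_derive_const 1 r) (is_derive_square _ _ _ w2)).
        apply (is_derive_eq _ _ _ _ (is_derive_plus _ _ _ _ _ d1 (is_derive_square _ _ _ dR))).
        unfold plus, zero; simpl. ring.
      - intros r hr. destruct (o r ltac:(lra)) as [w1 _]. destruct (E1_bounds r ltac:(lra)) as [e1 e2].
        assert (hq := Rpower_sublinear (W r) q w1 q_range). assert (ha := Rpower_sublinear (W r) a w1 a_range).
        pose proof (Rpower_pos (W r) q) as pq. pose proof (Rpower_pos (W r) a) as pa.
        assert (hP : P r = Rf r + E 1 r * Rpower (W r) a) by (unfold Rf, flux; ring).
        rewrite hP. set (x := W r) in *. set (y := Rf r) in *. set (ea := E 1 r * Rpower x a) in *.
        assert (hea : 0 <= ea <= 1 + x) by (unfold ea; nra).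
        set (wq := Rpower x q) in *. unfold Gf. fold x y.
        replace ((om - A) * E 1 r * Rpower x a) with ((om - A) * ea) by (unfold ea; ring).
        assert (q1 : 2 * x * (y + ea) <= 4 * (1 + x * x + y * y)).
        { assert (x * ea <= x * (1 + x)) by (apply Rmult_le_compat_l; lra). pose proof (Rle_0_sqr (x - y)). pose proof (Rle_0_sqr (x - 1)). unfold Rsqr in *. nra. }
        assert (q2 : 2 * y * (- A * y) <= 0) by (pose proof (Rle_0_sqr y); unfold Rsqr in *; nra).
        assert (q3 : 2 * y * (- B * x) <= 4 * B * (1 + x * x + y * y)).
        { assert (- (2 * (y * x)) <= x * x + y * y) by (pose proof (Rle_0_sqr (x + y)); unfold Rsqr in *; nra).
          assert (B * - (2 * (y * x)) <= B * (x * x + y * y)) by (apply Rmult_le_compat_l; lra).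
          assert (0 <= B * (x * x + y * y)) by (apply Rmult_le_pos; [lra|]; pose proof (Rle_0_sqr x); pose proof (Rle_0_sqr y); unfold Rsqr in *; lra). lra. }
        assert (gen : forall g, 0 <= g <= 1 + x -> 2 * Rabs y * g <= 4 * (1 + x * x + y * y)).
        { intros g hg. assert (hyy : y * y = Rabs y * Rabs y) by (rewrite <- Rabs_mult; symmetry; apply Rabs_pos_eq, Rle_0_sqr).
          rewrite hyy. pose proof (Rabs_pos y). set (z := Rabs y) in *.
          assert (z * g <= z * (1 + x)) by (apply Rmult_le_compat_l; lra). pose proof (Rle_0_sqr (z - 1)). pose proof (Rle_0_sqr (z - x)). unfold Rsqr in *. nra. }
        assert (q4 : 2 * y * (k * wq) <= 4 * k * (1 + x * x + y * y)).
        { assert (h1 := gen wq ltac:(lra)). assert (h2 : 2 * y * wq <= 2 * Rabs y * wq).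
          { apply Rmult_le_compat_r; [lra|]. pose proof (Rle_abs y). lra. }
          assert (k * (2 * y * wq) <= k * (4 * (1 + x * x + y * y))) by (apply Rmult_le_compat_l; lra). lra. }
        assert (q5 : 2 * y * ((om - A) * ea) <= 4 * m * (1 + x * x + y * y)).
        { assert (h1 := gen ea ltac:(lra)). 
          assert (h2 : y * (om - A) <= Rabs y * m) by (unfold m; rewrite <- Rabs_mult; apply Rle_abs).
          assert (y * (om - A) * ea <= Rabs y * m * ea) by (apply Rmult_le_compat_r; lra).
          assert (m * (2 * Rabs y * ea) <= m * (4 * (1 + x * x + y * y))) by (apply Rmult_le_compat_l; lra). lra. }
        assert (q6 : 0 <= A * (1 + x * x + y * y)) by (apply Rmult_le_pos; [lra|]; pose proof (Rle_0_sqr x); pose proof (Rle_0_sqr y); unfold Rsqr in *; lra).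
        assert (q7 : 0 <= x * x + y * y) by (pose proof (Rle_0_sqr x); pose proof (Rle_0_sqr y); unfold Rsqr in *; lra).
        unfold C. lra. }
    eapply Rle_trans; [exact G1|]. apply Rmult_le_compat_l.
    - unfold Gf. pose proof (Rle_0_sqr (W t0)). pose proof (Rle_0_sqr (Rf t0)). unfold Rsqr in *. lra.
    - left. apply exp_increasing. apply Rmult_lt_compat_l; [unfold C; lra|lra]. }
  set (M := Gf t0 * exp (C * (T - t0))) in *.
  assert (hM1 : 1 <= M).
  { specialize (hb t0 ltac:(lra)). unfold Gf in hb at 1. pose proof (Rle_0_sqr (W t0)). pose proof (Rle_0_sqr (Rf t0)). unfold Rsqr in *. lra. }
  exists (2 * M + 1). split; [lra|]. intros s hs. specialize (hb s hs). unfold Gf in hb.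
  destruct (o s ltac:(lra)) as [w1 _]. destruct (E1_bounds s ltac:(lra)) as [e1 e2].
  assert (ha := Rpower_sublinear (W s) a w1 a_range). pose proof (Rpower_pos (W s) a) as pa.
  replace (P s) with (Rf s + E 1 s * Rpower (W s) a) by (unfold Rf, flux; ring).
  assert (hx : W s <= M) by (pose proof (Rle_0_sqr (W s - 1)); pose proof (Rle_0_sqr (Rf s)); unfold Rsqr in *; nra).
  assert (hy : Rabs (Rf s) <= M).
  { assert (hyy : Rf s * Rf s = Rabs (Rf s) * Rabs (Rf s)) by (rewrite <- Rabs_mult; symmetry; apply Rabs_pos_eq, Rle_0_sqr).
    rewrite hyy in hb. pose proof (Rle_0_sqr (Rabs (Rf s) - 1)). pose proof (Rle_0_sqr (W s)). unfold Rsqr in *. nra. }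
  eapply Rle_trans; [apply Rabs_triang|]. rewrite (Rabs_pos_eq (E 1 s * _)); nra.
Qed.

(** Under a uniform lower bound the orbit coincides with a solution of the truncated problem, which
    exists on any interval and, by continuity, stays above [eta] a little beyond [T]. *)
Lemma shoot_extend k W P T m t0 : 0 <= k -> 0 < t0 < T -> shoot k W P T -> 0 < m ->
  (forall s, t0 <= s < T -> m <= W s) -> exists W' P' T', T < T' /\ shoot k W' P' T'.
Proof.
  intros hk ht [o i] hm hW. set (eta := m / 2). assert (heta : 0 < eta) by (unfold eta; lra).
  destruct (truncated_solution eta t0 (T + 1) k (W t0) (flux W P t0) heta ltac:(lra) ltac:(lra) hk) as [W1 [R1 [i1 [i2 h1]]]].
  assert (heq : forall x, t0 < x < T -> forall s, t0 <= s <= x -> W s = W1 s /\ flux W P s = R1 s).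
  { intros x hx. apply (truncated_unique eta k W (flux W P) W1 R1 t0 x); auto; try lra.
    - apply (orbit_truncated eta k W P 0 T); auto; try lra. intros s hs. specialize (hW s ltac:(lra)). unfold eta; lra.
    - intros s hs. apply h1; lra. }
  assert (hc : continuous W1 T) by (destruct (h1 T ltac:(lra)) as [h' _]; exact (derive_continuous _ _ _ h')).
  destruct (continuous_eps W1 T hc (m / 4) ltac:(lra)) as [d [hd hh]].
  set (y := T - Rmin (d / 2) ((T - t0) / 2)).
  assert (g1 := Rmin_l (d / 2) ((T - t0) / 2)). assert (g2 := Rmin_r (d / 2) ((T - t0) / 2)).
  assert (g3 : 0 < Rmin (d / 2) ((T - t0) / 2)) by (apply Rmin_pos; lra).
  assert (hWT : 3 / 4 * m <= W1 T).
  { assert (h2 := hh y ltac:(unfold y; apply Rabs_def1; lra)). apply Rabs_def2 in h2.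
    destruct (heq ((y + T) / 2) ltac:(unfold y; lra) y ltac:(unfold y; lra)) as [e1 _].
    specialize (hW y ltac:(unfold y; lra)). lra. }
  set (T' := T + Rmin (d / 2) 1). assert (g4 := Rmin_l (d / 2) 1). assert (g5 := Rmin_r (d / 2) 1).
  assert (g6 : 0 < Rmin (d / 2) 1) by (apply Rmin_pos; lra).
  assert (hW1 : forall s, t0 < s < T' -> eta <= W1 s).
  { intros s hs. destruct (Rlt_le_dec s T) as [l|l].
    - destruct (heq ((s + T) / 2) ltac:(lra) s ltac:(lra)) as [e1 _]. rewrite <- e1. specialize (hW s ltac:(lra)). unfold eta; lra.
    - specialize (hh s ltac:(unfold T' in hs; apply Rabs_def1; lra)). apply Rabs_def2 in hh. unfold eta; lra. }
  destruct (continuation eta k W P T t0 ((t0 + T) / 2) T' W1 R1) as [W2 [P2 [s1 _]]]; auto; try (unfold T'; lra).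
  - split; auto.
  - intros s hs. specialize (hW s ltac:(lra)). unfold eta; lra.
  - intros s hs. apply h1; unfold T' in hs; lra.
  - exists W2, P2, T'. split; auto. unfold T'; lra.
Qed.

(* By uniqueness the orbits on different intervals agree, so they have a common extension. *)
Lemma maximal_shoot k (S : R -> Prop) : 0 <= k -> (forall T, S T -> 0 < T /\ exists W P, shoot k W P T) -> (exists T, S T) ->
  exists W P, forall T, S T -> shoot k W P T.
Proof.
  intros hk hS [T0 hT0].
  assert (hx : forall s, exists wp : R * R, (exists T, S T /\ 0 < s < T) -> exists T W P, S T /\ 0 < s < T /\ shoot k W P T /\ wp = (W s, P s)).
  { intros s. destruct (classic (exists T, S T /\ 0 < s < T)) as [[T [hT hs]]|hn].
    - destruct (hS T hT) as [_ [W [P h]]]. exists (W s, P s). intros _. now exists T, W, P.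
    - exists (0, 0). intros h; contradiction. }
  destruct (choice _ hx) as [F hF].
  set (W := fun s => fst (F s)). set (P := fun s => snd (F s)).
  assert (agree : forall T W1 P1, S T -> shoot k W1 P1 T -> forall s, 0 < s < T -> W s = W1 s /\ P s = P1 s).
  { intros T W1 P1 hT [o1 i1] s hs. destruct (hF s) as [T2 [W2 [P2 [h2 [hs2 [[o2 i2] e2]]]]]]; [now exists T|].
    unfold W, P. rewrite e2. simpl. 
    apply (interface_unique k 1 W2 P2 W1 P1 0 T2 T); auto; lra. }
  exists W, P. intros T hT. destruct (hS T hT) as [hT' [W1 [P1 [o1 i1]]]].
  assert (ag := agree T W1 P1 hT (conj o1 i1)). split.
  - apply (orbit_ext k 1 W1 P1); auto.
  - apply (interface_ext 1 W1 P1 W P 0 T); auto.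
Qed.

(** With a bounded speed, one value [W s >= eps] close to the maximal time [T] keeps [W] above
    [eps / 2] up to [T], where the orbit could be continued; so a finite [T] forces [W] to vanish
    there. *)
Lemma global_or_dying k : 0 <= k -> global k \/ dying k.
Proof.
  intros hk. set (S := fun T => 0 < T /\ exists W P, shoot k W P T).
  destruct (head_exists k 1 hk ltac:(lra)) as [tau [htau [Wh [Ph hh]]]]. destruct (hh k ltac:(lra)) as [oh [ih _]].
  assert (hS0 : S tau) by (split; [lra|]; exists (Wh k), (Ph k); split; auto).
  assert (down : forall T T', S T -> 0 < T' <= T -> S T').
  { intros T T' [hT [W [P [o i]]]] hT'. split; [lra|]. exists W, P. split; auto. apply (orbit_sub k 1 W P 0 T); auto; lra. }
  destruct (maximal_shoot k S hk) as [W [P hWP]]; auto. { now exists tau. }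
  destruct (classic (exists M, forall T, S T -> T <= M)) as [[M hM]|hn].
  - right. destruct (completeness S) as [T [hub hlub]]; [now exists M|now exists tau|].
    assert (hT : 0 < T) by (specialize (hub tau hS0); lra).
    assert (hlt : forall s, s < T -> exists T', S T' /\ s < T').
    { intros s hs. destruct (classic (exists T', S T' /\ s < T')) as [|hn]; auto. exfalso.
      assert (T <= s); [|lra]. apply hlub. intros T' hT'. destruct (Rle_lt_dec T' s); auto. exfalso. apply hn. now exists T'. }
    assert (sh : shoot k W P T).
    { split.
      - intros s hs. destruct (hlt s ltac:(lra)) as [T' [hT' hs']]. apply (proj1 (hWP T' hT')). lra.
      - apply (proj2 (hWP tau hS0)). }
    exists W, P, T. split; auto. split; auto. intros eps he.
    destruct (shoot_speed_bounded k W P T (T / 2) hk ltac:(lra) sh) as [MP [hMP hP]].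
    set (d := Rmin (T / 2) (eps / (2 * MP))).
    assert (d1 : d <= T / 2) by apply Rmin_l. assert (d2 : d <= eps / (2 * MP)) by apply Rmin_r.
    assert (hd : 0 < d). { unfold d. apply Rmin_pos; [lra|]. apply Rdiv_lt_0_compat; lra. }
    exists d. split; auto. intros s hs0 hs. destruct (Rlt_le_dec (W s) eps) as [|hle]; auto. exfalso.
    destruct (shoot_extend k W P T (eps / 2) s hk ltac:(lra) sh ltac:(lra)) as [W' [P' [T' [hT' sh']]]].
    + intros r hr. destruct (Req_dec s r) as [<-|]; [lra|].
      destruct (MVT_interval W P s r ltac:(lra)) as [t [ht e]]. { intros x hx. apply (proj1 sh). lra. }
      specialize (hP t ltac:(lra)). apply Rabs_le_between in hP.
      assert (MP * (r - s) <= MP * (eps / (2 * MP))) by (apply Rmult_le_compat_l; lra).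
      replace (MP * (eps / (2 * MP))) with (eps / 2) in H0 by (field; lra).
      assert (- MP * (r - s) <= P t * (r - s)) by (apply Rmult_le_compat_r; lra). lra.
    + assert (T' <= T); [|lra]. apply hub. split; [lra|]. now exists W', P'.
  - left. exists W, P. intros T hT. apply hWP.
    destruct (classic (exists T', S T' /\ T < T')) as [[T' [h1 h2]]|hn2].
    + apply (down T'); auto; lra.
    + exfalso. apply hn. exists T. intros T' hT'. destruct (Rle_lt_dec T' T); auto. exfalso. apply hn2. now exists T'.
Qed.

(* [W = C e^{-chi s}] corresponds to the flat solutions of u_t = - |x|^sigma u^p. *)
Definition chi := om / (q - a).

Lemma chi_pos : 0 < chi.
Proof. unfold chi. apply Rdiv_lt_0_compat; [apply om_pos|pose proof a_lt_q; lra]. Qed.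

Lemma chi_om : chi * (q - a) = om.
Proof. unfold chi. field. pose proof a_lt_q; lra. Qed.

Definition tailw (W : R -> R) (s : R) := exp (chi * s) * W s.
Definition tailz (W P : R -> R) (s : R) := exp (chi * s) * (P s + chi * W s).

Lemma tailw_derive k e W P s0 s1 s : orbit k e W P s0 s1 -> s0 < s < s1 -> is_derive (tailw W) s (tailz W P s).
Proof.
  intros o hs. destruct (o s hs) as [w1 [w2 w3]].
  assert (d : is_derive (fun r => exp (chi * r)) s (chi * exp (chi * s))) by (auto_derive; [auto|ring]).
  apply (is_derive_eq _ _ _ _ (is_derive_mult _ _ _ _ _ d w2 Rmult_comm)). unfold plus, mult; simpl. unfold tailz. ring.
Qed.

Lemma tailw_pow W s z : 0 < W s -> Rpower (tailw W s) z = exp (chi * z * s) * Rpower (W s) z.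
Proof.
  intros h. unfold tailw. rewrite Rpower_mult_base; [|apply exp_pos|auto]. f_equal.
  unfold Rpower. rewrite ln_exp. f_equal. ring.
Qed.

Definition b0 := chi * chi - A * chi + B.
Definition tail_source (k e w : R) := k * Rpower w q - e * chi * a * Rpower w a.

(** [chi (q - a) = om] is the choice for which absorption and drag carry the same growing factor
    [e^(chi (1-q) s)]. This factor dominates the other terms, which is why the zero of [tail_source]
    will be the limit of [tailw]. *)
Lemma tailz_derive k e W P s0 s1 s : orbit k e W P s0 s1 -> s0 < s < s1 ->
  is_derive (tailz W P) s ((2 * chi - A) * tailz W P s - b0 * tailw W s
    + exp (chi * (1 - q) * s) * (tail_source k e (tailw W s) + e * a * Rpower (tailw W s) (a - 1) * tailz W P s)).
Proof.
  intros o hs. destruct (o s hs) as [w1 [w2 w3]].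
  assert (d : is_derive (fun r => exp (chi * r)) s (chi * exp (chi * s))) by (auto_derive; [auto|ring]).
  assert (d2 := is_derive_plus _ _ _ _ _ w3 (is_derive_scal W s chi _ w2)).
  apply (is_derive_eq _ _ _ _ (is_derive_mult _ _ _ _ _ d d2 Rmult_comm)). unfold plus, mult, scal; simpl. unfold mult; simpl.
  unfold tail_source. rewrite !tailw_pow by auto. unfold tailz, tailw, accel, E, b0.
  replace (exp (chi * s)) with (exp (chi * (1 - q) * s) * exp (chi * q * s)) by (rewrite <- exp_plus; f_equal; ring).
  assert (e1 : exp (chi * a * s) = exp (chi * q * s) * exp (- om * s)).
  { rewrite <- exp_plus. f_equal. rewrite <- chi_om. ring. }
  assert (e2 : exp (chi * (a - 1) * s) * (exp (chi * (1 - q) * s) * exp (chi * q * s)) = exp (chi * q * s) * exp (- om * s)).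
  { rewrite <- !exp_plus. f_equal. rewrite <- chi_om. ring. }
  rewrite e1. rewrite <- (Rpower_succ (W s) a w1).
  set (X := exp (chi * (1 - q) * s)) in *. set (Y := exp (chi * q * s)) in *. set (Z := exp (- om * s)) in *.
  set (V := exp (chi * (a - 1) * s)) in *. set (Pa := Rpower (W s) (a - 1)). set (Pq := Rpower (W s) q).
  transitivity ((2 * chi - A) * (X * Y * (P s + chi * W s)) - (chi * chi - A * chi + B) * (X * Y * W s)
    + X * (k * (Y * Pq) - e * chi * a * (Y * Z * (Pa * W s)) + e * a * Pa * (P s + chi * W s) * (V * (X * Y)))).
  - rewrite e2. ring.
  - ring.
Qed.

(* Below the level [d] of the tail variable the descent is irreversible. *)
Definition fatal (K d : R) := 0 < d /\ A <= a * Rpower d (a - 1) /\ K * Rpower d (q - a) <= chi * a / 2 /\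
  Rabs b0 * Rpower d (1 - a) <= chi * a / 2.

Lemma fatal_exists K : 0 <= K -> exists d, fatal K d.
Proof.
  intros hK. pose proof a_pos as ha. pose proof a_lt_q. pose proof q_lt_1. pose proof chi_pos as hc. pose proof (Rabs_pos b0).
  assert (hca : 0 < chi * a) by (now apply Rmult_lt_0_compat).
  assert (X1: a - 1 < 0) by lra. destruct (Rpower_large (a - 1) (A / a) X1) as [d1 [hd1 h1]].
  assert (X2 : 0 < q - a) by lra. assert (X3 : 0 < 1 - a) by lra.
  assert (X4 : 0 < chi * a / 2 / (K + 1)) by (apply Rdiv_lt_0_compat; lra).
  assert (X5 : 0 < chi * a / 2 / (Rabs b0 + 1)) by (apply Rdiv_lt_0_compat; lra).
  destruct (Rpower_small _ _ X2 X4) as [d2 [hd2 h2]]. destruct (Rpower_small _ _ X3 X5) as [d3 [hd3 h3]].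
  set (d := Rmin d1 (Rmin d2 d3) / 2).
  assert (g1 := Rmin_l d1 (Rmin d2 d3)). assert (g2 := Rmin_r d1 (Rmin d2 d3)).
  assert (g3 := Rmin_l d2 d3). assert (g4 := Rmin_r d2 d3). assert (g5 : 0 < Rmin d1 (Rmin d2 d3)) by (repeat apply Rmin_pos; lra).
  assert (hd : 0 < d < d1 /\ d < d2 /\ d < d3) by (unfold d; lra).
  exists d. split; [lra|]. split; [|split].
  - specialize (h1 d ltac:(lra) ltac:(lra)). apply Rle_trans with (a * (A / a)); [right; field; lra|apply Rmult_le_compat_l; lra].
  - specialize (h2 d ltac:(lra) ltac:(lra)). pose proof (Rpower_pos d (q - a)).
    apply Rle_trans with ((K + 1) * (chi * a / 2 / (K + 1))); [apply Rmult_le_compat; lra|right; field; lra].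
  - specialize (h3 d ltac:(lra) ltac:(lra)). pose proof (Rpower_pos d (1 - a)).
    apply Rle_trans with ((Rabs b0 + 1) * (chi * a / 2 / (Rabs b0 + 1))); [apply Rmult_le_compat; lra|right; field; lra].
Qed.

(** One half of [chi a w^a] absorbs the term with [k], the other half the term with [b0];
    [A <= a w^(a-1)] gives the coefficient of [z] its sign, and the exponential factor, at least 1,
    only strengthens the dominant terms. *)
Lemma fatal_source K d k s w z : fatal K d -> 0 <= k <= K -> 0 <= s -> 0 < w -> w <= d -> z <= 0 ->
  (2 * chi - A) * z - b0 * w + exp (chi * (1 - q) * s) * (tail_source k 1 w + 1 * a * Rpower w (a - 1) * z) <= 0.
Proof.
  intros [hd [f1 [f2 f3]]] hk hs hw hwd hz. pose proof a_range. pose proof a_lt_q. pose proof q_lt_1. pose proof chi_pos.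
  assert (hX : 1 <= exp (chi * (1 - q) * s)).
  { rewrite <- exp_0 at 1. assert (0 <= chi * (1 - q) * s) by (apply Rmult_le_pos; [apply Rmult_le_pos; lra|lra]).
    destruct H3 as [h|h]; [left; now apply exp_increasing|rewrite h; lra]. }
  set (X := exp (chi * (1 - q) * s)) in *.
  assert (h1 : Rpower d (a - 1) <= Rpower w (a - 1)) by (apply Rpower_le_neg; lra).
  assert (h2 : Rpower w (q - a) <= Rpower d (q - a)) by (apply Rpower_le; lra).
  assert (h3 : Rpower w (1 - a) <= Rpower d (1 - a)) by (apply Rpower_le; lra).
  assert (eq' : Rpower w q = Rpower w a * Rpower w (q - a)) by (rewrite <- Rpower_plus; f_equal; ring).
  assert (e1 : w = Rpower w a * Rpower w (1 - a)).
  { rewrite <- Rpower_plus. replace (a + (1 - a)) with 1 by ring. now rewrite Rpower_1. }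
  pose proof (Rpower_pos w a) as pa. pose proof (Rpower_pos w (q - a)). pose proof (Rpower_pos w (1 - a)). pose proof (Rpower_pos w (a - 1)).
  assert (t1 : A <= a * Rpower w (a - 1)). { apply Rle_trans with (a * Rpower d (a - 1)); auto. apply Rmult_le_compat_l; lra. }
  assert (t2 : k * Rpower w (q - a) <= chi * a / 2). { apply Rle_trans with (K * Rpower d (q - a)); auto. apply Rmult_le_compat; lra. }
  assert (t3 : - b0 * Rpower w (1 - a) <= chi * a / 2).
  { apply Rle_trans with (Rabs b0 * Rpower d (1 - a)); auto. apply Rle_trans with (Rabs b0 * Rpower w (1 - a)).
    - apply Rmult_le_compat_r; [lra|]. assert (hb := Rle_abs (- b0)). rewrite Rabs_Ropp in hb. exact hb.
    - apply Rmult_le_compat_l; auto. apply Rabs_pos. }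
  assert (s1 : tail_source k 1 w <= - (chi * a / 2) * Rpower w a).
  { unfold tail_source. rewrite eq'. nra. }
  assert (s2 : - b0 * w <= chi * a / 2 * Rpower w a).
  { rewrite e1 at 1. replace (- b0 * (Rpower w a * Rpower w (1 - a))) with (- b0 * Rpower w (1 - a) * Rpower w a) by ring.
    apply Rmult_le_compat_r; lra. }
  assert (s3 : X * tail_source k 1 w <= tail_source k 1 w).
  { assert (tail_source k 1 w <= 0). { assert (0 < chi * a) by (apply Rmult_lt_0_compat; lra). assert (0 <= chi * a / 2 * Rpower w a) by (apply Rmult_le_pos; lra). lra. } nra. }
  assert (s4 : X * (1 * a * Rpower w (a - 1) * z) <= a * Rpower w (a - 1) * z).
  { assert (0 < a * Rpower w (a - 1)) by (apply Rmult_lt_0_compat; lra).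
    assert (hneg : a * Rpower w (a - 1) * z <= 0) by nra. clear - hX hneg. nra. }
  assert (s5 : (2 * chi - A) * z + a * Rpower w (a - 1) * z <= 0).
  { replace ((2 * chi - A) * z + a * Rpower w (a - 1) * z) with ((2 * chi + (a * Rpower w (a - 1) - A)) * z) by ring. nra. }
  lra.
Qed.

Definition tail_accel (k s w z : R) :=
  (2 * chi - A) * z - b0 * w + exp (chi * (1 - q) * s) * (tail_source k 1 w + 1 * a * Rpower w (a - 1) * z).

(** As long as [w <= d] and [z < 0], the velocity [z] decreases, so the tail variable falls at least
    at its rate at time [s] and would be exhausted after the time [w / (- z)]; an orbit is positive,
    hence ends before. *)
Lemma irreversible_descent d k W P T s : orbit k 1 W P 0 T ->
  (forall r w z, s <= r < T -> 0 < w <= d -> z <= 0 -> tail_accel k r w z <= 0) -> 0 < s < T ->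
  tailw W s <= d -> tailz W P s < 0 -> T <= s + tailw W s / - tailz W P s.
Proof.
  intros o hf hs hw hz.
  assert (pos : forall r, 0 < r < T -> 0 < tailw W r).
  { intros r hr. apply Rmult_lt_0_compat; [apply exp_pos|apply o; auto]. }
  assert (hall : forall r, s <= r < T -> tailz W P r <= tailz W P s / 2 /\ tailw W r <= d).
  (* The threshold is half of [tailz W P s], so that a first crossing strictly contradicts the
     monotonicity up to it. *)
  { intros r hr. set (f := fun x => tailz W P s / 2 - tailz W P x).
    assert (neg : forall x, s <= x <= r -> 0 < f x).
    { intros x hx. destruct (Rlt_le_dec 0 (f x)) as [|hle]; auto. exfalso.
      assert (f0 : 0 < f s) by (unfold f; lra). assert (s <> x) by (intros <-; lra).
      destruct (first_zero f s x) as [y [hy [ey py]]]; try lra.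
      { intros t ht. apply (continuous_minus (fun _ => tailz W P s / 2) (tailz W P)); [apply continuous_const|].
        eapply derive_continuous, tailz_derive; [exact o|lra]. }
      assert (hwy : forall t, s <= t <= y -> tailw W t <= d).
      { intros t ht. apply Rle_trans with (tailw W s); auto.
        apply (decr_of_derive (tailw W) (tailz W P)); [lra| |].
        - intros u hu. apply (tailw_derive k 1 W P 0 T); auto; lra.
        - intros u hu. destruct (Req_dec u y) as [->|]; [unfold f in ey; lra|]. specialize (py u ltac:(lra)). unfold f in py. lra. }
      assert (tailz W P y <= tailz W P s); [|unfold f in ey; lra].
      apply (decr_of_derive (tailz W P) (fun u => tail_accel k u (tailw W u) (tailz W P u))); [lra| |].
      - intros u hu. apply (tailz_derive k 1 W P 0 T); auto; lra.
      - intros u hu. apply hf; [lra|split; [apply pos; lra|apply hwy; lra]|].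
        destruct (Req_dec u y) as [->|]; [unfold f in ey; lra|]. specialize (py u ltac:(lra)). unfold f in py. lra. }
    split; [specialize (neg r ltac:(lra)); unfold f in neg; lra|].
    apply Rle_trans with (tailw W s); auto.
    apply (decr_of_derive (tailw W) (tailz W P)); [lra| |].
    - intros u hu. apply (tailw_derive k 1 W P 0 T); auto; lra.
    - intros u hu. specialize (neg u hu). unfold f in neg. lra. }
  destruct (Rle_lt_dec T (s + tailw W s / - tailz W P s)) as [|hlt]; auto. exfalso.
  set (r := s + tailw W s / - tailz W P s) in *. assert (hp := pos s hs).
  assert (hr : s < r). { unfold r. assert (0 < tailw W s / - tailz W P s) by (apply Rdiv_lt_0_compat; lra). lra. }
  assert (hzz : forall u, s <= u <= r -> tailz W P u <= tailz W P s).
  { intros u hu. apply (decr_of_derive (tailz W P) (fun u => tail_accel k u (tailw W u) (tailz W P u))); [lra| |].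
    - intros v hv. apply (tailz_derive k 1 W P 0 T); auto; lra.
    - intros v hv. destruct (hall v ltac:(lra)). apply hf; [lra|split; [apply pos; lra|auto]|lra]. }
  destruct (MVT_interval (tailw W) (tailz W P) s r hr) as [u [hu eu]].
  { intros v hv. apply (tailw_derive k 1 W P 0 T); auto; lra. }
  specialize (hzz u hu). assert (hpr := pos r ltac:(lra)).
  assert (tailz W P u * (r - s) <= tailz W P s * (r - s)) by (apply Rmult_le_compat_r; lra).
  assert (tailz W P s * (r - s) = - tailw W s) by (unfold r; field; lra). lra.
Qed.

Lemma fatal_descent K d k W P T s : fatal K d -> 0 <= k <= K -> shoot k W P T -> 0 < s < T ->
  tailw W s <= d -> tailz W P s < 0 -> T <= s + tailw W s / - tailz W P s.
Proof.
  intros hf hk [o _] hs. apply irreversible_descent with k; auto.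
  intros r w z hr hw hz. apply (fatal_source K d); auto; lra.
Qed.

Lemma dying_fatal k W P T d : 0 < T -> shoot k W P T -> 0 < d ->
  (forall eps, 0 < eps -> exists d, 0 < d /\ forall s, 0 < s -> T - d < s < T -> W s < eps) ->
  exists s, 0 < s < T /\ tailw W s < d /\ tailz W P s < 0.
Proof.
  intros hT [o i] hd hlim.
  assert (hX : 0 < exp (chi * T)) by apply exp_pos.
  assert (hw : forall eps, 0 < eps -> exists x, 0 < x < T /\ forall s, x < s < T -> tailw W s < eps).
  { intros eps he. destruct (hlim (eps / exp (chi * T)) ltac:(apply Rdiv_lt_0_compat; auto)) as [dd [hdd hh]].
    exists (Rmax (T / 2) (T - dd)). assert (g1 := Rmax_l (T / 2) (T - dd)). assert (g2 := Rmax_r (T / 2) (T - dd)).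
    split; [split; [lra|apply Rmax_lub_lt; lra]|]. intros s hs. specialize (hh s ltac:(lra) ltac:(lra)).
    unfold tailw. assert (exp (chi * s) < exp (chi * T)) by (apply exp_increasing; pose proof chi_pos; nra).
    assert (0 < W s) by (apply o; lra). pose proof (exp_pos (chi * s)).
    apply Rlt_trans with (exp (chi * T) * W s); [apply Rmult_lt_compat_r; auto|].
    apply Rlt_le_trans with (exp (chi * T) * (eps / exp (chi * T))); [apply Rmult_lt_compat_l; auto|right; field; lra]. }
  destruct (hw d hd) as [x [hx hxd]].
  set (y := (x + T) / 2). assert (hy : x < y < T) by (unfold y; lra).
  assert (hpy : 0 < tailw W y). { apply Rmult_lt_0_compat; [apply exp_pos|apply o; lra]. }
  destruct (hw (tailw W y) hpy) as [x2 [hx2 hxd2]].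
  set (t := (Rmax y x2 + T) / 2). assert (g1 := Rmax_l y x2). assert (g2 := Rmax_r y x2).
  assert (g3 : Rmax y x2 < T) by (apply Rmax_lub_lt; lra).
  assert (ht : y < t < T /\ x2 < t) by (unfold t; lra).
  destruct (MVT_interval (tailw W) (tailz W P) y t ltac:(lra)) as [s [hs es]].
  { intros v hv. apply (tailw_derive k 1 W P 0 T); auto; lra. }
  exists s. split; [lra|]. split; [apply hxd; lra|]. specialize (hxd2 t ltac:(lra)).
  destruct (Rlt_le_dec (tailz W P s) 0) as [|hle]; auto. exfalso.
  assert (0 <= tailz W P s * (t - y)) by (apply Rmult_le_pos; lra). lra.
Qed.

Lemma global_not_fatal k W P K d s : 0 <= k <= K -> fatal K d -> (forall T, 0 < T -> shoot k W P T) -> 0 < s ->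
  tailw W s <= d -> 0 <= tailz W P s.
Proof.
  intros hk hf h hs hw. destruct (Rle_lt_dec 0 (tailz W P s)) as [|hlt]; auto. exfalso.
  assert (hpos : 0 < tailw W s).
  { apply Rmult_lt_0_compat; [apply exp_pos|apply (proj1 (h (s + 1) ltac:(lra))); lra]. }
  assert (hq : 0 < tailw W s / - tailz W P s) by (apply Rdiv_lt_0_compat; lra).
  set (T := s + tailw W s / - tailz W P s + 1). assert (hT : s < T) by (unfold T; lra).
  assert (h1 := fatal_descent K d k W P T s hf hk (h T ltac:(lra)) ltac:(lra) hw hlt). unfold T in h1. lra.
Qed.

(** Death happens at the end of a maximal interval and is not visibly stable. But it is announced at
    an earlier time by [tailw < d0] and [tailz < 0]: two strict inequalities at one time, which
    persist under small changes of [k] and are fatal. *)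
Lemma dying_open k0 : 0 <= k0 -> dying k0 -> exists d, 0 < d /\ forall k, 0 <= k -> Rabs (k - k0) < d -> dying k.
Proof.
  intros hk0 [W [P [T [hT [sh hlim]]]]].
  destruct (fatal_exists (k0 + 1) ltac:(lra)) as [d0 hf].
  destruct (dying_fatal k0 W P T d0 hT sh (proj1 hf) hlim) as [s [hs [hw hz]]].
  set (X := exp (chi * s)) in *. assert (hX : 0 < X) by apply exp_pos. pose proof chi_pos as hc.
  unfold tailw, tailz in hw, hz. fold X in hw, hz.
  set (eps := Rmin ((d0 - X * W s) / X) (- (P s + chi * W s) / (2 * (1 + chi)))).
  assert (hz' : P s + chi * W s < 0). { destruct (Rlt_le_dec (P s + chi * W s) 0); auto. exfalso. nra. }
  assert (he : 0 < eps). { unfold eps. apply Rmin_pos; apply Rdiv_lt_0_compat; lra. }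
  assert (he1 : eps <= (d0 - X * W s) / X) by apply Rmin_l.
  assert (he2 : eps <= - (P s + chi * W s) / (2 * (1 + chi))) by apply Rmin_r.
  destruct (nearby_shoot k0 W P T s s eps hk0 sh ltac:(lra) ltac:(lra) ltac:(lra) he) as [d [hd hh]].
  exists (Rmin d 1). split; [apply Rmin_pos; lra|]. intros k hk hkd.
  assert (m1 := Rmin_l d 1). assert (m2 := Rmin_r d 1).
  destruct (global_or_dying k hk) as [[W2 [P2 hg]]|]; auto. exfalso.
  destruct (hh k hk ltac:(lra)) as [W1 [P1 [T1 [hT1 [[o1 i1] hcl]]]]]. destruct (hcl s ltac:(lra)) as [cW cP].
  destruct (hg T1 ltac:(lra)) as [o2 i2].
  destruct (interface_unique k 1 W2 P2 W1 P1 0 T1 T1 ltac:(lra) hk ltac:(lra) ltac:(lra) o2 i2 o1 i1 s ltac:(lra) ltac:(lra) ltac:(lra)) as [eW eP].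
  assert (hkk : 0 <= k <= k0 + 1) by (apply Rabs_def2 in hkd; lra).
  assert (h := global_not_fatal k W2 P2 (k0 + 1) d0 s hkk hf hg ltac:(lra)).
  unfold tailw, tailz in h. rewrite eW, eP in h. fold X in h.
  apply Rabs_def2 in cW. apply Rabs_def2 in cP.
  assert (h1 : X * W1 s <= d0).
  { assert (X * (W1 s - W s) <= X * ((d0 - X * W s) / X)) by (apply Rmult_le_compat_l; lra).
    replace (X * ((d0 - X * W s) / X)) with (d0 - X * W s) in H by (field; lra). lra. }
  specialize (h h1).
  assert (P1 s + chi * W1 s < 0).
  { assert (chi * (W1 s - W s) <= chi * eps) by (apply Rmult_le_compat_l; lra).
    assert ((1 + chi) * eps <= (1 + chi) * (- (P s + chi * W s) / (2 * (1 + chi)))) by (apply Rmult_le_compat_l; lra).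
    replace ((1 + chi) * (- (P s + chi * W s) / (2 * (1 + chi)))) with (- (P s + chi * W s) / 2) in H0 by (field; lra). lra. }
  nra.
Qed.

End Dichotomy.

(** * Small and large values of [k] *)

Lemma barrier_below (f df : R -> R) (t s v : R) : t <= s -> (forall x, t <= x <= s -> is_derive f x (df x)) ->
  v <= f t -> (forall x, t <= x <= s -> f x = v -> 0 < df x) -> v <= f s.
Proof.
  intros hts hd h0 hb. destruct (Rle_lt_dec v (f s)) as [|hlt]; auto. exfalso.
  assert (t < s). { destruct (Req_dec t s) as [e|]; [rewrite e in h0|]; lra. }
  destruct (last_zero (fun x => v - f x) t s) as [x [hx [ex px]]]; try lra.
  { intros x hx. apply (continuous_minus (fun _ => v) f); [apply continuous_const|]. eapply derive_continuous, hd; auto. }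
  specialize (hb x ltac:(lra) ltac:(lra)).
  destruct (derive_pos_right f x (df x) (hd x ltac:(lra)) hb) as [d [hdd [h1 _]]].
  set (y := x + Rmin (d / 2) ((s - x) / 2)).
  assert (g1 := Rmin_l (d / 2) ((s - x) / 2)). assert (g2 := Rmin_r (d / 2) ((s - x) / 2)).
  assert (g3 : 0 < Rmin (d / 2) ((s - x) / 2)) by (apply Rmin_pos; lra).
  specialize (h1 y ltac:(unfold y; lra)). specialize (px y ltac:(unfold y; lra)). lra.
Qed.

Section Extremes.
Context {c : coeffs}.

Lemma E_small e eps : 0 < e -> 0 < eps -> exists s1, 0 < s1 /\ forall s, s1 <= s -> E e s < eps.
Proof.
  intros he hp. pose proof om_pos as ho. exists (Rmax 1 (e / (eps * om))).
  split; [pose proof (Rmax_l 1 (e / (eps * om))); lra|]. intros s hs.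
  assert (h1 := Rmax_l 1 (e / (eps * om))). assert (h2 := Rmax_r 1 (e / (eps * om))).
  unfold E. replace (- om * s) with (- (om * s)) by ring. rewrite exp_Ropp.
  assert (h3 := exp_ineq1_le (om * s)). pose proof (exp_pos (om * s)).
  assert (h4 : e / eps <= om * s).
  { apply Rle_trans with (om * (e / (eps * om))); [right; field; lra|apply Rmult_le_compat_l; lra]. }
  apply Rmult_lt_reg_r with (exp (om * s)); auto. rewrite Rmult_assoc, Rinv_l by lra.
  assert (e / eps * eps = e) by (field; lra). nra.
Qed.

Definition slope (W P : R -> R) (s : R) := - P s / W s.
Definition drag (e : R) (W : R -> R) (s : R) := E e s * (a * Rpower (W s) (a - 1)).

Lemma drag_pos e W s : 0 < e -> 0 < drag e W s.
Proof.
  intros he. apply Rmult_lt_0_compat; [now apply E_pos|]. apply Rmult_lt_0_compat; [apply a_pos|apply Rpower_pos].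
Qed.

Lemma slope_derive e W P s0 s1 s : orbit 0 e W P s0 s1 -> s0 < s < s1 ->
  is_derive (slope W P) s (slope W P s * slope W P s - A * slope W P s + B + drag e W s * slope W P s).
Proof.
  intros o hs. destruct (o s hs) as [w1 [w2 w3]]. unfold slope at 1.
  assert (d : is_derive (fun r => - P r / W r) s ((- accel 0 e s (W s) (P s) * W s + P s * P s) / (W s * W s))).
  { dsolve. }
  apply (is_derive_eq _ _ _ _ d). unfold slope, drag, accel. field. lra.
Qed.

Lemma drag_derive k e W P s0 s1 s : orbit k e W P s0 s1 -> s0 < s < s1 ->
  is_derive (drag e W) s (drag e W s * (- om + (1 - a) * slope W P s)).
Proof.
  intros o hs. destruct (o s hs) as [w1 [w2 w3]].
  assert (d := is_derive_scal _ _ a _ (is_derive_Rpower_comp (a - 1) W s _ w1 w2)).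
  apply (is_derive_eq _ _ _ _ (is_derive_mult _ _ _ _ _ (E_derive e s) d Rmult_comm)).
  unfold plus, mult, scal; simpl. unfold mult; simpl. unfold drag, slope.
  rewrite <- (Rpower_succ (W s) (a - 1) w1). field. lra.
Qed.

(** While [P > 0], [W] stays above [W 1], so the drag coefficient eventually falls below [A] and [P]
    decreases at least at the rate [B * W 1]. *)
Lemma free_orbit_turns e W P : 0 < e -> (forall T, 0 < T -> orbit 0 e W P 0 T) -> exists t, 0 < t /\ P t <= 0.
Proof.
  intros he o. destruct (classic (exists t, 0 < t /\ P t <= 0)) as [|hn]; auto. exfalso.
  assert (hP : forall s, 0 < s -> 0 < P s).
  { intros s hs. destruct (Rlt_le_dec 0 (P s)); auto. exfalso. apply hn. now exists s. }
  assert (hW1 : 0 < W 1) by (apply (o 2); lra).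
  assert (hW : forall s, 1 <= s -> W 1 <= W s).
  { intros s hs. apply (incr_of_derive W P); auto.
    - intros x hx. apply (o (s + 1)); lra.
    - intros x hx. left. apply hP; lra. }
  pose proof A_pos as hA. pose proof B_pos as hB. pose proof a_pos as ha.
  set (Ph := a * Rpower (W 1) (a - 1)). assert (hPh : 0 < Ph) by (apply Rmult_lt_0_compat; [auto|apply Rpower_pos]).
  destruct (E_small e (A / Ph) he) as [s1 [hs1 hE]]. { apply Rdiv_lt_0_compat; auto. }
  set (t1 := s1 + 1). set (t2 := t1 + P t1 / (B * W 1) + 1).
  assert (hBW : 0 < B * W 1) by (now apply Rmult_lt_0_compat).
  assert (hPt : 0 < P t1) by (apply hP; unfold t1; lra).
  assert (hq : 0 < P t1 / (B * W 1)) by (now apply Rdiv_lt_0_compat).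
  destruct (MVT_interval P (fun s => accel 0 e s (W s) (P s)) t1 t2 ltac:(unfold t2; lra)) as [x [hx ex]].
  { intros x hx. apply (o (t2 + 1)); unfold t1 in *; lra. }
  assert (hx1 : s1 + 1 <= x) by (unfold t1 in hx; lra).
  assert (hacc : accel 0 e x (W x) (P x) <= - (B * W 1)).
  { unfold accel. specialize (hW x ltac:(lra)). specialize (hP x ltac:(lra)). specialize (hE x ltac:(lra)).
    assert (a * Rpower (W x) (a - 1) <= Ph).
    { apply Rmult_le_compat_l; [lra|]. apply Rpower_le_neg; auto. pose proof a_range; lra. }
    assert (hd := drag_pos e W x he). unfold drag in hd. pose proof (E_pos e x he).
    assert (E e x * (a * Rpower (W x) (a - 1)) <= A).
    { apply Rle_trans with (A / Ph * Ph); [|right; field; lra]. apply Rmult_le_compat; try lra.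
      apply Rmult_le_pos; [lra|left; apply Rpower_pos]. }
    assert (E e x * (a * Rpower (W x) (a - 1)) * P x <= A * P x) by (apply Rmult_le_compat_r; lra). nra. }
  assert (accel 0 e x (W x) (P x) * (t2 - t1) <= - (B * W 1) * (t2 - t1)) by (apply Rmult_le_compat_r; unfold t2; lra).
  assert (- (B * W 1) * (t2 - t1) = - P t1 - B * W 1) by (unfold t2; field; lra).
  assert (0 < P t2) by (apply hP; assert (0 < t1) by (unfold t1; lra); unfold t2; lra). lra.
Qed.

(* Without absorption the pair (slope, drag) solves an autonomous planar system whose orbits blow up. *)
Lemma free_orbit_not_global e W P : 0 < e -> (forall T, 0 < T -> orbit 0 e W P 0 T) -> False.
Proof.
  intros he o. destruct (free_orbit_turns e W P he o) as [t0 [ht0 hPt0]].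
  set (r := slope W P). set (th := drag e W).
  set (dr := fun s => r s * r s - A * r s + B + th s * r s).
  assert (d : forall s, 0 < s -> is_derive r s (dr s)).
  { intros s hs. apply (slope_derive e W P 0 (s + 1)); [apply o|]; lra. }
  assert (dth : forall s, 0 < s -> is_derive th s (th s * (- om + (1 - a) * r s))).
  { intros s hs. apply (drag_derive 0 e W P 0 (s + 1)); [apply o|]; lra. }
  assert (hth : forall s, 0 < th s) by (intros s; now apply drag_pos).
  pose proof L_gt_2 as hL. pose proof n_ge_1 as hn. pose proof a_range as ha. pose proof A_pos as hA. pose proof B_pos as hB.
  assert (hr0 : 0 <= r t0).
  { unfold r, slope. assert (0 < W t0) by (apply (o (t0 + 1)); lra).
    unfold Rdiv. apply Rmult_le_pos; [lra|left; now apply Rinv_0_lt_compat]. }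
  (* The polynomial has the roots [L] and [L + n - 2 >= L - 1], so it is at least [3/2 * 1/2] up to
     [L - 3/2]. At this value of the slope [th] already grows, at a rate of at least 1/2. *)
  assert (hpoly : forall x, x <= L - 3 / 2 -> 3 / 4 <= x * x - A * x + B).
  { intros x hx. replace (x * x - A * x + B) with ((L - x) * (L - x + n - 2)) by (unfold A, B; ring). nra. }
  assert (hr : forall s, t0 <= s -> 0 <= r s).
  { intros s hs. apply (barrier_below r dr t0 s 0); auto.
    - intros x hx. apply d; lra.
    - intros x hx e0. unfold dr. rewrite e0. lra. }
  assert (ht1 : exists t1, t0 <= t1 /\ L - 3 / 2 <= r t1).
  { destruct (classic (exists t1, t0 <= t1 /\ L - 3 / 2 <= r t1)) as [|hn1]; auto. exfalso.
    set (s := t0 + 4 / 3 * L).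
    destruct (MVT_interval r dr t0 s ltac:(unfold s; lra)) as [x [hx ex]]. { intros x hx. apply d; lra. }
    assert (hlow : forall y, t0 <= y -> r y < L - 3 / 2).
    { intros y hy. destruct (Rlt_le_dec (r y) (L - 3 / 2)); auto. exfalso. apply hn1. now exists y. }
    assert (3 / 4 <= dr x).
    { unfold dr. specialize (hpoly (r x) ltac:(left; apply hlow; lra)). specialize (hr x ltac:(lra)). specialize (hth x). nra. }
    assert (3 / 4 * (s - t0) <= dr x * (s - t0)) by (apply Rmult_le_compat_r; unfold s; lra).
    specialize (hlow s ltac:(unfold s; lra)). unfold s in *. lra. }
  destruct ht1 as [t1 [ht1 hrt1]].
  assert (hr1 : forall s, t1 <= s -> L - 3 / 2 <= r s).
  { intros s hs. apply (barrier_below r dr t1 s (L - 3 / 2)); auto.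
    - intros x hx. apply d; lra.
    - intros x hx e0. unfold dr. specialize (hpoly (r x) ltac:(lra)). specialize (hr x ltac:(lra)). specialize (hth x). nra. }
  assert (hgrow : forall s, t1 <= s -> th t1 * (1 + (s - t1) / 2) <= th s).
  { assert (hrate : forall s, t1 <= s -> / 2 <= - om + (1 - a) * r s).
    { intros s hs. specialize (hr1 s hs). unfold om.
      assert ((1 - a) * (L - 3 / 2) <= (1 - a) * r s) by (apply Rmult_le_compat_l; lra). lra. }
    assert (hmon : forall s, t1 <= s -> th t1 <= th s).
    { intros s hs. apply (incr_of_derive th (fun s => th s * (- om + (1 - a) * r s))); auto.
      - intros x hx. apply dth; lra.
      - intros x hx. specialize (hrate x ltac:(lra)). specialize (hth x). nra. }
    intros s hs.
    assert (h : th t1 - th t1 / 2 * (t1 - t1) <= th s - th t1 / 2 * (s - t1)).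
    { apply (incr_of_derive (fun s => th s - th t1 / 2 * (s - t1)) (fun s => th s * (- om + (1 - a) * r s) - th t1 / 2)); auto.
      - intros x hx. assert (dx := dth x ltac:(lra)). dsolve.
      - intros x hx. specialize (hrate x ltac:(lra)). specialize (hmon x ltac:(lra)). specialize (hth x). nra. }
    lra. }
  set (t2 := t1 + 2 * A / th t1). assert (h1 := hth t1).
  assert (hq : 0 < A / th t1) by (apply Rdiv_lt_0_compat; auto).
  assert (hbig : forall s, t2 <= s -> A <= th s).
  { intros s hs. specialize (hgrow s ltac:(unfold t2, Rdiv in *; lra)).
    assert (A = th t1 * (A / th t1)) by (field; lra).
    assert (th t1 * (A / th t1) <= th t1 * (1 + (s - t1) / 2)); [|lra].
    apply Rmult_le_compat_l; [lra|]. unfold t2, Rdiv in *. lra. }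
  (* Once [th >= A] one has [r' >= r^2]; as [r > 1/2], blow-up occurs within time 2, which 3
     exceeds. *)
  set (t3 := t2 + 3).
  assert (ht2 : t1 <= t2) by (unfold t2, Rdiv in *; lra).
  assert (hpos : forall s, t2 <= s -> / 2 < r s) by (intros s hs; specialize (hr1 s ltac:(lra)); lra).
  assert (hinv : forall s, t2 <= s -> is_derive (fun s => - / r s - s) s (dr s / (r s * r s) - 1)).
  { intros s hs. assert (dx := d s ltac:(lra)). specialize (hpos s hs). dsolve. }
  assert (hfin : - / r t2 - t2 <= - / r t3 - t3).
  { apply (incr_of_derive (fun s => - / r s - s) (fun s => dr s / (r s * r s) - 1)); [unfold t3; lra| |].
    - intros s hs. apply hinv; lra.
    - intros s hs. specialize (hbig s ltac:(lra)). specialize (hpos s ltac:(lra)).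
      assert (hsq : 0 < r s * r s) by nra.
      assert (r s * r s <= dr s). { unfold dr. assert (A * r s <= th s * r s) by (apply Rmult_le_compat_r; lra). lra. }
      assert (1 <= dr s / (r s * r s)); [|lra].
      apply Rmult_le_reg_r with (r s * r s); auto. unfold Rdiv. rewrite Rmult_assoc, Rinv_l by lra. lra. }
  assert (h2 : / r t2 < 2). { rewrite <- (Rinv_inv 2). apply Rinv_lt_contravar; [|apply hpos; lra]. specialize (hpos t2 ltac:(lra)). nra. }
  assert (h3 : 0 < / r t3). { apply Rinv_0_lt_compat. specialize (hpos t3 ltac:(unfold t3; lra)). lra. }
  unfold t3 in *. lra.
Qed.

Lemma dying_zero : dying 0.
Proof.
  destruct (global_or_dying 0 (Rle_refl 0)) as [[W [P hg]]|]; auto. exfalso.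
  apply (free_orbit_not_global 1 W P ltac:(lra)). intros T hT. apply hg; auto.
Qed.

Lemma interface_limit k e W P s0 s1 eps : 0 < e -> s0 < s1 -> orbit k e W P s0 s1 -> interface e W P s0 -> 0 < eps ->
  exists d, 0 < d /\ forall s, s0 < s < s0 + d -> 0 < W s < eps /\ Rabs (P s) < eps.
Proof.
  intros he hs o hi hp. pose proof (E_pos e s0 he) as hE. pose proof a_range as ha.
  destruct (Rpower_small a (eps / (E e s0 + 1)) (proj1 ha)) as [d1 [hd1 h1]]. { apply Rdiv_lt_0_compat; lra. }
  destruct (hi (Rmin (Rmin eps d1) 1)) as [d [hd h]]. { repeat apply Rmin_pos; lra. }
  exists (Rmin d (s1 - s0)). split; [apply Rmin_pos; lra|]. intros s hss.
  assert (m1 := Rmin_l d (s1 - s0)). assert (m2 := Rmin_r d (s1 - s0)).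
  assert (m3 := Rmin_l (Rmin eps d1) 1). assert (m4 := Rmin_r (Rmin eps d1) 1).
  assert (m5 := Rmin_l eps d1). assert (m6 := Rmin_r eps d1).
  destruct (h s ltac:(lra)) as [g1 g2]. destruct (o s ltac:(lra)) as [w1 _]. split; [lra|].
  specialize (h1 (W s) w1 ltac:(lra)). pose proof (Rpower_pos (W s) a) as hp'.
  replace (P s) with (P s / Rpower (W s) a * Rpower (W s) a) by (field; lra).
  rewrite Rabs_mult, (Rabs_pos_eq (Rpower (W s) a)) by lra.
  assert (Rabs (P s / Rpower (W s) a) < E e s0 + 1) by (apply Rabs_def2 in g2; apply Rabs_def1; lra).
  pose proof (Rabs_pos (P s / Rpower (W s) a)).
  apply Rle_lt_trans with ((E e s0 + 1) * Rpower (W s) a); [apply Rmult_le_compat_r; lra|].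
  apply Rlt_le_trans with ((E e s0 + 1) * (eps / (E e s0 + 1))); [apply Rmult_lt_compat_l; lra|right; field; lra].
Qed.

Lemma restoring_B_1 : restoring B 1 = 0.
Proof. unfold restoring, Rpower. rewrite ln_1, Rmult_0_r, exp_0. ring. Qed.

Lemma potential_B_bounds w : 0 < w <= 1 -> - B * Rpower w (1 + q) <= potential B w < 0.
Proof.
  intros hw. unfold potential. pose proof B_pos as hB. pose proof q_range as hq.
  assert (e : w * w = Rpower w (1 - q) * Rpower w (1 + q)).
  { rewrite <- Rpower_plus. replace (1 - q + (1 + q)) with (1 + 1) by ring. rewrite Rpower_plus, Rpower_1; lra. }
  rewrite e. pose proof (Rpower_pos w (1 + q)). pose proof (Rpower_pos w (1 - q)).
  assert (Rpower w (1 - q) <= 1).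
  { apply Rle_trans with (Rpower 1 (1 - q)); [apply Rpower_le; lra|]. unfold Rpower. rewrite ln_1, Rmult_0_r, exp_0. lra. }
  set (X := Rpower w (1 - q)) in *. set (Y := Rpower w (1 + q)) in *.
  assert (hi : / 2 < / (1 + q) < 1).
  { split; [apply Rinv_lt_contravar; lra|]. rewrite <- Rinv_1. apply Rinv_lt_contravar; lra. }
  replace (B / 2 * (X * Y) - B / (1 + q) * Y) with (B * Y * (X / 2 - / (1 + q))) by (field; lra).
  assert (0 < B * Y) by (now apply Rmult_lt_0_compat). split; nra.
Qed.

(** For small [e] the drag feeds hardly any energy into the ascent, and friction along the way
    leaves the orbit too little to climb out of the well again. For [k = B] the force vanishes at
    the height 1, and the potential is negative on (0,1]. *)
Lemma weak_source_not_dying : exists e, 0 < e <= 1 /\ forall W P T, 0 < T -> orbit B e W P 0 T -> interface e W P 0 ->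
  (forall eps, 0 < eps -> exists d, 0 < d /\ forall s, 0 < s -> T - d < s < T -> W s < eps) -> False.
Proof.
  pose proof A_pos as hA. pose proof B_pos as hB. pose proof a_range as ha. pose proof q_range as hq.
  set (c1 := - potential B (/ 4) / 2).
  assert (hc1 : 0 < c1). { destruct (potential_B_bounds (/ 4) ltac:(lra)). unfold c1. lra. }
  set (c2 := sqrt (2 * c1)). assert (hc2 : 0 < c2) by (apply sqrt_lt_R0; lra).
  assert (hc22 : c2 * c2 = 2 * c1) by (apply sqrt_sqrt; lra).
  (* Large enough that [M0^2 / 2 > M0 + B]: the speed cannot reach [M0] up to the height [wl]. *)
  set (M0 := 2 + 2 * B).
  (* Energy budget: at most [A c2 / 16] is present at the height [wl], at least [A c2 / 8] is lost
     between the heights 1/4 and 1/2, and the potential at [wl] is above [- A c2 / 32]. The bound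
     [c1] keeps the speed above [c2] between these two heights. *)
  set (g := Rmin c1 (A * c2 / 32)).
  assert (hAc : 0 < A * c2) by (now apply Rmult_lt_0_compat).
  assert (hg : 0 < g) by (apply Rmin_pos; lra).
  assert (hg1 : g <= c1) by apply Rmin_l. assert (hg2 : g <= A * c2 / 32) by apply Rmin_r.
  assert (h1q : 0 < 1 + q) by lra. destruct (Rpower_small (1 + q) (g / B) h1q) as [d1 [hd1 hsmall]]. { apply Rdiv_lt_0_compat; auto. }
  set (wl := Rmin d1 (/ 4) / 2). assert (m1 := Rmin_l d1 (/ 4)). assert (m2 := Rmin_r d1 (/ 4)).
  assert (m3 : 0 < Rmin d1 (/ 4)) by (apply Rmin_pos; lra).
  assert (hwl : 0 < wl <= / 8 /\ wl < d1) by (unfold wl; lra).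
  assert (hVl : - g < potential B wl).
  { destruct (potential_B_bounds wl ltac:(lra)) as [h _]. specialize (hsmall wl ltac:(lra) ltac:(lra)).
    assert (B * Rpower wl (1 + q) < B * (g / B)) by (apply Rmult_lt_compat_l; auto).
    replace (B * (g / B)) with g in H by (field; lra). lra. }
  set (Pl := a * Rpower wl (a - 1)). assert (hPl : 0 < Pl) by (apply Rmult_lt_0_compat; [lra|apply Rpower_pos]).
  assert (hM0 : 0 < M0) by (unfold M0; lra).
  set (e := Rmin 1 (Rmin (A / 2 / Pl) (A * c2 / 16 / M0))).
  assert (he : 0 < e). { unfold e. repeat apply Rmin_pos; try lra; apply Rdiv_lt_0_compat; lra. }
  assert (he1 : e <= 1) by apply Rmin_l.
  assert (he2 : e <= A / 2 / Pl) by (eapply Rle_trans; [apply Rmin_r|apply Rmin_l]).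
  assert (he3 : e <= A * c2 / 16 / M0) by (eapply Rle_trans; [apply Rmin_r|apply Rmin_r]).
  assert (heP : e * Pl <= A / 2). { apply Rle_trans with (A / 2 / Pl * Pl); [apply Rmult_le_compat_r; lra|right; field; lra]. }
  assert (heM : e * M0 <= A * c2 / 16). { apply Rle_trans with (A * c2 / 16 / M0 * M0); [apply Rmult_le_compat_r; lra|right; field; lra]. }
  exists e. split; [lra|]. intros W P T hT o hi hlim.
  assert (hEe : forall s, 0 < s -> E e s <= e).
  { intros s hs. assert (h := E_decr e 0 s he hs). unfold E in h at 2. rewrite Rmult_0_r, exp_0 in h. lra. }
  assert (hneg : exists t, 0 < t < T /\ P t <= 0).
  { set (y := T / 2). assert (hWy : 0 < W y) by (apply o; unfold y; lra).
    destruct (hlim (W y) hWy) as [d [hd hh]].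
    set (x := Rmax (3 / 4 * T) (T - d / 2)). assert (g1 := Rmax_l (3 / 4 * T) (T - d / 2)). assert (g2 := Rmax_r (3 / 4 * T) (T - d / 2)).
    assert (hx : x < T) by (apply Rmax_lub_lt; lra). fold x in g1, g2.
    specialize (hh x ltac:(lra) ltac:(lra)).
    destruct (MVT_interval W P y x ltac:(unfold y; lra)) as [t [ht et]]. { intros t ht. apply o. unfold y in ht; lra. }
    exists t. split; [unfold y in ht; lra|]. destruct (Rle_lt_dec (P t) 0); auto. exfalso.
    assert (0 < P t * (x - y)) by (apply Rmult_lt_0_compat; [auto|unfold y; lra]). lra. }
  destruct hneg as [t [ht hPt]].
  destruct (first_top B e W P 0 T t he o hi ht hPt) as [b [hb [eb [u rb]]]].
  (* A dying orbit must turn, and the force is positive at its first top, which therefore lies above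
     1; so the ascent passes the heights [wl], 1/4 and 1/2. *)
  assert (hWb : 1 < W b). { apply (restoring_sign_lt B); auto; [lra|apply o; lra|rewrite restoring_B_1; lra]. }
  assert (inc : forall r s, 0 < r -> r < s -> s < b -> W r < W s).
  { intros r s hr hrs hs. apply (strict_incr_of_derive W P); auto; [intros x hx; apply o; lra|intros x hx; apply u; lra]. }
  destruct (interface_reaches B e W P 0 T b wl ltac:(lra) o hi ltac:(lra) ltac:(lra)) as [tl [htl etl]].
  destruct (interface_reaches B e W P 0 T b (/ 4) ltac:(lra) o hi ltac:(lra) ltac:(lra)) as [t4 [ht4 et4]].
  destruct (interface_reaches B e W P 0 T b (/ 2) ltac:(lra) o hi ltac:(lra) ltac:(lra)) as [t2 [ht2 et2]].
  assert (ord : forall r s, 0 < r < b -> 0 < s < b -> W r < W s -> r < s).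
  { intros r s hr hs h. destruct (Rlt_le_dec r s); auto. exfalso. destruct (Req_dec s r) as [->|]; [lra|].
    assert (W s < W r) by (apply inc; lra). lra. }
  assert (h14 : tl < t4) by (apply ord; auto; lra). assert (h42 : t4 < t2) by (apply ord; auto; lra).
  set (En := fun s => energy B (W s) (P s)).
  (* The subtracted term pays for the drag: as long as [P <= M0] the drag contributes at most
     [e M0 (W^a)'], so [F] decreases from its limit 0 at the edge. *)
  set (F := fun s => En s - e * M0 * Rpower (W s) a).
  assert (dEn : forall s, 0 < s < T -> is_derive En s ((E e s * (a * Rpower (W s) (a - 1)) - A) * (P s * P s))).
  { intros s hs. apply (energy_derive B e W P 0 T); auto. }
  assert (dF : forall s, 0 < s < T -> is_derive F s ((E e s * (a * Rpower (W s) (a - 1)) - A) * (P s * P s) - e * M0 * (a * Rpower (W s) (a - 1) * P s))).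
  { intros s hs. destruct (o s hs) as [w1 [w2 w3]].
    exact (is_derive_minus _ _ _ _ _ (dEn s hs) (is_derive_scal _ _ (e * M0) _ (is_derive_Rpower_comp a W s _ w1 w2))). }
  assert (Fneg : forall s, 0 < s < b -> (forall r, 0 < r <= s -> P r <= M0) -> F s <= 0).
  { intros s hs hPM. destruct (Rle_lt_dec (F s) 0) as [|hpos]; auto. exfalso.
    destruct (interface_limit B e W P 0 T (Rmin 1 (F s / (1 + B))) he hT o hi) as [d [hd hh]].
    { apply Rmin_pos; [lra|]. apply Rdiv_lt_0_compat; lra. }
    set (r := Rmin (d / 2) (s / 2)). assert (g1 := Rmin_l (d / 2) (s / 2)). assert (g2 := Rmin_r (d / 2) (s / 2)).
    assert (g3 : 0 < r) by (apply Rmin_pos; lra). fold r in g1, g2.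
    destruct (hh r ltac:(lra)) as [w1 w2]. assert (g4 := Rmin_l 1 (F s / (1 + B))). assert (g5 := Rmin_r 1 (F s / (1 + B))).
    assert (hdec : F s <= F r).
    { apply (decr_of_derive F (fun s => (E e s * (a * Rpower (W s) (a - 1)) - A) * (P s * P s) - e * M0 * (a * Rpower (W s) (a - 1) * P s))); [lra| |].
      - intros x hx. apply dF; lra.
      - intros x hx. specialize (hPM x ltac:(lra)). assert (hu := u x ltac:(lra)).
        assert (hEx := hEe x ltac:(lra)). pose proof (E_pos e x he).
        assert (0 < a * Rpower (W x) (a - 1)) by (apply Rmult_lt_0_compat; [lra|apply Rpower_pos]).
        set (Ph := a * Rpower (W x) (a - 1)) in *.
        replace ((E e x * Ph - A) * (P x * P x) - e * M0 * (Ph * P x)) with (Ph * P x * (E e x * P x - e * M0) - A * (P x * P x)) by ring.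
        assert (E e x * P x <= e * M0) by (apply Rmult_le_compat; lra).
        assert (0 <= Ph * P x) by (apply Rmult_le_pos; lra). assert (0 <= A * (P x * P x)) by (apply Rmult_le_pos; nra). nra. }
    assert (F r <= Rabs (P r)).
    { unfold F, En, energy. destruct (potential_B_bounds (W r) ltac:(lra)) as [_ hv].
      assert (0 <= e * M0 * Rpower (W r) a) by (apply Rmult_le_pos; [apply Rmult_le_pos; lra|left; apply Rpower_pos]).
      assert (P r * P r <= Rabs (P r)).
      { replace (P r * P r) with (Rabs (P r) * Rabs (P r)) by (rewrite <- Rabs_mult; apply Rabs_pos_eq, Rle_0_sqr).
        pose proof (Rabs_pos (P r)). nra. }
      pose proof (Rabs_pos (P r)). lra. }
    assert (F s / (1 + B) <= F s).
    { apply Rmult_le_reg_r with (1 + B); [lra|]. unfold Rdiv. rewrite Rmult_assoc, Rinv_l by lra. nra. }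
    lra. }
  assert (hPM : forall s, 0 < s <= tl -> P s < M0).
  { intros s hs. destruct (Rlt_le_dec (P s) M0) as [|hle]; auto. exfalso.
    destruct (interface_limit B e W P 0 T 1 he hT o hi ltac:(lra)) as [d [hd hh]].
    set (r := Rmin (d / 2) (s / 2)). assert (g1 := Rmin_l (d / 2) (s / 2)). assert (g2 := Rmin_r (d / 2) (s / 2)).
    assert (g3 : 0 < r) by (apply Rmin_pos; lra). fold r in g1, g2.
    assert (hr : forall x, 0 < x <= r -> P x < M0).
    { intros x hx. destruct (hh x ltac:(lra)) as [_ w2]. apply Rabs_def2 in w2. unfold M0; lra. }
    destruct (first_zero (fun x => M0 - P x) r s) as [x [hx [ex px]]].
    - lra.
    - intros x hx. apply (continuous_minus (fun _ => M0) P); [apply continuous_const|eapply orbit_contP; eauto; lra].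
    - specialize (hr r ltac:(lra)). lra.
    - lra.
    - assert (hF : F x <= 0).
      { apply Fneg; [lra|]. intros y hy. destruct (Rle_lt_dec y r); [left; apply hr; lra|].
        destruct (Req_dec y x) as [->|]; [lra|]. specialize (px y ltac:(lra)). lra. }
      assert (hWx : 0 < W x <= wl).
      { split; [apply o; lra|]. destruct (Req_dec x tl) as [->|]; [lra|]. left. rewrite <- etl. apply inc; lra. }
      unfold F, En, energy in hF. replace (P x) with M0 in hF by lra.
      destruct (potential_B_bounds (W x) ltac:(lra)) as [hv _].
      assert (r1 : Rpower (W x) (1 + q) <= 1).
      { apply Rle_trans with (Rpower 1 (1 + q)); [apply Rpower_le; lra|]. unfold Rpower. rewrite ln_1, Rmult_0_r, exp_0. lra. }
      assert (r2 : Rpower (W x) a <= 1).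
      { apply Rle_trans with (Rpower 1 a); [apply Rpower_le; lra|]. unfold Rpower. rewrite ln_1, Rmult_0_r, exp_0. lra. }
      pose proof (Rpower_pos (W x) a). pose proof (Rpower_pos (W x) (1 + q)).
      assert (e * M0 * Rpower (W x) a <= M0).
      { assert (e * M0 <= M0) by nra. assert (0 < e * M0) by (now apply Rmult_lt_0_compat). nra. }
      assert (B * Rpower (W x) (1 + q) <= B) by nra.
      unfold M0 in *. nra. }
  assert (hEl : En tl <= A * c2 / 16).
  { assert (hF : F tl <= 0) by (apply Fneg; [lra|]; intros r hr; left; apply hPM; lra). unfold F in hF. rewrite etl in hF.
    assert (r2 : Rpower wl a <= 1).
    { apply Rle_trans with (Rpower 1 a); [apply Rpower_le; lra|]. unfold Rpower. rewrite ln_1, Rmult_0_r, exp_0. lra. }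
    pose proof (Rpower_pos wl a). assert (0 < e * M0) by (now apply Rmult_lt_0_compat). nra. }
  assert (hdrag : forall s, tl <= s < b -> E e s * (a * Rpower (W s) (a - 1)) <= A / 2).
  { intros s hs. apply Rle_trans with (e * Pl); auto. pose proof (E_pos e s he).
    apply Rmult_le_compat; [lra|left; apply Rmult_lt_0_compat; [lra|apply Rpower_pos]|apply hEe; lra|].
    apply Rmult_le_compat_l; [lra|]. apply Rpower_le_neg; try lra.
    destruct (Req_dec s tl) as [->|]; [lra|]. left. rewrite <- etl. apply inc; lra. }
  assert (hE4 : En t4 <= En tl).
  { apply (decr_of_derive En (fun s => (E e s * (a * Rpower (W s) (a - 1)) - A) * (P s * P s))); [lra|intros x hx; apply dEn; lra|].
    intros x hx. specialize (hdrag x ltac:(lra)). pose proof (Rle_0_sqr (P x)). unfold Rsqr in *. nra. }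
  (* With less energy than the potential at [wl] the orbit would be trapped above [wl] and could not
     die. *)
  assert (hnt : forall s, t4 <= s <= t2 -> potential B wl <= En s).
  { intros s hs. destruct (Rle_lt_dec (potential B wl) (En s)) as [|hlt]; auto. exfalso.
    assert (hWs : wl < W s). { rewrite <- etl. apply inc; lra. }
    assert (htr : trapped B e s (W s) (P s) wl).
    { split; [lra|]. split; [auto|]. split; [|exact hlt]. fold Pl. apply Rle_trans with (e * Pl); [|lra].
      apply Rmult_le_compat_r; [lra|]. apply hEe; lra. }
    destruct (hlim wl ltac:(lra)) as [d [hd hh]].
    set (x := Rmax ((s + T) / 2) (T - d / 2)). assert (g1 := Rmax_l ((s + T) / 2) (T - d / 2)). assert (g2 := Rmax_r ((s + T) / 2) (T - d / 2)).
    assert (hx : x < T) by (apply Rmax_lub_lt; lra). fold x in g1, g2.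
    specialize (hh x ltac:(lra) ltac:(lra)).
    assert (h := energy_trap B e W P 0 T s wl he o ltac:(lra) htr x ltac:(lra)). lra. }
  assert (hPc : forall s, t4 <= s <= t2 -> c2 <= P s).
  { intros s hs. assert (hE := hnt s hs). unfold En, energy in hE. assert (hu := u s ltac:(lra)).
    assert (hV : potential B (W s) <= potential B (/ 4)).
    { assert (hle : / 4 <= W s). { destruct (Req_dec s t4) as [->|]; [lra|]. left. rewrite <- et4. apply inc; lra. }
      assert (hle2 : W s <= / 2). { destruct (Req_dec s t2) as [->|]; [lra|]. left. rewrite <- et2. apply inc; lra. }
      apply (decr_of_derive (potential B) (restoring B)); auto.
      - intros w hw. apply potential_derive; lra.
      - intros w hw. destruct (Rle_lt_dec (restoring B w) 0) as [|hr]; auto. exfalso.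
        assert (1 < w); [|lra]. apply (restoring_sign_lt B); auto; try lra. rewrite restoring_B_1; lra. }
    assert (2 * c1 <= P s * P s) by (unfold c1 in *; lra).
    destruct (Rle_lt_dec c2 (P s)); auto. exfalso. nra. }
  assert (hfin : En t2 + A / 2 * c2 * W t2 <= En t4 + A / 2 * c2 * W t4).
  { apply (decr_of_derive (fun s => En s + A / 2 * c2 * W s) (fun s => (E e s * (a * Rpower (W s) (a - 1)) - A) * (P s * P s) + A / 2 * c2 * P s)); [lra| |].
    - intros x hx. destruct (o x ltac:(lra)) as [w1 [w2 w3]].
      exact (is_derive_plus _ _ _ _ _ (dEn x ltac:(lra)) (is_derive_scal _ _ (A / 2 * c2) _ w2)).
    - intros x hx. specialize (hdrag x ltac:(lra)). specialize (hPc x hx). pose proof (Rle_0_sqr (P x)). unfold Rsqr in *.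
      assert ((E e x * (a * Rpower (W x) (a - 1)) - A) * (P x * P x) <= - (A / 2) * (P x * P x)) by (apply Rmult_le_compat_r; lra).
      assert (A / 2 * (c2 * P x) <= A / 2 * (P x * P x)) by (apply Rmult_le_compat_l; [lra|apply Rmult_le_compat_r; lra]). lra. }
  rewrite et2, et4 in hfin. specialize (hnt t2 ltac:(lra)). lra.
Qed.

(** A dilation trades the small [e] and [k = B] for [e = 1] and [k = B l^(q-1)]. *)
Lemma not_dying_exists : exists k, 0 < k /\ ~ dying k.
Proof.
  destruct weak_source_not_dying as [e [he h]]. pose proof a_range as ha. pose proof q_range as hq. pose proof B_pos as hB.
  set (l := Rpower e (/ (1 - a))). assert (hl : 0 < l) by apply Rpower_pos.
  exists (B * Rpower l (- (1 - q))). split; [apply Rmult_lt_0_compat; [auto|apply Rpower_pos]|].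
  intros [W [P [T [hT [[o i] hlim]]]]].
  assert (o' := orbit_scale _ _ _ _ _ _ l hl o). assert (i' := interface_scale _ _ _ _ _ _ l hT hl o i).
  replace (B * Rpower l (- (1 - q)) * Rpower l (1 - q)) with B in o'.
  2:{ rewrite Rmult_assoc, <- Rpower_plus. replace (- (1 - q) + (1 - q)) with 0 by ring. rewrite Rpower_O; auto. ring. }
  replace (1 * Rpower l (1 - a)) with e in o', i'.
  2:{ rewrite Rmult_1_l. unfold l. rewrite Rpower_inv_base; lra. }
  apply (h _ _ T hT o' i'). intros eps hp. destruct (hlim (eps / l) ltac:(now apply Rdiv_lt_0_compat)) as [d [hd hh]].
  exists d. split; auto. intros s hs hs2. specialize (hh s hs hs2).
  apply Rlt_le_trans with (l * (eps / l)); [apply Rmult_lt_compat_l; auto|right; field; lra].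
Qed.

End Extremes.

(** * The critical orbit *)

Section Critical.
Context {c : coeffs}.

Definition turning (P : R -> R) := exists x y, 0 < x /\ x < y /\ P x < 0 /\ 0 < P y.
Definition ever_trapped (k : R) (W P : R -> R) := exists s wl, 0 < s /\ trapped k 1 s (W s) (P s) wl.

(** Uniqueness from the edge makes the time of death intrinsic: another orbit with the same [k]
    could not stay positive at [T]. *)
Lemma lifetime k W P T W' P' T' : 0 <= k -> 0 < T -> 0 < T' -> shoot k W P T ->
  (forall eps, 0 < eps -> exists d, 0 < d /\ forall s, 0 < s -> T - d < s < T -> W s < eps) ->
  shoot k W' P' T' -> T' <= T.
Proof.
  intros hk hT hT' [o i] hlim [o' i']. destruct (Rle_lt_dec T' T) as [|hlt]; auto. exfalso.
  assert (hW : 0 < W' T) by (apply o'; lra).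
  destruct (continuous_eps W' T (orbit_contW k 1 W' P' 0 T' T o' ltac:(lra)) (W' T / 2) ltac:(lra)) as [d1 [hd1 h1]].
  destruct (hlim (W' T / 2) ltac:(lra)) as [d2 [hd2 h2]].
  set (s := T - Rmin (Rmin (d1 / 2) (d2 / 2)) (T / 2)).
  assert (g1 := Rmin_l (Rmin (d1 / 2) (d2 / 2)) (T / 2)). assert (g2 := Rmin_r (Rmin (d1 / 2) (d2 / 2)) (T / 2)).
  assert (g3 := Rmin_l (d1 / 2) (d2 / 2)). assert (g4 := Rmin_r (d1 / 2) (d2 / 2)).
  assert (g5 : 0 < Rmin (Rmin (d1 / 2) (d2 / 2)) (T / 2)) by (repeat apply Rmin_pos; lra).
  specialize (h1 s ltac:(unfold s; apply Rabs_def1; lra)). apply Rabs_def2 in h1.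
  specialize (h2 s ltac:(unfold s; lra) ltac:(unfold s; lra)).
  destruct (interface_unique k 1 W P W' P' 0 T T' ltac:(lra) hk hT hT' o i o' i' s ltac:(unfold s; lra) ltac:(unfold s; lra) ltac:(unfold s; lra)) as [eW _].
  lra.
Qed.

Lemma restoring_mono k v w : 0 < v -> v <= w -> 0 <= restoring k v -> restoring k v <= restoring k w.
Proof.
  intros hv hw h. rewrite !restoring_eq in * by lra.
  pose proof (Rpower_pos v q). pose proof q_range. pose proof B_pos.
  assert (Rpower v q <= Rpower w q) by (apply Rpower_le; lra).
  assert (Rpower v (1 - q) <= Rpower w (1 - q)) by (apply Rpower_le; lra).
  assert (0 <= B * Rpower v (1 - q) - k).
  { destruct (Rle_lt_dec 0 (B * Rpower v (1 - q) - k)); auto. exfalso. nra. }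
  assert (B * Rpower v (1 - q) <= B * Rpower w (1 - q)) by (apply Rmult_le_compat_l; lra).
  apply Rmult_le_compat; lra.
Qed.

Lemma dying_not_turning k W' P' T' : 0 <= k -> dying k -> shoot k W' P' T' ->
  forall x y, 0 < x -> x < y -> y < T' -> P' x < 0 -> 0 < P' y -> False.
Proof.
  intros hk hdy sh x y hx hxy hy hPx hPy.
  destruct (hdy) as [W [P [T [hT [shW hlim]]]]].
  assert (hl := lifetime k W P T W' P' T' hk hT ltac:(lra) shW hlim sh).
  destruct shW as [o i]. destruct sh as [o' i'].
  assert (ag : forall s, 0 < s < T' -> W s = W' s /\ P s = P' s).
  { intros s hs. apply (interface_unique k 1 W P W' P' 0 T T'); auto; lra. }
  destruct (turning_bounded_below k 1 W P 0 T x y ltac:(lra) o i hx hxy ltac:(lra)) as [m [hm hb]].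
  { destruct (ag x ltac:(lra)) as [_ ->]. auto. } { destruct (ag y ltac:(lra)) as [_ ->]. auto. }
  destruct (hlim m hm) as [d [hd hh]].
  set (s := Rmax ((y + T) / 2) (T - d / 2)). assert (g1 := Rmax_l ((y + T) / 2) (T - d / 2)). assert (g2 := Rmax_r ((y + T) / 2) (T - d / 2)).
  assert (hs : s < T) by (apply Rmax_lub_lt; lra). fold s in g1, g2.
  specialize (hh s ltac:(lra) ltac:(lra)). specialize (hb s ltac:(lra)). lra.
Qed.

Lemma dying_not_trapped k W' P' T' s wl : 0 <= k -> dying k -> shoot k W' P' T' -> 0 < s < T' ->
  trapped k 1 s (W' s) (P' s) wl -> False.
Proof.
  intros hk hdy sh hs htr.
  destruct (hdy) as [W [P [T [hT [shW hlim]]]]].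
  assert (hl := lifetime k W P T W' P' T' hk hT ltac:(lra) shW hlim sh).
  destruct shW as [o i]. destruct sh as [o' i'].
  destruct (interface_unique k 1 W P W' P' 0 T T' ltac:(lra) hk hT ltac:(lra) o i o' i' s ltac:(lra) ltac:(lra) ltac:(lra)) as [eW eP].
  rewrite <- eW, <- eP in htr.
  destruct (hlim wl (proj1 htr)) as [d [hd hh]].
  set (y := Rmax ((s + T) / 2) (T - d / 2)). assert (g1 := Rmax_l ((s + T) / 2) (T - d / 2)). assert (g2 := Rmax_r ((s + T) / 2) (T - d / 2)).
  assert (hy : y < T) by (apply Rmax_lub_lt; lra). fold y in g1, g2.
  specialize (hh y ltac:(lra) ltac:(lra)).
  assert (h := energy_trap k 1 W P 0 T s wl ltac:(lra) o ltac:(lra) htr y ltac:(lra)). lra.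
Qed.

Lemma trapped_open k0 s w p wl : trapped k0 1 s w p wl -> exists eps, 0 < eps /\
  forall k w' p', Rabs (k - k0) < eps -> Rabs (w' - w) < eps -> Rabs (p' - p) < eps -> trapped k 1 s w' p' wl.
Proof.
  intros [h0 [h1 [h2 h3]]]. set (g := potential k0 wl - energy k0 w p). assert (hg : 0 < g) by (unfold g; lra).
  pose proof q_range as hq.
  destruct (continuous_eps (potential k0) w (derive_continuous _ _ _ (potential_derive k0 w ltac:(lra))) (g / 4) ltac:(lra)) as [d1 [hd1 c1]].
  assert (cp : continuous (fun p => p * p / 2) p) by (apply derive_continuous with p; auto_derive; [auto|field]).
  destruct (continuous_eps _ p cp (g / 4) ltac:(lra)) as [d2 [hd2 c2]].
  set (M := Rpower wl (1 + q) + Rpower (w + 1) (1 + q) + 1).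
  assert (hM : 1 < M) by (unfold M; pose proof (Rpower_pos wl (1 + q)); pose proof (Rpower_pos (w + 1) (1 + q)); lra).
  set (eps := Rmin (Rmin d1 d2) (Rmin (Rmin 1 (w - wl)) (g / (4 * M)))).
  assert (m1 := Rmin_l (Rmin d1 d2) (Rmin (Rmin 1 (w - wl)) (g / (4 * M)))).
  assert (m2 := Rmin_r (Rmin d1 d2) (Rmin (Rmin 1 (w - wl)) (g / (4 * M)))). fold eps in m1, m2.
  assert (m3 := Rmin_l d1 d2). assert (m4 := Rmin_r d1 d2).
  assert (m5 := Rmin_l (Rmin 1 (w - wl)) (g / (4 * M))). assert (m6 := Rmin_r (Rmin 1 (w - wl)) (g / (4 * M))).
  assert (m7 := Rmin_l 1 (w - wl)). assert (m8 := Rmin_r 1 (w - wl)).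
  assert (he : 0 < eps). { unfold eps. repeat apply Rmin_pos; try lra. apply Rdiv_lt_0_compat; lra. }
  exists eps. split; auto. intros k w' p' hk hw hp.
  assert (hw2 := Rabs_def2 _ _ hw).
  split; [auto|]. split; [lra|]. split; [auto|].
  specialize (c1 w' ltac:(lra)). specialize (c2 p' ltac:(lra)). apply Rabs_def2 in c1. apply Rabs_def2 in c2.
  assert (e1 : energy k w' p' - potential k wl = energy k0 w' p' - potential k0 wl - (k - k0) / (1 + q) * (Rpower w' (1 + q) - Rpower wl (1 + q))).
  { unfold energy, potential. field. lra. }
  assert (e2 : Rabs ((k - k0) / (1 + q) * (Rpower w' (1 + q) - Rpower wl (1 + q))) <= g / 4).
  { unfold Rdiv. rewrite !Rabs_mult.
    assert (Rabs (/ (1 + q)) <= 1). { rewrite Rabs_pos_eq by (left; apply Rinv_0_lt_compat; lra). rewrite <- Rinv_1 at 2. apply Rinv_le_contravar; lra. }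
    assert (Rabs (Rpower w' (1 + q) - Rpower wl (1 + q)) <= M).
    { assert (Rpower w' (1 + q) <= Rpower (w + 1) (1 + q)) by (apply Rpower_le; lra).
      pose proof (Rpower_pos w' (1 + q)). pose proof (Rpower_pos wl (1 + q)). pose proof (Rpower_pos (w + 1) (1 + q)). unfold M. apply Rabs_le. lra. }
    pose proof (Rabs_pos (k - k0)). pose proof (Rabs_pos (/ (1 + q))). pose proof (Rabs_pos (Rpower w' (1 + q) - Rpower wl (1 + q))).
    apply Rle_trans with (g / (4 * M) * 1 * M); [|right; field; lra].
    apply Rmult_le_compat; auto; [now apply Rmult_le_pos|]. apply Rmult_le_compat; auto; lra. }
  apply Rabs_le_between in e2. unfold energy in *. unfold g in *. lra.
Qed.

Lemma critical_orbit : exists k W P, 0 < k /\ (forall T, 0 < T -> shoot k W P T) /\ ~ turning P /\ ~ ever_trapped k W P.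
Proof.
  destruct not_dying_exists as [k1 [hk1 hnd]].
  (* The dying parameters might not form an interval, so [S] collects those up to which every
     parameter is dying. Its supremum is approached from below by dying orbits, which is what
     excludes turning and trapping there. *)
  set (S := fun k => 0 <= k /\ forall k', 0 <= k' <= k -> dying k').
  destruct (completeness S) as [k [hub hlub]].
  - exists k1. intros x [hx h]. destruct (Rle_lt_dec x k1); auto. exfalso. apply hnd, h. lra.
  - exists 0. split; [lra|]. intros k' hk'. replace k' with 0 by lra. apply dying_zero.
  - assert (below : forall k', 0 <= k' < k -> dying k').
    { intros k' hk'. destruct (classic (exists x, S x /\ k' < x)) as [[x [[hx h] hlt]]|hn].
      - apply h. lra.
      - exfalso. assert (k <= k'); [|lra]. apply hlub. intros x hx. destruct (Rle_lt_dec x k'); auto. exfalso. apply hn. now exists x. }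
    assert (hk0 : 0 <= k). { apply hub. split; [lra|]. intros k' hk'. replace k' with 0 by lra. apply dying_zero. }
    assert (step : forall k0, 0 <= k0 -> dying k0 -> (forall k', 0 <= k' < k0 -> dying k') -> k0 < k).
    { intros k0 h0 hd hb. destruct (dying_open k0 h0 hd) as [d [hdd hh]].
      assert (k0 + d / 2 <= k); [|lra]. apply hub. split; [lra|]. intros k' hk'.
      destruct (Rlt_le_dec k' k0); [apply hb; lra|]. apply hh; [lra|]. apply Rabs_def1; lra. }
    assert (hk : 0 < k) by (apply step; [lra|apply dying_zero|intros; lra]).
    assert (hndk : ~ dying k). { intros hd. specialize (step k hk0 hd below). lra. }
    destruct (global_or_dying k hk0) as [[W [P hg]]|]; [|contradiction].
    exists k, W, P. split; auto. split; auto. split.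
    + intros [x [y [hx [hxy [hPx hPy]]]]].
      destruct (nearby_shoot k W P (y + 1) x y (Rmin (- P x) (P y)) hk0 (hg (y + 1) ltac:(lra)) hx ltac:(lra) ltac:(lra) ltac:(apply Rmin_pos; lra)) as [d [hd hh]].
      assert (g1 := Rmin_l (- P x) (P y)). assert (g2 := Rmin_r (- P x) (P y)).
      set (k' := k - Rmin (d / 2) (k / 2)). assert (g3 := Rmin_l (d / 2) (k / 2)). assert (g4 := Rmin_r (d / 2) (k / 2)).
      assert (g5 : 0 < Rmin (d / 2) (k / 2)) by (apply Rmin_pos; lra).
      destruct (hh k' ltac:(unfold k'; lra) ltac:(unfold k'; apply Rabs_def1; lra)) as [W' [P' [T' [hT' [sh hcl]]]]].
      destruct (hcl x ltac:(lra)) as [_ cx]. destruct (hcl y ltac:(lra)) as [_ cy]. apply Rabs_def2 in cx. apply Rabs_def2 in cy.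
      apply (dying_not_turning k' W' P' T' ltac:(unfold k'; lra) (below k' ltac:(unfold k'; lra)) sh x y); lra.
    + intros [s [wl [hs htr]]]. destruct (trapped_open k s (W s) (P s) wl htr) as [eps [he hop]].
      destruct (nearby_shoot k W P (s + 1) s s eps hk0 (hg (s + 1) ltac:(lra)) hs ltac:(lra) ltac:(lra) he) as [d [hd hh]].
      set (d' := Rmin d eps). assert (g1 : d' <= d) by apply Rmin_l. assert (g2 : d' <= eps) by apply Rmin_r.
      assert (hd' : 0 < d') by (apply Rmin_pos; lra).
      set (k' := k - Rmin (d' / 2) (k / 2)). assert (g3 := Rmin_l (d' / 2) (k / 2)). assert (g4 := Rmin_r (d' / 2) (k / 2)).
      assert (g5 : 0 < Rmin (d' / 2) (k / 2)) by (apply Rmin_pos; lra).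
      assert (hkk : Rabs (k' - k) < d') by (unfold k'; apply Rabs_def1; lra).
      destruct (hh k' ltac:(unfold k'; lra) ltac:(lra)) as [W' [P' [T' [hT' [sh hcl]]]]].
      destruct (hcl s ltac:(lra)) as [cw cp].
      apply (dying_not_trapped k' W' P' T' s wl ltac:(unfold k'; lra) (below k' ltac:(unfold k'; lra)) sh); [lra|].
      apply hop; lra.
Qed.

End Critical.

(** * The critical orbit tends to zero *)

Section Tail.
Context {c : coeffs}.
Variables (k : R) (W P : R -> R).
Hypothesis hk : 0 < k.
Hypothesis horb : forall T, 0 < T -> orbit k 1 W P 0 T.

Lemma tail_at s : 0 < s -> 0 < W s /\ is_derive W s (P s) /\ is_derive P s (accel k 1 s (W s) (P s)).
Proof. intros hs. apply (horb (s + 1)); lra. Qed.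

(** The mean speed of a bounded [W] over long times tends to 0; the energy trap needs one late time
    with little kinetic energy. *)
Lemma slow_times S0 v eps : 0 < S0 -> 0 < eps -> (forall s, S0 <= s -> Rabs (W s) <= v) ->
  exists s, S0 <= s /\ Rabs (P s) <= eps.
Proof.
  intros hS he hb. assert (hv : 0 <= v) by (specialize (hb S0 ltac:(lra)); pose proof (Rabs_pos (W S0)); lra).
  set (T := S0 + (2 * v + 1) / eps). assert (hq : 0 < (2 * v + 1) / eps) by (apply Rdiv_lt_0_compat; lra).
  destruct (MVT_interval W P S0 T ltac:(unfold T; lra)) as [s [hs es]]. { intros x hx. apply tail_at; lra. }
  exists s. split; [lra|]. destruct (Rle_lt_dec (Rabs (P s)) eps) as [|hlt]; auto. exfalso.
  assert (h1 := hb S0 ltac:(lra)). assert (h2 := hb T ltac:(unfold T; lra)). apply Rabs_le_between in h1. apply Rabs_le_between in h2.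
  assert (h3 : Rabs (W T - W S0) <= 2 * v) by (apply Rabs_le; lra).
  rewrite es, Rabs_mult, (Rabs_pos_eq (T - S0)) in h3 by (unfold T; lra).
  assert (eps * (T - S0) <= Rabs (P s) * (T - S0)) by (apply Rmult_le_compat_r; [unfold T|]; lra).
  assert (eps * (T - S0) = 2 * v + 1) by (unfold T; field; lra). lra.
Qed.

Lemma potential_decr v w : 0 < v -> v < w -> restoring k w <= 0 -> potential k w < potential k v.
Proof.
  intros hv hvw hr.
  assert (hneg : forall x, v <= x -> x < w -> restoring k x < 0).
  { intros x hx hxw. destruct (Rlt_le_dec (restoring k x) 0) as [|hle]; auto. exfalso.
    rewrite restoring_eq in hle, hr by lra. pose proof (Rpower_pos x q). pose proof (Rpower_pos w q). pose proof B_pos. pose proof q_range.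
    assert (Rpower x (1 - q) < Rpower w (1 - q)) by (apply Rpower_incr; lra).
    assert (0 <= B * Rpower x (1 - q) - k). { destruct (Rle_lt_dec 0 (B * Rpower x (1 - q) - k)); auto. exfalso. nra. }
    assert (B * Rpower x (1 - q) < B * Rpower w (1 - q)) by (apply Rmult_lt_compat_l; auto). nra. }
  set (m := (v + w) / 2). assert (potential k m < potential k v).
  { apply (strict_decr_of_derive (potential k) (restoring k)); [unfold m; lra|intros x hx; apply potential_derive; lra|].
    intros x hx. apply hneg; unfold m in *; lra. }
  assert (potential k w <= potential k m); [|lra].
  apply (decr_of_derive (potential k) (restoring k)); [unfold m; lra|intros x hx; apply potential_derive; unfold m in *; lra|].
  intros x hx. destruct (Req_dec x w) as [->|]; auto. left. apply hneg; unfold m in *; lra.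
Qed.

Hypothesis hturn : ~ turning P.
Hypothesis htrap : ~ ever_trapped k W P.

(** At a late slow time the drag coefficient at [wl] is below [A] and the kinetic energy below the
    margin [eps], so the orbit would be trapped. *)
Lemma trapped_late wl S0 v eps : 0 < wl -> 0 < eps -> 0 < S0 -> (forall s, S0 <= s -> wl < W s /\ W s <= v) ->
  (forall s, S0 <= s -> potential k (W s) + eps <= potential k wl) -> False.
Proof.
  intros hwl he hS hW hV. pose proof A_pos as hA. pose proof a_range as ha.
  set (Ph := a * Rpower wl (a - 1)). assert (hPh : 0 < Ph) by (apply Rmult_lt_0_compat; [lra|apply Rpower_pos]).
  destruct (E_small 1 (A / Ph) ltac:(lra)) as [s1 [hs1 hE]]. { apply Rdiv_lt_0_compat; auto. }
  set (e1 := Rmin 1 eps). assert (g1 : e1 <= 1) by apply Rmin_l. assert (g2 : e1 <= eps) by apply Rmin_r.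
  assert (he1 : 0 < e1) by (apply Rmin_pos; lra).
  assert (h1 := Rmax_l S0 s1). assert (h2 := Rmax_r S0 s1).
  destruct (slow_times (Rmax S0 s1) v e1 ltac:(lra) he1) as [s [hs hP]].
  { intros s hs. destruct (hW s ltac:(lra)). rewrite Rabs_pos_eq; lra. }
  apply htrap. exists s, wl. split; [lra|]. split; [auto|]. split; [apply hW; lra|]. split.
  - fold Ph. apply Rle_trans with (A / Ph * Ph); [|right; field; lra]. apply Rmult_le_compat_r; [lra|]. left. apply hE. lra.
  - unfold energy. specialize (hV s ltac:(lra)).
    assert (P s * P s <= e1). { replace (P s * P s) with (Rabs (P s) * Rabs (P s)) by (rewrite <- Rabs_mult; apply Rabs_pos_eq, Rle_0_sqr).
      pose proof (Rabs_pos (P s)). nra. }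
    lra.
Qed.

Lemma orbit_turns : exists s1, 0 < s1 /\ P s1 < 0.
Proof.
  destruct (classic (exists s1, 0 < s1 /\ P s1 < 0)) as [|hn]; auto. exfalso.
  assert (hP : forall s, 0 < s -> 0 <= P s).
  { intros s hs. destruct (Rle_lt_dec 0 (P s)); auto. exfalso. apply hn. now exists s. }
  assert (hW : forall r s, 0 < r -> r <= s -> W r <= W s).
  { intros r s hr hs. apply (incr_of_derive W P); auto; intros x hx; [apply tail_at|apply hP]; lra. }
  pose proof A_pos as hA. pose proof a_range as ha.
  (* Either the rising orbit passes the height of zero force, and the force turns it, or it stays in
     the well, where a lower height serves as the rim of a trap. *)
  destruct (classic (exists s, 0 < s /\ 0 < restoring k (W s))) as [[s0 [hs0 hr0]]|hnr].
  - set (n0 := restoring k (W s0)) in *. assert (hW0 : 0 < W s0) by (apply tail_at; auto).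
    set (Ph := a * Rpower (W s0) (a - 1)). assert (hPh : 0 < Ph) by (apply Rmult_lt_0_compat; [lra|apply Rpower_pos]).
    destruct (E_small 1 (A / Ph) ltac:(lra)) as [s1 [hs1 hE]]. { apply Rdiv_lt_0_compat; auto. }
    set (t1 := s0 + s1). set (t2 := t1 + P t1 / n0 + 1).
    assert (hPt := hP t1 ltac:(unfold t1; lra)). assert (hq : 0 <= P t1 / n0).
    { apply Rmult_le_pos; auto. left; now apply Rinv_0_lt_compat. }
    destruct (MVT_interval P (fun s => accel k 1 s (W s) (P s)) t1 t2 ltac:(unfold t2; lra)) as [x [hx ex]].
    { intros x hx. apply tail_at. unfold t1 in hx; lra. }
    assert (hx0 : s0 + s1 <= x) by (unfold t1 in hx; lra).
    assert (hWx := hW s0 x hs0 ltac:(lra)).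
    assert (hr : n0 <= restoring k (W x)).
    { apply restoring_mono; auto. unfold n0 in hr0; lra. }
    assert (hacc : accel k 1 x (W x) (P x) <= - n0).
    { replace (accel k 1 x (W x) (P x)) with ((E 1 x * (a * Rpower (W x) (a - 1)) - A) * P x - restoring k (W x)) by (unfold accel, restoring; ring).
      specialize (hE x ltac:(lra)). specialize (hP x ltac:(lra)). pose proof (E_pos 1 x ltac:(lra)).
      assert (a * Rpower (W x) (a - 1) <= Ph) by (apply Rmult_le_compat_l; [lra|apply Rpower_le_neg; lra]).
      assert (E 1 x * (a * Rpower (W x) (a - 1)) <= A).
      { apply Rle_trans with (A / Ph * Ph); [|right; field; lra]. apply Rmult_le_compat; try lra.
        apply Rmult_le_pos; [lra|left; apply Rpower_pos]. }
      nra. }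
    assert (accel k 1 x (W x) (P x) * (t2 - t1) <= - n0 * (t2 - t1)) by (apply Rmult_le_compat_r; unfold t2; lra).
    assert (- n0 * (t2 - t1) = - P t1 - n0) by (unfold t2; field; lra).
    assert (ht1 : 0 < t1) by (unfold t1; lra).
    assert (0 <= P t2) by (apply hP; unfold t2; lra). lra.
  - assert (hr : forall s, 0 < s -> restoring k (W s) <= 0).
    { intros s hs. destruct (Rle_lt_dec (restoring k (W s)) 0); auto. exfalso. apply hnr. now exists s. }
    assert (hW1 : 0 < W 1) by (apply tail_at; lra).
    assert (hV1 := potential_decr (W 1 / 2) (W 1) ltac:(lra) ltac:(lra) (hr 1 ltac:(lra))).
    set (v := Rpower (k / B) (/ (1 - q))).
    assert (hv : forall s, 0 < s -> W s <= v).
    { intros s hs. specialize (hr s hs). destruct (tail_at s hs) as [w1 _]. rewrite restoring_eq in hr by auto.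
      pose proof (Rpower_pos (W s) q). pose proof B_pos. pose proof q_range.
      assert (h1 : B * Rpower (W s) (1 - q) - k <= 0). { destruct (Rle_lt_dec (B * Rpower (W s) (1 - q) - k) 0); auto. exfalso. nra. }
      destruct (Rle_lt_dec (W s) v) as [|hlt]; auto. exfalso.
      assert (h2 : Rpower v (1 - q) < Rpower (W s) (1 - q)) by (apply Rpower_incr; [lra|apply Rpower_pos|auto]).
      unfold v in h2. rewrite Rpower_inv_base in h2 by (try apply Rdiv_lt_0_compat; lra).
      assert (B * (k / B) < B * Rpower (W s) (1 - q)) by (apply Rmult_lt_compat_l; auto).
      replace (B * (k / B)) with k in H2 by (field; lra). lra. }
    apply (trapped_late (W 1 / 2) 1 v (potential k (W 1 / 2) - potential k (W 1))); try lra.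
    + intros s hs. split; [|apply hv; lra]. specialize (hW 1 s ltac:(lra) hs). lra.
    + intros s hs. assert (potential k (W s) <= potential k (W 1)); [|lra].
      destruct (hW 1 s ltac:(lra) hs) as [hlt|e]; [|rewrite e; lra]. left. apply potential_decr; auto. apply hr; lra.
Qed.

Lemma orbit_decreasing : exists s1, 0 < s1 /\ forall s, s1 <= s -> P s <= 0.
Proof.
  destruct orbit_turns as [s1 [hs1 hP1]]. exists s1. split; auto. intros s hs.
  destruct (Rle_lt_dec (P s) 0) as [|hlt]; auto. exfalso. apply hturn. exists s1, s.
  destruct (Req_dec s1 s) as [e|]; [rewrite e in hP1; lra|]. repeat split; auto; lra.
Qed.

(** A positive limit [l] of the decreasing orbit is impossible: a positive force at [l] would bring
    [P] below -1 for good, and otherwise [l] lies in the well, where a late slow orbit is trapped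
    above [l / 2]. *)
Lemma orbit_vanishes eps : 0 < eps -> exists S0, 0 < S0 /\ forall s, S0 <= s -> W s < eps /\ P s <= 0.
Proof.
  intros he. destruct orbit_decreasing as [s1 [hs1 hP]].
  assert (hW : forall r s, s1 <= r -> r <= s -> W s <= W r).
  { intros r s hr hs. apply (decr_of_derive W P); auto; intros x hx; [apply tail_at|apply hP]; lra. }
  destruct (classic (exists s, s1 <= s /\ W s < eps)) as [[s2 [hs2 h2]]|hn].
  { exists s2. split; [lra|]. intros s hs. split; [specialize (hW s2 s ltac:(lra) hs); lra|apply hP; lra]. }
  exfalso.
  assert (hlow : forall s, s1 <= s -> eps <= W s).
  { intros s hs. destruct (Rle_lt_dec eps (W s)); auto. exfalso. apply hn. now exists s. }
  destruct (completeness (fun x => exists s, s1 <= s /\ x = - W s)) as [ml [hub hlub]].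
  { exists (- eps). intros x [s [hs ->]]. specialize (hlow s hs). lra. }
  { exists (- W s1). exists s1. split; [lra|auto]. }
  set (l := - ml).
  assert (hl1 : forall s, s1 <= s -> l <= W s).
  { intros s hs. assert (- W s <= ml) by (apply hub; now exists s). unfold l. lra. }
  assert (hl0 : eps <= l).
  { assert (ml <= - eps); [|unfold l; lra]. apply hlub. intros x [s [hs ->]]. specialize (hlow s hs). lra. }
  assert (hl2 : forall d, 0 < d -> exists s, s1 <= s /\ forall r, s <= r -> W r < l + d).
  { intros d hd. destruct (classic (exists s, s1 <= s /\ W s < l + d)) as [[s [hs h]]|hnn].
    - exists s. split; auto. intros r hr. specialize (hW s r hs hr). lra.
    - exfalso. assert (ml <= - (l + d)); [|unfold l in *; lra]. apply hlub. intros x [s [hs ->]].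
      destruct (Rlt_le_dec (W s) (l + d)); [exfalso; apply hnn; now exists s|lra]. }
  pose proof A_pos as hA.
  assert (hrl : restoring k l <= 0).
  { destruct (Rle_lt_dec (restoring k l) 0) as [|hr]; auto. exfalso.
    assert (hr2 : 0 < restoring k l / 2) by lra.
    destruct (continuous_eps (restoring k) l (restoring_continuous k l ltac:(lra)) _ hr2) as [d [hd hc]].
    destruct (hl2 d hd) as [s2 [hs2 h2]].
    set (n0 := restoring k l / 2). assert (hn0 : 0 < n0) by (unfold n0; lra).
    (* Adding [A W] to [P] cancels the friction; the drag has the sign of [P], so only the force
       remains. *)
    assert (hdec : forall s, s2 <= s -> P s + A * W s <= P s2 + A * W s2 - n0 * (s - s2)).
    { intros s hs. assert (hx : (P s + A * W s) + n0 * s <= (P s2 + A * W s2) + n0 * s2); [|lra].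
      apply (decr_of_derive (fun r => (P r + A * W r) + n0 * r) (fun r => accel k 1 r (W r) (P r) + A * P r + n0)); auto.
      - intros x hx. destruct (tail_at x ltac:(lra)) as [w1 [w2 w3]]. dsolve.
      - intros x hx. specialize (hl1 x ltac:(lra)). specialize (h2 x ltac:(lra)). specialize (hP x ltac:(lra)).
        specialize (hc (W x) ltac:(apply Rabs_def1; lra)). apply Rabs_def2 in hc.
        assert (E 1 x * (a * Rpower (W x) (a - 1)) * P x <= 0).
        { assert (0 < E 1 x * (a * Rpower (W x) (a - 1))) by (apply Rmult_lt_0_compat; [apply E_pos; lra|apply Rmult_lt_0_compat; [apply a_range|apply Rpower_pos]]). nra. }
        unfold accel. unfold restoring in *. unfold n0. lra. }
    assert (hneg : forall s, s2 + (P s2 + A * W s2 + 1) / n0 <= s -> s2 <= s -> P s <= - 1).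
    { intros s hs hs'. specialize (hdec s hs'). specialize (hl1 s ltac:(lra)).
      assert (0 <= A * W s) by (apply Rmult_le_pos; lra).
      assert (n0 * ((P s2 + A * W s2 + 1) / n0) <= n0 * (s - s2)) by (apply Rmult_le_compat_l; lra).
      replace (n0 * ((P s2 + A * W s2 + 1) / n0)) with (P s2 + A * W s2 + 1) in H0 by (field; lra). lra. }
    set (t := Rmax s2 (s2 + (P s2 + A * W s2 + 1) / n0)). assert (g1 := Rmax_l s2 (s2 + (P s2 + A * W s2 + 1) / n0)).
    assert (g2 := Rmax_r s2 (s2 + (P s2 + A * W s2 + 1) / n0)). fold t in g1, g2.
    assert (hWt : 0 < W t) by (apply tail_at; lra).
    destruct (MVT_interval W P t (t + W t) ltac:(lra)) as [x [hx ex]]. { intros x hx. apply tail_at; lra. }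
    specialize (hneg x ltac:(lra) ltac:(lra)).
    assert (0 < W (t + W t)) by (apply tail_at; lra). nra. }
  assert (hV := potential_decr (l / 2) l ltac:(lra) ltac:(lra) hrl).
  set (g := potential k (l / 2) - potential k l) in *.
  assert (hg2 : 0 < g / 2) by (unfold g; lra).
  destruct (continuous_eps (potential k) l (derive_continuous _ _ _ (potential_derive k l ltac:(lra))) (g / 2) hg2) as [d [hd hc]].
  destruct (hl2 d hd) as [s2 [hs2 h2]].
  apply (trapped_late (l / 2) s2 (W s2) (g / 2)); try (unfold g; lra).
  - intros s hs. specialize (hl1 s ltac:(lra)). split; [lra|apply hW; lra].
  - intros s hs. specialize (hl1 s ltac:(lra)). specialize (h2 s hs).
    specialize (hc (W s) ltac:(apply Rabs_def1; lra)). apply Rabs_def2 in hc. unfold g in *. lra.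
Qed.

End Tail.

(** * Decay rate *)

Section TailLimit.
Context {c : coeffs}.
Variables (k : R) (W P : R -> R).
Hypothesis hk : 0 < k.
Hypothesis horb : forall T, 0 < T -> orbit k 1 W P 0 T.
Hypothesis hvan : forall eps, 0 < eps -> exists S0, 0 < S0 /\ forall s, S0 <= s -> W s < eps /\ P s <= 0.

Lemma tailw_pos s : 0 < s -> 0 < tailw W s.
Proof. intros hs. apply Rmult_lt_0_compat; [apply exp_pos|apply (horb (s + 1)); lra]. Qed.

Lemma tailw_d s : 0 < s -> is_derive (tailw W) s (tailz W P s).
Proof. intros hs. apply (tailw_derive k 1 W P 0 (s + 1)); [apply horb|]; lra. Qed.

Lemma tailz_d s : 0 < s -> is_derive (tailz W P) s (tail_accel k s (tailw W s) (tailz W P s)).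
Proof. intros hs. apply (tailz_derive k 1 W P 0 (s + 1)); [apply horb|]; lra. Qed.

Lemma growth_large M : exists S0, 0 < S0 /\ forall s, S0 <= s -> M <= exp (chi * (1 - q) * s).
Proof.
  pose proof chi_pos. pose proof q_range. set (r := chi * (1 - q)). assert (hr : 0 < r) by (apply Rmult_lt_0_compat; lra).
  exists (Rmax 1 (M / r)). assert (h1 := Rmax_l 1 (M / r)). assert (h2 := Rmax_r 1 (M / r)). split; [lra|].
  intros s hs. pose proof (exp_ineq1_le (r * s)).
  assert (M <= r * s). { apply Rle_trans with (r * (M / r)); [right; field; lra|apply Rmult_le_compat_l; lra]. }
  lra.
Qed.

Lemma stays_below w1 S0 : 0 < S0 -> (forall s, S0 <= s -> w1 <= tailw W s -> tailz W P s <= 0) -> tailw W S0 <= w1 ->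
  forall s, S0 <= s -> tailw W s <= w1.
Proof.
  intros hS h h0 s hs. destruct (Rle_lt_dec (tailw W s) w1) as [|hlt]; auto. exfalso.
  assert (S0 < s). { destruct (Req_dec S0 s) as [e|]; [rewrite e in h0|]; lra. }
  destruct (last_zero (fun x => tailw W x - w1) S0 s) as [y [hy [ey py]]]; try lra.
  { intros x hx. apply (continuous_minus (tailw W) (fun _ => w1)); [eapply derive_continuous, tailw_d; lra|apply continuous_const]. }
  destruct (MVT_interval (tailw W) (tailz W P) y s ltac:(lra)) as [x [hx ex]]. { intros x hx. apply tailw_d; lra. }
  assert (hz : tailz W P x <= 0).
  { apply h; [lra|]. destruct (Req_dec x y) as [->|]; [lra|]. specialize (py x ltac:(lra)). lra. }
  nra.
Qed.

Lemma stays_above w2 S0 : 0 < S0 -> (forall s, S0 <= s -> tailw W s <= w2 -> 0 <= tailz W P s) -> w2 <= tailw W S0 ->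
  forall s, S0 <= s -> w2 <= tailw W s.
Proof.
  intros hS h h0 s hs. destruct (Rle_lt_dec w2 (tailw W s)) as [|hlt]; auto. exfalso.
  assert (S0 < s). { destruct (Req_dec S0 s) as [e|]; [rewrite e in h0|]; lra. }
  destruct (last_zero (fun x => w2 - tailw W x) S0 s) as [y [hy [ey py]]]; try lra.
  { intros x hx. apply (continuous_minus (fun _ => w2) (tailw W)); [apply continuous_const|eapply derive_continuous, tailw_d; lra]. }
  destruct (MVT_interval (tailw W) (tailz W P) y s ltac:(lra)) as [x [hx ex]]. { intros x hx. apply tailw_d; lra. }
  assert (hz : 0 <= tailz W P x).
  { apply h; [lra|]. destruct (Req_dec x y) as [->|]; [lra|]. specialize (py x ltac:(lra)). lra. }
  nra.
Qed.

Lemma tail_source_factor w : 0 < w -> tail_source k 1 w = Rpower w a * (k * Rpower w (q - a) - chi * a).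
Proof.
  intros hw. unfold tail_source. replace (Rpower w q) with (Rpower w a * Rpower w (q - a)); [ring|].
  rewrite <- Rpower_plus. f_equal. ring.
Qed.

(* Above the equilibrium level an increasing tail variable would grow faster than W can. *)
Lemma no_growth_above w1 : 0 < w1 -> chi * a < k * Rpower w1 (q - a) ->
  exists S0, 0 < S0 /\ forall s, S0 <= s -> w1 <= tailw W s -> tailz W P s <= 0.
Proof.
  intros hw1 hc. pose proof a_range as ha. pose proof q_range as hq. pose proof a_lt_q as haq. pose proof A_pos as hA. pose proof chi_pos as hchi.
  pose proof (Rpower_pos w1 (q - a)) as hp1.
  (* Above the level [w1] the drag term is at most [1 - th] times the absorption term. *)
  set (th := 1 - chi * a / (k * Rpower w1 (q - a))).
  assert (hkp : 0 < k * Rpower w1 (q - a)) by (now apply Rmult_lt_0_compat).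
  assert (hth : 0 < th).
  { unfold th. assert (chi * a / (k * Rpower w1 (q - a)) < 1); [|lra].
    apply Rmult_lt_reg_r with (k * Rpower w1 (q - a)); auto. unfold Rdiv. rewrite Rmult_assoc, Rinv_l by lra. lra. }
  (* Bounds the other terms of [x'] for [0 < x <= chi], with 1 to spare. *)
  set (Lam := A * chi + Rabs b0 + chi * chi + 1). 
  assert (hqneg : q - 1 < 0) by lra.
  destruct (Rpower_large (q - 1) (Lam / (th * k)) hqneg) as [eps [heps hlarge]].
  destruct (hvan eps heps) as [S0 [hS hS0]]. exists S0. split; auto. intros s hs hw.
  destruct (Rle_lt_dec (tailz W P s) 0) as [|hz]; auto. exfalso.
  (* [x] is the logarithmic derivative of [tailw]. It is at most [chi] because [P <= 0], yet a
     positive value would force [x' >= 1] for ever. *)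
  set (x := fun r => P r / W r + chi).
  set (dx := fun r => (accel k 1 r (W r) (P r) * W r - P r * P r) / (W r * W r)).
  assert (hdx : forall r, 0 < r -> is_derive x r (dx r)).
  { intros r hr. destruct (horb (r + 1) ltac:(lra) r ltac:(lra)) as [w1' [w2 w3]]. unfold x, dx. dsolve. }
  assert (hxz : forall r, 0 < r -> tailz W P r = x r * tailw W r).
  { intros r hr. destruct (horb (r + 1) ltac:(lra) r ltac:(lra)) as [w1' _]. unfold tailz, tailw, x. field. lra. }
  assert (hxle : forall r, S0 <= r -> x r <= chi).
  { intros r hr. destruct (hS0 r hr) as [_ hP]. destruct (horb (r + 1) ltac:(lra) r ltac:(lra)) as [w1' _].
    unfold x. assert (0 < / W r) by now apply Rinv_0_lt_compat. unfold Rdiv. nra. }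
  assert (hfast : forall r, S0 <= r -> w1 <= tailw W r -> 0 < x r -> 1 <= dx r).
  { intros r hr hwr hxr. destruct (horb (r + 1) ltac:(lra) r ltac:(lra)) as [w1' _].
    destruct (hS0 r hr) as [hWe hP]. assert (hl := hlarge (W r) w1' hWe). assert (hx1 := hxle r hr).
    assert (htw := tailw_pos r ltac:(lra)).
    assert (edx : dx r = (2 * chi - A) * x r - b0 - x r * x r + (k * Rpower (W r) (q - 1) - E 1 r * chi * a * Rpower (W r) (a - 1)) + E 1 r * a * Rpower (W r) (a - 1) * x r).
    { unfold dx, x, accel, b0. rewrite <- (Rpower_succ (W r) q w1'). field. lra. }
    assert (hsrc : th * k * Rpower (W r) (q - 1) <= k * Rpower (W r) (q - 1) - E 1 r * chi * a * Rpower (W r) (a - 1)).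
    { assert (e1 : E 1 r * Rpower (W r) (a - 1) = Rpower (W r) (q - 1) / Rpower (tailw W r) (q - a)).
      { rewrite tailw_pow by auto. unfold E. rewrite Rmult_1_l.
        replace (chi * (q - a) * r) with (om * r) by (rewrite <- chi_om; ring).
        replace (- om * r) with (- (om * r)) by ring. rewrite exp_Ropp.
        replace (Rpower (W r) (q - 1)) with (Rpower (W r) (a - 1) * Rpower (W r) (q - a)) by (rewrite <- Rpower_plus; f_equal; ring).
        pose proof (Rpower_pos (W r) (q - a)). pose proof (exp_pos (om * r)). field. lra. }
      replace (E 1 r * chi * a * Rpower (W r) (a - 1)) with (chi * a * (E 1 r * Rpower (W r) (a - 1))) by ring. rewrite e1.
      assert (hge : Rpower w1 (q - a) <= Rpower (tailw W r) (q - a)) by (apply Rpower_le; lra).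
      pose proof (Rpower_pos (W r) (q - 1)) as hpq.
      assert (hinv : / Rpower (tailw W r) (q - a) <= / Rpower w1 (q - a)) by (apply Rinv_le_contravar; auto).
      assert (hca : 0 < chi * a) by (now apply Rmult_lt_0_compat).
      assert (hm : chi * a * Rpower (W r) (q - 1) * / Rpower (tailw W r) (q - a) <= chi * a * Rpower (W r) (q - 1) * / Rpower w1 (q - a)).
      { apply Rmult_le_compat_l; auto. left. now apply Rmult_lt_0_compat. }
      replace (th * k * Rpower (W r) (q - 1)) with (k * Rpower (W r) (q - 1) - chi * a * Rpower (W r) (q - 1) * / Rpower w1 (q - a)) by (unfold th; field; lra).
      unfold Rdiv. lra. }
    assert (hbig : Lam <= th * k * Rpower (W r) (q - 1)).
    { assert (htk : 0 < th * k) by (now apply Rmult_lt_0_compat).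
      apply Rle_trans with (th * k * (Lam / (th * k))); [right; field; lra|apply Rmult_le_compat_l; lra]. }
    assert (hpos : 0 <= E 1 r * a * Rpower (W r) (a - 1) * x r).
    { apply Rmult_le_pos; [|lra]. apply Rmult_le_pos; [|left; apply Rpower_pos]. apply Rmult_le_pos; [left; apply E_pos|]; lra. }
    assert (hxx : x r * x r <= chi * chi) by (apply Rmult_le_compat; lra).
    assert (hAx : A * x r <= A * chi) by (apply Rmult_le_compat_l; lra).
    pose proof (Rle_abs b0). assert (0 <= chi * x r) by (apply Rmult_le_pos; lra). rewrite edx. unfold Lam in hbig. lra. }
  assert (hx0 : 0 < x s).
  { assert (hp := tailw_pos s ltac:(lra)). rewrite hxz in hz by lra. destruct (Rlt_le_dec 0 (x s)); auto. exfalso. nra. }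
  assert (hkeep : forall r, s <= r -> x s / 2 < x r).
  { intros r hr. destruct (Rlt_le_dec (x s / 2) (x r)) as [|hle]; auto. exfalso.
    assert (s < r). { destruct (Req_dec s r) as [e|]; [rewrite <- e in hle|]; lra. }
    destruct (first_zero (fun r => x r - x s / 2) s r) as [y [hy [ey py]]]; try lra.
    { intros t ht. apply (continuous_minus x (fun _ => x s / 2)); [eapply derive_continuous, hdx; lra|apply continuous_const]. }
    assert (hxp : forall t, s <= t <= y -> 0 < x t).
    { intros t ht. destruct (Req_dec t y) as [->|]; [lra|]. specialize (py t ltac:(lra)). lra. }
    assert (hwt : forall t, s <= t <= y -> w1 <= tailw W t).
    { intros t ht. apply Rle_trans with (tailw W s); auto.
      apply (incr_of_derive (tailw W) (tailz W P)); [lra|intros u hu; apply tailw_d; lra|].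
      intros u hu. rewrite hxz by lra. specialize (hxp u ltac:(lra)). pose proof (tailw_pos u ltac:(lra)). nra. }
    assert (x s <= x y); [|lra].
    apply (incr_of_derive x dx); [lra|intros u hu; apply hdx; lra|].
    intros u hu. assert (1 <= dx u); [|lra]. apply hfast; [lra|apply hwt; lra|apply hxp; lra]. }
  assert (hwt : forall t, s <= t -> w1 <= tailw W t).
  { intros t ht. apply Rle_trans with (tailw W s); auto.
    apply (incr_of_derive (tailw W) (tailz W P)); [lra|intros u hu; apply tailw_d; lra|].
    intros u hu. rewrite hxz by lra. specialize (hkeep u ltac:(lra)). pose proof (tailw_pos u ltac:(lra)). nra. }
  assert (hsx : s < s + chi) by lra. destruct (MVT_interval x dx s (s + chi) hsx) as [y [hy ey]]. { intros y hy. apply hdx; lra. }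
  assert (1 <= dx y). { apply hfast; [lra|apply hwt; lra|specialize (hkeep y ltac:(lra)); lra]. }
  assert (hsx' : S0 <= s + chi) by lra. specialize (hxle (s + chi) hsx'). nra.
Qed.

(** Otherwise the tail variable decreases for ever above [w1], with [tail_source] at least [g1] and
    multiplied by a growing factor. A velocity [z >= - d1] would then be driven to positive values,
    and [z < - d1] for ever would make the tail variable negative. *)
Lemma eventually_below w1 : 0 < w1 -> chi * a < k * Rpower w1 (q - a) ->
  exists S0, 0 < S0 /\ forall s, S0 <= s -> tailw W s <= w1.
Proof.
  intros hw1 hc. destruct (no_growth_above w1 hw1 hc) as [S0 [hS h]].
  destruct (classic (exists s, S0 <= s /\ tailw W s <= w1)) as [[S1 [hS1 h1]]|hn].
  { exists S1. split; [lra|]. apply stays_below; auto; [lra|]. intros s hs. apply h; lra. }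
  exfalso. assert (hlow : forall s, S0 <= s -> w1 <= tailw W s).
  { intros s hs. destruct (Rle_lt_dec w1 (tailw W s)); auto. exfalso. apply hn. exists s; split; lra. }
  pose proof a_range as ha. pose proof q_range as hq. pose proof a_lt_q as haq. pose proof A_pos as hA. pose proof chi_pos as hchi.
  set (M := tailw W S0).
  assert (hM : forall s, S0 <= s -> tailw W s <= M).
  { intros s hs. apply (decr_of_derive (tailw W) (tailz W P)); auto; [intros u hu; apply tailw_d; lra|].
    intros u hu. apply h; [lra|apply hlow; lra]. }
  set (g1 := Rpower w1 a * (k * Rpower w1 (q - a) - chi * a)).
  pose proof (Rpower_pos w1 a) as hpa. assert (hg1 : 0 < g1) by (apply Rmult_lt_0_compat; lra).
  assert (hts : forall s, S0 <= s -> g1 <= tail_source k 1 (tailw W s)).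
  { intros s hs. specialize (hlow s hs). rewrite tail_source_factor by lra. unfold g1.
    assert (Rpower w1 a <= Rpower (tailw W s) a) by (apply Rpower_le; lra).
    assert (Rpower w1 (q - a) <= Rpower (tailw W s) (q - a)) by (apply Rpower_le; lra).
    assert (k * Rpower w1 (q - a) <= k * Rpower (tailw W s) (q - a)) by (apply Rmult_le_compat_l; lra).
    apply Rmult_le_compat; lra. }
  set (q1 := a * Rpower w1 (a - 1)). assert (hq1 : 0 < q1) by (apply Rmult_lt_0_compat; [lra|apply Rpower_pos]).
  (* For velocities between [- d1] and 0 the drag takes at most half of [g1]. *)
  set (d1 := g1 / (2 * q1)). assert (hd1 : 0 < d1) by (apply Rdiv_lt_0_compat; lra).
  destruct (growth_large ((Rabs (2 * chi - A) * d1 + Rabs b0 * M + 1) / (g1 / 2))) as [S2 [hS2 hX]].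
  set (S3 := Rmax S0 S2). assert (i1 := Rmax_l S0 S2). assert (i2 := Rmax_r S0 S2). fold S3 in i1, i2.
  assert (hup : forall s, S3 <= s -> - d1 <= tailz W P s -> 1 <= tail_accel k s (tailw W s) (tailz W P s)).
  { intros s hs hz. assert (hz0 := h s ltac:(lra) (hlow s ltac:(lra))). specialize (hts s ltac:(lra)). specialize (hX s ltac:(lra)).
    specialize (hlow s ltac:(lra)). specialize (hM s ltac:(lra)).
    unfold tail_accel. set (X := exp (chi * (1 - q) * s)) in *. set (z := tailz W P s) in *. set (w := tailw W s) in *.
    assert (hXg : Rabs (2 * chi - A) * d1 + Rabs b0 * M + 1 <= X * (g1 / 2)).
    { apply Rle_trans with ((Rabs (2 * chi - A) * d1 + Rabs b0 * M + 1) / (g1 / 2) * (g1 / 2)); [right; field; lra|apply Rmult_le_compat_r; lra]. }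
    assert (hXp : 0 < X) by apply exp_pos.
    assert (hpw : Rpower w (a - 1) <= Rpower w1 (a - 1)) by (apply Rpower_le_neg; lra).
    assert (hz1 : - (g1 / 2) <= 1 * a * Rpower w (a - 1) * z).
    { assert (q1 * d1 = g1 / 2) by (unfold d1; field; lra).
      assert (a * Rpower w (a - 1) <= q1) by (apply Rmult_le_compat_l; lra).
      assert (0 < a * Rpower w (a - 1)) by (apply Rmult_lt_0_compat; [lra|apply Rpower_pos]).
      assert (a * Rpower w (a - 1) * - z <= q1 * d1) by (apply Rmult_le_compat; lra). lra. }
    assert (hz2 : X * (g1 / 2) <= X * (tail_source k 1 w + 1 * a * Rpower w (a - 1) * z)) by (apply Rmult_le_compat_l; lra).
    assert (hz3 : - (Rabs (2 * chi - A) * d1) <= (2 * chi - A) * z).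
    { assert (Rabs ((2 * chi - A) * z) <= Rabs (2 * chi - A) * d1).
      { rewrite Rabs_mult. apply Rmult_le_compat_l; [apply Rabs_pos|]. rewrite Rabs_left1; lra. }
      apply Rabs_le_between in H. lra. }
    assert (hz4 : b0 * w <= Rabs b0 * M).
    { apply Rle_trans with (Rabs b0 * w); [apply Rmult_le_compat_r; [lra|apply Rle_abs]|apply Rmult_le_compat_l; [apply Rabs_pos|lra]]. }
    lra. }
  destruct (classic (exists s, S3 <= s /\ - d1 <= tailz W P s)) as [[s [hs hz]]|hnn].
  - assert (hb : forall r, s <= r -> - d1 <= tailz W P r).
    { intros r hr. apply (barrier_below (tailz W P) (fun u => tail_accel k u (tailw W u) (tailz W P u)) s r); auto.
      - intros u hu. apply tailz_d; lra.
      - intros u hu e. specialize (hup u ltac:(lra) ltac:(lra)). lra. }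
    destruct (MVT_interval (tailz W P) (fun u => tail_accel k u (tailw W u) (tailz W P u)) s (s + d1 + 1) ltac:(lra)) as [y [hy ey]].
    { intros u hu. apply tailz_d; lra. }
    specialize (hup y ltac:(lra) (hb y ltac:(lra))). assert (h2 := h (s + d1 + 1) ltac:(lra) (hlow (s + d1 + 1) ltac:(lra))). nra.
  - assert (hMp : 0 < M) by (apply tailw_pos; lra).
    assert (hMd : 0 < M / d1) by (apply Rdiv_lt_0_compat; lra).
    destruct (MVT_interval (tailw W) (tailz W P) S3 (S3 + M / d1) ltac:(lra)) as [y [hy ey]]. { intros u hu. apply tailw_d; lra. }
    assert (hz : tailz W P y < - d1). { destruct (Rlt_le_dec (tailz W P y) (- d1)); auto. exfalso. apply hnn. exists y; lra. }
    assert (hp := tailw_pos (S3 + M / d1) ltac:(lra)). specialize (hM S3 i1).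
    assert (tailz W P y * (M / d1) <= - d1 * (M / d1)) by (apply Rmult_le_compat_r; lra).
    assert (- d1 * (M / d1) = - M) by (field; lra).
    replace (S3 + M / d1 - S3) with (M / d1) in ey by ring. lra.
Qed.

(** Below the balance [tail_source] is negative, and the growing factor in front of it replaces the
    smallness of the level required by [fatal]: a descent from there would again be irreversible,
    which a global orbit excludes. *)
Lemma no_descent_below w2 : 0 < w2 -> k * Rpower w2 (q - a) < chi * a ->
  exists S0, 0 < S0 /\ forall s, S0 <= s -> tailw W s <= w2 -> 0 <= tailz W P s.
Proof.
  intros hw2 hc. pose proof a_range as ha. pose proof q_range as hq. pose proof a_lt_q as haq. pose proof A_pos as hA. pose proof chi_pos as hchi.
  set (th := chi * a - k * Rpower w2 (q - a)). assert (hth : 0 < th) by (unfold th; lra).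
  set (q2 := a * Rpower w2 (a - 1)). assert (hq2 : 0 < q2) by (apply Rmult_lt_0_compat; [lra|apply Rpower_pos]).
  pose proof (Rpower_pos w2 (1 - a)) as hp1. pose proof (Rabs_pos b0) as hb0.
  destruct (growth_large (A / q2 + (Rabs b0 * Rpower w2 (1 - a)) / th)) as [S0 [hS hX]].
  exists S0. split; auto. intros s hs hw. destruct (Rle_lt_dec 0 (tailz W P s)) as [|hz]; auto. exfalso.
  assert (hX' : forall r, S0 <= r -> A <= exp (chi * (1 - q) * r) * q2 /\ Rabs b0 * Rpower w2 (1 - a) <= exp (chi * (1 - q) * r) * th).
  { intros r hr. specialize (hX r hr). 
    assert (0 < A / q2) by (apply Rdiv_lt_0_compat; auto).
    assert (0 <= Rabs b0 * Rpower w2 (1 - a) / th). { apply Rmult_le_pos; [apply Rmult_le_pos; lra|left; now apply Rinv_0_lt_compat]. }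
    split.
    - apply Rle_trans with (A / q2 * q2); [right; field; lra|apply Rmult_le_compat_r; lra].
    - apply Rle_trans with (Rabs b0 * Rpower w2 (1 - a) / th * th); [right; field; lra|apply Rmult_le_compat_r; lra]. }
  set (T := s + tailw W s / - tailz W P s + 1). assert (hp := tailw_pos s ltac:(lra)).
  assert (hq0 : 0 < tailw W s / - tailz W P s) by (apply Rdiv_lt_0_compat; lra).
  assert (hT : T <= s + tailw W s / - tailz W P s); [|unfold T in hT; lra].
  apply (irreversible_descent w2 k W P T s); auto.
  - apply horb. unfold T; lra.
  - intros r w z hr hww hzz. unfold tail_accel. destruct (hX' r ltac:(lra)) as [x1 x2].
    set (X := exp (chi * (1 - q) * r)) in *. assert (hXp : 0 < X) by apply exp_pos.
    rewrite tail_source_factor by lra. pose proof (Rpower_pos w a) as hpa.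
    assert (p1 : Rpower w2 (a - 1) <= Rpower w (a - 1)) by (apply Rpower_le_neg; lra).
    assert (p2 : Rpower w (q - a) <= Rpower w2 (q - a)) by (apply Rpower_le; lra).
    assert (p3 : Rpower w (1 - a) <= Rpower w2 (1 - a)) by (apply Rpower_le; lra).
    assert (e1 : w = Rpower w a * Rpower w (1 - a)).
    { rewrite <- Rpower_plus. replace (a + (1 - a)) with 1 by ring. now rewrite Rpower_1. }
    assert (t1 : k * Rpower w (q - a) - chi * a <= - th). { unfold th. assert (k * Rpower w (q - a) <= k * Rpower w2 (q - a)) by (apply Rmult_le_compat_l; lra). lra. }
    assert (t2 : X * (Rpower w a * (k * Rpower w (q - a) - chi * a)) <= - (X * th) * Rpower w a).
    { assert (Rpower w a * (k * Rpower w (q - a) - chi * a) <= Rpower w a * - th) by (apply Rmult_le_compat_l; lra).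
      assert (X * (Rpower w a * (k * Rpower w (q - a) - chi * a)) <= X * (Rpower w a * - th)) by (apply Rmult_le_compat_l; lra). lra. }
    assert (t3 : - b0 * w <= Rabs b0 * Rpower w2 (1 - a) * Rpower w a).
    { assert (hb := Rle_abs (- b0)). rewrite Rabs_Ropp in hb. pose proof (Rpower_pos w (1 - a)).
      apply Rle_trans with (Rabs b0 * w); [apply Rmult_le_compat_r; lra|]. rewrite e1 at 1.
      replace (Rabs b0 * (Rpower w a * Rpower w (1 - a))) with (Rabs b0 * Rpower w (1 - a) * Rpower w a) by ring.
      apply Rmult_le_compat_r; [lra|]. apply Rmult_le_compat_l; lra. }
    assert (t4 : Rabs b0 * Rpower w2 (1 - a) * Rpower w a <= X * th * Rpower w a) by (apply Rmult_le_compat_r; lra).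
    assert (t5 : A <= X * (a * Rpower w (a - 1))).
    { apply Rle_trans with (X * q2); auto. apply Rmult_le_compat_l; [lra|]. apply Rmult_le_compat_l; lra. }
    assert (t6 : (2 * chi - A + X * (a * Rpower w (a - 1))) * z <= 0) by nra.
    lra.
  - unfold T; lra.
Qed.

(** Mirror image of [eventually_below]: an increase for ever below [w2] is braked by a negative
    source with a growing factor. *)
Lemma eventually_above w2 : 0 < w2 -> k * Rpower w2 (q - a) < chi * a ->
  exists S0, 0 < S0 /\ forall s, S0 <= s -> w2 <= tailw W s.
Proof.
  intros hw2 hc. destruct (no_descent_below w2 hw2 hc) as [S0 [hS h]].
  destruct (classic (exists s, S0 <= s /\ w2 <= tailw W s)) as [[S1 [hS1 h1]]|hn].
  { exists S1. split; [lra|]. apply stays_above; auto; [lra|]. intros s hs. apply h; lra. }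
  exfalso. assert (hup : forall s, S0 <= s -> tailw W s <= w2).
  { intros s hs. destruct (Rle_lt_dec (tailw W s) w2); auto. exfalso. apply hn. exists s; split; lra. }
  pose proof a_range as ha. pose proof q_range as hq. pose proof a_lt_q as haq. pose proof A_pos as hA. pose proof chi_pos as hchi.
  set (w3 := tailw W S0). assert (hw3 : 0 < w3) by (apply tailw_pos; lra).
  assert (hM : forall s, S0 <= s -> w3 <= tailw W s).
  { intros s hs. apply (incr_of_derive (tailw W) (tailz W P)); auto; [intros u hu; apply tailw_d; lra|].
    intros u hu. apply h; [lra|apply hup; lra]. }
  set (g3 := Rpower w3 a * (chi * a - k * Rpower w2 (q - a))).
  pose proof (Rpower_pos w3 a) as hpa. assert (hg3 : 0 < g3) by (apply Rmult_lt_0_compat; lra).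
  assert (hts : forall s, S0 <= s -> tail_source k 1 (tailw W s) <= - g3).
  { intros s hs. specialize (hM s hs). specialize (hup s hs). rewrite tail_source_factor by lra. unfold g3.
    assert (Rpower w3 a <= Rpower (tailw W s) a) by (apply Rpower_le; lra).
    assert (Rpower (tailw W s) (q - a) <= Rpower w2 (q - a)) by (apply Rpower_le; lra).
    assert (k * Rpower (tailw W s) (q - a) <= k * Rpower w2 (q - a)) by (apply Rmult_le_compat_l; lra).
    assert (Rpower w3 a * (chi * a - k * Rpower w2 (q - a)) <= Rpower (tailw W s) a * (chi * a - k * Rpower (tailw W s) (q - a))) by (apply Rmult_le_compat; lra).
    lra. }
  set (q1 := a * Rpower w3 (a - 1)). assert (hq1 : 0 < q1) by (apply Rmult_lt_0_compat; [lra|apply Rpower_pos]).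
  set (d1 := g3 / (2 * q1)). assert (hd1 : 0 < d1) by (apply Rdiv_lt_0_compat; lra).
  destruct (growth_large ((Rabs (2 * chi - A) * d1 + Rabs b0 * w2 + 1) / (g3 / 2))) as [S2 [hS2 hX]].
  set (S3 := Rmax S0 S2). assert (i1 := Rmax_l S0 S2). assert (i2 := Rmax_r S0 S2). fold S3 in i1, i2.
  assert (hdn : forall s, S3 <= s -> tailz W P s <= d1 -> tail_accel k s (tailw W s) (tailz W P s) <= - 1).
  { intros s hs hz. assert (hz0 := h s ltac:(lra) (hup s ltac:(lra))). specialize (hts s ltac:(lra)). specialize (hX s ltac:(lra)).
    specialize (hup s ltac:(lra)). specialize (hM s ltac:(lra)).
    unfold tail_accel. set (X := exp (chi * (1 - q) * s)) in *. set (z := tailz W P s) in *. set (w := tailw W s) in *.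
    assert (hXg : Rabs (2 * chi - A) * d1 + Rabs b0 * w2 + 1 <= X * (g3 / 2)).
    { apply Rle_trans with ((Rabs (2 * chi - A) * d1 + Rabs b0 * w2 + 1) / (g3 / 2) * (g3 / 2)); [right; field; lra|apply Rmult_le_compat_r; lra]. }
    assert (hXp : 0 < X) by apply exp_pos.
    assert (hpw : Rpower w (a - 1) <= Rpower w3 (a - 1)) by (apply Rpower_le_neg; lra).
    assert (hz1 : 1 * a * Rpower w (a - 1) * z <= g3 / 2).
    { assert (q1 * d1 = g3 / 2) by (unfold d1; field; lra).
      assert (a * Rpower w (a - 1) <= q1) by (apply Rmult_le_compat_l; lra).
      assert (0 < a * Rpower w (a - 1)) by (apply Rmult_lt_0_compat; [lra|apply Rpower_pos]).
      assert (a * Rpower w (a - 1) * z <= q1 * d1) by (apply Rmult_le_compat; lra). lra. }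
    assert (hz2 : X * (tail_source k 1 w + 1 * a * Rpower w (a - 1) * z) <= X * - (g3 / 2)) by (apply Rmult_le_compat_l; lra).
    assert (hz3 : (2 * chi - A) * z <= Rabs (2 * chi - A) * d1).
    { apply Rle_trans with (Rabs (2 * chi - A) * z); [apply Rmult_le_compat_r; [lra|apply Rle_abs]|apply Rmult_le_compat_l; [apply Rabs_pos|lra]]. }
    assert (hz4 : - b0 * w <= Rabs b0 * w2).
    { assert (hb := Rle_abs (- b0)). rewrite Rabs_Ropp in hb.
      apply Rle_trans with (Rabs b0 * w); [apply Rmult_le_compat_r; lra|apply Rmult_le_compat_l; [apply Rabs_pos|lra]]. }
    lra. }
  destruct (classic (exists s, S3 <= s /\ tailz W P s <= d1)) as [[s [hs hz]]|hnn].
  - assert (hb : forall r, s <= r -> - d1 <= - tailz W P r).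
    { intros r hr. apply (barrier_below (fun u => - tailz W P u) (fun u => - tail_accel k u (tailw W u) (tailz W P u)) s r); auto.
      - intros u hu. apply (is_derive_opp (tailz W P)). apply tailz_d; lra.
      - lra.
      - intros u hu e. specialize (hdn u ltac:(lra) ltac:(lra)). lra. }
    destruct (MVT_interval (tailz W P) (fun u => tail_accel k u (tailw W u) (tailz W P u)) s (s + d1 + 1) ltac:(lra)) as [y [hy ey]].
    { intros u hu. apply tailz_d; lra. }
    specialize (hb y ltac:(lra)). specialize (hdn y ltac:(lra) ltac:(lra)).
    assert (h2 := h (s + d1 + 1) ltac:(lra) (hup (s + d1 + 1) ltac:(lra))). nra.
  - assert (hMd : 0 < w2 / d1) by (apply Rdiv_lt_0_compat; lra).
    destruct (MVT_interval (tailw W) (tailz W P) S3 (S3 + w2 / d1) ltac:(lra)) as [y [hy ey]]. { intros u hu. apply tailw_d; lra. }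
    assert (hz : d1 < tailz W P y). { destruct (Rlt_le_dec d1 (tailz W P y)); auto. exfalso. apply hnn. exists y; lra. }
    assert (hp := tailw_pos S3 ltac:(lra)). specialize (hup (S3 + w2 / d1) ltac:(lra)).
    assert (d1 * (w2 / d1) <= tailz W P y * (w2 / d1)) by (apply Rmult_le_compat_r; lra).
    assert (d1 * (w2 / d1) = w2) by (field; lra).
    replace (S3 + w2 / d1 - S3) with (w2 / d1) in ey by ring. lra.
Qed.

Lemma tail_limit C : 0 < C -> k * Rpower C (q - a) = chi * a -> forall d, 0 < d ->
  exists S0, 0 < S0 /\ forall s, S0 <= s -> Rabs (tailw W s - C) < d.
Proof.
  intros hC eC d hd. assert (haq : 0 < q - a) by (pose proof a_lt_q; lra).
  set (e := Rmin (d / 2) (C / 2)). assert (h1 : e <= d / 2) by apply Rmin_l. assert (h2 : e <= C / 2) by apply Rmin_r.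
  assert (he : 0 < e) by (apply Rmin_pos; lra).
  destruct (eventually_below (C + e)) as [S1 [hS1 g1]]; [lra| |].
  { rewrite <- eC. apply Rmult_lt_compat_l; auto. apply Rpower_incr; lra. }
  destruct (eventually_above (C - e)) as [S2 [hS2 g2]]; [lra| |].
  { rewrite <- eC. apply Rmult_lt_compat_l; auto. apply Rpower_incr; lra. }
  exists (Rmax S1 S2). assert (i1 := Rmax_l S1 S2). assert (i2 := Rmax_r S1 S2). split; [lra|].
  intros s hs. specialize (g1 s ltac:(lra)). specialize (g2 s ltac:(lra)). apply Rabs_def1; lra.
Qed.

End TailLimit.

(** * Unimodality *)

Section Shape.
Context {c : coeffs}.

Definition decaying (k e : R) (W P : R -> R) (s0 C : R) :=
  (forall T, s0 < T -> orbit k e W P s0 T) /\ interface e W P s0 /\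
  forall d, 0 < d -> exists S, s0 < S /\ forall s, S <= s -> Rabs (tailw W s - C) < d.

Lemma decaying_at k e W P s0 C s : decaying k e W P s0 C -> s0 < s ->
  0 < W s /\ is_derive W s (P s) /\ is_derive P s (accel k e s (W s) (P s)).
Proof. intros [h _] hs. apply (h (s + 1) ltac:(lra)). lra. Qed.

Lemma decaying_contW k e W P s0 C s : decaying k e W P s0 C -> s0 < s -> continuous W s.
Proof. intros hd hs. destruct (decaying_at _ _ _ _ _ _ s hd hs) as [_ [h _]]. exact (derive_continuous _ _ _ h). Qed.

(** [(chi - L) (q - a) = L (1 - q) - 2], which is positive. Thus [e^(L s) W], the profile itself,
    also vanishes at infinity. *)
Lemma chi_gt_L : L < chi.
Proof.
  unfold chi, om. pose proof a_lt_q. pose proof L_large. apply Rmult_lt_reg_r with (q - a); [lra|].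
  unfold Rdiv. rewrite Rmult_assoc, Rinv_l by lra. lra.
Qed.

Lemma decaying_small k e W P s0 C r : r < chi -> decaying k e W P s0 C -> forall eps, 0 < eps ->
  exists S, s0 < S /\ forall s, S <= s -> exp (r * s) * W s < eps.
Proof.
  intros hr hd eps heps. pose proof hd as [_ [_ ht]]. destruct (ht 1 ltac:(lra)) as [S1 [hS1 h1]].
  assert (hC : 0 < C + 1).
  { specialize (h1 S1 ltac:(lra)). apply Rabs_def2 in h1. destruct (decaying_at _ _ _ _ _ _ S1 hd hS1) as [hp _].
    assert (0 < tailw W S1) by (apply Rmult_lt_0_compat; [apply exp_pos|auto]). lra. }
  assert (hcr : 0 < chi - r) by lra.
  set (S2 := ln ((C + 1) / eps) / (chi - r)).
  exists (Rmax S1 S2). assert (i1 := Rmax_l S1 S2). assert (i2 := Rmax_r S1 S2). split; [lra|].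
  intros s hs. specialize (h1 s ltac:(lra)). apply Rabs_def2 in h1. unfold tailw in h1.
  assert (hq : 0 < (C + 1) / eps) by (apply Rdiv_lt_0_compat; lra).
  assert (hx : (C + 1) / eps <= exp ((chi - r) * s)).
  { rewrite <- (exp_ln _ hq). assert (ln ((C + 1) / eps) <= (chi - r) * s).
    { replace (ln ((C + 1) / eps)) with ((chi - r) * S2) by (unfold S2; field; lra). apply Rmult_le_compat_l; lra. }
    destruct H as [H|H]; [left; now apply exp_increasing|right; now rewrite H]. }
  assert (hw : 0 < W s) by (apply (decaying_at _ _ _ _ _ _ s hd); lra).
  assert (e1 : exp (chi * s) * W s = exp ((chi - r) * s) * (exp (r * s) * W s)).
  { rewrite <- Rmult_assoc, <- exp_plus. f_equal. f_equal. ring. }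
  assert (hp : 0 < exp (r * s) * W s) by (apply Rmult_lt_0_compat; auto; apply exp_pos).
  rewrite e1 in h1. apply Rmult_lt_reg_l with ((C + 1) / eps); auto.
  apply Rle_lt_trans with (exp ((chi - r) * s) * (exp (r * s) * W s)); [apply Rmult_le_compat_r; lra|].
  replace ((C + 1) / eps * eps) with (C + 1) by (field; lra). lra.
Qed.

Lemma decaying_vanish k e W P s0 C : decaying k e W P s0 C -> forall eps, 0 < eps ->
  exists S, s0 < S /\ forall s, S <= s -> W s < eps.
Proof.
  intros hd eps heps. destruct (decaying_small k e W P s0 C 0 chi_pos hd eps heps) as [S [hS h]].
  exists S. split; auto. intros s hs. specialize (h s hs). replace (0 * s) with 0 in h by ring. rewrite exp_0 in h. lra.
Qed.

(** A turn after the first top would bound [W] below, by [turning_trap], although [W] tends to 0. *)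
Lemma decaying_shape k e W P s0 C : 0 < e -> decaying k e W P s0 C ->
  exists b, s0 < b /\ P b = 0 /\ 0 < restoring k (W b) /\ up W P s0 b /\ forall s, b < s -> P s < 0.
Proof.
  intros he hd. pose proof hd as [ho [hi _]].
  assert (hneg : exists t, s0 < t /\ P t < 0).
  { destruct (classic (exists t, s0 < t /\ P t < 0)) as [|hn]; auto. exfalso.
    destruct (decaying_at _ _ _ _ _ _ (s0 + 1) hd ltac:(lra)) as [hp _].
    destruct (decaying_vanish _ _ _ _ _ _ hd (W (s0 + 1)) hp) as [S [hS h]].
    set (S' := Rmax S (s0 + 2)). assert (i1 := Rmax_l S (s0 + 2)). assert (i2 := Rmax_r S (s0 + 2)). fold S' in i1, i2.
    specialize (h S' i1).
    assert (W (s0 + 1) <= W S'); [|lra]. apply (incr_of_derive W P); [lra|intros x hx; apply (decaying_at _ _ _ _ _ _ x hd); lra|].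
    intros x hx. destruct (Rle_lt_dec 0 (P x)); auto. exfalso. apply hn. exists x; split; lra. }
  destruct hneg as [t [ht hP]].
  destruct (first_top k e W P s0 (t + 1) t he (ho (t + 1) ltac:(lra)) hi ltac:(lra) ltac:(lra)) as [b [hb [eb [ub rb]]]].
  exists b. split; [lra|]. refine (conj eb (conj rb (conj ub _))). intros s hs.
  destruct (Rlt_le_dec (P s) 0) as [|hge]; auto. exfalso.
  destruct (descent_to_bottom k e W P s0 (s + 1) b s (ho (s + 1) ltac:(lra)) ltac:(lra) hs ltac:(lra) eb rb hge) as [d [hd1 [ed [dd rd]]]].
  destruct (decaying_at _ _ _ _ _ _ d hd ltac:(lra)) as [hWd _].
  destruct (decaying_vanish _ _ _ _ _ _ hd (W d) hWd) as [S [hS h]].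
  set (S' := Rmax S d). assert (i1 := Rmax_l S d). assert (i2 := Rmax_r S d). fold S' in i1, i2.
  specialize (h S' i1).
  assert (hs' : d < S' + 1) by lra.
  assert (W d <= W S'); [|lra].
  apply (turning_trap k e W P s0 (S' + 1) b d); auto; try lra. apply ho; lra.
Qed.

(* [e^{L s} W] is the profile [f^m]; this is the multiple of [W] whose critical points are controlled. *)
Definition rawV (W : R -> R) (s : R) := exp (L * s) * W s.
Definition rawU (W P : R -> R) (s : R) := exp (L * s) * (P s + L * W s).
(** This is [xi^sigma f^(p-1)], as [(f^m)^(q-a) = f^(p-1)] and [L (1 - q) - 2 = sigma]. *)
Definition rawH (W : R -> R) (s : R) := Rpower (rawV W s) (q - a) * exp ((L * (1 - q) - 2) * s).

Lemma rawV_derive W P s : is_derive W s (P s) -> is_derive (rawV W) s (rawU W P s).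
Proof. intros h. unfold rawV, rawU. dsolve. Qed.

Lemma rawV_pos W s : 0 < W s -> 0 < rawV W s.
Proof. intros h. apply Rmult_lt_0_compat; auto. apply exp_pos. Qed.

Lemma rawH_incr W s t : 0 < W s -> 0 < W t -> s < t -> rawV W s <= rawV W t -> rawH W s < rawH W t.
Proof.
  intros hs ht hst hv. unfold rawH. pose proof a_lt_q. pose proof L_large.
  assert (exp ((L * (1 - q) - 2) * s) < exp ((L * (1 - q) - 2) * t)) by (apply exp_increasing, Rmult_lt_compat_l; lra).
  assert (Rpower (rawV W s) (q - a) <= Rpower (rawV W t) (q - a)) by (apply Rpower_le; [lra|now apply rawV_pos|auto]).
  pose proof (Rpower_pos (rawV W s) (q - a)). pose proof (exp_pos ((L * (1 - q) - 2) * s)).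
  apply Rle_lt_trans with (Rpower (rawV W t) (q - a) * exp ((L * (1 - q) - 2) * s)); [apply Rmult_le_compat_r; lra|].
  apply Rmult_lt_compat_l; lra.
Qed.

Lemma rawH_eq W s : 0 < W s -> exp (- om * s) * rawH W s = Rpower (W s) (q - a).
Proof.
  intros hw. unfold rawH, rawV. rewrite Rpower_mult_base by (auto using exp_pos).
  replace (Rpower (exp (L * s)) (q - a)) with (exp ((q - a) * (L * s))) by (unfold Rpower; now rewrite ln_exp).
  replace (exp (- om * s) * (exp ((q - a) * (L * s)) * Rpower (W s) (q - a) * exp ((L * (1 - q) - 2) * s)))
    with (exp (- om * s) * exp ((q - a) * (L * s)) * exp ((L * (1 - q) - 2) * s) * Rpower (W s) (q - a)) by ring.
  rewrite <- !exp_plus. replace (- om * s + (q - a) * (L * s) + (L * (1 - q) - 2) * s) with 0 by (unfold om; ring).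
  rewrite exp_0. ring.
Qed.

(** At a critical point [P = - L W], and [-L] is a root of [x^2 + A x + B]: the linear terms cancel,
    and absorption and drag alone decide the sign. *)
Lemma rawU_derive k e W P s : 0 < W s -> is_derive W s (P s) -> is_derive P s (accel k e s (W s) (P s)) -> rawU W P s = 0 ->
  exists r, 0 < r /\ is_derive (rawU W P) s (r * (k * rawH W s - e * a * L)).
Proof.
  intros hw hW hP h0. exists (exp (L * s) * Rpower (W s) a * exp (- om * s)).
  split. { repeat apply Rmult_lt_0_compat; apply exp_pos. }
  assert (eP : P s = - L * W s).
  { unfold rawU in h0. apply Rmult_integral in h0. destruct h0 as [h0|h0]; [pose proof (exp_pos (L * s)); lra|lra]. }
  assert (eq : Rpower (W s) q = Rpower (W s) (a - 1) * W s * (exp (- om * s) * rawH W s)).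
  { rewrite rawH_eq, Rpower_succ by auto. rewrite <- Rpower_plus. f_equal. ring. }
  unfold rawU. dsolve. rewrite eP. unfold accel, E, A, B. rewrite eq, <- (Rpower_succ (W s) a hw). ring.
Qed.

Definition local_max (f : R -> R) (x : R) := exists d, 0 < d /\ forall y, Rabs (y - x) < d -> f y <= f x.

Lemma local_max_derive f x l : is_derive f x l -> local_max f x -> l = 0.
Proof.
  intros hd [d [hd0 h]]. destruct (Rtotal_order l 0) as [hl|[hl|hl]]; auto; exfalso.
  - destruct (derive_neg_right f x l hd hl) as [d' [hd' [_ h']]].
    assert (i1 := Rmin_l d d'). assert (i2 := Rmin_r d d'). assert (i3 := Rmin_pos d d' hd0 hd').
    specialize (h' (x - Rmin d d' / 2) ltac:(lra)). specialize (h (x - Rmin d d' / 2) ltac:(apply Rabs_def1; lra)). lra.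
  - destruct (derive_pos_right f x l hd hl) as [d' [hd' [h' _]]].
    assert (i1 := Rmin_l d d'). assert (i2 := Rmin_r d d'). assert (i3 := Rmin_pos d d' hd0 hd').
    specialize (h' (x + Rmin d d' / 2) ltac:(lra)). specialize (h (x + Rmin d d' / 2) ltac:(apply Rabs_def1; lra)). lra.
Qed.

Lemma local_max_second f g x l d : 0 < d -> (forall y, Rabs (y - x) < d -> is_derive f y (g y)) -> g x = 0 ->
  is_derive g x l -> local_max f x -> l <= 0.
Proof.
  intros hd hf h0 hg [d1 [hd1 h]]. apply Rnot_lt_le. intros hl.
  destruct (derive_pos_right g x l hg hl) as [d2 [hd2 [h2 _]]].
  set (r := Rmin d (Rmin d1 d2)). assert (i1 := Rmin_l d (Rmin d1 d2)). assert (i2 := Rmin_r d (Rmin d1 d2)).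
  assert (i3 := Rmin_l d1 d2). assert (i4 := Rmin_r d1 d2).
  assert (i5 : 0 < r) by (apply Rmin_pos; auto; apply Rmin_pos; auto). fold r in i1, i2.
  assert (f x < f (x + r / 2)).
  { apply Rle_lt_trans with (f (x + r / 4)).
    - apply (incr_of_derive f g); [lra|intros y hy; apply hf, Rabs_def1; lra|].
      intros y hy. destruct (Req_dec y x) as [->|]; [lra|]. left. rewrite <- h0. apply h2. lra.
    - apply (strict_incr_of_derive f g); [lra|intros y hy; apply hf, Rabs_def1; lra|].
      intros y hy. rewrite <- h0. apply h2. lra. }
  specialize (h (x + r / 2) ltac:(apply Rabs_def1; lra)). lra.
Qed.

Section Peak.
Variables (k e : R) (W P : R -> R) (s0 C : R).
Hypothesis hk : 0 < k.
Hypothesis he : 0 < e.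
Hypothesis hdec : decaying k e W P s0 C.

Lemma raw_d s : s0 < s -> is_derive (rawV W) s (rawU W P s).
Proof. intros hs. apply rawV_derive, (decaying_at _ _ _ _ _ _ s hdec hs). Qed.

Lemma raw_near s : s0 < s -> forall y, Rabs (y - s) < s - s0 -> is_derive (rawV W) y (rawU W P y).
Proof. intros hs y hy. apply Rabs_def2 in hy. apply raw_d; lra. Qed.

Lemma raw_max s : s0 < s -> local_max (rawV W) s -> k * rawH W s <= e * a * L.
Proof.
  intros hs hm. assert (h0 := local_max_derive _ _ _ (raw_d s hs) hm).
  destruct (decaying_at _ _ _ _ _ _ s hdec hs) as [w1 [w2 w3]].
  destruct (rawU_derive k e W P s w1 w2 w3 h0) as [r [hr hd]].
  assert (h := local_max_second _ _ s _ (s - s0) ltac:(lra) (raw_near s hs) h0 hd hm). nra.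
Qed.

Lemma raw_min s : s0 < s -> local_max (fun r => - rawV W r) s -> e * a * L <= k * rawH W s.
Proof.
  intros hs hm. assert (h0 := local_max_derive _ _ _ (is_derive_opp _ _ _ (raw_d s hs)) hm).
  destruct (decaying_at _ _ _ _ _ _ s hdec hs) as [w1 [w2 w3]].
  assert (h1 : rawU W P s = 0). { unfold opp in h0; simpl in h0. lra. }
  destruct (rawU_derive k e W P s w1 w2 w3 h1) as [r [hr hd]].
  assert (h2 : - rawU W P s = 0) by lra.
  assert (h := local_max_second (fun r => - rawV W r) (fun r => - rawU W P r) s _ (s - s0) ltac:(lra)
    (fun y hy => is_derive_opp _ _ _ (raw_near s hs y hy)) h2 (is_derive_opp _ _ _ hd) hm).
  unfold opp in h; simpl in h. nra.
Qed.

(* At a maximum [rawH <= e a L / k] and at a minimum the opposite holds; since [rawH] increases with both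
   [s] and [rawV], a minimum cannot precede a higher maximum. *)
Lemma raw_one_max x y : s0 < x -> x < y -> local_max (rawV W) x -> local_max (rawV W) y -> False.
Proof.
  intros hx hxy mx my. assert (hy := raw_max y ltac:(lra) my).
  destruct (continuous_bounded_min (rawV W) x y ltac:(lra)) as [z [hz hmin]].
  { intros u hu. eapply derive_continuous, raw_d. lra. }
  (* An end point, being a local maximum, can be the minimum only if the function is constant next
     to it; the minimum can then be moved inside. *)
  assert (hc : exists z', x < z' < y /\ forall u, x <= u <= y -> rawV W z' <= rawV W u).
  { destruct mx as [d1 [hd1 h1]]. destruct my as [d2 [hd2 h2]].
    destruct (Req_dec z x) as [->|].
    { set (r := Rmin d1 (y - x)). assert (i1 := Rmin_l d1 (y - x)). assert (i2 := Rmin_r d1 (y - x)).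
      assert (i3 : 0 < r) by (apply Rmin_pos; lra). fold r in i1, i2.
      exists (x + r / 2). split; [lra|]. intros u hu. specialize (hmin u hu). 
      specialize (h1 (x + r / 2) ltac:(apply Rabs_def1; lra)). lra. }
    destruct (Req_dec z y) as [->|].
    { set (r := Rmin d2 (y - x)). assert (i1 := Rmin_l d2 (y - x)). assert (i2 := Rmin_r d2 (y - x)).
      assert (i3 : 0 < r) by (apply Rmin_pos; lra). fold r in i1, i2.
      exists (y - r / 2). split; [lra|]. intros u hu. specialize (hmin u hu). 
      specialize (h2 (y - r / 2) ltac:(apply Rabs_def1; lra)). lra. }
    exists z. split; [lra|auto]. }
  destruct hc as [z' [hz' hm']].
  assert (hl : e * a * L <= k * rawH W z').
  { apply raw_min; [lra|]. exists (Rmin (z' - x) (y - z')). assert (i1 := Rmin_l (z' - x) (y - z')). assert (i2 := Rmin_r (z' - x) (y - z')).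
    split; [apply Rmin_pos; lra|]. intros u hu. apply Rabs_def2 in hu. specialize (hm' u ltac:(lra)). lra. }
  assert (hh : rawH W z' < rawH W y).
  { apply rawH_incr; try lra; try (apply (decaying_at _ _ _ _ _ _ _ hdec); lra). apply hm'; lra. }
  nra.
Qed.

Lemma raw_max_exists x : s0 < x -> exists z, x <= z /\ forall u, x <= u -> rawV W u <= rawV W z.
Proof.
  intros hx. destruct (decaying_at _ _ _ _ _ _ x hdec hx) as [hw _].
  destruct (decaying_small k e W P s0 C L chi_gt_L hdec (rawV W x) (rawV_pos W x hw)) as [S [hS h]].
  assert (i1 := Rmax_l S (x + 1)). assert (i2 := Rmax_r S (x + 1)). 
  destruct (continuous_bounded_max (rawV W) x (Rmax S (x + 1)) ltac:(lra)) as [z [hz hmax]].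
  { intros u hu. eapply derive_continuous, raw_d. lra. }
  exists z. split; [lra|]. intros u hu. destruct (Rle_lt_dec u (Rmax S (x + 1))); [apply hmax; lra|].
  apply Rle_trans with (rawV W x); [left; apply h; lra|apply hmax; lra].
Qed.

Lemma raw_rises : exists t, s0 < t /\ forall s, s0 < s < t -> 0 < rawU W P s.
Proof.
  pose proof hdec as [ho [hi _]].
  destruct (interface_up k e W P s0 (s0 + 1) he ltac:(lra) (ho (s0 + 1) ltac:(lra)) hi) as [t [ht hu]].
  exists t. split; [lra|]. intros s hs. destruct (decaying_at _ _ _ _ _ _ s hdec ltac:(lra)) as [hw _].
  specialize (hu s ltac:(lra)). pose proof L_gt_2. apply Rmult_lt_0_compat; [apply exp_pos|].
  assert (0 < L * W s) by (apply Rmult_lt_0_compat; lra). lra.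
Qed.

Lemma raw_peak : exists b, s0 < b /\ (forall s, s0 < s -> rawV W s <= rawV W b) /\
  (forall s, s0 < s -> local_max (rawV W) s -> s = b) /\ (forall s, b <= s -> rawU W P s <= 0).
Proof.
  destruct raw_rises as [t [ht hr]]. set (x := (s0 + t) / 2).
  destruct (raw_max_exists x ltac:(unfold x; lra)) as [b [hb hmax]].
  assert (hg : forall s, s0 < s -> rawV W s <= rawV W b).
  { intros s hs. destruct (Rle_lt_dec x s); auto. apply Rle_trans with (rawV W x); [|apply hmax; lra].
    apply (incr_of_derive (rawV W) (rawU W P)); [lra|intros u hu; apply raw_d; lra|].
    intros u hu. left. apply hr. unfold x in *. lra. }
  assert (hbs : s0 < b) by (unfold x in hb; lra).
  assert (hlb : local_max (rawV W) b).
  { exists (b - s0). split; [lra|]. intros y hy. apply Rabs_def2 in hy. apply hg; lra. }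
  assert (hun : forall s, s0 < s -> local_max (rawV W) s -> s = b).
  { intros s hs hl. destruct (Rtotal_order s b) as [hlt|[heq|hlt]]; auto; exfalso; [apply (raw_one_max s b)|apply (raw_one_max b s)]; auto. }
  exists b. refine (conj hbs (conj hg (conj hun _))). intros s hs. apply Rnot_lt_le. intros hpos.
  (* A rise at [s] puts the maximum over the times from [s] on strictly to the right of [s]: a
     second local maximum. *)
  destruct (raw_max_exists s ltac:(lra)) as [z [hz hm]].
  assert (s < z).
  { destruct (Req_dec s z) as [ez|]; [|lra]. subst z.
    destruct (derive_pos_right _ _ _ (raw_d s ltac:(lra)) hpos) as [d [hd [h1 _]]].
    specialize (h1 (s + d / 2) ltac:(lra)). specialize (hm (s + d / 2) ltac:(lra)). lra. }
  assert (z = b); [|lra]. apply hun; [lra|]. exists (z - s). split; [lra|]. intros y hy. apply Rabs_def2 in hy. apply hm; lra.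
Qed.
End Peak.
End Shape.

(** * Uniqueness *)

Lemma real_induction (S : R -> Prop) (a b : R) : S a ->
  (forall l, a <= l < b -> S l -> exists d, 0 < d /\ forall r, l <= r <= l + d -> S r) ->
  (forall l, a < l < b -> (forall r, a <= r < l -> S r) -> S l) ->
  forall l, a <= l < b -> S l.
Proof.
  intros h0 hopen hclosed l hl. apply NNPP. intros hn.
  destruct (completeness (fun t => a <= t <= l /\ forall r, a <= r <= t -> S r)) as [m [hub hlub]].
  - exists l. intros t [ht _]; lra.
  - exists a. split; [lra|]. intros r hr. replace r with a by lra. auto.
  - assert (hm1 : a <= m). { apply hub. split; [lra|]. intros r hr. replace r with a by lra. auto. }
    assert (hm2 : m <= l). { apply hlub. intros t [ht _]; lra. }
    assert (hlow : forall r, a <= r < m -> S r).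
    { intros r hr. apply NNPP. intros hr'. assert (m <= r); [|lra]. apply hlub. intros t [ht h].
      apply Rnot_lt_le. intros hlt. apply hr', h. lra. }
    assert (hSm : S m). { destruct (Req_dec a m) as [<-|]; auto. apply hclosed; auto. lra. }
    destruct (hopen m ltac:(lra) hSm) as [d [hd hr]].
    destruct (Req_dec m l) as [->|]; auto.
    assert (i1 := Rmin_l (m + d) l). assert (i2 := Rmin_r (m + d) l).
    assert (m < Rmin (m + d) l) by (apply Rmin_glb_lt; lra).
    assert (Rmin (m + d) l <= m); [|lra]. apply hub. split; [lra|].
    intros r hr'. destruct (Rlt_le_dec r m); [apply hlow; lra|apply hr; lra].
Qed.

Section Uniqueness.
Context {c : coeffs}.

(** At a point of contact heights and speeds agree and the accelerations differ by
    [(k2 - k1) W^q > 0], against the second order condition at a maximum of [W2 - W1]. *)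
Lemma no_contact k1 k2 e W1 P1 W2 P2 x y s : k1 < k2 -> orbit k1 e W1 P1 x y -> orbit k2 e W2 P2 x y -> x < s < y ->
  (forall r, x < r < y -> W2 r <= W1 r) -> W2 s = W1 s -> False.
Proof.
  intros hk o1 o2 hs hle heq. destruct (o1 s hs) as [a1 [a2 a3]]. destruct (o2 s hs) as [b1 [b2 b3]].
  assert (hm : local_max (fun r => W2 r - W1 r) s).
  { exists (Rmin (s - x) (y - s)). assert (i1 := Rmin_l (s - x) (y - s)). assert (i2 := Rmin_r (s - x) (y - s)).
    split; [apply Rmin_pos; lra|]. intros r hr. apply Rabs_def2 in hr. specialize (hle r ltac:(lra)). lra. }
  assert (h0 := local_max_derive _ _ _ (is_derive_minus _ _ _ _ _ b2 a2) hm). unfold minus, plus, opp in h0; simpl in h0.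
  assert (h := local_max_second (fun r => W2 r - W1 r) (fun r => P2 r - P1 r) s _ (Rmin (s - x) (y - s))
    ltac:(apply Rmin_pos; lra)
    (fun r hr => is_derive_minus _ _ _ _ _ (proj1 (proj2 (o2 r ltac:(apply Rabs_def2 in hr; pose proof (Rmin_l (s - x) (y - s)); pose proof (Rmin_r (s - x) (y - s)); lra))))
       (proj1 (proj2 (o1 r ltac:(apply Rabs_def2 in hr; pose proof (Rmin_l (s - x) (y - s)); pose proof (Rmin_r (s - x) (y - s)); lra)))))
    h0 (is_derive_minus _ _ _ _ _ b3 a3) hm).
  unfold minus, plus, opp in h; simpl in h. replace (P2 s) with (P1 s) in h by lra. rewrite heq in h. unfold accel in h.
  assert (k1 * Rpower (W1 s) q < k2 * Rpower (W1 s) q) by (apply Rmult_lt_compat_r; [apply Rpower_pos|auto]). lra.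
Qed.

Variables (k e : R) (W1 P1 W2 P2 : R -> R) (s1 s2 C : R).
Hypothesis hk : 0 < k.
Hypothesis he : 0 < e.
Hypothesis hC : 0 < C.
Hypothesis hd1 : decaying k e W1 P1 s1 C.
Hypothesis hd2 : decaying k e W2 P2 s2 C.
Hypothesis hs : s1 < s2.

(* The substitution [e^{kap s} W] makes the equation invariant under translations but for its term [k W^q]. *)
Definition kap := om / (1 - a).
Definition ext2 (s : R) := if Rle_dec s s2 then 0 else exp (kap * s) * W2 s.

Lemma kap_pos : 0 < kap.
Proof. pose proof om_pos. pose proof a_range. apply Rdiv_lt_0_compat; lra. Qed.

Lemma kap_lt_L : kap < L.
Proof. unfold kap, om. pose proof a_range. apply Rmult_lt_reg_r with (1 - a); [lra|]. unfold Rdiv. rewrite Rmult_assoc, Rinv_l by lra. lra. Qed.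

Lemma kap_om : kap * (1 - a) = om.
Proof. unfold kap. pose proof a_range. field. lra. Qed.

Lemma ext2_left s : s <= s2 -> ext2 s = 0.
Proof. intros h. unfold ext2. destruct (Rle_dec s s2); [auto|lra]. Qed.

Lemma ext2_right s : s2 < s -> ext2 s = exp (kap * s) * W2 s.
Proof. intros h. unfold ext2. destruct (Rle_dec s s2); [lra|auto]. Qed.

Lemma ext2_continuous s : continuous ext2 s.
Proof.
  destruct (Rtotal_order s s2) as [h|[->|h]].
  - apply (continuous_ext_loc _ (fun _ => 0)); [|apply continuous_const].
    exists (mkposreal (s2 - s) ltac:(lra)). intros y hy. change (Rabs (y - s) < s2 - s) in hy. apply Rabs_def2 in hy.
    symmetry. apply ext2_left. lra.
  - apply eps_continuous. intros eps heps. rewrite (ext2_left s2) by lra. pose proof kap_pos as hkap.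
    set (M := exp (kap * (s2 + 1))). assert (hM : 0 < M) by apply exp_pos.
    assert (hq : 0 < eps / M) by (apply Rdiv_lt_0_compat; lra).
    destruct (proj1 (proj2 hd2) (eps / M) hq) as [d [hd h]].
    assert (i1 := Rmin_l d 1). assert (i2 := Rmin_r d 1).
    exists (Rmin d 1). split; [apply Rmin_pos; lra|]. intros y hy. apply Rabs_def2 in hy.
    destruct (Rle_lt_dec y s2) as [hle|hlt]. { rewrite ext2_left by auto. replace (0 - 0) with 0 by ring. rewrite Rabs_R0. auto. }
    rewrite ext2_right by auto. destruct (h y ltac:(lra)) as [hw _].
    destruct (decaying_at _ _ _ _ _ _ y hd2 hlt) as [hp _].
    assert (exp (kap * y) < M) by (apply exp_increasing, Rmult_lt_compat_l; lra).
    pose proof (exp_pos (kap * y)). rewrite Rminus_0_r, Rabs_pos_eq by (apply Rmult_le_pos; lra).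
    apply Rlt_trans with (M * W2 y); [apply Rmult_lt_compat_r; auto|].
    apply Rlt_le_trans with (M * (eps / M)); [apply Rmult_lt_compat_l; auto|right; field; lra].
  - apply (continuous_ext_loc _ (fun r => exp (kap * r) * W2 r)).
    + exists (mkposreal (s - s2) ltac:(lra)). intros y hy. change (Rabs (y - s) < s - s2) in hy. apply Rabs_def2 in hy.
      symmetry. apply ext2_right. lra.
    + destruct (decaying_at _ _ _ _ _ _ s hd2 h) as [_ [w2 _]]. apply (continuous_mult (fun r => exp (kap * r)) W2).
      * apply (derive_continuous _ _ (kap * exp (kap * s))). auto_derive; auto. ring.
      * eapply derive_continuous; eauto.
Qed.

Definition slide (l s : R) := exp (kap * l) * W2 (s + l).
Definition slideP (l s : R) := exp (kap * l) * P2 (s + l).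
Definition slidek (l : R) := k * exp (kap * l * (1 - q)).

Lemma slide_orbit l T : s2 < T -> orbit (slidek l) e (slide l) (slideP l) (s2 - l) (T - l).
Proof.
  intros hT. pose proof hd2 as [ho _].
  assert (o := orbit_scale _ _ _ _ _ _ (exp (kap * l)) (exp_pos _) (orbit_shift k e W2 P2 s2 T l (ho T hT))).
  assert (e1 : k * Rpower (exp (kap * l)) (1 - q) = slidek l).
  { unfold slidek, Rpower. rewrite ln_exp. do 2 f_equal. ring. }
  assert (e2 : e * exp (- om * l) * Rpower (exp (kap * l)) (1 - a) = e).
  { unfold Rpower. rewrite ln_exp, Rmult_assoc, <- exp_plus. replace (- om * l + (1 - a) * (kap * l)) with 0.
    - rewrite exp_0. ring.
    - rewrite <- kap_om. ring. }
  rewrite e1, e2 in o. exact o.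
Qed.

Lemma slide_ext l s : s2 < s + l -> exp (kap * s) * slide l s = ext2 (s + l).
Proof. intros h. rewrite ext2_right by auto. unfold slide. rewrite <- Rmult_assoc, <- exp_plus. do 2 f_equal. ring. Qed.

Lemma slidek_gt l : 0 < l -> k < slidek l.
Proof.
  intros hl. unfold slidek. pose proof kap_pos. pose proof q_range. rewrite <- (Rmult_1_r k) at 1. apply Rmult_lt_compat_l; auto.
  rewrite <- exp_0 at 1. apply exp_increasing, Rmult_lt_0_compat; [now apply Rmult_lt_0_compat|lra].
Qed.

(** Beyond the peak of [rawV] the factor [e^((kap - L) s)] decreases as well. Far out, sliding to
    the left thus cannot raise the second orbit, which settles the unbounded part of
    [shifted_open]. *)
Lemma ext2_decreasing : exists t, s2 < t /\ forall x y, t <= x -> x <= y -> ext2 y <= ext2 x.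
Proof.
  destruct (raw_peak k e W2 P2 s2 C hk he hd2) as [b [hb [_ [_ hdn]]]]. exists b. split; auto. intros x y hx hxy.
  rewrite !ext2_right by lra. destruct (decaying_at _ _ _ _ _ _ y hd2 ltac:(lra)) as [hp _].
  assert (hv : rawV W2 y <= rawV W2 x).
  { apply (decr_of_derive (rawV W2) (rawU W2 P2)); auto.
    - intros z hz. apply (raw_d k e W2 P2 s2 C hd2); lra.
    - intros z hz. apply hdn; lra. }
  assert (ev : forall z, exp (kap * z) * W2 z = exp ((kap - L) * z) * rawV W2 z).
  { intros z. unfold rawV. rewrite <- Rmult_assoc, <- exp_plus. do 2 f_equal. ring. }
  rewrite !ev. pose proof kap_lt_L. assert (exp ((kap - L) * y) <= exp ((kap - L) * x)).
  { assert ((kap - L) * y <= (kap - L) * x) by nra. destruct H0 as [h|h]; [left; now apply exp_increasing|right; now rewrite h]. }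
  pose proof (exp_pos ((kap - L) * y)). pose proof (rawV_pos W2 y hp). apply Rmult_le_compat; lra.
Qed.

Definition shifted_below (l : R) := forall s, s1 < s -> ext2 (s + l) < exp (kap * s) * W1 s.

Lemma W1_pos s : s1 < s -> 0 < exp (kap * s) * W1 s.
Proof. intros h. apply Rmult_lt_0_compat; [apply exp_pos|apply (decaying_at _ _ _ _ _ _ _ hd1 h)]. Qed.

Lemma W1_cont s : s1 < s -> continuous (fun r => exp (kap * r) * W1 r) s.
Proof.
  intros h. destruct (decaying_at _ _ _ _ _ _ s hd1 h) as [_ [w2 _]]. apply (continuous_mult (fun r => exp (kap * r)) W1).
  - apply (derive_continuous _ _ (kap * exp (kap * s))). auto_derive; auto. ring.
  - eapply derive_continuous; eauto.
Qed.

Lemma ext2_shift_cont s l : continuous (fun r => ext2 (r + l)) s.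
Proof. apply (continuous_comp (fun r => r + l) ext2); [|apply ext2_continuous]. apply (continuous_plus (fun r => r) (fun _ => l)); [apply continuous_id|apply continuous_const]. Qed.

Lemma shifted_open l : 0 <= l < s2 - s1 -> shifted_below l -> exists d, 0 < d /\ forall r, l <= r <= l + d -> shifted_below r.
Proof.
  intros hl hb. destruct ext2_decreasing as [t [ht hdec]]. set (eta := (s2 - s1 - l) / 2). assert (heta : 0 < eta) by (unfold eta; lra).
  (* Three ranges of times: up to [x] the slid orbit is still 0, as a slide by at most [l + eta]
     leaves its edge at [x] or later; on [[x, y]] uniform continuity applies; after [y] further
     sliding does not raise the orbit. *)
  set (x := s1 + eta). set (y := Rmax x (t - l)). assert (i1 := Rmax_l x (t - l)). assert (i2 := Rmax_r x (t - l)). fold y in i1, i2.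
  destruct (continuous_bounded_min (fun s => exp (kap * s) * W1 s - ext2 (s + l)) x y i1) as [z [hz hmin]].
  { intros s hs'. apply (continuous_minus (fun s => exp (kap * s) * W1 s) (fun s => ext2 (s + l))); [apply W1_cont; unfold x in *; lra|apply ext2_shift_cont]. }
  set (eps := exp (kap * z) * W1 z - ext2 (z + l)) in *.
  assert (heps : 0 < eps). { specialize (hb z ltac:(unfold x in *; lra)). unfold eps. lra. }
  destruct (Heine ext2 (fun s => x + l <= s <= y + l + 1) (compact_P3 _ _)) with (eps := mkposreal eps heps) as [d hd].
  { intros s _. apply continuous_continuity_pt, ext2_continuous. }
  set (d' := Rmin (d / 2) (Rmin eta 1)). assert (j1 := Rmin_l (d / 2) (Rmin eta 1)). assert (j2 := Rmin_r (d / 2) (Rmin eta 1)).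
  assert (j3 := Rmin_l eta 1). assert (j4 := Rmin_r eta 1). pose proof (cond_pos d) as hdp.
  assert (hd' : 0 < d') by (apply Rmin_pos; [lra|apply Rmin_pos; lra]). fold d' in j1, j2.
  exists d'. split; auto. intros r hr s hs'.
  destruct (Rle_lt_dec s x) as [hsx|hsx].
  { rewrite ext2_left; [now apply W1_pos|]. unfold x, eta in *. lra. }
  destruct (Rle_lt_dec s y) as [hsy|hsy].
  { specialize (hmin s ltac:(lra)).
    specialize (hd (s + r) (s + l) ltac:(lra) ltac:(lra)). 
    assert (hc : Rabs (s + r - (s + l)) < d) by (rewrite Rabs_pos_eq; lra). specialize (hd hc). simpl in hd.
    apply Rabs_def2 in hd. lra. }
  apply Rle_lt_trans with (ext2 (s + l)); [apply hdec; lra|apply hb; lra].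
Qed.

Lemma shifted_le l : (forall eps, 0 < eps -> exists r, l - eps < r <= l /\ shifted_below r) ->
  forall s, s1 < s -> ext2 (s + l) <= exp (kap * s) * W1 s.
Proof.
  intros h s hs'. apply Rnot_lt_le. intros hlt.
  set (g := ext2 (s + l) - exp (kap * s) * W1 s). assert (hg : 0 < g) by (unfold g; lra).
  destruct (continuous_eps ext2 (s + l) (ext2_continuous _) g hg) as [d [hd hc]].
  destruct (h d hd) as [r [hr hb]]. specialize (hb s hs').
  specialize (hc (s + r)). assert (Rabs (s + r - (s + l)) < d) by (apply Rabs_def1; lra). specialize (hc H).
  apply Rabs_def2 in hc. unfold g in *. lra.
Qed.

Lemma slide_le l : (forall s, s1 < s -> ext2 (s + l) <= exp (kap * s) * W1 s) ->
  forall s, s1 < s -> s2 < s + l -> slide l s <= W1 s.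
Proof.
  intros h s hs' hsl. specialize (h s hs'). rewrite <- slide_ext in h by auto.
  apply Rmult_le_reg_l with (exp (kap * s)); auto. apply exp_pos.
Qed.

Lemma slide_strict l s : 0 < l -> (forall s, s1 < s -> ext2 (s + l) <= exp (kap * s) * W1 s) ->
  s1 < s -> s2 < s + l -> slide l s = W1 s -> False.
Proof.
  intros hl h hs' hsl heq. pose proof hd1 as [ho1 _].
  set (x := Rmax s1 (s2 - l)). assert (i1 := Rmax_l s1 (s2 - l)). assert (i2 := Rmax_r s1 (s2 - l)). fold x in i1, i2.
  assert (hx : x < s) by (apply Rmax_lub_lt; lra).
  apply (no_contact k (slidek l) e W1 P1 (slide l) (slideP l) x (s + 1) s); auto; try lra.
  - now apply slidek_gt.
  - apply (orbit_sub _ _ _ _ s1 (s + 1)); [apply ho1| |]; lra.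
  - apply (orbit_sub _ _ _ _ (s2 - l) (s + 1 + l - l)); [apply slide_orbit| |]; lra.
  - intros r hr. apply slide_le; auto; lra.
Qed.

(** A limit of admissible slides could fail only by contact, which the larger [k] of the slid orbit
    forbids; so admissibility is closed as well as open. *)
Lemma sliding : shifted_below 0 -> forall l, 0 <= l < s2 - s1 -> shifted_below l.
Proof.
  intros h0. apply real_induction; auto.
  - intros l hl. now apply shifted_open.
  - intros l hl hlow.
    assert (hle : forall s, s1 < s -> ext2 (s + l) <= exp (kap * s) * W1 s).
    { apply shifted_le. intros eps heps. exists (Rmax 0 (l - eps / 2)). split; [|apply hlow]; unfold Rmax; destruct (Rle_dec 0 (l - eps / 2)); lra. }
    intros s hs'. destruct (hle s hs') as [|heq]; auto. exfalso.
    destruct (Rle_lt_dec (s + l) s2) as [hx|hx].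
    { rewrite ext2_left in heq by auto. pose proof (W1_pos s hs'). lra. }
    apply (slide_strict l s); auto; [lra|]. rewrite <- slide_ext in heq by auto.
    apply Rmult_eq_reg_l with (exp (kap * s)); auto. pose proof (exp_pos (kap * s)). lra.
Qed.

Lemma slide_interface l : interface e (slide l) (slideP l) (s2 - l).
Proof.
  pose proof hd2 as [ho [hi _]].
  assert (e2 : e * exp (- om * l) * Rpower (exp (kap * l)) (1 - a) = e).
  { unfold Rpower. rewrite ln_exp, Rmult_assoc, <- exp_plus. replace (- om * l + (1 - a) * (kap * l)) with 0.
    - rewrite exp_0. ring.
    - rewrite <- kap_om. ring. }
  assert (h : interface (e * exp (- om * l)) (fun s => W2 (s + l)) (fun s => P2 (s + l)) (s2 - l)).
  { intros eps heps. destruct (hi eps heps) as [d [hd h]]. exists d. split; auto. intros s hs'. specialize (h (s + l) ltac:(lra)).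
    rewrite <- E_shift. replace (s2 - l + l) with s2 by ring. auto. }
  assert (h' := interface_scale _ _ _ _ (s2 - l) (s2 + 1 - l) (exp (kap * l)) ltac:(lra) (exp_pos _)
    (orbit_shift k e W2 P2 s2 (s2 + 1) l (ho (s2 + 1) ltac:(lra))) h).
  rewrite e2 in h'. exact h'.
Qed.

(** Slid until the edges coincide, the second orbit has the larger [k], so it reaches small heights
    no later than the first, while sliding has kept it below: the two would touch, which the larger
    [k] forbids. *)
Lemma not_always_above : ~ shifted_below 0.
Proof.
  intros h0. set (D := s2 - s1). assert (hD : 0 < D) by (unfold D; lra).
  assert (hle : forall s, s1 < s -> ext2 (s + D) <= exp (kap * s) * W1 s).
  { apply shifted_le. intros eps heps. exists (Rmax 0 (D - eps / 2)).
    assert (0 <= Rmax 0 (D - eps / 2) < D /\ D - eps < Rmax 0 (D - eps / 2)) by (unfold Rmax; destruct (Rle_dec 0 (D - eps / 2)); lra).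
    split; [lra|]. apply sliding; auto. unfold D in *; lra. }
  pose proof hd1 as [ho1 [hi1 _]].
  assert (oD := slide_orbit D (s2 + 1) ltac:(lra)). assert (iD := slide_interface D).
  replace (s2 - D) with s1 in oD, iD by (unfold D; ring). replace (s2 + 1 - D) with (s1 + 1) in oD by (unfold D; ring).
  assert (o1 := ho1 (s1 + 1) ltac:(lra)).
  assert (hs1 : s1 < s1 + 1) by lra.
  destruct (interface_up _ _ _ _ _ _ he hs1 oD iD) as [tD [htD uD]].
  destruct (interface_up _ _ _ _ _ _ he hs1 o1 hi1) as [t1 [ht1 u1]].
  set (t := Rmin tD t1). assert (i1 := Rmin_l tD t1). assert (i2 := Rmin_r tD t1).
  assert (ht : s1 < t) by (apply Rmin_glb_lt; lra). fold t in i1, i2.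
  assert (hw : 0 < slide D ((s1 + t) / 2)) by (apply oD; lra).
  destruct (proj1 (proj2 hd1) _ hw) as [d [hd hsm]].
  set (y := Rmin (s1 + d / 2) ((s1 + t) / 2)). assert (j1 := Rmin_l (s1 + d / 2) ((s1 + t) / 2)). assert (j2 := Rmin_r (s1 + d / 2) ((s1 + t) / 2)).
  assert (hy : s1 < y) by (apply Rmin_glb_lt; lra). fold y in j1, j2.
  destruct (hsm y ltac:(lra)) as [hW1y _]. destruct (o1 y ltac:(lra)) as [hp1 _].
  destruct (interface_reaches _ _ _ _ s1 (s1 + 1) ((s1 + t) / 2) (W1 y) ltac:(lra) oD iD hp1 hW1y) as [z [hz ez]].
  pose proof kap_pos. pose proof (slidek_gt D hD).
  destruct (head_comparison_le (slidek D) e (slide D) (slideP D) s1 t k e W1 P1 s1 t z y) as [_ hE]; auto; try lra.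
  { apply (orbit_sub _ _ _ _ s1 (s1 + 1)); [exact oD|lra|lra]. }
  { intros s hs'. apply uD; lra. }
  { intros s hs'. apply u1; lra. }
  assert (hzy : z <= y). { apply Rnot_lt_le. intros hlt. pose proof (E_decr e y z he hlt). lra. }
  assert (h1 : slide D y <= W1 y) by (apply slide_le; auto; unfold D; lra).
  apply (slide_strict D z hD hle); try lra; [unfold D; lra|].
  destruct (Req_dec z y) as [->|]; auto. exfalso.
  assert (slide D z < slide D y); [|lra].
  apply (strict_incr_of_derive (slide D) (slideP D)); [lra|intros s hs'; apply oD; lra|intros s hs'; apply uD; lra].
Qed.
End Uniqueness.

(** * Crossing orbits and their lag *)

Section Crossing.
Context {c : coeffs}.

Lemma descent_strict k e W P s0 C b x y : decaying k e W P s0 C -> s0 < b -> (forall s, b < s -> P s < 0) ->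
  b <= x -> x < y -> W y < W x.
Proof.
  intros hd hb hdn hx hxy. set (z := (x + y) / 2).
  assert (W z <= W x).
  { apply (decr_of_derive W P); [unfold z; lra|intros s hs; apply (decaying_at _ _ _ _ _ _ s hd); lra|].
    intros s hs. destruct (Req_dec s b) as [->|]; [|left; apply hdn; lra].
    destruct (decaying_at _ _ _ _ _ _ b hd hb) as [_ [w2 w3]].
    apply Rnot_lt_le. intros hp. destruct (derive_continuous _ _ _ w3 (fun v => 0 < v)) as [d h].
    { exists (mkposreal _ hp). intros v hv. change (Rabs (v - P b) < P b) in hv. apply Rabs_def2 in hv. lra. }
    pose proof (cond_pos d). specialize (h (b + d / 2)). assert (hb2 : ball b d (b + d / 2)).
    { change (Rabs (b + d / 2 - b) < d). apply Rabs_def1; lra. }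
    specialize (h hb2). specialize (hdn (b + d / 2) ltac:(lra)). lra. }
  assert (W y < W z); [|lra].
  apply (strict_decr_of_derive W P); [unfold z; lra|intros s hs; apply (decaying_at _ _ _ _ _ _ s hd); unfold z in *; lra|].
  intros s hs. apply hdn. unfold z in *. lra.
Qed.

Lemma descent_level k e W P s0 C x w : decaying k e W P s0 C -> s0 < x -> 0 < w -> w < W x -> exists y, x < y /\ W y = w.
Proof.
  intros hd hx hw hwx. destruct (decaying_vanish _ _ _ _ _ _ hd w hw) as [S [hS h]].
  set (T := Rmax S (x + 1)). assert (i1 := Rmax_l S (x + 1)). assert (i2 := Rmax_r S (x + 1)). fold T in i1, i2.
  specialize (h T i1).
  destruct (IVT_interval_decr W x T w ltac:(lra)) as [y [hy ey]]; try lra.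
  { intros s hs. apply (decaying_contW k e W P s0 C); auto. lra. }
  exists y. split; [lra|auto].
Qed.

Variables (k e : R) (W1 P1 W2 P2 : R -> R) (s1 s2 C : R).
Hypothesis hk : 0 < k.
Hypothesis he : 0 < e.
Hypothesis hC : 0 < C.
Hypothesis hd1 : decaying k e W1 P1 s1 C.
Hypothesis hd2 : decaying k e W2 P2 s2 C.
Hypothesis hs : s1 < s2.

(** Just after its edge the second orbit is lower, and by [not_always_above] it does not remain so;
    a tangential first crossing would identify the orbits by uniqueness. *)
Lemma crossing : exists x s, s2 < x /\ x < s /\ W1 s = W2 s /\ P1 s < P2 s.
Proof.
  assert (hn := not_always_above k e W1 P1 W2 P2 s1 s2 C hk he hd1 hd2 hs).
  assert (hex : exists s, s2 < s /\ W1 s <= W2 s).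
  { apply NNPP. intros hne. apply hn. intros s hs'. replace (s + 0) with s by ring.
    destruct (Rle_lt_dec s s2) as [hle|hlt]; [rewrite ext2_left by auto; apply (W1_pos k e W1 P1 s1 C hd1); auto|].
    rewrite ext2_right by auto. apply Rmult_lt_compat_l; [apply exp_pos|]. apply Rnot_le_lt. intros hle. apply hne. exists s; auto. }
  destruct hex as [s [hs2 hle]].
  destruct (decaying_at _ _ _ _ _ _ s2 hd1 hs) as [w1 [w2 _]].
  destruct (continuous_eps W1 s2 (derive_continuous _ _ _ w2) (W1 s2 / 2) ltac:(lra)) as [da [hda ha]].
  destruct (proj1 (proj2 hd2) (W1 s2 / 2) ltac:(lra)) as [db [hdb hb]].
  set (x := s2 + Rmin (Rmin da db) (s - s2) / 2).
  assert (i1 := Rmin_l (Rmin da db) (s - s2)). assert (i2 := Rmin_r (Rmin da db) (s - s2)).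
  assert (i3 := Rmin_l da db). assert (i4 := Rmin_r da db).
  assert (i5 : 0 < Rmin (Rmin da db) (s - s2)) by (apply Rmin_pos; [apply Rmin_pos|]; lra).
  assert (hx : s2 < x < s) by (unfold x; lra).
  assert (hgt : W2 x < W1 x).
  { destruct (hb x ltac:(unfold x; lra)) as [h1 _]. specialize (ha x). assert (Rabs (x - s2) < da) by (apply Rabs_def1; unfold x; lra).
    specialize (ha H). apply Rabs_def2 in ha. lra. }
  destruct (first_zero (fun r => W1 r - W2 r) x s ltac:(lra)) as [y [hy [ey py]]]; try lra.
  { intros r hr. apply (continuous_minus W1 W2); [apply (decaying_contW k e W1 P1 s1 C)|apply (decaying_contW k e W2 P2 s2 C)]; auto; lra. }
  assert (hxy : x < y). { destruct (Req_dec x y) as [<-|]; lra. }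
  exists x, y. refine (conj _ (conj hxy (conj _ _))); [lra|lra|].
  destruct (decaying_at _ _ _ _ _ _ y hd1 ltac:(lra)) as [_ [u1 _]]. destruct (decaying_at _ _ _ _ _ _ y hd2 ltac:(lra)) as [_ [u2 _]].
  assert (hle' := derive_le_of_left _ x y _ hxy (is_derive_minus _ _ _ _ _ u1 u2)). unfold minus, plus, opp in hle'; simpl in hle'.
  assert (hle'' : P1 y <= P2 y).
  { assert (P1 y + - P2 y <= 0); [|lra]. apply hle'. intros r hr. specialize (py r ltac:(lra)). lra. }
  destruct hle'' as [|heq]; auto. exfalso.
  pose proof hd1 as [ho1 _]. pose proof hd2 as [ho2 _].
  destruct (orbit_unique k e W1 P1 W2 P2 s2 (s + 1) y) with (s := x) as [ex _]; try lra.
  - apply (orbit_sub _ _ _ _ s1 (s + 1)); [apply ho1| |]; lra.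
  - apply ho2; lra.
Qed.

(** A crossing may occur while the second orbit still rises; the comparison of descents needs a
    common height that both pass downwards, the first orbit faster and no later. The crossing itself
    will do if it follows both tops; otherwise the top of the second orbit, at rest where the first
    descends, provides such a height. *)
Lemma descending_match : exists b1 b2 x1 x2, s1 < b1 /\ (forall s, b1 < s -> P1 s < 0) /\ s2 < b2 /\ (forall s, b2 < s -> P2 s < 0) /\
  b1 < x1 /\ b2 < x2 /\ W1 x1 = W2 x2 /\ P1 x1 < P2 x2 /\ x1 <= x2.
Proof.
  destruct crossing as [x [s [hx [hxs [eW hP]]]]].
  destruct (decaying_shape _ _ _ _ _ _ he hd1) as [b1 [hb1 [z1 [_ [u1 d1]]]]].
  destruct (decaying_shape _ _ _ _ _ _ he hd2) as [b2 [hb2 [z2 [_ [u2 d2]]]]].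
  exists b1, b2. pose proof hd1 as [ho1 [hi1 _]]. pose proof hd2 as [ho2 [hi2 _]].
  assert (hE : E e s2 < E e s1) by (now apply E_decr).
  assert (hhead : forall y1 y2, s1 < y1 < b1 -> s2 < y2 < b2 -> W1 y1 = W2 y2 -> P2 y2 < P1 y1 /\ E e y2 < E e y1).
  { intros y1 y2 hy1 hy2 ey. apply (head_comparison k e W1 P1 s1 b1 k e W2 P2 s2 b2); auto; lra. }
  assert (htop : W2 b2 < W1 b1).
  { set (y1 := (s1 + b1) / 2). assert (hy1 : s1 < y1 < b1) by (unfold y1; lra).
    set (y2 := (s2 + b2) / 2). assert (hy2 : s2 < y2 < b2) by (unfold y2; lra).
    destruct (decaying_at _ _ _ _ _ _ y1 hd1 ltac:(lra)) as [p1 _]. destruct (decaying_at _ _ _ _ _ _ y2 hd2 ltac:(lra)) as [p2 _].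
    set (w := Rmin (W1 y1) (W2 y2) / 2). assert (i1 := Rmin_l (W1 y1) (W2 y2)). assert (i2 := Rmin_r (W1 y1) (W2 y2)).
    assert (i3 := Rmin_pos _ _ p1 p2).
    destruct (interface_reaches k e W1 P1 s1 b1 y1 w hy1 (ho1 b1 hb1) hi1 ltac:(unfold w; lra) ltac:(unfold w; lra)) as [v1 [hv1 ev1]].
    destruct (interface_reaches k e W2 P2 s2 b2 y2 w hy2 (ho2 b2 hb2) hi2 ltac:(unfold w; lra) ltac:(unfold w; lra)) as [v2 [hv2 ev2]].
    destruct (hhead v1 v2 ltac:(lra) ltac:(lra) ltac:(lra)) as [g1 g2].
    apply (top_comparison k e W1 P1 s1 (b1 + 1) b1 v1 W2 P2 s2 (b2 + 1) b2 v2); auto; try lra; [apply ho1|apply ho2]; lra. }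
  assert (hmax2 : forall r, s2 < r -> W2 r <= W2 b2).
  { intros r hr. destruct (Rtotal_order r b2) as [hlt|[->|hlt]]; [|lra|left; apply (descent_strict k e W2 P2 s2 C b2); auto; lra].
    apply (incr_of_derive W2 P2); [lra|intros u hu; apply (decaying_at _ _ _ _ _ _ u hd2); lra|].
    intros u hu. destruct (Req_dec u b2) as [->|]; [lra|left; apply u2; lra]. }
  (* Before its top the first orbit is faster at equal heights, against [P1 s < P2 s]; and its top
     is too high to be the crossing. *)
  assert (hsb1 : b1 < s).
  { destruct (Rtotal_order s b1) as [hlt|[heq|hgt]]; auto; exfalso.
    - assert (hp := u1 s ltac:(lra)). assert (s < b2).
      { destruct (Rtotal_order s b2) as [|[h2|h2]]; auto; exfalso; [rewrite h2 in hP; rewrite h2 in hp|specialize (d2 s h2)]; lra. }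
      destruct (hhead s s ltac:(lra) ltac:(lra) eW). lra.
    - subst s. specialize (hmax2 b1 ltac:(lra)). lra. }
  destruct (Rlt_le_dec b2 s) as [hsb2|hsb2].
  { exists s, s. refine (conj hb1 (conj d1 (conj hb2 (conj d2 (conj hsb1 (conj hsb2 (conj eW (conj hP _)))))))). lra. }
  assert (hle := hmax2 s ltac:(lra)).
  assert (hlev : exists t1, b1 < t1 <= s /\ W1 t1 = W2 b2).
  { destruct (Req_dec (W1 s) (W2 b2)) as [he'|hne]; [exists s; split; [lra|auto]|].
    destruct (IVT_interval_decr W1 b1 s (W2 b2) hsb1) as [t1 [ht1 et1]]; try lra.
    - intros u hu. apply (decaying_contW k e W1 P1 s1 C); auto. lra.
    - exists t1. split; [lra|auto]. }
  destruct hlev as [t1 [[hbt ht1] et1]].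
  (* Unless [t1] precedes [b2], both are the crossing time, after which [W1 - W2] decreases; either
     case orders the times. *)
  assert (hbeta : exists r, t1 < r /\ forall x1 x2, t1 < x1 < r -> b2 < x2 -> W1 x1 = W2 x2 -> x1 <= x2).
  { destruct (Rlt_le_dec t1 b2) as [hlt|hge]; [exists b2; split; auto; intros; lra|].
    assert (hsb : s = b2) by lra. assert (hts : t1 = s) by lra. 
    destruct (decaying_at _ _ _ _ _ _ s hd1 ltac:(lra)) as [_ [v1 _]]. destruct (decaying_at _ _ _ _ _ _ s hd2 ltac:(lra)) as [_ [v2 _]].
    destruct (derive_neg_right _ _ _ (is_derive_minus _ _ _ _ _ v1 v2)) as [d [hd [h _]]]; [unfold minus, plus, opp; simpl; lra|].
    exists (t1 + d). split; [lra|]. intros x1 x2 hx1 hx2 ex. apply Rnot_lt_le. intros hlt.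
    specialize (h x2 ltac:(lra)). unfold minus, plus, opp in h; simpl in h.
    assert (W1 x1 < W1 x2) by (apply (descent_strict k e W1 P1 s1 C b1); auto; lra). lra. }
  destruct hbeta as [r [hr hord]].
  destruct (launch (fun v => - W1 v) (fun v => - P1 v) (fun v => - W2 v) (fun v => - P2 v) t1 r b2 (b2 + 1)) as [x1 [x2 [h1 [h2 [h3 h4]]]]]; auto; try lra.
  - apply rising_opp. apply (orbit_rising k e W1 P1 s1 (r + 1)); [apply ho1| |]; lra.
  - apply rising_opp. apply (orbit_rising k e W2 P2 s2 (b2 + 2)); [apply ho2| |]; lra.
  - intros v hv. specialize (d1 v ltac:(lra)). lra.
  - intros v hv. specialize (d2 v ltac:(lra)). lra.
  - exists x1, x2. assert (W1 x1 = W2 x2) by lra. assert (x1 <= x2) by (apply hord; auto; lra). 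
    refine (conj hb1 (conj d1 (conj hb2 (conj d2 _)))). lra.
Qed.

(** The lag is read off [E]: the ratio of its values at equal heights is the exponential of [om]
    times the difference of the times, and the comparison preserves a lower bound [r] of this
    ratio. *)
Lemma interfaces_not_ordered : False.
Proof.
  destruct descending_match as [b1 [b2 [x1 [x2 [hb1 [d1 [hb2 [d2 [hx1 [hx2 [eW [hP hx]]]]]]]]]]]].
  pose proof hd1 as [ho1 _]. pose proof hd2 as [ho2 _]. pose proof om_pos as hom. pose proof chi_pos as hchi.
  assert (hcomp : forall r u1 u2 y1 y2, 1 <= r -> b1 < u1 -> b2 < u2 -> W1 u1 = W2 u2 -> P1 u1 < P2 u2 -> r * E e u2 <= E e u1 ->
    u1 < y1 -> b2 < y2 -> W1 y1 = W2 y2 -> P1 y1 < P2 y2 /\ r * E e y2 < E e y1).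
  { intros r u1 u2 y1 y2 hr hu1 hu2 eu hPu hE hy1 hy2 ey.
    apply (down_comparison k e W1 P1 b1 (y1 + 1) e W2 P2 b2 (Rmax u2 y2 + 1) r u1 y1 u2 y2); auto; try lra.
    - apply (orbit_sub _ _ _ _ s1 (y1 + 1)); [apply ho1| |]; lra.
    - intros s hs'. apply d1; lra.
    - pose proof (Rmax_l u2 y2). apply (orbit_sub _ _ _ _ s2 (Rmax u2 y2 + 1)); [apply ho2| |]; lra.
    - intros s hs'. apply d2; lra.
    - pose proof (Rmax_l u2 y2). lra.
    - pose proof (Rmax_r u2 y2). lra. }
  assert (hmatch : forall y1, x1 < y1 -> exists y2, x2 < y2 /\ W1 y1 = W2 y2).
  { intros y1 hy1. destruct (decaying_at _ _ _ _ _ _ y1 hd1 ltac:(lra)) as [p1 _].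
    assert (W1 y1 < W1 x1) by (apply (descent_strict k e W1 P1 s1 C b1); auto; lra).
    destruct (descent_level k e W2 P2 s2 C x2 (W1 y1) hd2) as [y2 [hy2 ey2]]; try lra. exists y2. split; auto. }
  (* One unit of time turns [x1 <= x2] into a strict inequality for [E], hence into a positive lag
     [d]. *)
  destruct (hmatch (x1 + 1) ltac:(lra)) as [y2 [hy2 ey]]. set (y1 := x1 + 1) in *.
  destruct (hcomp 1 x1 x2 y1 y2) as [hPy hEy]; auto; try lra; [|unfold y1; lra|].
  { rewrite Rmult_1_l. destruct hx as [hx|hx]; [left; now apply E_decr|right; now rewrite hx]. }
  rewrite Rmult_1_l in hEy.
  assert (hord : y1 < y2). { apply Rnot_le_lt. intros [hlt|heq]; [pose proof (E_decr e y2 y1 he hlt); lra|rewrite heq in hEy; lra]. }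
  set (d := y2 - y1). assert (hd : 0 < d) by (unfold d; lra).
  assert (hEd : forall s t, E e s = exp (om * (t - s)) * E e t).
  { intros s t. unfold E. rewrite (Rmult_comm (exp (om * (t - s)))), Rmult_assoc, <- exp_plus. do 2 f_equal. ring. }
  assert (hshift : forall s, y1 < s -> W1 s <= W2 (s + d)).
  { intros s hs'. destruct (hmatch s ltac:(unfold y1 in *; lra)) as [t [ht et]].
    destruct (hcomp (exp (om * d)) y1 y2 s t) as [_ hE]; auto; try lra.
    - rewrite <- exp_0 at 1. left. apply exp_increasing. now apply Rmult_lt_0_compat.
    - unfold y1; lra.
    - right. rewrite (hEd y1 y2). unfold d. auto.
    - rewrite (hEd s t) in hE. apply Rmult_lt_reg_r in hE; [|now apply E_pos]. apply exp_lt_inv, Rmult_lt_reg_l in hE; auto.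
      rewrite et. left. apply (descent_strict k e W2 P2 s2 C b2); auto; unfold d in *; lra. }
  set (g := exp (- (chi * d))). assert (hg : 0 < g < 1).
  { split; [apply exp_pos|]. unfold g. rewrite <- exp_0. apply exp_increasing. assert (0 < chi * d) by (now apply Rmult_lt_0_compat). lra. }
  set (eps := C * (1 - g) / 2). assert (heps : 0 < eps) by (unfold eps; apply Rdiv_lt_0_compat; [apply Rmult_lt_0_compat|]; lra).
  destruct (proj2 (proj2 hd1) eps heps) as [S1 [_ t1]]. destruct (proj2 (proj2 hd2) eps heps) as [S2 [_ t2]].
  set (s := Rmax (Rmax S1 S2) (y1 + 1)). assert (i1 := Rmax_l (Rmax S1 S2) (y1 + 1)). assert (i2 := Rmax_r (Rmax S1 S2) (y1 + 1)).
  assert (i3 := Rmax_l S1 S2). assert (i4 := Rmax_r S1 S2). fold s in i1, i2.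
  specialize (t1 s ltac:(lra)). specialize (t2 (s + d) ltac:(lra)). specialize (hshift s ltac:(lra)).
  (* A lag of [d] costs the factor [e^(-chi d) < 1] in the limit, yet both limits are [C]. *)
  assert (ht : tailw W1 s <= g * tailw W2 (s + d)).
  { unfold tailw, g. rewrite <- Rmult_assoc, <- exp_plus. replace (- (chi * d) + chi * (s + d)) with (chi * s) by ring.
    apply Rmult_le_compat_l; auto. left; apply exp_pos. }
  apply Rabs_def2 in t1. apply Rabs_def2 in t2. 
  assert (g * tailw W2 (s + d) <= g * (C + eps)) by (apply Rmult_le_compat_l; lra).
  assert (g * eps < 1 * eps) by (apply Rmult_lt_compat_r; lra). unfold eps in *. lra.
Qed.
End Crossing.

Lemma decaying_unique {c : coeffs} k e W1 P1 W2 P2 s1 s2 C : 0 < k -> 0 < e -> 0 < C ->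
  decaying k e W1 P1 s1 C -> decaying k e W2 P2 s2 C -> s1 = s2 /\ forall s, s1 < s -> W1 s = W2 s.
Proof.
  intros hk he hC h1 h2. destruct (Rtotal_order s1 s2) as [hlt|[heq|hgt]].
  - exfalso. exact (interfaces_not_ordered k e W1 P1 W2 P2 s1 s2 C hk he hC h1 h2 hlt).
  - split; auto. subst s2. intros s hs. destruct h1 as [o1 [i1 _]]. destruct h2 as [o2 [i2 _]].
    apply (interface_unique k e W1 P1 W2 P2 s1 (s + 1) (s + 1)); auto; try lra; [apply o1|apply o2]; lra.
  - exfalso. exact (interfaces_not_ordered k e W2 P2 W1 P1 s2 s1 C hk he hC h2 h1 hgt).
Qed.

Lemma Rpower_exp_base x z : Rpower (exp x) z = exp (z * x).
Proof. unfold Rpower. now rewrite ln_exp. Qed.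

(* The critical orbit has [e = 1] and its interface at [0]; a translation and a dilation give it [k = 1] and any [e]. *)
Lemma decaying_exists {c : coeffs} e C : 0 < e -> 0 < C -> Rpower C (q - a) = e * (chi * a) ->
  exists W P s0, decaying 1 e W P s0 C.
Proof.
  intros he hC eC. destruct critical_orbit as [k [W [P [hk [hs [hturn htrap]]]]]].
  assert (ho : forall T, 0 < T -> orbit k 1 W P 0 T) by (intros T hT; apply hs; auto).
  assert (hvan := orbit_vanishes k W P hk ho hturn htrap).
  pose proof om_pos as hom. pose proof q_range as hq. pose proof chi_om as hco.
  (* [t] is the logarithm of the dilation and [l] the translation: they solve [k e^((1-q) t) = 1]
     and [e^(- om l + (1-a) t) = e]. *)
  set (t := - ln k / (1 - q)). set (l := ((1 - a) * t - ln e) / om).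
  assert (ek : k = exp (- (1 - q) * t)).
  { unfold t. replace (- (1 - q) * (- ln k / (1 - q))) with (ln k) by (field; lra). now rewrite exp_ln. }
  assert (ee : e = exp (- om * l + (1 - a) * t)).
  { unfold l. replace (- om * (((1 - a) * t - ln e) / om) + (1 - a) * t) with (ln e) by (field; lra). now rewrite exp_ln. }
  set (C' := C * exp (chi * l - t)).
  assert (hC' : 0 < C') by (apply Rmult_lt_0_compat; auto; apply exp_pos).
  assert (eC' : k * Rpower C' (q - a) = chi * a).
  { unfold C'. rewrite Rpower_mult_base, Rpower_exp_base, eC by (auto using exp_pos).
    replace (k * (e * (chi * a) * exp ((q - a) * (chi * l - t)))) with (k * e * exp ((q - a) * (chi * l - t)) * (chi * a)) by ring.
    rewrite ek, ee, <- !exp_plus. 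
    replace (- (1 - q) * t + (- om * l + (1 - a) * t) + (q - a) * (chi * l - t)) with 0 by (rewrite <- hco; ring).
    rewrite exp_0. ring. }
  assert (htl := tail_limit k W P hk ho hvan C' hC' eC').
  assert (e1 : k * Rpower (exp t) (1 - q) = 1).
  { rewrite Rpower_exp_base, ek, <- exp_plus. replace (- (1 - q) * t + (1 - q) * t) with 0 by ring. apply exp_0. }
  assert (e2 : 1 * exp (- om * l) * Rpower (exp t) (1 - a) = e).
  { rewrite Rpower_exp_base, Rmult_1_l, <- exp_plus. now rewrite ee. }
  exists (fun s => exp t * W (s + l)), (fun s => exp t * P (s + l)), (- l). split; [|split].
  - intros T hT. assert (o := orbit_scale _ _ _ _ _ _ (exp t) (exp_pos t) (orbit_shift k 1 W P 0 (T + l) l (ho (T + l) ltac:(lra)))).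
    rewrite e1, e2 in o. replace (0 - l) with (- l) in o by ring. replace (T + l - l) with T in o by ring. exact o.
  - assert (h : interface (1 * exp (- om * l)) (fun s => W (s + l)) (fun s => P (s + l)) (0 - l)).
    { intros eps heps. destruct (hs 1 ltac:(lra)) as [_ hi]. destruct (hi eps heps) as [d [hd h]].
      exists d. split; auto. intros s hs'. specialize (h (s + l) ltac:(lra)).
      rewrite <- E_shift. replace (0 - l + l) with 0 by ring. auto. }
    assert (h' := interface_scale _ _ _ _ (0 - l) (1 - l) (exp t) ltac:(lra) (exp_pos t) (orbit_shift k 1 W P 0 1 l (ho 1 ltac:(lra))) h).
    rewrite e2 in h'. replace (0 - l) with (- l) in h' by ring. exact h'.
  - intros d hd. set (g := exp (t - chi * l)). assert (hg : 0 < g) by apply exp_pos.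
    assert (hdg : 0 < d / g) by (apply Rdiv_lt_0_compat; auto).
    destruct (htl (d / g) hdg) as [S [hS h]]. exists (S - l). split; [lra|]. intros s hss. specialize (h (s + l) ltac:(lra)).
    replace (tailw (fun r => exp t * W (r + l)) s - C) with (g * (tailw W (s + l) - C')).
    + rewrite Rabs_mult, (Rabs_pos_eq g) by lra. apply Rlt_le_trans with (g * (d / g)); [now apply Rmult_lt_compat_l|right; field; lra].
    + unfold tailw, g, C'. replace (chi * (s + l)) with (chi * s + chi * l) by ring. 
      replace (t - chi * l) with (- (chi * l - t)) by ring. rewrite exp_Ropp, !exp_plus.
      replace (exp t) with (exp (chi * l) / exp (chi * l - t)).
      * pose proof (exp_pos (chi * l - t)). field. lra.
      * unfold Rdiv. rewrite <- exp_Ropp, <- exp_plus. f_equal. ring.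
Qed.

(* The flux [P - E W^a] is of smaller order than [W^a] at a point where [W] attains a new record, hence
   [P > 0] there: this makes [W] increase near the interface, and then every point is a record. *)
Lemma interface_of_limit {c : coeffs} k e W P s0 s1 : 0 < k -> 0 < e -> s0 < s1 -> orbit k e W P s0 s1 ->
  (forall eps, 0 < eps -> exists d, 0 < d /\ forall s, s0 < s < s0 + d -> W s < eps /\ Rabs (P s) < eps) ->
  interface e W P s0.
Proof.
  intros hk he hs o hlim. pose proof a_range as ha. pose proof q_range as hq. pose proof a_lt_q as haq.
  pose proof A_pos as hA. pose proof B_pos as hB. pose proof om_pos as hom.
  (* The factor [e^(A s)] removes the friction, and what remains of the derivative of the flux
     contains no [P]: where [W < 1] it is bounded by a multiple of [W^a]. *)
  set (Rf := fun s => exp (A * s) * (P s - E e s * Rpower (W s) a)).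
  set (dR := fun s => exp (A * s) * (- B * W s + k * Rpower (W s) q + (om - A) * E e s * Rpower (W s) a)).
  assert (hdR : forall s, s0 < s < s1 -> is_derive Rf s (dR s)).
  { intros s hss. destruct (o s hss) as [w1 [w2 w3]].
    assert (hpw := is_derive_Rpower_comp a W s _ w1 w2). assert (hEd := E_derive e s).
    assert (hexp : is_derive (fun r => exp (A * r)) s (A * exp (A * s))) by (auto_derive; auto; ring).
    apply (is_derive_eq _ _ _ _ (is_derive_mult _ _ _ _ _ hexp (is_derive_minus _ _ _ _ _ w3 (is_derive_mult _ _ _ _ _ hEd hpw Rmult_comm)) Rmult_comm)).
    unfold plus, mult, minus, plus, opp; simpl. unfold dR, accel. ring. }
  destruct (hlim 1 ltac:(lra)) as [d1 [hd1 h1]].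
  set (x1 := s0 + Rmin (Rmin d1 1) (s1 - s0) / 2).
  assert (i1 := Rmin_l (Rmin d1 1) (s1 - s0)). assert (i2 := Rmin_r (Rmin d1 1) (s1 - s0)). assert (i3 := Rmin_l d1 1). assert (i4 := Rmin_r d1 1).
  assert (i5 : 0 < Rmin (Rmin d1 1) (s1 - s0)) by (apply Rmin_pos; [apply Rmin_pos|]; lra).
  assert (hx1 : s0 < x1 < s1 /\ x1 < s0 + d1 /\ x1 < s0 + 1) by (unfold x1; lra).
  set (X := exp (A * (s0 + 1))). assert (hX : 0 < X) by apply exp_pos.
  set (K := B + k + Rabs (om - A) * E e s0 + 1). pose proof (E_pos e s0 he) as hE0. pose proof (Rabs_pos (om - A)).
  assert (hK : 0 < K). { unfold K. assert (0 <= Rabs (om - A) * E e s0) by (apply Rmult_le_pos; lra). lra. }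
  assert (hWa : forall s, s0 < s <= x1 -> 0 < W s < 1).
  { intros s hss. split; [apply o; lra|apply h1; lra]. }
  assert (hbd : forall s, s0 < s <= x1 -> Rabs (dR s) <= X * K * Rpower (W s) a).
  { intros s hss. destruct (hWa s hss) as [w1 w2]. unfold dR. rewrite Rabs_mult, (Rabs_pos_eq (exp _)) by (left; apply exp_pos).
    rewrite (Rmult_assoc X K). apply Rmult_le_compat; [left; apply exp_pos|apply Rabs_pos| |].
    { left. apply exp_increasing. apply Rmult_lt_compat_l; lra. }
    pose proof (Rpower_pos (W s) a) as hp.
    assert (f1 : W s <= Rpower (W s) a).
    { rewrite <- (Rpower_1 (W s)) at 1 by auto. unfold Rpower. 
      assert (ln (W s) < 0) by (rewrite <- ln_1; apply ln_increasing; lra).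
      left. apply exp_increasing. nra. }
    assert (f2 : Rpower (W s) q <= Rpower (W s) a).
    { unfold Rpower. assert (ln (W s) < 0) by (rewrite <- ln_1; apply ln_increasing; lra). left. apply exp_increasing. nra. }
    pose proof (Rpower_pos (W s) q) as hp2. assert (hE := E_decr e s0 s he ltac:(lra)). pose proof (E_pos e s he).
    apply Rabs_le_between.
    assert (g1 : B * W s <= B * Rpower (W s) a) by (apply Rmult_le_compat_l; lra).
    assert (g2 : k * Rpower (W s) q <= k * Rpower (W s) a) by (apply Rmult_le_compat_l; lra).
    assert (g3 : Rabs ((om - A) * E e s * Rpower (W s) a) <= Rabs (om - A) * E e s0 * Rpower (W s) a).
    { rewrite !Rabs_mult, (Rabs_pos_eq (E e s)), (Rabs_pos_eq (Rpower (W s) a)) by lra.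
      apply Rmult_le_compat_r; [lra|]. apply Rmult_le_compat_l; lra. }
    apply Rabs_le_between in g3. unfold K.
    assert (0 < B * W s) by (apply Rmult_lt_0_compat; auto). assert (0 < k * Rpower (W s) q) by (apply Rmult_lt_0_compat; auto).
    assert (0 < B * Rpower (W s) a) by (apply Rmult_lt_0_compat; auto). assert (0 < k * Rpower (W s) a) by (apply Rmult_lt_0_compat; auto).
    lra. }
  assert (hRlim : forall eps, 0 < eps -> exists d, 0 < d /\ forall s, s0 < s < s0 + d -> s < s1 -> Rabs (Rf s) < eps).
  { intros eps heps. set (e' := eps / (2 * X * (1 + E e s0))).
    assert (hXE : 0 < 2 * X * (1 + E e s0)) by (apply Rmult_lt_0_compat; lra).
    assert (he' : 0 < e') by (apply Rdiv_lt_0_compat; auto).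
    destruct (Rpower_small a e' (proj1 ha) he') as [d2 [hd2 h2]].
    destruct (hlim (Rmin e' d2) (Rmin_pos _ _ he' hd2)) as [d3 [hd3 h3]].
    exists (Rmin d3 1). split; [apply Rmin_pos; lra|]. intros s hss hs1. 
    assert (j1 := Rmin_l d3 1). assert (j2 := Rmin_r d3 1). assert (j3 := Rmin_l e' d2). assert (j4 := Rmin_r e' d2).
    destruct (h3 s ltac:(lra)) as [g1 g2]. destruct (o s ltac:(lra)) as [w1 _].
    specialize (h2 (W s) w1 ltac:(lra)). pose proof (Rpower_pos (W s) a). assert (hE := E_decr e s0 s he ltac:(lra)). pose proof (E_pos e s he).
    unfold Rf. rewrite Rabs_mult, (Rabs_pos_eq (exp _)) by (left; apply exp_pos).
    assert (exp (A * s) < X) by (apply exp_increasing, Rmult_lt_compat_l; lra).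
    assert (t1 : E e s * Rpower (W s) a <= E e s0 * e') by (apply Rmult_le_compat; lra).
    assert (t0 : 0 < E e s * Rpower (W s) a) by (apply Rmult_lt_0_compat; auto).
    assert (t2 : Rabs (P s - E e s * Rpower (W s) a) <= (1 + E e s0) * e') by (apply Rabs_def2 in g2; apply Rabs_le_between; lra).
    apply Rle_lt_trans with (X * ((1 + E e s0) * e')).
    - apply Rmult_le_compat; [left; apply exp_pos|apply Rabs_pos| |]; lra.
    - replace (X * ((1 + E e s0) * e')) with (eps / 2) by (unfold e'; field; split; lra). lra. }
  (* At a record the final height bounds the derivative on the whole stretch, so integration from
     the edge makes the flux small compared with [W^a]. *)
  assert (hrec : forall s, s0 < s <= x1 -> (forall r, s0 < r <= s -> W r <= W s) ->
     Rabs (Rf s) <= X * K * Rpower (W s) a * (s - s0)).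
  { intros s hss hmax. set (M := X * K * Rpower (W s) a). pose proof (Rpower_pos (W s) a) as hp.
    assert (hM : 0 < M) by (apply Rmult_lt_0_compat; [apply Rmult_lt_0_compat|]; auto).
    apply Rnot_lt_le. intros hlt. set (g := Rabs (Rf s) - M * (s - s0)). assert (hg : 0 < g) by (unfold g; lra).
    destruct (hRlim g hg) as [d [hd h]].
    set (t := s0 + Rmin d (s - s0) / 2). assert (j1 := Rmin_l d (s - s0)). assert (j2 := Rmin_r d (s - s0)).
    assert (j3 : 0 < Rmin d (s - s0)) by (apply Rmin_pos; lra).
    specialize (h t ltac:(unfold t; lra) ltac:(unfold t; lra)).
    destruct (MVT_interval Rf dR t s ltac:(unfold t; lra)) as [y [hy ey]]. { intros y hy. apply hdR. unfold t in hy. lra. }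
    assert (hyM : Rabs (dR y) <= M).
    { apply Rle_trans with (X * K * Rpower (W y) a); [apply hbd; unfold t in hy; lra|]. unfold M.
      apply Rmult_le_compat_l; [left; now apply Rmult_lt_0_compat|]. 
      apply Rpower_le; [lra|apply hWa; unfold t in hy; lra|apply hmax; unfold t in hy; lra]. }
    assert (Rabs (Rf s - Rf t) <= M * (s - t)).
    { rewrite ey, Rabs_mult, (Rabs_pos_eq (s - t)) by (unfold t; lra). apply Rmult_le_compat_r; [unfold t; lra|auto]. }
    assert (M * (s - t) <= M * (s - s0)) by (apply Rmult_le_compat_l; unfold t; lra).
    assert (Rabs (Rf s) <= Rabs (Rf s - Rf t) + Rabs (Rf t)).
    { replace (Rf s) with (Rf s - Rf t + Rf t) at 1 by ring. apply Rabs_triang. }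
    unfold g in h. lra. }
  set (X0 := exp (A * s0)). assert (hX0 : 0 < X0) by apply exp_pos.
  assert (hclose : forall s, s0 < s <= x1 -> (forall r, s0 < r <= s -> W r <= W s) ->
     Rabs (P s / Rpower (W s) a - E e s) <= X * K / X0 * (s - s0)).
  { intros s hss hmax. specialize (hrec s hss hmax). pose proof (Rpower_pos (W s) a) as hp.
    unfold Rf in hrec. rewrite Rabs_mult, (Rabs_pos_eq (exp _)) in hrec by (left; apply exp_pos).
    assert (hxs : X0 <= exp (A * s)) by (left; apply exp_increasing, Rmult_lt_compat_l; lra).
    replace (P s / Rpower (W s) a - E e s) with ((P s - E e s * Rpower (W s) a) * / Rpower (W s) a) by (field; lra).
    rewrite Rabs_mult, (Rabs_pos_eq (/ _)) by (left; now apply Rinv_0_lt_compat).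
    set (Y := Rabs (P s - E e s * Rpower (W s) a)) in *. assert (hY : 0 <= Y) by apply Rabs_pos.
    apply Rmult_le_reg_r with (Rpower (W s) a * X0); [now apply Rmult_lt_0_compat|].
    replace (Y * / Rpower (W s) a * (Rpower (W s) a * X0)) with (X0 * Y) by (field; lra).
    replace (X * K / X0 * (s - s0) * (Rpower (W s) a * X0)) with (X * K * Rpower (W s) a * (s - s0)) by (field; lra).
    apply Rle_trans with (exp (A * s) * Y); auto. apply Rmult_le_compat_r; auto. }
  set (Q := X * K / X0). assert (hQ : 0 < Q) by (apply Rdiv_lt_0_compat; auto; apply Rmult_lt_0_compat; auto).
  set (E1 := E e (s0 + 1)). pose proof (E_pos e (s0 + 1) he) as hE1. fold E1 in hE1.
  (* Up to [x2] the relative error is at most half of [E1], a lower bound of [E]; hence [P > 0] at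
     every record. *)
  set (x2 := Rmin x1 (s0 + E1 / (2 * Q))).
  assert (k1 := Rmin_l x1 (s0 + E1 / (2 * Q))). assert (k2 := Rmin_r x1 (s0 + E1 / (2 * Q))). fold x2 in k1, k2.
  assert (hq2 : 0 < E1 / (2 * Q)) by (apply Rdiv_lt_0_compat; lra).
  assert (hx2 : s0 < x2) by (apply Rmin_glb_lt; lra).
  assert (hup : forall s, s0 < s < x2 -> 0 < P s).
  { intros s hss. destruct (Rlt_le_dec 0 (P s)) as [|hneg]; auto. exfalso.
    destruct (o s ltac:(lra)) as [ws _]. destruct (hlim (W s) ws) as [d [hd h]].
    set (t := s0 + Rmin d (s - s0) / 2). assert (j1 := Rmin_l d (s - s0)). assert (j2 := Rmin_r d (s - s0)).
    assert (j3 : 0 < Rmin d (s - s0)) by (apply Rmin_pos; lra).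
    destruct (continuous_bounded_max W t s ltac:(unfold t; lra)) as [r [hr hmax]].
    { intros y hy. apply (orbit_contW k e W P s0 s1); auto. unfold t in hy; lra. }
    assert (hrs : forall y, s0 < y <= s -> W y <= W r).
    { intros y hy. destruct (Rle_lt_dec t y); [apply hmax; lra|].
      destruct (h y ltac:(unfold t in *; lra)) as [hyw _]. specialize (hmax s ltac:(unfold t; lra)). lra. }
    assert (hr0 : s0 < r) by (unfold t in hr; lra).
    assert (hcl := hclose r ltac:(lra) ltac:(intros; apply hrs; lra)). fold Q in hcl.
    assert (hEr : E1 < E e r) by (apply E_decr; auto; lra).
    assert (hsm : Q * (r - s0) < E1).
    { apply Rle_lt_trans with (Q * (E1 / (2 * Q))); [apply Rmult_le_compat_l; lra|]. replace (Q * (E1 / (2 * Q))) with (E1 / 2) by (field; lra). lra. }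
    assert (hPr : 0 < P r).
    { apply Rabs_le_between in hcl. pose proof (Rpower_pos (W r) a).
      replace (P r) with (P r / Rpower (W r) a * Rpower (W r) a) by (field; lra). apply Rmult_lt_0_compat; lra. }
    destruct (Req_dec r s) as [->|hrne]; [lra|].
    destruct (o r ltac:(lra)) as [_ [w2 _]].
    destruct (derive_pos_right _ _ _ w2 hPr) as [d' [hd' [hinc _]]].
    assert (m1 := Rmin_l d' (s - r)). assert (m2 := Rmin_r d' (s - r)). assert (m3 : 0 < Rmin d' (s - r)) by (apply Rmin_pos; lra).
    specialize (hinc (r + Rmin d' (s - r) / 2) ltac:(lra)). specialize (hrs (r + Rmin d' (s - r) / 2) ltac:(lra)). lra. }
  assert (hinc : forall s, s0 < s < x2 -> forall r, s0 < r <= s -> W r <= W s).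
  { intros s hss r hr. apply (incr_of_derive W P); [lra|intros y hy; apply o; lra|intros y hy; left; apply hup; lra]. }
  intros eps heps. destruct (hlim eps heps) as [d2 [hd2 h2]].
  assert (hEc : continuous (E e) s0) by (eapply derive_continuous, E_derive).
  destruct (continuous_eps _ _ hEc (eps / 2) ltac:(lra)) as [d3 [hd3 h3]].
  set (d4 := eps / (2 * Q)). assert (hd4 : 0 < d4) by (apply Rdiv_lt_0_compat; lra).
  set (d := Rmin (Rmin d2 d3) (Rmin d4 (x2 - s0))).
  assert (n1 := Rmin_l (Rmin d2 d3) (Rmin d4 (x2 - s0))). assert (n2 := Rmin_r (Rmin d2 d3) (Rmin d4 (x2 - s0))).
  assert (n3 := Rmin_l d2 d3). assert (n4 := Rmin_r d2 d3). assert (n5 := Rmin_l d4 (x2 - s0)). assert (n6 := Rmin_r d4 (x2 - s0)).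
  assert (hd : 0 < d) by (apply Rmin_pos; apply Rmin_pos; lra). fold d in n1, n2.
  exists d. split; auto. intros s hss. split; [apply h2; lra|].
  assert (hcl := hclose s ltac:(lra) (hinc s ltac:(lra))). fold Q in hcl.
  specialize (h3 s ltac:(apply Rabs_def1; lra)).
  assert (Q * (s - s0) < eps / 2).
  { apply Rlt_le_trans with (Q * d4); [apply Rmult_lt_compat_l; lra|right; unfold d4; field; lra]. }
  replace (P s / Rpower (W s) a - E e s0) with ((P s / Rpower (W s) a - E e s) + (E e s - E e s0)) by ring.
  eapply Rle_lt_trans; [apply Rabs_triang|]. lra.
Qed.

(** * One-sided limits and derivatives *)

Lemma is_derive_halfline_of F x l : 0 <= x -> is_derive F x l -> is_derive_halfline F x l.
Proof.
  intros hx [hl hd]. split; [exact hl|]. intros y hy eps.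
  (* [filterdiff] quantifies over all limits [y] of the filter; for [halfline_at x] with [x >= 0]
     only [x] is one, since [x] belongs to every set of this filter. *)
  assert (e : x = y).
  { apply NNPP. intros hne. assert (hr : 0 < Rabs (x - y)) by (apply Rabs_pos_lt; lra).
    assert (hb := hy (ball y (mkposreal _ hr)) (locally_ball y (mkposreal _ hr))).
    destruct hb as [d hb]. specialize (hb x (ball_center x d) hx). change (Rabs (x - y) < Rabs (x - y)) in hb. lra. }
  subst y. specialize (hd x (fun P h => h) eps). revert hd. apply filter_le_within.
Qed.

Lemma is_derive_of_halfline F x l : 0 < x -> is_derive_halfline F x l -> is_derive F x l.
Proof.
  intros hx [hl hd]. split; [exact hl|]. intros y hy eps.
  assert (e : x = y) by now apply is_filter_lim_locally_unique. subst y.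
  assert (hw : is_filter_lim (halfline_at x) x) by (intros P hP; now apply filter_le_within).
  specialize (hd x hw eps). destruct hd as [d hd].
  assert (hm : 0 < Rmin d x) by (apply Rmin_pos; [apply cond_pos|auto]).
  exists (mkposreal _ hm). intros z hz. change (Rabs (z - x) < Rmin d x) in hz.
  assert (i1 := Rmin_l d x). assert (i2 := Rmin_r d x).
  apply hd; [change (Rabs (z - x) < d); lra|]. apply Rabs_def2 in hz. lra.
Qed.

Lemma continuous_halfline_of f : (forall x, 0 <= x -> continuous f x) -> continuous_halfline f.
Proof. intros h x hx P hP. apply filter_le_within. apply (h x hx P hP). Qed.

Lemma halfline_continuous f x : 0 < x -> continuous_halfline f -> continuous f x.
Proof.
  intros hx h. apply eps_continuous. intros eps heps.
  destruct (h x ltac:(lra) (ball (f x) (mkposreal eps heps)) (locally_ball _ _)) as [d hd].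
  exists (Rmin d x). assert (i1 := Rmin_l d x). assert (i2 := Rmin_r d x). pose proof (cond_pos d).
  split; [apply Rmin_pos; lra|]. intros y hy. apply (hd y); [change (Rabs (y - x) < d); lra|]. apply Rabs_def2 in hy. lra.
Qed.

Lemma is_derive_exp_linear r s : is_derive (fun t => exp (r * t)) s (r * exp (r * s)).
Proof. auto_derive; auto. ring. Qed.

Lemma rpow_positive x y : 0 < x -> Defs.rpow x y = Rpower x y.
Proof. intros h. unfold Defs.rpow. destruct (Rlt_dec 0 x); [auto|lra]. Qed.

Lemma rpow_nonpositive x y : x <= 0 -> Defs.rpow x y = 0.
Proof. intros h. unfold Defs.rpow. destruct (Rlt_dec 0 x); [lra|auto]. Qed.

(** * Profiles and orbits *)

Section Profile.
Variables (N : nat) (m p sigma : R).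
Hypothesis hN : (1 <= N)%nat.
Hypothesis hp : 1 < p.
Hypothesis hpm : p < m.
Hypothesis hsigma : 0 < sigma.

Lemma coeffs_a_pos : 0 < 1 / m.
Proof. apply Rdiv_lt_0_compat; lra. Qed.
Lemma coeffs_a_lt_q : 1 / m < p / m.
Proof. apply Rmult_lt_compat_r; [apply Rinv_0_lt_compat|]; lra. Qed.
Lemma coeffs_q_lt_1 : p / m < 1.
Proof. apply Rmult_lt_reg_r with m; [lra|]. unfold Rdiv. rewrite Rmult_assoc, Rinv_l; lra. Qed.
Lemma coeffs_L_large : 2 < m * (sigma + 2) / (m - p) * (1 - p / m).
Proof. replace (m * (sigma + 2) / (m - p) * (1 - p / m)) with (sigma + 2) by (field; lra). lra. Qed.
Lemma coeffs_n_ge_1 : 1 <= INR N.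
Proof. change 1 with (INR 1). now apply le_INR. Qed.

(* [W(s) = e^{-L s} f(e^s)^m]. *)
Instance profile_coeffs : coeffs := {| a := 1 / m; q := p / m; L := m * (sigma + 2) / (m - p); n := INR N;
  a_pos := coeffs_a_pos; a_lt_q := coeffs_a_lt_q; q_lt_1 := coeffs_q_lt_1; L_large := coeffs_L_large; n_ge_1 := coeffs_n_ge_1 |}.

Let be := beta m p sigma.
Let al := alpha m p sigma.

Lemma denom_pos : 0 < sigma * (m - 1) + 2 * (p - 1).
Proof. assert (0 < sigma * (m - 1)) by (apply Rmult_lt_0_compat; lra). lra. Qed.

Lemma beta_pos : 0 < be.
Proof. pose proof denom_pos. apply Rdiv_lt_0_compat; lra. Qed.

Lemma alpha_beta : al = be * (L * a).
Proof. pose proof denom_pos. unfold al, be, alpha, beta, L, a; simpl. field. lra. Qed.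

Lemma L_sigma : L * (1 - q) = sigma + 2.
Proof. unfold L, q; simpl. field. lra. Qed.

Lemma a_m : a * m = 1.
Proof. unfold a; simpl. field. lra. Qed.

Lemma q_m : q * m = p.
Proof. unfold q; simpl. field. lra. Qed.

Lemma chi_value : chi * a = L * a + sigma / (p - 1).
Proof. unfold chi, om, L, a, q; simpl. field. lra. Qed.

Lemma chi_beta : be * (chi * a) = 1 / (p - 1).
Proof. pose proof denom_pos. unfold be, beta, chi, om, L, a, q; simpl. field. repeat split; lra. Qed.

(** One identity serves both directions: up to the factor [e^(-L s) xi^2], the residual of the orbit
    equation is that of the profile equation. The first bracket is [e^(L s) W''] by the chain
    rule. *)
Lemma profile_identity s v F1 F2 f1 : 0 < v -> F1 = m * Rpower v (m - 1) * f1 ->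
  let x := exp s in let W := exp (- L * s) * Rpower v m in let P := exp (- L * s) * (x * F1 - L * Rpower v m) in
  exp (- L * s) * (L * L * Rpower v m + (1 - 2 * L) * (x * F1) + x * x * F2) - accel 1 be s W P =
  exp (- L * s) * (x * x) * (F2 + (INR N - 1) / x * F1 + al * v - be * x * f1 - Rpower x sigma * Rpower v p).
Proof.
  intros hv eF x W P. assert (hx : 0 < x) by apply exp_pos.
  assert (hv2 : Rpower v (m - 1) * v = Rpower v m) by (apply Rpower_succ; auto).
  assert (eWq : Rpower W q = exp (- L * s) * (x * x) * (Rpower x sigma * Rpower v p)).
  { unfold W, x. rewrite Rpower_mult_base, !Rpower_exp_base by (auto using exp_pos; apply Rpower_pos).
    rewrite Rpower_mult. replace (m * q) with p by (rewrite <- q_m; ring).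
    assert (ee : exp (q * (- L * s)) = exp (- L * s) * (exp s * exp s) * exp (sigma * s)).
    { rewrite <- !exp_plus. f_equal. replace sigma with (L * (1 - q) - 2) at 1 by (rewrite L_sigma; ring). ring. }
    rewrite ee. ring. }
  assert (eWa : E be s * (a * Rpower W (a - 1)) * P = exp (- L * s) * (x * x) * (be * x * f1 - al * v)).
  { unfold W, P, E, x. rewrite Rpower_mult_base, Rpower_exp_base by (auto using exp_pos; apply Rpower_pos).
    rewrite Rpower_mult. replace (m * (a - 1)) with (- (m - 1)) by (replace (m * (a - 1)) with (a * m - m) by ring; rewrite a_m; ring).
    rewrite Rpower_Ropp, eF, <- hv2, alpha_beta.
    replace (exp (- L * s) * (exp s * exp s) * (be * exp s * f1 - be * (L * a) * v)) with
      (be * (exp (- L * s) * (exp s * exp s)) * (exp s * f1 - L * a * v)) by ring.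
    replace (exp (- L * s) * (exp s * exp s)) with (exp (- om * s) * exp ((a - 1) * (- L * s)) * exp (- L * s)).
    - pose proof (Rpower_pos v (m - 1)). pose proof a_m as ham. 
      transitivity (be * (exp (- om * s) * exp ((a - 1) * (- L * s)) * exp (- L * s)) * (a * m * exp s * f1 - L * a * v)).
      + field. lra.
      + rewrite ham. ring.
    - rewrite <- !exp_plus. f_equal. unfold om. ring. }
  unfold accel. rewrite eWq, eWa. unfold W, P, A, B, n; simpl. field. lra.
Qed.

(** The limit of [tailw] that corresponds to the required decay; [Cst_level] identifies it with the
    balance of absorption and drag for [k = 1] and [e = beta]. *)
Definition Cst := Rpower (1 / (p - 1)) (m / (p - 1)).

Lemma Cst_pos : 0 < Cst.
Proof. apply Rpower_pos. Qed.

Lemma Cst_level : Rpower Cst (q - a) = be * (chi * a).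
Proof.
  unfold Cst. rewrite Rpower_mult, chi_beta. replace (m / (p - 1) * (q - a)) with 1 by (unfold q, a; simpl; field; lra).
  apply Rpower_1, Rdiv_lt_0_compat; lra.
Qed.

Lemma Cst_root : Rpower Cst a = Rpower (1 / (p - 1)) (1 / (p - 1)).
Proof. unfold Cst. rewrite Rpower_mult. f_equal. unfold a; simpl. field. lra. Qed.

Lemma tailw_root W s : 0 < W s -> Rpower (tailw W s) a = Rpower (exp s) (sigma / (p - 1)) * Rpower (rawV W s) a.
Proof.
  intros hw. unfold tailw, rawV. rewrite !Rpower_mult_base, !Rpower_exp_base by (auto using exp_pos).
  rewrite <- (Rmult_assoc (exp (sigma / (p - 1) * s))), <- exp_plus. do 2 f_equal.
  replace (a * (chi * s)) with (chi * a * s) by ring. rewrite chi_value. ring.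
Qed.

Section FromProfile.
Variables (xi0 : R) (f : R -> R).
Hypothesis hf : dead_core_profile N m p sigma xi0 f.

Let F := fun x => Defs.rpow (f x) m.
Definition logW (s : R) := exp (- L * s) * F (exp s).
Definition logP (s : R) := exp (- L * s) * (exp s * Derive F (exp s) - L * F (exp s)).

Lemma profile_pos x : xi0 < x -> 0 < f x.
Proof. apply hf. Qed.

Lemma xi0_pos : 0 < xi0.
Proof. apply hf. Qed.

Lemma rawV_logW s : rawV logW s = F (exp s).
Proof. unfold rawV, logW. rewrite <- Rmult_assoc, <- exp_plus. replace (L * s + - L * s) with 0 by ring. rewrite exp_0. ring. Qed.

Lemma profile_at x : xi0 < x -> exists f1 F2, F x = Rpower (f x) m /\ is_derive f x f1 /\
  is_derive F x (m * Rpower (f x) (m - 1) * f1) /\ is_derive (Derive F) x F2 /\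
  F2 + (INR N - 1) / x * (m * Rpower (f x) (m - 1) * f1) + al * f x - be * x * f1 - Rpower x sigma * Rpower (f x) p = 0.
Proof.
  intros hx. pose proof xi0_pos as h0. assert (hfx := profile_pos x hx).
  destruct hf as [_ [[_ [_ [_ [_ [_ heq]]]]] _]]. destruct (heq x ltac:(lra) hfx) as [d1 [d2 [d3 e]]].
  assert (hd : is_derive F x (m * Rpower (f x) (m - 1) * Derive f x)).
  { apply (is_derive_near F (fun y => Rpower (f y) m) x _ (x - xi0)); [lra| |].
    - intros y hy. apply Rabs_def2 in hy. unfold F. apply rpow_positive, profile_pos. lra.
    - apply is_derive_Rpower_comp; auto. now apply Derive_correct. }
  exists (Derive f x), (Derive (Derive F) x). refine (conj _ (conj _ (conj hd (conj _ _)))).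
  - now apply rpow_positive.
  - now apply Derive_correct.
  - apply Derive_correct. exact d3.
  - rewrite <- (is_derive_unique _ _ _ hd). rewrite (rpow_positive x), (rpow_positive (f x)) in e by lra. exact e.
Qed.

Lemma exp_gt_xi0 s : ln xi0 < s -> xi0 < exp s.
Proof. intros h. rewrite <- (exp_ln xi0) by apply xi0_pos. now apply exp_increasing. Qed.

Lemma is_derive_exp_comp (g : R -> R) s l : is_derive g (exp s) l -> is_derive (fun t => g (exp t)) s (exp s * l).
Proof.
  intros h. apply (is_derive_eq _ _ _ _ (is_derive_comp g exp s l (exp s) h (is_derive_exp s))).
  unfold scal; simpl. unfold mult; simpl. ring.
Qed.

Lemma log_orbit T : orbit 1 be logW logP (ln xi0) T.
Proof.
  intros s hs. destruct (profile_at (exp s) (exp_gt_xi0 s ltac:(lra))) as [f1 [F2 [eF [df [dF [dF2 heq]]]]]].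
  assert (hv := profile_pos (exp s) (exp_gt_xi0 s ltac:(lra))).
  assert (eD := is_derive_unique _ _ _ dF). 
  assert (hexp := is_derive_exp_linear (- L) s).
  assert (g1 := is_derive_exp_comp _ _ _ dF). assert (g2 := is_derive_exp_comp _ _ _ dF2).
  split; [|split].
  - apply Rmult_lt_0_compat; [apply exp_pos|]. rewrite eF. apply Rpower_pos.
  - unfold logP. rewrite eD.
    apply (is_derive_eq _ _ _ _ (is_derive_mult _ _ _ _ _ hexp g1 Rmult_comm)). unfold plus, mult; simpl. ring.
  - assert (g3 := is_derive_mult _ _ _ _ _ (is_derive_exp s) g2 Rmult_comm).
    assert (g4 := is_derive_minus _ _ _ _ _ g3 (is_derive_scal _ _ L _ g1)).
    apply (is_derive_eq _ _ _ _ (is_derive_mult _ _ _ _ _ hexp g4 Rmult_comm)).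
    unfold plus, mult, minus, plus, opp; simpl. change (m * (sigma + 2) / (m - p)) with L.
    assert (hid := profile_identity s (f (exp s)) _ F2 f1 hv eq_refl). cbv zeta in hid. rewrite heq, Rmult_0_r in hid.
    assert (eW : logW s = exp (- L * s) * Rpower (f (exp s)) m) by (unfold logW; now rewrite eF).
    assert (eP : logP s = exp (- L * s) * (exp s * (m * Rpower (f (exp s)) (m - 1) * f1) - L * Rpower (f (exp s)) m)) by (unfold logP; now rewrite eF, eD).
    rewrite eW, eP. rewrite eD, eF. lra.
Qed.

Lemma log_limit eps : 0 < eps -> exists d, 0 < d /\ forall s, ln xi0 < s < ln xi0 + d -> logW s < eps /\ Rabs (logP s) < eps.
Proof.
  intros heps. pose proof xi0_pos as h0. pose proof L_gt_2 as hL.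
  pose proof hf as [_ [[_ [_ [[G [hG hGc]] _]]] [[hz [_ hd0]] _]]].
  assert (hGd : forall x, 0 < x -> is_derive F x (G x)) by (intros x hx; apply is_derive_of_halfline; auto; apply hG; lra).
  assert (G0 : G xi0 = 0) by (rewrite <- (is_derive_unique _ _ _ (hGd xi0 h0)); now apply is_derive_unique).
  assert (F0 : F xi0 = 0) by (unfold F; rewrite hz by lra; apply rpow_nonpositive; lra).
  set (M1 := exp (- L * ln xi0)). assert (hM1 : 0 < M1) by apply exp_pos.
  set (M := M1 * (xi0 + 1 + L)). assert (hM : 0 < M) by (apply Rmult_lt_0_compat; lra).
  set (e' := eps / (2 * (M + M1))). assert (he' : 0 < e') by (apply Rdiv_lt_0_compat; lra).
  destruct (continuous_eps F xi0 (derive_continuous _ _ _ (hGd xi0 h0)) e' he') as [d1 [hd1 h1]].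
  destruct (continuous_eps G xi0 (halfline_continuous G xi0 h0 hGc) e' he') as [d2 [hd2 h2]].
  assert (hm : 0 < Rmin (Rmin d1 d2) 1) by (apply Rmin_pos; [apply Rmin_pos|]; lra).
  assert (i1 := Rmin_l (Rmin d1 d2) 1). assert (i2 := Rmin_r (Rmin d1 d2) 1). assert (i3 := Rmin_l d1 d2). assert (i4 := Rmin_r d1 d2).
  assert (hexpc : continuous exp (ln xi0)) by (eapply derive_continuous, is_derive_exp).
  destruct (continuous_eps exp (ln xi0) hexpc _ hm) as [d [hd h]].
  exists d. split; auto. intros s hs. specialize (h s ltac:(apply Rabs_def1; lra)). rewrite exp_ln in h by auto.
  assert (hx := exp_gt_xi0 s ltac:(lra)). specialize (h1 (exp s) ltac:(lra)). specialize (h2 (exp s) ltac:(lra)).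
  rewrite F0, Rminus_0_r in h1. rewrite G0, Rminus_0_r in h2.
  assert (eD : Derive F (exp s) = G (exp s)) by (apply is_derive_unique, hGd; lra).
  assert (hxs : exp s <= xi0 + 1) by (apply Rabs_def2 in h; lra).
  assert (hex : exp (- L * s) <= M1). { left. apply exp_increasing. assert (L * ln xi0 < L * s) by (apply Rmult_lt_compat_l; lra). lra. }
  pose proof (exp_pos (- L * s)) as hep. pose proof (exp_pos s) as hes.
  assert (hee : M1 * e' < eps /\ M * e' < eps).
  { assert (2 * (M + M1) * e' = eps) by (unfold e'; field; lra). assert (0 < M1 * e') by (now apply Rmult_lt_0_compat). assert (0 < M * e') by (now apply Rmult_lt_0_compat). lra. }
  split.
  - unfold logW. apply Rle_lt_trans with (M1 * e'); [|apply hee].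
    apply Rle_trans with (exp (- L * s) * Rabs (F (exp s))); [apply Rmult_le_compat_l; [lra|apply Rle_abs]|apply Rmult_le_compat; try lra; apply Rabs_pos].
  - unfold logP. rewrite eD. rewrite Rabs_mult, (Rabs_pos_eq (exp (- L * s))) by lra.
    apply Rle_lt_trans with (M * e'); [|apply hee]. unfold M. rewrite Rmult_assoc.
    apply Rmult_le_compat; [lra|apply Rabs_pos|auto|].
    assert (t1 : Rabs (exp s * G (exp s)) <= (xi0 + 1) * e').
    { rewrite Rabs_mult, (Rabs_pos_eq (exp s)) by lra. apply Rmult_le_compat; try lra. apply Rabs_pos. }
    assert (t2 : Rabs (L * F (exp s)) <= L * e').
    { rewrite Rabs_mult, (Rabs_pos_eq L) by lra. apply Rmult_le_compat_l; lra. }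
    apply Rabs_le_between in t1. apply Rabs_le_between in t2. apply Rabs_le_between. lra.
Qed.

(** At the edge a profile is only known to have [f^m] of class C1 with zero derivative; the sharper
    asymptotics required by [interface] come from [interface_of_limit]. *)
Lemma log_decaying : decaying 1 be logW logP (ln xi0) Cst.
Proof.
  split; [intros T _; apply log_orbit|split].
  - apply (interface_of_limit 1 be logW logP (ln xi0) (ln xi0 + 1)); [lra|apply beta_pos|lra|apply log_orbit|apply log_limit].
  - intros d hd. pose proof hf as [_ [_ [_ hlim]]]. pose proof xi0_pos as h0. pose proof a_range as ha.
    set (c1 := Rpower (1 / (p - 1)) (1 / (p - 1))). assert (hc1 : 0 < c1) by apply Rpower_pos.
    assert (hcont : continuous (fun y => Rpower y m) c1) by (eapply derive_continuous; apply (is_derive_Rpower m c1); auto).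
    destruct (continuous_eps _ _ hcont d hd) as [r [hr h]].
    unfold has_decay in hlim. rewrite (rpow_positive (1 / (p - 1))) in hlim by (apply Rdiv_lt_0_compat; lra). fold c1 in hlim.
    apply is_lim_spec in hlim. destruct (hlim (mkposreal r hr)) as [M hM]. simpl in hM.
    set (S := Rmax (ln xi0 + 1) (ln (Rmax M 1 + 1))).
    assert (i1 := Rmax_l (ln xi0 + 1) (ln (Rmax M 1 + 1))). assert (i2 := Rmax_r (ln xi0 + 1) (ln (Rmax M 1 + 1))). fold S in i1, i2.
    assert (i3 := Rmax_l M 1). assert (i4 := Rmax_r M 1).
    exists S. split; [lra|]. intros s hs. assert (hxs := exp_gt_xi0 s ltac:(lra)).
    assert (hMs : M < exp s).
    { apply Rlt_le_trans with (Rmax M 1 + 1); [lra|]. rewrite <- (exp_ln (Rmax M 1 + 1)) by lra.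
      destruct (Rle_lt_or_eq_dec (ln (Rmax M 1 + 1)) s ltac:(lra)) as [hl|hl]; [left; now apply exp_increasing|right; now rewrite hl]. }
    specialize (hM (exp s) hMs). rewrite rpow_positive in hM by apply exp_pos.
    destruct (log_orbit (s + 1) s ltac:(lra)) as [hw _].
    assert (htw : 0 < tailw logW s) by (apply Rmult_lt_0_compat; auto; apply exp_pos).
    assert (hroot := tailw_root logW s hw). rewrite rawV_logW in hroot.
    assert (hv := profile_pos (exp s) hxs).
    assert (eF : Rpower (F (exp s)) a = f (exp s)).
    { unfold F. rewrite rpow_positive by auto. rewrite Rpower_mult. replace (m * a) with 1 by (rewrite <- a_m; ring). now apply Rpower_1. }
    rewrite eF in hroot. rewrite <- hroot in hM.
    assert (hinv : forall y, 0 < y -> Rpower (Rpower y a) m = y) by (intros y hy; rewrite Rpower_mult, a_m; now apply Rpower_1).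
    specialize (h _ hM). rewrite hinv in h by auto. unfold c1 in h. rewrite <- Cst_root, hinv in h by apply Cst_pos. exact h.
Qed.
End FromProfile.

Section ToProfile.
Variables (W P : R -> R) (s0 : R).
Hypothesis hW : decaying 1 be W P s0 Cst.

Definition prof (x : R) := if Rle_dec x (exp s0) then 0 else Rpower (rawV W (ln x)) a.
Definition profF (x : R) := Defs.rpow (prof x) m.
Definition profG (x : R) := if Rle_dec x (exp s0) then 0 else rawU W P (ln x) / x.

Lemma prof_left x : x <= exp s0 -> prof x = 0.
Proof. intros h. unfold prof. destruct (Rle_dec x (exp s0)); [auto|lra]. Qed.

Lemma prof_right x : exp s0 < x -> prof x = Rpower (rawV W (ln x)) a.
Proof. intros h. unfold prof. destruct (Rle_dec x (exp s0)); [lra|auto]. Qed.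

Lemma profG_left x : x <= exp s0 -> profG x = 0.
Proof. intros h. unfold profG. destruct (Rle_dec x (exp s0)); [auto|lra]. Qed.

Lemma profG_right x : exp s0 < x -> profG x = rawU W P (ln x) / x.
Proof. intros h. unfold profG. destruct (Rle_dec x (exp s0)); [lra|auto]. Qed.

Lemma prof_pos x : exp s0 < x -> 0 < prof x.
Proof. intros h. rewrite prof_right by auto. apply Rpower_pos. Qed.

Lemma ln_gt_s0 x : exp s0 < x -> s0 < ln x.
Proof. intros h. rewrite <- (ln_exp s0). apply ln_increasing; auto. apply exp_pos. Qed.

Lemma rawV_pos_at s : s0 < s -> 0 < rawV W s.
Proof. intros h. apply rawV_pos, (decaying_at _ _ _ _ _ _ s hW h). Qed.

Lemma prof_pow x : exp s0 < x -> Rpower (prof x) m = rawV W (ln x).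
Proof.
  intros h. rewrite prof_right, Rpower_mult, a_m by auto. apply Rpower_1, rawV_pos_at, ln_gt_s0; auto.
Qed.

Lemma profF_left x : x <= exp s0 -> profF x = 0.
Proof. intros h. unfold profF. rewrite prof_left by auto. apply rpow_nonpositive. lra. Qed.

Lemma profF_right x : exp s0 < x -> profF x = rawV W (ln x).
Proof. intros h. unfold profF. rewrite rpow_positive by now apply prof_pos. now apply prof_pow. Qed.

Lemma is_derive_ln_comp (g : R -> R) x l : 0 < x -> is_derive g (ln x) l -> is_derive (fun y => g (ln y)) x (l / x).
Proof.
  intros hx h. assert (hl : is_derive ln x (/ x)) by (auto_derive; [auto|field; lra]).
  apply (is_derive_eq _ _ _ _ (is_derive_comp g ln x l (/ x) h hl)).
  unfold scal; simpl. unfold mult; simpl. unfold Rdiv. ring.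
Qed.

Lemma near_right (f g : R -> R) x l : exp s0 < x -> (forall y, exp s0 < y -> f y = g y) -> is_derive g x l -> is_derive f x l.
Proof.
  intros hx h. apply (is_derive_near f g x l (x - exp s0)); [lra|]. intros y hy. apply Rabs_def2 in hy. apply h. lra.
Qed.

Lemma profF_derive x : exp s0 < x -> is_derive profF x (profG x).
Proof.
  intros hx. pose proof (exp_pos s0). rewrite profG_right by auto.
  apply (near_right profF (fun y => rawV W (ln y))); auto. { intros y hy. now apply profF_right. }
  apply is_derive_ln_comp; [lra|]. apply rawV_derive, (decaying_at _ _ _ _ _ _ _ hW). now apply ln_gt_s0.
Qed.

Lemma prof_derive x : exp s0 < x -> exists l, is_derive prof x l.
Proof.
  intros hx. pose proof (exp_pos s0). eexists.
  apply (near_right prof (fun y => Rpower (rawV W (ln y)) a)); auto. { intros y hy. now apply prof_right. }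
  apply (is_derive_Rpower_comp a (fun y => rawV W (ln y))). { apply rawV_pos_at, ln_gt_s0; auto. }
  apply is_derive_ln_comp; [lra|]. apply rawV_derive, (decaying_at _ _ _ _ _ _ _ hW). now apply ln_gt_s0.
Qed.

Lemma profG_derive x : exp s0 < x -> is_derive profG x
  ((exp (L * ln x) * (accel 1 be (ln x) (W (ln x)) (P (ln x)) + 2 * L * P (ln x) + L * L * W (ln x)) - rawU W P (ln x)) / (x * x)).
Proof.
  intros hx. pose proof (exp_pos s0).
  apply (near_right profG (fun y => rawU W P (ln y) / y)); auto. { intros y hy. now apply profG_right. }
  destruct (decaying_at _ _ _ _ _ _ _ hW (ln_gt_s0 x hx)) as [w1 [w2 w3]].
  assert (hu : is_derive (rawU W P) (ln x) (exp (L * ln x) * (accel 1 be (ln x) (W (ln x)) (P (ln x)) + 2 * L * P (ln x) + L * L * W (ln x)))).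
  { apply (is_derive_eq _ _ _ _ (is_derive_mult _ _ _ _ _ (is_derive_exp_linear L (ln x)) (is_derive_plus _ _ _ _ _ w3 (is_derive_scal _ _ L _ w2)) Rmult_comm)).
    unfold plus, mult; simpl. change (m * (sigma + 2) / (m - p)) with L. ring. }
  assert (hd := is_derive_div _ (fun y => y) x _ 1 (is_derive_ln_comp _ x _ ltac:(lra) hu) (is_derive_id x) ltac:(lra)).
  apply (is_derive_eq _ _ _ _ hd). simpl. field. lra.
Qed.

Lemma prof_limit eps : 0 < eps -> exists d, 0 < d /\ forall x, exp s0 < x < exp s0 + d -> Rabs (profF x) < eps /\ Rabs (profG x) < eps.
Proof.
  intros heps. pose proof hW as [ho [hi _]]. pose proof L_gt_2 as hL. pose proof (exp_pos s0) as hx0.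
  set (M := exp (L * (s0 + 1)) * (1 + L) * (1 + / exp s0)).
  assert (hM1 : 0 < exp (L * (s0 + 1))) by apply exp_pos. assert (hi0 : 0 < / exp s0) by now apply Rinv_0_lt_compat.
  assert (hM : 0 < M) by (apply Rmult_lt_0_compat; [apply Rmult_lt_0_compat|]; lra).
  set (e' := eps / (2 * M)). assert (he' : 0 < e') by (apply Rdiv_lt_0_compat; lra).
  destruct (interface_limit 1 be W P s0 (s0 + 1) e' beta_pos ltac:(lra) (ho (s0 + 1) ltac:(lra)) hi he') as [d1 [hd1 h1]].
  assert (hlc : continuous ln (exp s0)). { apply (derive_continuous _ _ (/ exp s0)). auto_derive; [auto|field; lra]. }
  assert (hm1 : 0 < Rmin d1 1) by (apply Rmin_pos; lra). assert (i1 := Rmin_l d1 1). assert (i2 := Rmin_r d1 1).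
  destruct (continuous_eps ln (exp s0) hlc _ hm1) as [d [hd h]]. rewrite ln_exp in h.
  exists d. split; auto. intros x hx. specialize (h x ltac:(apply Rabs_def1; lra)). apply Rabs_def2 in h.
  assert (hl := ln_gt_s0 x ltac:(lra)). destruct (h1 (ln x) ltac:(lra)) as [[w1 w2] w3].
  assert (hexp : 0 < exp (L * ln x) <= exp (L * (s0 + 1))). { split; [apply exp_pos|]. left. apply exp_increasing, Rmult_lt_compat_l; lra. }
  assert (hee : exp (L * (s0 + 1)) * ((1 + L) * e') * (1 + / exp s0) < eps).
  { replace (exp (L * (s0 + 1)) * ((1 + L) * e') * (1 + / exp s0)) with (M * e') by (unfold M; ring).
    replace (M * e') with (eps / 2) by (unfold e'; field; lra). lra. }
  assert (hu : Rabs (rawU W P (ln x)) <= exp (L * (s0 + 1)) * ((1 + L) * e')).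
  { unfold rawU. rewrite Rabs_mult, (Rabs_pos_eq (exp _)) by lra. apply Rmult_le_compat; [lra|apply Rabs_pos|lra|].
    apply Rabs_def2 in w3. assert (L * W (ln x) <= L * e') by (apply Rmult_le_compat_l; lra). assert (0 < L * W (ln x)) by (apply Rmult_lt_0_compat; lra).
    apply Rabs_le_between. lra. }
  set (Q := exp (L * (s0 + 1)) * ((1 + L) * e')) in *.
  assert (hQ : 0 < Q) by (apply Rmult_lt_0_compat; [|apply Rmult_lt_0_compat]; lra).
  assert (hq1 : 0 < Q * / exp s0) by (now apply Rmult_lt_0_compat).
  split.
  - rewrite profF_right by lra. rewrite Rabs_pos_eq by (left; apply rawV_pos_at; auto). unfold rawV.
    apply Rle_lt_trans with Q; [|lra]. unfold Q. apply Rmult_le_compat; try lra.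
    assert (0 < L * e') by (apply Rmult_lt_0_compat; lra). lra.
  - rewrite profG_right by lra. unfold Rdiv. rewrite Rabs_mult, (Rabs_pos_eq (/ x)) by (left; apply Rinv_0_lt_compat; lra).
    assert (/ x <= / exp s0) by (apply Rinv_le_contravar; lra).
    apply Rle_lt_trans with (Q * / exp s0); [|lra]. apply Rmult_le_compat; try lra; [apply Rabs_pos|left; apply Rinv_0_lt_compat; lra].
Qed.

Lemma profG_continuous x : continuous profG x.
Proof.
  destruct (Rtotal_order x (exp s0)) as [h|[->|h]].
  - apply (continuous_ext_loc _ (fun _ => 0)); [|apply continuous_const].
    exists (mkposreal (exp s0 - x) ltac:(lra)). intros y hy. change (Rabs (y - x) < exp s0 - x) in hy. apply Rabs_def2 in hy.
    symmetry. apply profG_left. lra.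
  - apply eps_continuous. intros eps heps. destruct (prof_limit eps heps) as [d [hd h]]. exists d. split; auto. intros y hy.
    rewrite (profG_left (exp s0)), Rminus_0_r by lra. destruct (Rle_lt_dec y (exp s0)); [rewrite profG_left, Rabs_R0 by auto; auto|].
    apply Rabs_def2 in hy. apply h. lra.
  - eapply derive_continuous. now apply profG_derive.
Qed.

Lemma profF_derive_all x : is_derive profF x (profG x).
Proof.
  destruct (Rtotal_order x (exp s0)) as [h|[->|h]].
  - rewrite profG_left by lra. apply (is_derive_near profF (fun _ => 0) x 0 (exp s0 - x)); [lra| |apply (is_derive_const 0)].
    intros y hy. apply Rabs_def2 in hy. apply profF_left. lra.
  - rewrite profG_left by lra. apply eps_derive. intros eps heps. destruct (prof_limit (eps / 2) ltac:(lra)) as [d [hd h]].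
    exists d. split; auto. intros y hy. rewrite (profF_left (exp s0)) by lra.
    destruct (Rle_lt_dec y (exp s0)) as [hle|hlt].
    { rewrite profF_left by auto. replace (0 - 0 - 0 * (y - exp s0)) with 0 by ring. rewrite Rabs_R0. apply Rmult_le_pos; [lra|apply Rabs_pos]. }
    replace (profF y - 0 - 0 * (y - exp s0)) with (profF y) by ring. apply Rabs_def2 in hy. rewrite (Rabs_pos_eq (y - exp s0)) by lra.
    apply Rnot_lt_le. intros hgt. set (g := Rabs (profF y) - eps * (y - exp s0)). assert (hg : 0 < g) by (unfold g; lra).
    destruct (prof_limit g hg) as [d' [hd' h']].
    (* The mean value theorem is applied from a point [t] near the edge, since differentiability at
       the edge is being proved. *)
    set (t := exp s0 + Rmin d' (y - exp s0) / 2). assert (i1 := Rmin_l d' (y - exp s0)). assert (i2 := Rmin_r d' (y - exp s0)).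
    assert (i3 : 0 < Rmin d' (y - exp s0)) by (apply Rmin_pos; lra).
    destruct (h' t ltac:(unfold t; lra)) as [g1 _].
    destruct (MVT_interval profF profG t y ltac:(unfold t; lra)) as [z [hz ez]]. { intros z hz. apply profF_derive. unfold t in hz; lra. }
    destruct (h z ltac:(unfold t in hz; lra)) as [_ g2].
    assert (Rabs (profF y - profF t) <= eps / 2 * (y - t)).
    { rewrite ez, Rabs_mult, (Rabs_pos_eq (y - t)) by (unfold t; lra). apply Rmult_le_compat_r; [unfold t|]; lra. }
    assert (eps / 2 * (y - t) <= eps * (y - exp s0)) by (apply Rmult_le_compat; unfold t; lra).
    assert (Rabs (profF y) <= Rabs (profF y - profF t) + Rabs (profF t)).
    { replace (profF y) with (profF y - profF t + profF t) at 1 by ring. apply Rabs_triang. }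
    unfold g in g1. lra.
  - now apply profF_derive.
Qed.

Lemma prof_continuous x : continuous prof x.
Proof.
  destruct (Rtotal_order x (exp s0)) as [h|[->|h]].
  - apply (continuous_ext_loc _ (fun _ => 0)); [|apply continuous_const].
    exists (mkposreal (exp s0 - x) ltac:(lra)). intros y hy. change (Rabs (y - x) < exp s0 - x) in hy. apply Rabs_def2 in hy.
    symmetry. apply prof_left. lra.
  - apply eps_continuous. intros eps heps. pose proof a_range as ha.
    destruct (prof_limit (Rpower eps m) (Rpower_pos _ _)) as [d [hd h]]. exists d. split; auto. intros y hy.
    rewrite (prof_left (exp s0)), Rminus_0_r by lra. destruct (Rle_lt_dec y (exp s0)) as [|hlt]; [rewrite prof_left, Rabs_R0 by auto; auto|].
    apply Rabs_def2 in hy. destruct (h y ltac:(lra)) as [h1 _]. assert (hv := rawV_pos_at _ (ln_gt_s0 y hlt)).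
    rewrite profF_right, Rabs_pos_eq in h1 by lra. rewrite Rabs_pos_eq by (left; now apply prof_pos). rewrite prof_right by auto.
    apply Rlt_le_trans with (Rpower (Rpower eps m) a); [apply Rpower_incr; lra|].
    rewrite Rpower_mult, Rmult_comm, a_m, Rpower_1 by auto. lra.
  - destruct (prof_derive x h) as [l hl]. eapply derive_continuous; eauto.
Qed.

Lemma prof_equation x : exp s0 < x -> profile_equation_at N m p sigma prof x.
Proof.
  intros hx. pose proof (exp_pos s0) as he0. destruct (prof_derive x hx) as [f1 hf1]. assert (hv := prof_pos x hx).
  assert (hFd := profF_derive x hx). assert (hGd := profG_derive x hx).
  assert (hDF : forall y, Derive profF y = profG y) by (intros y; apply is_derive_unique, profF_derive_all).
  set (F2 := (exp (L * ln x) * (accel 1 be (ln x) (W (ln x)) (P (ln x)) + 2 * L * P (ln x) + L * L * W (ln x)) - rawU W P (ln x)) / (x * x)) in hGd.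
  assert (hDD : is_derive (Derive profF) x F2).
  { apply (is_derive_ext profG); auto. }
  assert (eG : profG x = m * Rpower (prof x) (m - 1) * f1).
  { rewrite <- (is_derive_unique _ _ _ hFd). apply is_derive_unique.
    apply (near_right profF (fun y => Rpower (prof y) m)); auto. { intros y hy. unfold profF. apply rpow_positive. now apply prof_pos. }
    now apply is_derive_Rpower_comp. }
  assert (hid := profile_identity (ln x) (prof x) (profG x) F2 f1 hv eG). cbv zeta in hid.
  rewrite exp_ln in hid by lra. rewrite prof_pow in hid by auto.
  assert (hee : exp (- L * ln x) * exp (L * ln x) = 1).
  { rewrite <- exp_plus. replace (- L * ln x + L * ln x) with 0 by ring. apply exp_0. }
  assert (exG : x * profG x = rawU W P (ln x)) by (rewrite profG_right by auto; field; lra).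
  assert (eW : exp (- L * ln x) * rawV W (ln x) = W (ln x)) by (unfold rawV; rewrite <- Rmult_assoc, hee; ring).
  assert (eP : exp (- L * ln x) * (x * profG x - L * rawV W (ln x)) = P (ln x)).
  { rewrite exG. unfold rawU, rawV. 
    replace (exp (- L * ln x) * (exp (L * ln x) * (P (ln x) + L * W (ln x)) - L * (exp (L * ln x) * W (ln x)))) with (exp (- L * ln x) * exp (L * ln x) * P (ln x)) by ring.
    rewrite hee. ring. }
  rewrite eW, eP in hid.
  assert (h0 : exp (- L * ln x) * (L * L * rawV W (ln x) + (1 - 2 * L) * (x * profG x) + x * x * F2) - accel 1 be (ln x) (W (ln x)) (P (ln x)) = 0).
  { rewrite exG. unfold F2. replace (x * x * ((exp (L * ln x) * (accel 1 be (ln x) (W (ln x)) (P (ln x)) + 2 * L * P (ln x) + L * L * W (ln x)) - rawU W P (ln x)) / (x * x)))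
      with (exp (L * ln x) * (accel 1 be (ln x) (W (ln x)) (P (ln x)) + 2 * L * P (ln x) + L * L * W (ln x)) - rawU W P (ln x)) by (field; lra).
    unfold rawU, rawV. set (ac := accel 1 be (ln x) (W (ln x)) (P (ln x))).
    transitivity (exp (- L * ln x) * exp (L * ln x) * ac - ac); [ring|rewrite hee; ring]. }
  rewrite h0 in hid. symmetry in hid. apply Rmult_integral in hid. destruct hid as [hid|hid].
  { exfalso. pose proof (exp_pos (- L * ln x)). assert (0 < exp (- L * ln x) * (x * x)) by (apply Rmult_lt_0_compat; [auto|apply Rmult_lt_0_compat; lra]). lra. }
  refine (conj _ (conj _ (conj _ _))).
  - exists f1. exact hf1.
  - exists (profG x). exact hFd.
  - exists F2. exact hDD.
  - change (Derive (Derive profF) x + (INR N - 1) / x * Derive profF x + al * prof x - be * x * Derive prof x - Defs.rpow x sigma * Defs.rpow (prof x) p = 0).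
    rewrite (is_derive_unique _ _ _ hDD), hDF, (is_derive_unique _ _ _ hf1), !rpow_positive by lra. exact hid.
Qed.

Lemma prof_decay : has_decay p sigma prof.
Proof.
  unfold has_decay. apply is_lim_spec. intros eps. pose proof (cond_pos eps) as heps. pose proof hW as [_ [_ ht]]. pose proof Cst_pos as hC.
  assert (hcont : continuous (fun y => Rpower y a) Cst) by (eapply derive_continuous; apply (is_derive_Rpower a Cst); auto).
  destruct (continuous_eps _ _ hcont eps heps) as [d [hd h]]. destruct (ht d hd) as [S [hS hs]].
  exists (exp S). intros x hx. assert (hx0 : exp s0 < exp S) by now apply exp_increasing. pose proof (exp_pos s0).
  assert (hlx : S <= ln x) by (rewrite <- (ln_exp S); left; apply ln_increasing; lra).
  rewrite !rpow_positive by (try (apply Rdiv_lt_0_compat); lra). rewrite <- Cst_root, prof_right by lra.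
  specialize (h (tailw W (ln x)) (hs (ln x) hlx)). rewrite tailw_root, exp_ln in h; [exact h|lra|].
  apply (decaying_at _ _ _ _ _ _ _ hW). lra.
Qed.

Lemma prof_dead_core : dead_core_profile N m p sigma (exp s0) prof.
Proof.
  pose proof (exp_pos s0) as h0. refine (conj h0 (conj _ (conj _ prof_decay))).
  - refine (conj _ (conj _ (conj _ (conj _ (conj _ _))))).
    + intros x hx. destruct (Rle_lt_dec x (exp s0)); [rewrite prof_left by auto; lra|left; now apply prof_pos].
    + apply continuous_halfline_of. intros x _. apply prof_continuous.
    + exists profG. split.
      * intros x hx. apply is_derive_halfline_of; auto. apply profF_derive_all.
      * apply continuous_halfline_of. intros x _. apply profG_continuous.
    + apply is_derive_halfline_of; [lra|]. assert (h := profF_derive_all 0). rewrite profG_left in h by lra. exact h.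
    + intros x hx hz. apply is_derive_halfline_of; auto. assert (h := profF_derive_all x). rewrite profG_left in h; [exact h|].
      apply Rnot_lt_le. intros hlt. pose proof (prof_pos x hlt). lra.
    + intros x hx hpos. apply prof_equation. apply Rnot_le_lt. intros hle. rewrite prof_left in hpos by auto. lra.
  - refine (conj _ (conj prof_pos _)).
    + intros x hx. apply prof_left. lra.
    + assert (h := profF_derive_all (exp s0)). rewrite profG_left in h by lra. exact h.
Qed.

Lemma prof_single_maximum : single_maximum_point prof (exp s0).
Proof.
  destruct (raw_peak 1 be W P s0 Cst ltac:(lra) beta_pos hW) as [b [hb [hmax [hun _]]]]. pose proof a_range as ha. pose proof (exp_pos s0) as he0.
  assert (hpb : exp s0 < exp b) by now apply exp_increasing.
  exists (exp b). refine (conj hpb (conj _ _)).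
  - intros x hx. rewrite !prof_right, ln_exp by auto. apply Rpower_le; [lra|apply rawV_pos_at, ln_gt_s0; auto|apply hmax, ln_gt_s0; auto].
  - intros y hy [d hloc]. rewrite <- (exp_ln y) by lra. f_equal. apply hun; [now apply ln_gt_s0|].
    assert (hexpc : continuous exp (ln y)) by (eapply derive_continuous, is_derive_exp).
    destruct (continuous_eps _ _ hexpc d (cond_pos d)) as [d1 [hd1 h1]]. rewrite exp_ln in h1 by lra. assert (hl := ln_gt_s0 y hy).
    exists (Rmin d1 (ln y - s0)). assert (i1 := Rmin_l d1 (ln y - s0)). assert (i2 := Rmin_r d1 (ln y - s0)).
    split; [apply Rmin_pos; lra|]. intros s hs. specialize (h1 s ltac:(lra)). apply Rabs_def2 in hs.
    assert (hes : exp s0 < exp s) by (apply exp_increasing; lra).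
    specialize (hloc (exp s) h1). assert (ep : rawV W s = Rpower (prof (exp s)) m) by (rewrite prof_pow, ln_exp; auto).
    rewrite ep, <- prof_pow by auto.
    apply Rpower_le; [lra|now apply prof_pos|exact hloc].
Qed.
End ToProfile.

Lemma dead_core_profile_exists : exists W P s0, decaying 1 be W P s0 Cst.
Proof. apply decaying_exists; [apply beta_pos|apply Cst_pos|apply Cst_level]. Qed.

Lemma dead_core_profile_unique W P s0 xi1 g : decaying 1 be W P s0 Cst -> dead_core_profile N m p sigma xi1 g ->
  xi1 = exp s0 /\ forall x, 0 <= x -> g x = prof W s0 x.
Proof.
  intros hW hg. assert (hg' := log_decaying xi1 g hg).
  destruct (decaying_unique 1 be _ _ _ _ _ _ Cst ltac:(lra) beta_pos Cst_pos hg' hW) as [e1 e2].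
  assert (h1 := xi0_pos xi1 g hg). assert (ex : xi1 = exp s0) by (rewrite <- e1; symmetry; now apply exp_ln).
  split; auto. intros x hx. destruct (Rle_lt_dec x (exp s0)) as [hle|hlt].
  - rewrite prof_left by auto. apply hg. lra.
  - rewrite prof_right by auto. assert (hgp := profile_pos xi1 g hg x ltac:(lra)).
    assert (hl : ln xi1 < ln x) by (apply ln_increasing; lra).
    unfold rawV. rewrite <- (e2 (ln x) hl). change (exp (L * ln x) * logW g (ln x)) with (rawV (logW g) (ln x)).
    rewrite rawV_logW. rewrite exp_ln by lra. rewrite rpow_positive, Rpower_mult by auto.
    replace (m * a) with 1 by (rewrite <- a_m; ring). symmetry. now apply Rpower_1.
Qed.
End Profile.

Theorem theorem1p2 (N : nat) (m p sigma : R)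
  (hN : (1 <= N)%nat) (hp : 1 < p) (hpm : p < m) (hsigma : 0 < sigma) :
  exists (xi0 : R) (f : R -> R),
    dead_core_profile N m p sigma xi0 f /\
    (forall (xi1 : R) (g : R -> R), dead_core_profile N m p sigma xi1 g ->
       xi1 = xi0 /\ forall xi, 0 <= xi -> g xi = f xi) /\
    single_maximum_point f xi0.
Proof.
  destruct (dead_core_profile_exists N m p sigma hN hp hpm hsigma) as [W [P [s0 hW]]].
  exists (exp s0), (prof N m p sigma hN hp hpm hsigma W s0). refine (conj _ (conj _ _)).
  - exact (prof_dead_core N m p sigma hN hp hpm hsigma W P s0 hW).
  - intros xi1 g hg. exact (dead_core_profile_unique N m p sigma hN hp hpm hsigma W P s0 xi1 g hW hg).
  - exact (prof_single_maximum N m p sigma hN hp hpm hsigma W P s0 hW).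
Qed.
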